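(* Let $H>0$, $\lambda>0$, $a\in\mathbb{R}$, $b>0$, $\sigma>0$, $y_0\in\mathbb{R}$, let $B_{H,\lambda}$ be the tempered fractional Brownian motion with parameters $H,\lambda$, let $Y$ be the tempered fractional Vasicek process, i.e. the solution of $Y_t = y_0 + \int_0^t (a+bY_s)\,ds + \sigma B_{H,\lambda}(t)$, $t\ge 0$, and let $$\hat a_T = \frac{(Y_T - y_0)\left(\int_0^T Y_t^2\, dt - \frac12 (Y_T+y_0)\int_0^T Y_t\, dt\right)}{T\int_0^T Y_t^2\, dt - \left(\int_0^T Y_t\, dt\right)^2},\qquad \hat b_T = \frac{(Y_T - y_0)\left(\frac12 T (Y_T+y_0) - \int_0^T Y_t\, dt\right)}{T\int_0^T Y_t^2\, dt - \left(\int_0^T Y_t\, dt\right)^2}.$$ Then the following hold. (i) The estimator $\hat a_T$ is asymptotically normal: $$T(\hat a_T - a)\xrightarrow{d} \mathcal N\left(0,\sigma^2\alpha_{H,\lambda}^2\right)\quad\text{as } T\to\infty.$$ (ii) The estimator $\hat b_T$ has an asymptotic Cauchy-type distribution: $$e^{bT}(\hat b_T - b)\xrightarrow{d}\frac{\eta_1}{\eta_2}\quad\text{as } T\to\infty,$$ where $\eta_1\sim\mathcal N\left(0,4b^2\sigma^2\beta_{H,\lambda,b}^2\right)$ and $\eta_2\sim\mathcal N\left(y_0+\frac ab,\ \sigma^2\beta_{H,\lambda,b}^2\right)$ are independent normal random variables.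
   Context: Tempered fractional Brownian motion (TFBM). Let $W=\{W_x, x\in\mathbb{R}\}$ be a two-sided Wiener process, $H>0$, $\lambda>0$. The TFBM $B_{H,\lambda}=\{B_{H,\lambda}(t), t\ge 0\}$ is the zero-mean Gaussian process defined by the Wiener integral $$B_{H,\lambda}(t)=\int_{\mathbb{R}}\left[e^{-\lambda(t-x)_+}(t-x)_+^{H-\frac12}-e^{-\lambda(-x)_+}(-x)_+^{H-\frac12}\right]dW_x,$$ where $(y)_+=\max(y,0)$ and $(y)_+^{p}$ means $y^p$ if $y>0$ and $0$ if $y\le 0$. A version with continuous sample paths is used. Its covariance is $$\operatorname{Cov}[B_{H,\lambda}(t),B_{H,\lambda}(s)]=\tfrac12\left(C_t^2t^{2H}+C_s^2s^{2H}-C_{|t-s|}^2|t-s|^{2H}\right),$$ $$C_t^2=\frac{2\Gamma(2H)}{(2\lambda t)^{2H}}-\frac{2\Gamma(H+\frac12)}{\sqrt\pi\,(2\lambda t)^H}K_H(\lambda t),\quad t>0,$$ with $C_t^2t^{2H}$ read as $0$ at $t=0$, where $K_\nu(x)=\int_0^\infty e^{-x\cosh t}\cosh(\nu t)\,dt$ ($x>0$) is the modified Bessel function of the second kind. Constants: $$\alpha_{H,\lambda}^2=\frac{2\Gamma(2H)}{(2\lambda)^{2H}},\qquad \beta_{H,\lambda,b}^2=\frac b2\int_0^\infty e^{-bu}C_u^2u^{2H}\,du.$$ The process $Y$ is given explicitly by $Y_t=(y_0+\frac ab)e^{bt}-\frac ab+\sigma\int_0^te^{b(t-s)}dB_{H,\lambda}(s)$,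 where $\int_0^te^{b(t-s)}dB_{H,\lambda}(s):=B_{H,\lambda}(t)+b\int_0^te^{b(t-s)}B_{H,\lambda}(s)\,ds$. $\xrightarrow{d}$ denotes convergence in distribution; $\mathcal N(m,v)$ is the normal law with mean $m$ and variance $v$. *)

(* Defs.v *)
From HB Require Import structures.
From mathcomp Require Import all_boot all_order all_algebra.
From mathcomp Require Import all_classical all_reals all_analysis.

Set Implicit Arguments.
Unset Strict Implicit.
Unset Printing Implicit Defensive.

Import Order.TTheory GRing.Theory Num.Theory.
Import numFieldNormedType.Exports.

Local Open Scope classical_set_scope.
Local Open Scope ring_scope.

(* Laws are compared on measurable sets only: outside the sigma-algebra the
   values of a [probability] are unconstrained. *)
Definition has_law {R : realType} {d} {Omega : measurableType d}
    (P : probability Omega R) (X : Omega -> R) (mu : set R -> \bar R) : Prop :=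
  measurable_fun setT X /\
  forall A : set R, measurable A -> P (X @^-1` A) = mu A.

(* The second argument is the variance, whereas [normal_prob] takes the standard
   deviation.  Meaningful for v > 0 only. *)
Definition normal_law {R : realType} (m v : R) : set R -> \bar R :=
  normal_prob m (Num.sqrt v).

(* Mutual independence of X 0, ..., X (n - 1); subfamilies are covered by taking
   some of the A i to be the whole line. *)
Definition mutually_independent {R : realType} {d} {Omega : measurableType d}
    (P : probability Omega R) (n : nat) (X : nat -> Omega -> R) : Prop :=
  forall A : nat -> set R, (forall i, measurable (A i)) ->
    P (\bigcap_(i in `I_n) (X i @^-1` A i)) =
      (\prod_(i < n) P (X i @^-1` A i))%E.

Definition independent {R : realType} {d} {Omega : measurableType d}
    (P : probability Omega R) (X Y : Omega -> R) : Prop :=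
  forall A B : set R, measurable A -> measurable B ->
    P ((X @^-1` A) `&` (Y @^-1` B)) = (P (X @^-1` A) * P (Y @^-1` B))%E.

(* Convergence in distribution of X t, as t tends to +oo, to the law mu. *)
Definition cvg_in_distribution {R : realType} {d} {Omega : measurableType d}
    (P : probability Omega R) (X : R -> Omega -> R)
    (mu : set R -> \bar R) : Prop :=
  (\forall t \near +oo, measurable_fun setT (X t)) /\
  forall f : R -> R, continuous f -> (exists M : R, forall x, `|f x| <= M) ->
    (\int[P]_w (f (X t w))%:E)%E @[t --> +oo] --> (\int[mu]_x (f x)%:E)%E.

Record two_sided_wiener {R : realType} {d} {Omega : measurableType d}
    (P : probability Omega R) (W : R -> {RV P >-> R}) : Prop :=
  TwoSidedWiener {
    wiener_at0 : {ae P, forall w, W 0 w = 0} ;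
    wiener_increment_law : forall s t : R, s < t ->
      has_law P (fun w => W t w - W s w) (normal_law 0 (t - s)) ;
    wiener_increment_indep : forall (n : nat) (t : nat -> R),
      (forall i, (i < n)%N -> t i <= t i.+1) ->
      mutually_independent P n (fun i w => W (t i.+1) w - W (t i) w) ;
    wiener_continuous : {ae P, forall w, continuous (fun t : R => W t w)}
  }.

(* A triple (c, s, t) with s <= t stands for c times the indicator of ]s, t],
   and a list of triples for the sum of its members. *)
Definition step_data (R : realType) := seq (R * R * R).

Definition well_ordered_step {R : realType} (phi : step_data R) : bool :=
  all (fun p => p.1.2 <= p.2) phi.

Definition step_fun {R : realType} (phi : step_data R) (x : R) : R :=
  \sum_(p <- phi) p.1.1 * \1_(`]p.1.2, p.2]) x.

Definition step_wiener_integral {R : realType} {Omega : Type}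
    (W : R -> Omega -> R) (phi : step_data R) (w : Omega) : R :=
  \sum_(p <- phi) p.1.1 * (W p.2 w - W p.1.2 w).

(* X is (a version of) the Wiener integral of h with respect to W: the limit in
   L^2(P) of the integrals of step functions that tend to h in L^2(dx).  By the
   Wiener isometry the limit does not depend on the approximating sequence. *)
Definition is_wiener_integral {R : realType} {d} {Omega : measurableType d}
    (P : probability Omega R) (W : R -> {RV P >-> R}) (h : R -> R)
    (X : Omega -> R) : Prop :=
  exists phi : nat -> step_data R,
    [/\ forall n, well_ordered_step (phi n),
        (\int[lebesgue_measure]_x ((h x - step_fun (phi n) x) ^+ 2)%:E)%E
          @[n --> \oo] --> 0%E &
        (\int[P]_w ((X w - step_wiener_integral W (phi n) w) ^+ 2)%:E)%E
          @[n --> \oo] --> 0%E].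

(* [powR] has 0 `^ 0 = 1, hence the test. *)
Definition pos_powR {R : realType} (y p : R) : R :=
  if 0 < y then y `^ p else 0.

Definition tfbm_kernel {R : realType} (H lambda t x : R) : R :=
  expR (- (lambda * Num.max (t - x) 0)) * pos_powR (t - x) (H - 2^-1)
  - expR (- (lambda * Num.max (- x) 0)) * pos_powR (- x) (H - 2^-1).

(* The process is indexed by [0, +oo[ : its values at negative times are
   unconstrained. *)
Record is_tfbm {R : realType} {d} {Omega : measurableType d}
    (P : probability Omega R) (H lambda : R) (B : R -> {RV P >-> R}) : Prop :=
  IsTfbm {
    tfbm_wiener_integral : exists2 W : R -> {RV P >-> R},
      two_sided_wiener W &
      forall t, 0 <= t -> is_wiener_integral W (tfbm_kernel H lambda t) (B t) ;
    tfbm_continuous : forall w,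
      {within `[0, +oo[, continuous (fun t : R => B t w)}
  }.

(* Continuity is part of the notion of solution so that the Lebesgue integral
   of a path over [0, t] makes sense. *)
Record is_tf_vasicek {R : realType} {Omega : Type} (a b sigma y0 : R)
    (B Y : R -> Omega -> R) : Prop :=
  IsTfVasicek {
    tf_vasicek_continuous : forall w,
      {within `[0, +oo[, continuous (fun t : R => Y t w)} ;
    tf_vasicek_equation : forall w (t : R), 0 <= t ->
      Y t w = y0 + \int[lebesgue_measure]_(s in `[0, t]) (a + b * Y s w)
              + sigma * B t w
  }.

Definition estimator_denominator {R : realType} (y : R -> R) (T : R) : R :=
  T * \int[lebesgue_measure]_(t in `[0, T]) (y t ^+ 2)
  - (\int[lebesgue_measure]_(t in `[0, T]) y t) ^+ 2.

Definition a_hat {R : realType} (y0 : R) (y : R -> R) (T : R) : R :=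
  (y T - y0)
  * (\int[lebesgue_measure]_(t in `[0, T]) (y t ^+ 2)
     - 2^-1 * (y T + y0) * \int[lebesgue_measure]_(t in `[0, T]) y t)
  / estimator_denominator y T.

Definition b_hat {R : realType} (y0 : R) (y : R -> R) (T : R) : R :=
  (y T - y0)
  * (2^-1 * T * (y T + y0) - \int[lebesgue_measure]_(t in `[0, T]) y t)
  / estimator_denominator y T.

Definition Gamma {R : realType} (x : R) : R :=
  \int[lebesgue_measure]_(t in `]0, +oo[) (t `^ (x - 1) * expR (- t)).

Definition cosh {R : realType} (x : R) : R := (expR x + expR (- x)) / 2.

Definition besselK {R : realType} (nu x : R) : R :=
  \int[lebesgue_measure]_(t in `[0, +oo[)
    (expR (- (x * cosh t)) * cosh (nu * t)).

(* C_t^2, for t > 0. *)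
Definition tfbm_C2 {R : realType} (H lambda t : R) : R :=
  2 * Gamma (2 * H) / (2 * lambda * t) `^ (2 * H)
  - 2 * Gamma (H + 2^-1) / (Num.sqrt pi * (2 * lambda * t) `^ H)
    * besselK H (lambda * t).

(* C_t^2 t^(2H), read as 0 at t = 0. *)
Definition tfbm_C2_t2H {R : realType} (H lambda t : R) : R :=
  if 0 < t then tfbm_C2 H lambda t * t `^ (2 * H) else 0.

Definition alpha2 {R : realType} (H lambda : R) : R :=
  2 * Gamma (2 * H) / (2 * lambda) `^ (2 * H).

Definition beta2 {R : realType} (H lambda b : R) : R :=
  b / 2 * \int[lebesgue_measure]_(u in `[0, +oo[)
            (expR (- (b * u)) * tfbm_C2_t2H H lambda u).

(* Main.v *)
Require Import Defs.
From HB Require Import structures.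
From mathcomp Require Import all_boot all_order all_algebra.
From mathcomp Require Import all_classical all_reals all_analysis.
From mathcomp Require Import measurable_realfun ring lra zify.

Set Implicit Arguments.
Unset Strict Implicit.
Unset Printing Implicit Defensive.

Import Order.TTheory GRing.Theory Num.Theory.
Import numFieldNormedType.Exports.

Local Open Scope classical_set_scope.
Local Open Scope ring_scope.

(* Write N_T = b int_0^T e^(-bs) B_s ds, P_T = b int_0^T e^(-b(T-s)) B_s ds and
   zeta_T = y0 + a/b + sigma N_T.  The equation gives
   b int_0^T Y = e^(bT) zeta_T - (y0 + a/b + a T), and integration by parts gives
   (Y_T^2 - y0^2) / 2 - a int_0^T Y - b int_0^T Y^2 = sigma e^(bT) zeta_T (B_T - P_T) + R_T
   with |R_T| bounded in terms of B_T and int_0^T B^2, whose mean is O(T).  Hence, uniformly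
   where B_T, N_T, P_T and (1/T) int_0^T B^2 are bounded and zeta_T stays away from 0,
   T (a_hat - a) and e^(bT) (b_hat - b) are within o(1) of sigma (2 P_T - B_T) and of
   2 b sigma (B_T - P_T) / zeta_T.

   Any two L^2 limits of Wiener integrals of step functions are jointly Gaussian, in
   particular B_T - P_T and N_T, and their law is continuous in the covariances.  With
   v(t) = E B_t^2 one has E B_s B_t = (v(s) + v(t) - v(|s - t|)) / 2 and v(t) tends to alpha^2,
   so the variance of 2 P_T - B_T tends to alpha^2, those of N_T and B_T - P_T tend to beta^2,
   and the covariance of the last two tends to 0.  That v(t) is C_t^2 t^(2H) comes from writing
   the autocovariance of the kernel as a Bessel integral. *)

(** * Standard normal integrals *)

(** No characteristic functions are used: a Gaussian pair is an image of the standard Gaussian law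
    of the plane under a triangular matrix. Rotation invariance of that law lets independent
    increments be added one at a time, and the triangular form makes the matrix continuous in the
    covariances. The weight b e^(-bs) ds is treated as the exponential law, so that N_T and P_T
    average B over a random time. The distance of two independent exponential times is again
    exponential with the same rate, so all limiting covariances are combinations of alpha^2 and the
    one mean E v(tau) = 2 beta^2. Mean-square continuity of B comes from the continuity of its
    paths: a centred Gaussian variable that is small in probability is small in L^2. The estimators
    are singular at zeta_T = 0, and the test function need not be uniformly continuous. A cutoff
    near zeta_T = 0, compactness away from it and a Markov bound for large values reduce the claim
    to continuous functions of Gaussian pairs; the cutoff costs nothing in the limit because the
    limit law of zeta_T has no atom at 0. *)

Section lebesgue_affine.
Context {R : realType}.
Notation mu := (@lebesgue_measure R).
Local Open Scope ereal_scope.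

(** A measure on the line is Lebesgue measure as soon as it gives half-open intervals their length;
    the same criterion yields scaling, reflection and the general substitution further on. *)
Lemma lebesgue_measure_shift (c : R) (A : set R) : measurable A ->
  pushforward mu (fun x : R => (x + c)%R : measurableTypeR R) A = mu A.
Proof.
have mf : measurable_fun [set: R] (fun x : R => (x + c)%R : measurableTypeR R).
  exact: measurable_funD.
pose m' : {measure set (measurableTypeR R) -> \bar R} :=
  measure_function_pushforward__canonical__measure_function_Measure mu mf.
move=> mA; apply/esym; apply: (@lebesgue_measure_unique _ m') => //= _ [[a b]] _ <-.
rewrite /m' /= /pushforward.
rewrite (_ : _ @^-1` _ = `](a - c)%R, (b - c)%R]%classic); last first.
  by apply/seteqP; split=> x /=; rewrite !in_itv/= ltrBlDr lerBrDr.
rewrite !lebesgue_measure_itv/= !lte_fin ltrD2r; case: ifP => // _.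
by congr (_%:E); ring.
Qed.

Lemma ge0_integral_shift (f : R -> \bar R) (c : R) :
  measurable_fun [set: R] f -> (forall r, 0 <= f r) ->
  \int[mu]_x f (x + c)%R = \int[mu]_x f x.
Proof.
move=> mf f0.
have mp : measurable_fun [set: R] (fun x : R => (x + c)%R : measurableTypeR R).
  exact: measurable_funD.
rewrite -[LHS](@ge0_integral_pushforward _ _ (measurableTypeR R) (measurableTypeR R) R _ mp mu setT f)//=.
by apply: eq_measure_integral => //= A mA AS; exact/lebesgue_measure_shift.
Qed.

Lemma lebesgue_measure_scale (k : R) (kk : (0 < k)%R) (A : set R) : measurable A ->
  k%:E * pushforward mu (fun x : R => (k * x)%R : measurableTypeR R) A = mu A.
Proof.
have mf : measurable_fun [set: R] (fun x : R => (k * x)%R : measurableTypeR R).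
  exact: measurable_funM.
pose m' : {measure set (measurableTypeR R) -> \bar R} :=
  mscale (NngNum (ltW kk)) (measure_function_pushforward__canonical__measure_function_Measure mu mf).
move=> mA; apply/esym; apply: (@lebesgue_measure_unique _ m') => //= _ [[a b]] _ <-.
rewrite /m' /mscale /= /pushforward.
rewrite (_ : _ @^-1` _ = `](a / k)%R, (b / k)%R]%classic); last first.
  by apply/seteqP; split=> x /=; rewrite !in_itv/= ltr_pdivrMr// ler_pdivlMr// ![(x * k)%R]mulrC.
rewrite !lebesgue_measure_itv/= !lte_fin ltr_pM2r ?invr_gt0//; case: ifP => // _; last by rewrite mule0.
by rewrite -!EFinB -EFinM; congr (_%:E); field; exact: lt0r_neq0.
Qed.

Lemma ge0_integral_scale (f : R -> \bar R) (k : R) : (0 < k)%R ->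
  measurable_fun [set: R] f -> (forall r, 0 <= f r) ->
  \int[mu]_x f (k * x)%R = k^-1%:E * \int[mu]_x f x.
Proof.
move=> k0 mf f0.
have mp : measurable_fun [set: R] (fun x : R => (k * x)%R : measurableTypeR R).
  exact: measurable_funM.
pose m' : {measure set (measurableTypeR R) -> \bar R} :=
  mscale (NngNum (ltW k0)) (measure_function_pushforward__canonical__measure_function_Measure mu mp).
rewrite -[LHS](@ge0_integral_pushforward _ _ (measurableTypeR R) (measurableTypeR R) R _ mp mu setT f)//=.
have -> : \int[mu]_x f x = \int[m']_x f x.
  by apply: eq_measure_integral => A mA _; exact/esym/lebesgue_measure_scale.
rewrite ge0_integral_mscale//= muleA -EFinM mulVf ?mul1e//.
exact: lt0r_neq0.
Qed.

End lebesgue_affine.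

(** * Integration against a measure with a density *)

Section density.
Local Open Scope ereal_scope.
Context d (T : measurableType d) (R : realType).
Variables (mu nu : {measure set T -> \bar R}) (g : T -> R).
Hypothesis mg : measurable_fun setT g.
Hypothesis g0 : forall x, (0 <= g x)%R.
Hypothesis nuE : forall A, measurable A -> nu A = \int[mu]_(x in A) (g x)%:E.

Import HBNNSimple.

Let ge0_integral_density_indic A : measurable A ->
  \int[nu]_x (\1_A x)%:E = \int[mu]_x ((\1_A x)%:E * (g x)%:E).
Proof.
move=> mA; rewrite integral_indic// setIT nuE// integral_mkcond.
by apply: eq_integral => x _; rewrite patchE indicE; case: ifPn => _; rewrite ?mul1e ?mul0e.
Qed.

Let ge0_integral_density_nnsfun (f : {nnsfun T >-> R}) :
  \int[nu]_x (f x)%:E = \int[mu]_x ((f x)%:E * (g x)%:E).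
Proof.
under [LHS]eq_integral do rewrite fimfunE -fsumEFin//.
rewrite ge0_integral_fsum//; last 2 first.
  - by move=> r; exact/measurable_EFinP/measurableT_comp.
  - by move=> n x _; rewrite nnfun_muleindic_ge0.
transitivity (\int[mu]_x (\sum_(r \in range f) (r * \1_(f @^-1` [set r]) x)%:E * (g x)%:E)); last first.
  apply: eq_integral => x _; rewrite [in RHS]fimfunE -fsumEFin//.
  by rewrite ge0_mule_fsuml// => i; rewrite nnfun_muleindic_ge0.
rewrite ge0_integral_fsum//; last 2 first.
  - move=> r; apply: emeasurable_funM; last exact/measurable_EFinP.
    exact/measurable_EFinP/measurableT_comp.
  - by move=> n x _; apply: mule_ge0; [exact: nnfun_muleindic_ge0|rewrite lee_fin].
apply: eq_fsbigr => r /set_mem[x _ <-].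
under [RHS]eq_integral do rewrite EFinM -muleA.
under [LHS]eq_integral do rewrite EFinM.
have mi : measurable_fun setT (fun y => (\1_(f @^-1` [set f x]) y)%:E : \bar R).
  exact/measurable_EFinP/measurable_indic.
rewrite ge0_integralZl ?lee_fin// [RHS]ge0_integralZl ?lee_fin//.
- by rewrite ge0_integral_density_indic.
- by apply: emeasurable_funM => //; exact/measurable_EFinP.
- by move=> y _; rewrite mule_ge0 ?lee_fin.
Qed.

(** Indicators, then simple functions, then monotone limits. *)
Lemma ge0_integral_density (f : T -> \bar R) : measurable_fun setT f ->
  (forall x, 0 <= f x) -> \int[nu]_x f x = \int[mu]_x (f x * (g x)%:E).
Proof.
move=> mf f0; pose f_ := nnsfun_approx measurableT mf.
transitivity (limn (fun n => \int[nu]_x (f_ n x)%:E)).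
  rewrite -monotone_convergence//.
  - apply: eq_integral => ? /[!inE] xD; apply/esym/cvg_lim => //=.
    exact: cvg_nnsfun_approx.
  - by move=> n; exact/measurable_EFinP/measurable_funTS.
  - by move=> n ? _; rewrite lee_fin.
  - by move=> ? _ ? ? ?; rewrite lee_fin; exact/lefP/nd_nnsfun_approx.
transitivity (limn (fun n => \int[mu]_x ((f_ n x)%:E * (g x)%:E))).
  by congr (limn _); apply/funext => n; exact: ge0_integral_density_nnsfun.
rewrite -monotone_convergence//.
- apply: eq_integral => x _; apply/cvg_lim => //=.
  rewrite muleC; under eq_fun do rewrite muleC.
  by apply: cvgeZl => //; exact: cvg_nnsfun_approx.
- move=> n; apply: emeasurable_funM; apply/measurable_EFinP => //.
- by move=> n x _; rewrite mule_ge0// lee_fin.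
- move=> x _ m n mn; apply: lee_wpmul2r; first by rewrite lee_fin.
  by rewrite lee_fin; exact/lefP/nd_nnsfun_approx.
Qed.

End density.

(** * The standard normal law and its rotation invariance *)

Section standard_normal.
Context {R : realType}.
Notation mu := (@lebesgue_measure R).
Local Notation gam := (@normal_prob R 0 1).
Local Notation rho := (@normal_pdf R 0 1).
Local Open Scope ereal_scope.

Lemma ge0_integral_normal (m s : R) (f : R -> \bar R) :
  measurable_fun [set: R] f -> (forall x, 0 <= f x) ->
  \int[normal_prob m s]_x f x = \int[mu]_x (f x * (normal_pdf m s x)%:E).
Proof.
move=> mf f0; apply: ge0_integral_density => //.
- exact: measurable_normal_pdf.
- by move=> x; exact: normal_pdf_ge0.
Qed.

(** Translation and scaling of Lebesgue measure; the factor [s] produced by the scaling is absorbed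
    by the peak of the density. *)
Lemma ge0_integral_normal_standard (m s : R) (f : R -> \bar R) : (0 < s)%R ->
  measurable_fun [set: R] f -> (forall x, 0 <= f x) ->
  \int[normal_prob m s]_x f x = \int[gam]_x f (m + s * x)%R.
Proof.
move=> s0 mf f0; rewrite (ge0_integral_normal m s mf f0).
have mfs : measurable_fun [set: R] (fun x => f (m + s * x)%R).
  apply: measurableT_comp; first exact: mf.
  by apply: measurable_funD => //; exact: measurable_funM.
rewrite (ge0_integral_normal 0 1 mfs); last by move=> x; exact: f0.
pose h x := f (m + x)%R * (normal_pdf 0 s x)%:E.
have mh : measurable_fun [set: R] h.
  apply: emeasurable_funM; last by apply/measurable_EFinP; exact: measurable_normal_pdf.
  by apply: measurableT_comp => //; exact: measurable_funD.
have h0 x : 0 <= h x by rewrite mule_ge0// lee_fin normal_pdf_ge0.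
transitivity (\int[mu]_x h x).
  rewrite -(ge0_integral_shift (- m) mh h0); apply: eq_integral => x _.
  rewrite /h addrC subrK; congr (_ * _%:E).
  by rewrite !normal_pdfE ?gt_eqF// /normal_fun subr0.
transitivity (s%:E * \int[mu]_x h (s * x)%R).
  rewrite ge0_integral_scale// muleA -EFinM divff ?mul1e// gt_eqF//.
have mhs : measurable_fun [set: R] (fun x => h (s * x)%R).
  by apply: measurableT_comp; [exact: mh|exact: measurable_funM].
rewrite -ge0_integralZl; [|exact: measurableT|exact: mhs|by move=> x _; exact: h0|by rewrite lee_fin ltW].
apply: eq_integral => x _; rewrite /h muleCA -EFinM; congr (_ * _%:E).
rewrite !normal_pdfE ?gt_eqF// /normal_fun /normal_peak !subr0 expr1n !mul1r.
rewrite -mulrnAr sqrtrM ?sqr_ge0// sqrtr_sqr gtr0_norm// invfM !mulrA divff ?mul1r ?gt_eqF//.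
congr (_ * expR _)%R.
have s2 : (s ^+ 2 != 0)%R by rewrite expf_neq0// gt_eqF.
by rewrite -mulr_natr exprMn invfM -!mulNr mulrA; congr (_ / _)%R; apply: (canLR (mulfK s2)); ring.
Qed.

Lemma normal_prob_standard (m s : R) (A : set R) : (0 < s)%R -> measurable A ->
  normal_prob m s A = gam ((fun x => (m + s * x)%R) @^-1` A).
Proof.
move=> s0 mA.
have := @ge0_integral_normal_standard m s (EFin \o \1_A) s0.
rewrite integral_indic; [|exact: measurableT|exact: mA].
rewrite setIT => ->; [|by apply/measurable_EFinP; exact: measurable_indic|by move=> x; rewrite lee_fin].
transitivity (\int[gam]_x (\1_((fun x => (m + s * x)%R) @^-1` A) x)%:E) => //.
rewrite integral_indic ?setIT//.
rewrite -[X in measurable X]setTI.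
have : measurable_fun [set: R] (fun x : R => (m + s * x)%R).
  by apply: measurable_funD => //; exact: measurable_funM.
exact.
Qed.

Lemma normal_pdf01E (x : R) :
  rho x = (normal_peak (1 : R) * expR (- (x ^+ 2 / 2)))%R.
Proof.
by rewrite normal_pdfE ?oner_neq0// /normal_fun subr0 expr1n mulNr mulr2n.
Qed.

Lemma lebesgue_tonelli (K : R * R -> \bar R) :
  measurable_fun [set: R * R] K -> (forall z, 0 <= K z) ->
  \int[mu]_y \int[mu]_x K (x, y) = \int[mu]_x \int[mu]_y K (x, y).
Proof.
move=> mK K0; apply/esym.
exact: (@fubini_tonelli _ _ (measurableTypeR R) (measurableTypeR R) R mu mu K mK K0).
Qed.

(** On each horizontal line a shear is a translation. *)
Lemma ge0_integral_shear (K : R * R -> \bar R) (t : R) :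
  measurable_fun [set: R * R] K -> (forall z, 0 <= K z) ->
  \int[mu]_y \int[mu]_x K (x + t * y, y)%R = \int[mu]_y \int[mu]_x K (x, y).
Proof.
move=> mK K0; apply: eq_integral => y _.
rewrite (ge0_integral_shift (f := fun x => K (x, y)))//.
exact: measurableT_comp.
Qed.

(** For [q != 0] a rotation is a product of three shears, horizontal by [t = (p - 1) / q], vertical
    by [q], and horizontal by [t] again, so translations of the line suffice. For [q = 0] the sign
    of [p] leaves only the identity. *)
Lemma ge0_integral_rotation_lebesgue (K : R * R -> \bar R) (p q : R) :
  (p ^+ 2 + q ^+ 2 = 1)%R -> (0 <= p)%R ->
  measurable_fun [set: R * R] K -> (forall z, 0 <= K z) ->
  \int[mu]_y \int[mu]_x K (p * x - q * y, q * x + p * y)%R =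
  \int[mu]_y \int[mu]_x K (x, y).
Proof.
move=> pq p0 mK K0; have [q0|q0] := eqVneq q 0%R.
  have -> : p = 1%R.
    apply/eqP; rewrite -(@eqrXn2 _ 2)// expr1n.
    by move: pq; rewrite q0 expr0n addr0 => ->.
  rewrite q0; apply: eq_integral => y _; apply: eq_integral => x _.
  by congr (K (_, _)); ring.
pose t := ((p - 1) / q)%R.
have msh (c : R) : measurable_fun [set: R * R] (fun z : R * R => (z.1 + c * z.2, z.2)%R).
  apply/measurable_fun_pairP; split => //=; first [exact: measurable_fst | exact: measurable_snd | idtac].
  by apply: measurable_funD => //; exact: measurable_funM.
have msv (c : R) : measurable_fun [set: R * R] (fun z : R * R => (z.1, z.2 + c * z.1)%R).
  apply/measurable_fun_pairP; split => //=; first [exact: measurable_fst | exact: measurable_snd | idtac].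
  by apply: measurable_funD => //; exact: measurable_funM.
pose K1 z := K (z.1 + t * z.2, z.2)%R.
have mK1 : measurable_fun [set: R * R] K1 by exact: (measurableT_comp mK (msh t)).
pose K2 z := K1 (z.1, z.2 + q * z.1)%R.
have mK2 : measurable_fun [set: R * R] K2 by exact: (measurableT_comp mK1 (msv q)).
rewrite -(ge0_integral_shear t mK K0).
transitivity (\int[mu]_y \int[mu]_x K2 (x + t * y, y)%R).
  apply: eq_integral => y _; apply: eq_integral => x _.
  rewrite /K2 /K1/=; congr (K (_, _)); last by rewrite /t; field.
  apply/eqP; rewrite -subr_eq0 /t; apply/eqP.
  transitivity ((1 - (p ^+ 2 + q ^+ 2)) / q * y)%R; first by field.
  by rewrite pq subrr !mul0r.
rewrite (ge0_integral_shear t mK2); last by move=> z; exact: K0.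
rewrite (lebesgue_tonelli mK2); last by move=> z; exact: K0.
rewrite -[RHS]/(\int[mu]_y \int[mu]_x K1 (x, y)).
rewrite (lebesgue_tonelli mK1); last by move=> z; exact: K0.
apply: eq_integral => x _; rewrite /K2/=.
apply: (ge0_integral_shift (f := fun y => K1 (x, y))).
  exact: measurableT_comp.
by move=> y; exact: K0.
Qed.

(** The product density depends on x^2 + y^2 only, so it can be carried along by the rotation of
    Lebesgue measure. *)
Lemma ge0_integral_rotation (G : R * R -> \bar R) (p q : R) :
  (p ^+ 2 + q ^+ 2 = 1)%R -> (0 <= p)%R ->
  measurable_fun [set: R * R] G -> (forall z, 0 <= G z) ->
  \int[gam]_y \int[gam]_x G (p * x - q * y, q * x + p * y)%R =
  \int[gam]_y \int[gam]_x G (x, y).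
Proof.
move=> pq p0 mG G0.
have mrot : measurable_fun [set: R * R] (fun z : R * R => (p * z.1 - q * z.2, q * z.1 + p * z.2)%R).
  apply/measurable_fun_pairP; split => /=.
    by apply: measurable_funB; exact: measurable_funM.
  by apply: measurable_funD; exact: measurable_funM.
have E (F : R * R -> \bar R) : measurable_fun [set: R * R] F -> (forall z, 0 <= F z) ->
  \int[gam]_y \int[gam]_x F (x, y) =
  \int[mu]_y \int[mu]_x (F (x, y) * (normal_peak 1 ^+ 2 * expR (- ((x ^+ 2 + y ^+ 2) / 2)))%:E).
  move=> mF F0.
  rewrite ge0_integral_normal//; last 2 first.
  - exact: (measurable_fun_fubini_tonelli_G (m1 := gam) F).
  - by move=> y; exact: integral_ge0.
  apply: eq_integral => y _.
  have mFy : measurable_fun [set: R] (fun x => F (x, y)) by exact: measurableT_comp.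
  rewrite ge0_integral_normal// -ge0_integralZr//.
  - apply: eq_integral => x _; rewrite -muleA -EFinM; congr (_ * _%:E).
    rewrite !normal_pdf01E mulrACA -expr2 -expRD; congr (_ * expR _)%R; ring.
  - by apply: emeasurable_funM => //; apply/measurable_EFinP; exact: measurable_normal_pdf.
  - by move=> x _; rewrite mule_ge0// lee_fin normal_pdf_ge0.
  - by rewrite lee_fin normal_pdf_ge0.
have mGr : measurable_fun [set: R * R] (fun z : R * R => G (p * z.1 - q * z.2, q * z.1 + p * z.2)%R).
  exact: (measurableT_comp mG mrot).
rewrite (E _ mGr); last by move=> z; exact: G0.
rewrite (E _ mG G0).
pose K z := G z * (normal_peak 1 ^+ 2 * expR (- ((z.1 ^+ 2 + z.2 ^+ 2) / 2)))%:E.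
rewrite -[RHS](@ge0_integral_rotation_lebesgue K p q pq p0).
- apply: eq_integral => y _; apply: eq_integral => x _; rewrite /K/=.
  congr (_ * (_ * expR (- (_ / 2)))%R%:E)%E.
  transitivity ((p ^+ 2 + q ^+ 2) * (x ^+ 2 + y ^+ 2))%R; last ring.
  by rewrite pq mul1r.
- apply: emeasurable_funM => //; apply/measurable_EFinP.
  apply: measurable_funM => //; apply: measurableT_comp => //.
  apply: measurableT_comp => //; apply: measurable_funM => //.
  by apply: measurable_funD; exact: measurable_funX.
- by move=> z; rewrite mule_ge0// lee_fin mulr_ge0 ?expR_ge0// sqr_ge0.
Qed.

Let measurable_toR : measurable_fun [set: measurableTypeR R] (fun x : measurableTypeR R => x : R).
Proof. exact: (@measurable_id _ R). Qed.

Let toR : {mfun measurableTypeR R >-> R} :=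
  HB.pack (fun x : measurableTypeR R => x : R) (isMeasurableFun.Build _ _ _ _ _ measurable_toR).

(* A copy of [normal_prob 0 1] whose carrier is [R] with its canonical Borel structure
   instead of [measurableTypeR R], so that products are formed over [R * R]. *)
Definition stdn : probability R R :=
  distribution [the probability (measurableTypeR R) R of normal_prob 0 1] toR.

Lemma stdnE (A : set R) : stdn A = gam A.
Proof. by []. Qed.

Lemma ge0_integral_stdn (f : R -> \bar R) :
  measurable_fun [set: R] f -> (forall x, 0 <= f x) ->
  \int[stdn]_x f x = \int[gam]_x f x.
Proof.
by move=> mf f0; rewrite /stdn /= ge0_integral_distribution.
Qed.

Lemma stdn_rotation (G : R * R -> \bar R) (p q : R) :
  (p ^+ 2 + q ^+ 2 = 1)%R -> (0 <= p)%R ->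
  measurable_fun [set: R * R] G -> (forall z, 0 <= G z) ->
  \int[stdn]_y \int[stdn]_x G (p * x - q * y, q * x + p * y)%R =
  \int[stdn]_y \int[stdn]_x G (x, y).
Proof.
move=> pq p0 mG G0.
have mrot : measurable_fun [set: R * R] (fun z : R * R => (p * z.1 - q * z.2, q * z.1 + p * z.2)%R).
  apply/measurable_fun_pairP; split => /=.
    by apply: measurable_funB; exact: measurable_funM.
  by apply: measurable_funD; exact: measurable_funM.
have E (F : R * R -> \bar R) : measurable_fun [set: R * R] F -> (forall z, 0 <= F z) ->
    \int[stdn]_y \int[stdn]_x F (x, y) = \int[gam]_y \int[gam]_x F (x, y).
  move=> mF F0; rewrite ge0_integral_stdn.
  - apply: eq_integral => y _; rewrite ge0_integral_stdn//.
    exact: measurableT_comp.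
  - exact: (measurable_fun_fubini_tonelli_G (m1 := stdn) F).
  - by move=> y; exact: integral_ge0.
rewrite (E _ mG G0) (E (fun z => G (p * z.1 - q * z.2, q * z.1 + p * z.2)%R)).
- exact: ge0_integral_rotation.
- exact: (measurableT_comp mG mrot).
- by move=> z; exact: G0.
Qed.

End standard_normal.
Arguments stdn {R} : simpl never.

(** * Gaussian pairs *)

Section gauss_pair.
Context {R : realType} {d} {Omega : measurableType d} (P : probability Omega R).
Local Open Scope ereal_scope.

(* The law of (S1, S2) is the image of the standard Gaussian law of the plane under
   (x, y) |-> (a x, b x + c y). *)
Definition gauss_pair (S1 S2 : Omega -> R) (a b c : R) :=
  forall F : R * R -> \bar R, measurable_fun setT F -> (forall z, 0 <= F z) ->
  \int[P]_w F (S1 w, S2 w) =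
  \int[stdn]_y \int[stdn]_x F (a * x, b * x + c * y)%R.

(** Polar coordinates of [(a, - k)]; [a >= 0] puts the angle in the half plane where the cosine is
    nonnegative, as the rotation lemmas ask. At radius zero any angle does. *)
Lemma rotation_params (a k : R) : (0 <= a)%R -> exists pqr : R * R * R,
  [/\ (pqr.1.1 ^+ 2 + pqr.1.2 ^+ 2 = 1)%R, (0 <= pqr.1.1)%R, (0 <= pqr.2)%R,
      (a = pqr.1.1 * pqr.2)%R & (k = - pqr.1.2 * pqr.2)%R].
Proof.
move=> a0; pose r := Num.sqrt (a ^+ 2 + k ^+ 2).
have r2 : (r ^+ 2 = a ^+ 2 + k ^+ 2)%R by rewrite sqr_sqrtr// addr_ge0 ?sqr_ge0.
have r0 : (0 <= r)%R by rewrite sqrtr_ge0.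
have [re|re] := eqVneq r 0%R.
  exists (1, 0, 0)%R => /=; split => //; rewrite ?expr1n ?expr0n ?addr0//= ?oppr0 ?mul0r ?mulr0.
    apply/eqP; rewrite -sqrf_eq0; apply/eqP; move: r2; rewrite re expr0n/=.
    by have := sqr_ge0 a; have := sqr_ge0 k; lra.
  apply/eqP; rewrite -sqrf_eq0; apply/eqP; move: r2; rewrite re expr0n/=.
  by have := sqr_ge0 a; have := sqr_ge0 k; lra.
exists (a / r, - k / r, r)%R => /=; split => //.
- rewrite !exprMn sqrrN -mulrDl exprVn -r2 divff// expf_neq0//.
- by rewrite divr_ge0.
- by rewrite divfK.
- by rewrite !mulNr opprK divfK.
Qed.

Lemma stdn_swap (F : R * R -> \bar R) :
  measurable_fun [set: R * R] F -> (forall z, 0 <= F z) ->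
  \int[stdn]_y \int[stdn]_x F (x, y) = \int[stdn]_x \int[stdn]_y F (x, y).
Proof. by move=> mF F0; rewrite -fubini_tonelli. Qed.

(** A rotation turns c x + l y into a multiple of one coordinate; the other coordinate integrates to
    1. *)
Lemma stdn_combine (f : R -> \bar R) (c l : R) : (0 <= c)%R ->
  measurable_fun [set: R] f -> (forall z, 0 <= f z) ->
  \int[stdn]_y \int[stdn]_x f (c * x + l * y)%R =
  \int[stdn]_x f (Num.sqrt (c ^+ 2 + l ^+ 2) * x)%R.
Proof.
move=> c0 mf f0; have [[[p q] r] [/= pq p0 r0 cE lE]] := rotation_params l c0.
have -> : Num.sqrt (c ^+ 2 + l ^+ 2) = r.
  rewrite -[RHS]ger0_norm// -sqrtr_sqr; congr (Num.sqrt _).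
  by rewrite -[RHS]mul1r -pq cE lE; ring.
have mfr : measurable_fun [set: R * R] (fun z : R * R => f (r * z.1)%R).
  apply: measurableT_comp => //; apply: measurable_funM => //; exact: measurable_fst.
transitivity (\int[@stdn R]_y \int[@stdn R]_x f (r * (p * x - q * y))%R).
  apply: eq_integral => y _; apply: eq_integral => x _; congr f; rewrite cE lE; ring.
rewrite (@stdn_rotation _ (fun z : R * R => f (r * z.1)%R) p q pq p0 mfr)//=.
transitivity (\int[@stdn R]_y (cst (\int[@stdn R]_x f (r * x)%R) y)) => //.
by rewrite integral_cst//= probability_setT mule1.
Qed.

(** The triangular form is restored in two steps: a rotation in the plane of x and u removes u from
    the first coordinate, then the y and u parts of the second merge into one normal variable. The
    relations say that covariance matrices add up. *)
Lemma stdn_triple (a b c k l : R) : (0 <= a)%R -> (0 <= c)%R ->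
  exists abc : R * R * R,
  [/\ (0 <= abc.1.1)%R, (0 <= abc.2)%R, (abc.1.1 ^+ 2 = a ^+ 2 + k ^+ 2)%R,
     (abc.1.1 * abc.1.2 = a * b + k * l)%R & (abc.1.2 ^+ 2 + abc.2 ^+ 2 = b ^+ 2 + c ^+ 2 + l ^+ 2)%R] /\
    forall F : R * R -> \bar R, measurable_fun [set: R * R] F -> (forall z, 0 <= F z) ->
    \int[stdn]_u \int[stdn]_y \int[stdn]_x F (a * x + k * u, b * x + c * y + l * u)%R =
    \int[stdn]_y \int[stdn]_x F (abc.1.1 * x, abc.1.2 * x + abc.2 * y)%R.
Proof.
move=> a0 c0; have [[[p q] r] [/= pq p0 r0 aE kE]] := rotation_params k a0.
pose b1 := (b * p - l * q)%R; pose l1 := (b * q + l * p)%R.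
pose s := Num.sqrt (c ^+ 2 + l1 ^+ 2).
have s2 : (s ^+ 2 = c ^+ 2 + l1 ^+ 2)%R by rewrite sqr_sqrtr// addr_ge0 ?sqr_ge0.
exists (r, b1, s) => /=; split.
  split => //; rewrite ?sqrtr_ge0//.
  - by rewrite -[LHS]mul1r -pq aE kE; ring.
  - by rewrite aE kE /b1; ring.
  - rewrite s2 /b1 /l1 -[(b ^+ 2)%R]mul1r -[(l ^+ 2)%R]mul1r -pq; ring.
move=> F mF F0.
have lin (D := [set: R * (R * R)]) (x1 x2 x3 : R) :
    measurable_fun D (fun z : R * (R * R) => x1 * z.1 + x2 * z.2.1 + x3 * z.2.2)%R.
  have m2 : measurable_fun D (fun z : R * (R * R) => z.2) by exact: measurable_snd.
  apply: measurable_funD; first apply: measurable_funD; apply: measurable_funM => //.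
  - exact: (measurableT_comp measurable_fst m2).
  - exact: (measurableT_comp measurable_snd m2).
have mlin (x1 x2 x3 y1 y2 y3 : R) : measurable_fun [set: R * (R * R)]
    (fun z : R * (R * R) => F (x1 * z.1 + x2 * z.2.1 + x3 * z.2.2, y1 * z.1 + y2 * z.2.1 + y3 * z.2.2)%R).
  apply: (measurableT_comp mF); apply/measurable_fun_pairP; split; exact: lin.
have swap12 (x1 x2 x3 y1 y2 y3 : R) :
    \int[stdn]_u \int[stdn]_y \int[stdn]_x F (x1 * x + x2 * y + x3 * u, y1 * x + y2 * y + y3 * u)%R =
    \int[stdn]_u \int[stdn]_x \int[stdn]_y F (x1 * x + x2 * y + x3 * u, y1 * x + y2 * y + y3 * u)%R.
  apply: eq_integral => u _.
  rewrite (@stdn_swap (fun z => F (x1 * z.1 + x2 * z.2 + x3 * u, y1 * z.1 + y2 * z.2 + y3 * u)%R))//.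
  apply: (measurableT_comp mF); apply/measurable_fun_pairP.
  by split; (apply: measurable_funD => //; apply: measurable_funD; apply: measurable_funM => //).
have swap23 (x1 x2 x3 y1 y2 y3 : R) :
    \int[stdn]_u \int[stdn]_y \int[stdn]_x F (x1 * x + x2 * y + x3 * u, y1 * x + y2 * y + y3 * u)%R =
    \int[stdn]_y \int[stdn]_u \int[stdn]_x F (x1 * x + x2 * y + x3 * u, y1 * x + y2 * y + y3 * u)%R.
  have := @stdn_swap (fun z => \int[stdn]_x F (x1 * x + x2 * z.1 + x3 * z.2, y1 * x + y2 * z.1 + y3 * z.2)%R).
  apply.
  - have := mlin x1 x2 x3 y1 y2 y3.
    move/(measurable_fun_fubini_tonelli_G (m1 := stdn)); apply.
    by move=> z; exact: F0.
  - by move=> z; apply: integral_ge0 => x _; exact: F0.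
(* The zero coefficients put every integrand into one general linear shape, so that the same
   exchanges of integrals apply to all of them. *)
transitivity (\int[@stdn R]_u \int[@stdn R]_y \int[@stdn R]_x F (a * x + 0 * y + k * u, b * x + c * y + l * u)%R).
  do 3 (apply: eq_integral => ? _); congr (F (_, _)); ring.
rewrite swap23.
transitivity (\int[@stdn R]_y \int[@stdn R]_u \int[@stdn R]_x F (r * x + 0 * y + 0 * u, b1 * x + c * y + l1 * u)%R).
  apply: eq_integral => y _.
  rewrite -(@stdn_rotation _ (fun z => F (r * z.1 + 0 * y + 0 * z.2, b1 * z.1 + c * y + l1 * z.2)%R) p q pq p0); last by move=> z; exact: F0.
    apply: eq_integral => u _; apply: eq_integral => x _; congr (F (_, _)) => /=.
      by rewrite aE kE; ring.
    apply/eqP; rewrite -subr_eq0; apply/eqP; rewrite /b1 /l1.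
    transitivity ((1 - (p ^+ 2 + q ^+ 2)) * (b * x + l * u))%R; first ring.
    by rewrite pq subrr mul0r.
  apply: (measurableT_comp mF); apply/measurable_fun_pairP.
  by split; (apply: measurable_funD; last exact: measurable_funM);
    (apply: measurable_funD => //; exact: measurable_funM).
rewrite -swap23 swap12.
rewrite (@stdn_swap (fun z => \int[@stdn R]_y F (r * z.1 + 0 * y + 0 * z.2, b1 * z.1 + c * y + l1 * z.2)%R)); last 2 first.
- have := mlin 0%R r 0%R c b1 l1.
  move/(measurable_fun_fubini_tonelli_G (m1 := stdn)) => /(_ (fun z => F0 _)).
  congr (measurable_fun _ _); apply/funext => z; apply: eq_integral => y _ /=.
  by congr (F (_, _)); ring.
- by move=> z; apply: integral_ge0 => x _; exact: F0.
rewrite (@stdn_swap (fun z => F (r * z.1, b1 * z.1 + s * z.2)%R)); first last.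
  by move=> z; exact: F0.
  apply: (measurableT_comp mF); apply/measurable_fun_pairP.
  by split; [exact: measurable_funM|apply: measurable_funD; exact: measurable_funM].
apply: eq_integral => x _ /=.
rewrite -(@stdn_combine (fun t => F (r * x, b1 * x + t)%R) c l1 c0); last by move=> z; exact: F0.
  by do 2 (apply: eq_integral => ? _); congr (F (_, _)); ring.
have mm : measurable_fun [set: R] (fun t : R => (r * x, b1 * x + t)%R).
  by apply/measurable_fun_pairP; split; [exact: measurable_cst|exact: measurable_funD].
exact: (measurableT_comp mF mm).
Qed.


Lemma measurable_pairR (S1 S2 : Omega -> R) : measurable_fun setT S1 ->
  measurable_fun setT S2 -> measurable_fun setT (fun w => (S1 w, S2 w)).
Proof. by move=> m1 m2; apply/measurable_fun_pairP. Qed.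

(** The event [E] is carried along because the induction over increments needs independence of a
    pair jointly with all increments still to come. Dividing the restricted measure by [P E] makes
    uniqueness of product measures applicable; a null [E] is trivial. *)
Lemma prob_pair_prod (S : Omega -> R * R) (X : Omega -> R) (E : set Omega)
    (mS : measurable_fun setT S) (mX : measurable_fun setT X)
    (nu1 : probability (R * R)%type R) (nu2 : probability R R) :
  measurable E ->
  (forall C A, measurable C -> measurable A ->
    P (S @^-1` C `&` X @^-1` A `&` E) = nu1 C * nu2 A * P E) ->
  forall D : set (R * R * R), measurable D ->
    P ((fun w => (S w, X w)) @^-1` D `&` E) = (nu1 \x nu2) D * P E.
Proof.
move=> mE H D mD.
have mSX : measurable_fun setT (fun w => (S w, X w)) by apply/measurable_fun_pairP.
have PEf : P E \is a fin_num by exact: fin_num_measure.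
have [PE0|PE0] := eqVneq (P E) 0.
  rewrite PE0 mule0; apply/eqP; rewrite eq_le measure_ge0 andbT -PE0.
  apply: le_measure; rewrite ?inE//.
  by apply: measurableI => //; rewrite -[X in measurable X]setTI; exact: mSX.
have fE0 : (0 < fine (P E))%R by rewrite fine_gt0// lt0e PE0 measure_ge0/= ltey_eq PEf.
have kE : (0 <= (fine (P E))^-1)%R by rewrite invr_ge0 ltW.
have kPE : (fine (P E))^-1%:E * P E = 1.
  by rewrite -[X in _ * X](fineK PEf) -EFinM mulVf// gt_eqF.
pose m' : {measure set (R * R * R) -> \bar R} := mscale (NngNum kE)
  (measure_function_pushforward__canonical__measure_function_Measure (mrestr P mE) mSX).
have key : (nu1 \x nu2) D = m' D.
  apply: product_measure_unique => // C A mC mA.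
  rewrite -[LHS]/((fine (P E))^-1%:E * P ((fun w => (S w, X w)) @^-1` (C `*` A) `&` E)).
  have -> : (fun w => (S w, X w)) @^-1` (C `*` A) `&` E = S @^-1` C `&` X @^-1` A `&` E.
    by apply/seteqP; split.
  by rewrite H// muleCA kPE mule1.
rewrite key -[m' D]/((fine (P E))^-1%:E * P ((fun w => (S w, X w)) @^-1` D `&` E)).
by rewrite muleAC kPE mul1e.
Qed.

(** For a fixed value of the new variable the integrand is one for the old pair; integrating over
    that value leaves the triple integral of [stdn_triple]. *)
Lemma gauss_pair_add (S1 S2 X : Omega -> R) (a b c k l v : R) : (0 <= a)%R -> (0 <= c)%R ->
  measurable_fun setT S1 -> measurable_fun setT S2 ->
  gauss_pair S1 S2 a b c -> (0 < v)%R -> has_law P X (normal_law 0 v) ->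
  (forall C A, measurable C -> measurable A ->
    P ((fun w => (S1 w, S2 w)) @^-1` C `&` X @^-1` A) =
    P ((fun w => (S1 w, S2 w)) @^-1` C) * P (X @^-1` A)) ->
  exists abc : R * R * R,
  [/\ (0 <= abc.1.1)%R, (0 <= abc.2)%R, (abc.1.1 ^+ 2 = a ^+ 2 + k ^+ 2 * v)%R,
     (abc.1.1 * abc.1.2 = a * b + k * l * v)%R &
     (abc.1.2 ^+ 2 + abc.2 ^+ 2 = b ^+ 2 + c ^+ 2 + l ^+ 2 * v)%R] /\
  gauss_pair (fun w => S1 w + k * X w)%R (fun w => S2 w + l * X w)%R abc.1.1 abc.1.2 abc.2.
Proof.
move=> a0 c0 mS1 mS2 gS v0 [mX lX] ind.
pose s := Num.sqrt v.
have s0 : (0 < s)%R by rewrite sqrtr_gt0.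
have s2 : (s ^+ 2 = v)%R by rewrite sqr_sqrtr// ltW.
pose S w := (S1 w, S2 w).
have mS : measurable_fun setT S by exact: measurable_pairR.
pose mfS : {mfun Omega >-> (R * R)%type} := HB.pack S (isMeasurableFun.Build _ _ _ _ _ mS).
pose mfX : {mfun Omega >-> R} := HB.pack X (isMeasurableFun.Build _ _ _ _ _ mX).
pose nu1 := distribution P mfS; pose nu2 := distribution P mfX.
have law D : measurable D -> P ((fun w => (S w, X w)) @^-1` D) = (nu1 \x nu2) D.
  move=> mD; have := @prob_pair_prod S X setT mS mX nu1 nu2 measurableT _ D mD.
  rewrite setIT probability_setT mule1; apply.
  by move=> C A mC mA; rewrite setIT mule1; exact: ind.
have mlin : measurable_fun [set: R * R * R] (fun z : R * R * R => (z.1.1 + k * z.2, z.1.2 + l * z.2)%R).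
  have m1 : measurable_fun [set: R * R * R] (fun z : R * R * R => z.1) by exact: measurable_fst.
  apply/measurable_fun_pairP; split; apply: measurable_funD => /=.
  - exact: (measurableT_comp measurable_fst m1).
  - exact: measurable_funM.
  - exact: (measurableT_comp measurable_snd m1).
  - exact: measurable_funM.
have int_X (f : R -> \bar R) : measurable_fun setT f -> (forall x, 0 <= f x) ->
    \int[nu2]_x f x = \int[stdn]_x f (s * x)%R.
  move=> mf f0.
  have ms : measurable_fun [set: R] (fun x : R => s * x)%R by exact: measurable_funM.
  have -> : \int[nu2]_x f x = \int[pushforward stdn (fun x : R => s * x)%R]_x f x.
    have : \int[nu2]_x f x = \int[measure_function_pushforward__canonical__measure_function_Measure stdn ms]_x f x.
      apply: eq_measure_integral => A mA _.
      rewrite -[LHS]/(P (X @^-1` A)) lX// /normal_law (normal_prob_standard 0 s0 mA).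
      transitivity (normal_prob 0 1 ((fun x : R => s * x)%R @^-1` A)) => //.
      by congr (normal_prob 0 1 _); apply/seteqP; split => x /=; rewrite add0r.
    by [].
  by rewrite (ge0_integral_pushforward ms).
have [abc [[h1 h2 h3 h4 h5] tri]] := stdn_triple b (k * s) (l * s) a0 c0.
exists abc; split.
  by split => //; rewrite ?h3 ?h4 ?h5 -s2; ring.
move=> F mF F0.
pose G (z : R * R * R) := F (z.1.1 + k * z.2, z.1.2 + l * z.2)%R.
have mG : measurable_fun setT G by exact: (measurableT_comp mF mlin).
have mSX : measurable_fun setT (fun w => (S w, X w)) by apply/measurable_fun_pairP.
transitivity (\int[nu1 \x nu2]_z G z).
  transitivity (\int[pushforward P (fun w => (S w, X w))]_z G z).
    by rewrite (ge0_integral_pushforward mSX P measurableT mG)// => z _; exact: F0.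
  by apply: eq_measure_integral => D mD _; exact: law.
rewrite (fubini_tonelli2 G mG); last by move=> z; exact: F0.
have mGs (x : R) : measurable_fun setT (fun z : R * R => G (z, x)).
  have mm : measurable_fun setT (fun z : R * R => (z, x)).
    by apply/measurable_fun_pairP; split; [exact: measurable_id|exact: measurable_cst].
  exact: (measurableT_comp mG mm).
have inner x : fubini_G nu1 G x =
    \int[stdn]_y \int[stdn]_u F (a * u + k * x, b * u + c * y + l * x)%R.
  apply: etrans (gS (fun z => G (z, x)) (mGs x) (fun=> F0 _)).
  exact: (@ge0_integral_distribution _ _ _ _ _ P mfS (fun z => G (z, x)) (mGs x) (fun=> F0 _)).
transitivity (\int[nu2]_x \int[stdn]_y \int[stdn]_u F (a * u + k * x, b * u + c * y + l * x)%R).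
  by apply: eq_integral => x _; exact: inner.
rewrite int_X.
- rewrite -(tri F mF F0); apply: eq_integral => u _; apply: eq_integral => y _.
  by apply: eq_integral => x _; congr (F (_, _)); ring.
- have := measurable_fun_fubini_tonelli_G (m1 := nu1) G mG (fun z => F0 _).
  by congr (measurable_fun _ _); apply/funext => x; exact: inner.
- by move=> x; apply: integral_ge0 => y _; apply: integral_ge0 => u _; exact: F0.
Qed.

(** Independence is assumed for arbitrary planar sets [C], not only for rectangles, so that it
    passes on to the pair augmented by a multiple of [X 0]. *)
Lemma gauss_pair_sum (m : nat) : forall (X : nat -> Omega -> R) (k l v : nat -> R)
    (S1 S2 : Omega -> R) (a b c : R), (0 <= a)%R -> (0 <= c)%R ->
  measurable_fun setT S1 -> measurable_fun setT S2 -> gauss_pair S1 S2 a b c ->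
  (forall i, (i < m)%N -> (0 < v i)%R /\ has_law P (X i) (normal_law 0 (v i))) ->
  (forall (C : set (R * R)) (A : nat -> set R), measurable C -> (forall i, measurable (A i)) ->
    P ((fun w => (S1 w, S2 w)) @^-1` C `&` \bigcap_(i in `I_m) (X i @^-1` A i)) =
    P ((fun w => (S1 w, S2 w)) @^-1` C) * \prod_(i < m) P (X i @^-1` A i)) ->
  exists abc : R * R * R,
  [/\ (0 <= abc.1.1)%R, (0 <= abc.2)%R,
     (abc.1.1 ^+ 2 = a ^+ 2 + \sum_(i < m) k i ^+ 2 * v i)%R,
     (abc.1.1 * abc.1.2 = a * b + \sum_(i < m) k i * l i * v i)%R &
     (abc.1.2 ^+ 2 + abc.2 ^+ 2 = b ^+ 2 + c ^+ 2 + \sum_(i < m) l i ^+ 2 * v i)%R] /\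
  gauss_pair (fun w => S1 w + \sum_(i < m) k i * X i w)%R
             (fun w => S2 w + \sum_(i < m) l i * X i w)%R abc.1.1 abc.1.2 abc.2.
Proof.
elim: m => [|m IH] X k l v S1 S2 a b c a0 c0 mS1 mS2 gS hX ind.
  exists (a, b, c) => /=; split; first by split => //; rewrite big_ord0 addr0.
  move=> F mF F0; rewrite -(gS F mF F0); apply: eq_integral => w _.
  by rewrite !big_ord0 !addr0.
have [v0 lX] := hX 0%N isT.
have [mX _] := lX.
have mSX C : measurable C -> measurable ((fun w => (S1 w, S2 w)) @^-1` C).
  move=> mC; rewrite -[X in measurable X]setTI.
  by have := measurable_pairR mS1 mS2; apply.
pose rest (A : nat -> set R) := \bigcap_(i in `I_m) (X i.+1 @^-1` A i).
have capS (A : nat -> set R) : \bigcap_(i in `I_m.+1) (X i @^-1` A i) =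
    X 0%N @^-1` A 0%N `&` rest (fun i => A i.+1).
  apply/seteqP; split => [w h|w [h0 h] [|i] /= im]//.
    by split; [exact: (h 0%N)|move=> i im; exact: (h i.+1)].
  exact: (h i).
pose cons (A0 : set R) (A : nat -> set R) i := if i is j.+1 then A j else A0.
have mcons A0 A : measurable A0 -> (forall i, measurable (A i)) -> forall i, measurable (cons A0 A i).
  by move=> mA0 mA [|i] /=.
have mrest A : (forall i, measurable (A i)) -> measurable (rest A).
  move=> mA; apply: bigcap_measurableType => i im.
  have [mXi _] := (hX i.+1 im).2.
  by rewrite -[X in measurable X]setTI; exact: mXi.
have ind' C A0 A : measurable C -> measurable A0 -> (forall i, measurable (A i)) ->
    P ((fun w => (S1 w, S2 w)) @^-1` C `&` X 0%N @^-1` A0 `&` rest A) =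
    P ((fun w => (S1 w, S2 w)) @^-1` C) * P (X 0%N @^-1` A0) * \prod_(i < m) P (X i.+1 @^-1` A i).
  move=> mC mA0 mA; have := ind C (cons A0 A) mC (mcons _ _ mA0 mA).
  by rewrite capS setIA => ->; rewrite big_ord_recl/= muleA.
have Prest A : (forall i, measurable (A i)) -> P (rest A) = \prod_(i < m) P (X i.+1 @^-1` A i).
  move=> mA; have := ind' setT setT A measurableT measurableT mA.
  by rewrite !preimage_setT !setTI probability_setT !mul1e.
have indX C A0 : measurable C -> measurable A0 ->
    P ((fun w => (S1 w, S2 w)) @^-1` C `&` X 0%N @^-1` A0) =
    P ((fun w => (S1 w, S2 w)) @^-1` C) * P (X 0%N @^-1` A0).
  move=> mC mA0; have := ind' C A0 (fun=> setT) mC mA0 (fun=> measurableT).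
  have -> : rest (fun=> setT) = setT by apply/seteqP; split.
  rewrite setIT => ->; rewrite big1 ?mule1// => i _.
  by rewrite preimage_setT probability_setT.
have [[[a1 b1] c1] [/= [h1 h2 h3 h4 h5] g1]] :=
  gauss_pair_add (k 0%N) (l 0%N) a0 c0 mS1 mS2 gS v0 lX indX.
have mS1' : measurable_fun setT (fun w => S1 w + k 0%N * X 0%N w)%R.
  by apply: measurable_funD => //; exact: measurable_funM.
have mS2' : measurable_fun setT (fun w => S2 w + l 0%N * X 0%N w)%R.
  by apply: measurable_funD => //; exact: measurable_funM.
have [||abc [[e1 e2 e3 e4 e5] g2]] := IH (fun i => X i.+1) (fun i => k i.+1) (fun i => l i.+1)
  (fun i => v i.+1) _ _ a1 b1 c1 h1 h2 mS1' mS2' g1.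
- by move=> i im; exact: hX.
- move=> C A mC mA.
  pose mfS : {mfun Omega >-> (R * R)%type} :=
    HB.pack (fun w => (S1 w, S2 w)) (isMeasurableFun.Build _ _ _ _ _ (measurable_pairR mS1 mS2)).
  pose mfX : {mfun Omega >-> R} := HB.pack (X 0%N) (isMeasurableFun.Build _ _ _ _ _ mX).
  have mT : measurable_fun setT (fun z : R * R * R => (z.1.1 + k 0%N * z.2, z.1.2 + l 0%N * z.2)%R).
    have m1 : measurable_fun [set: R * R * R] (fun z : R * R * R => z.1) by exact: measurable_fst.
    apply/measurable_fun_pairP; split; apply: measurable_funD => /=.
    - exact: (measurableT_comp measurable_fst m1).
    - exact: measurable_funM.
    - exact: (measurableT_comp measurable_snd m1).
    - exact: measurable_funM.
  (* An event on the new partial sums is an event on the old ones together with [X 0]. *)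
  have mD : measurable ((fun z : R * R * R => (z.1.1 + k 0%N * z.2, z.1.2 + l 0%N * z.2)%R) @^-1` C).
    by rewrite -[X in measurable X]setTI; exact: mT.
  have Q E (mE : measurable E) := @prob_pair_prod _ _ E (measurable_pairR mS1 mS2) mX
    (distribution P mfS) (distribution P mfX) mE.
  have H1 C' A' : measurable C' -> measurable A' ->
      P ((fun w => (S1 w, S2 w)) @^-1` C' `&` X 0%N @^-1` A' `&` rest A) =
      distribution P mfS C' * distribution P mfX A' * P (rest A).
    by move=> mC' mA'; rewrite ind'// Prest.
  have := Q _ (mrest A mA) H1 _ mD; rewrite Prest// => E1.
  apply: (etrans E1).
  congr (_ * _).
  have H2 C' A' : measurable C' -> measurable A' ->
      P ((fun w => (S1 w, S2 w)) @^-1` C' `&` X 0%N @^-1` A' `&` setT) =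
      distribution P mfS C' * distribution P mfX A' * P setT.
    by move=> mC' mA'; rewrite setIT probability_setT mule1; exact: indX.
  by have := Q setT measurableT H2 _ mD; rewrite setIT probability_setT mule1 => <-.
exists abc; split.
  by split => //; rewrite ?e3 ?e4 ?e5 ?h3 ?h4 ?h5 big_ord_recl ?addrA.
move=> F mF F0; rewrite -(g2 F mF F0); apply: eq_integral => w _.
by rewrite !big_ord_recl/= !addrA.
Qed.

End gauss_pair.

Lemma cvg_eq1 {T : Type} {V : topologicalType} {F : set_system T} (u v : T -> V) (l : V) :
  u =1 v -> u x @[x --> F] --> l -> v x @[x --> F] --> l.
Proof. by move=> /funext ->. Qed.

(** * Square-integrable functions *)

Section square_integrable.
Context {d} {T : measurableType d} {R : realType} (mu : {measure set T -> \bar R}).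
Implicit Types f g h : T -> R.

Definition sqint f := measurable_fun setT f /\
  mu.-integrable setT (EFin \o (fun x => f x ^+ 2)).

Definition ip f g : R := \int[mu]_x (f x * g x).

Lemma sqint_measurable f : sqint f -> measurable_fun setT f.
Proof. by case. Qed.

Lemma sqint_integrableM f g : sqint f -> sqint g ->
  mu.-integrable setT (EFin \o (fun x => f x * g x)).
Proof.
move=> [mf f2] [mg g2].
apply: (le_integrable _ _ _ (integrableD _ f2 g2)) => //.
- by apply/measurable_EFinP; exact: measurable_funM.
- move=> x _; rewrite /= lee_fin normrM.
  have f0 := sqr_ge0 (`|f x| - `|g x|); have n1 := real_normK (num_real (f x)).
  have n2 := real_normK (num_real (g x)).
  rewrite [leRHS]ger0_norm; last by rewrite addr_ge0 ?sqr_ge0.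
  have : 0 <= `|f x| * `|g x| by exact: mulr_ge0.
  by move: f0 n1 n2; set u := `|f x|; set v := `|g x|; nra.
Qed.

Lemma sqintD f g : sqint f -> sqint g -> sqint (fun x => f x + g x).
Proof.
move=> hf hg; have [mf f2] := hf; have [mg g2] := hg; split; first exact: measurable_funD.
have := integrableD measurableT (integrableD measurableT f2 g2)
  (integrableZl measurableT 2 (sqint_integrableM hf hg)).
apply: eq_integrable => // x _ /=; rewrite -EFinM -!EFinD; congr EFin; ring.
Qed.

Lemma sqintZ k f : sqint f -> sqint (fun x => k * f x).
Proof.
move=> [mf f2]; split; first exact: measurable_funM.
have := integrableZl measurableT (k ^+ 2) f2.
by apply: eq_integrable => // x _ /=; rewrite -EFinM exprMn.
Qed.

Lemma sqintB f g : sqint f -> sqint g -> sqint (fun x => f x - g x).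
Proof.
move=> hf /(sqintZ (-1)) hg; have := sqintD hf hg.
by congr sqint; apply/funext => x; rewrite mulN1r.
Qed.

Lemma sqint_lty f : measurable_fun setT f ->
  (\int[mu]_x (f x ^+ 2)%:E < +oo)%E -> sqint f.
Proof.
move=> mf fy; split => //; apply/integrableP; split.
  by apply/measurable_EFinP; exact: measurable_funX.
apply: le_lt_trans fy; apply: ge0_le_integral => //.
- by apply: measurableT_comp => //; apply/measurable_EFinP; exact: measurable_funX.
- by apply/measurable_EFinP; exact: measurable_funX.
- by move=> x _ /=; rewrite ger0_norm// sqr_ge0.
Qed.

Lemma sqint_EFin f : sqint f -> (\int[mu]_x (f x ^+ 2)%:E)%E = (ip f f)%:E.
Proof.
move=> [mf f2]; rewrite /ip /Rintegral fineK; last first.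
  have := integrable_fin_num measurableT f2.
  by congr (_ \is a fin_num); apply: eq_integral => x _; rewrite /= expr2.
by apply: eq_integral => x _; rewrite expr2.
Qed.

Lemma ipC f g : ip f g = ip g f.
Proof. by apply: eq_Rintegral => x _; rewrite mulrC. Qed.

Lemma ipDl f g h : sqint f -> sqint g -> sqint h ->
  ip (fun x => f x + g x) h = ip f h + ip g h.
Proof.
move=> hf hg hh; rewrite /ip -RintegralD//; try exact: sqint_integrableM.
by apply: eq_Rintegral => x _; rewrite mulrDl.
Qed.

Lemma ipDr f g h : sqint f -> sqint g -> sqint h ->
  ip f (fun x => g x + h x) = ip f g + ip f h.
Proof. by move=> hf hg hh; rewrite ipC ipDl// !(ipC f). Qed.

Lemma ipZl k f g : sqint f -> sqint g -> ip (fun x => k * f x) g = k * ip f g.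
Proof.
move=> hf hg; rewrite /ip -RintegralZl//; try exact: sqint_integrableM.
by apply: eq_Rintegral => x _; rewrite mulrA.
Qed.

Lemma ipZr k f g : sqint f -> sqint g -> ip f (fun x => k * g x) = k * ip f g.
Proof. by move=> hf hg; rewrite ipC ipZl// ipC. Qed.

Lemma ipBl f g h : sqint f -> sqint g -> sqint h ->
  ip (fun x => f x - g x) h = ip f h - ip g h.
Proof.
move=> hf hg hh; rewrite -mulN1r -ipZl// -ipDl//; last exact: sqintZ.
by congr ip; apply/funext => x; rewrite mulN1r.
Qed.

Lemma ipBr f g h : sqint f -> sqint g -> sqint h ->
  ip f (fun x => g x - h x) = ip f g - ip f h.
Proof. by move=> hf hg hh; rewrite ipC ipBl// !(ipC f). Qed.

Lemma ip_ge0 f : 0 <= ip f f.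
Proof. by apply: Rintegral_ge0 => x _; rewrite -expr2 sqr_ge0. Qed.

Lemma ip_CauchySchwarz f g : sqint f -> sqint g -> ip f g ^+ 2 <= ip f f * ip g g.
Proof.
move=> hf hg.
have key t : 0 <= ip f f + 2 * t * ip f g + t ^+ 2 * ip g g.
  have := ip_ge0 (fun x => f x + t * g x).
  have hz := sqintZ t hg.
  rewrite ipDl ?ipDr ?ipZl ?ipZr//; last exact: sqintD.
  by rewrite (ipC g f); lra.
have g0 := ip_ge0 g; have f0 := ip_ge0 f.
have [g00|gn] := eqVneq (ip g g) 0.
  have [q0|qn] := eqVneq (ip f g) 0; first by rewrite q0 g00 mulr0 expr0n.
  (* If [g] has norm zero the quadratic in [t] is affine; this [t] would make it equal to -1. *)
  have := key (- (ip f f + 1) / (2 * ip f g)); rewrite g00 mulr0 addr0.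
  have -> : 2 * (- (ip f f + 1) / (2 * ip f g)) * ip f g = - (ip f f + 1) by field.
  by lra.
have gp : 0 < ip g g by rewrite lt0r gn.
have := key (- ip f g / ip g g).
have -> : ip f f + 2 * (- ip f g / ip g g) * ip f g + (- ip f g / ip g g) ^+ 2 * ip g g
  = (ip f f * ip g g - ip f g ^+ 2) / ip g g by field.
by rewrite pmulr_lge0 ?invr_gt0// subr_ge0.
Qed.

(** The error expands into two terms linear in the differences and one bilinear term, each
    controlled by the Cauchy-Schwarz inequality. *)
Lemma ip_cvg (f_ g_ : nat -> T -> R) f g :
  (forall n, sqint (f_ n)) -> (forall n, sqint (g_ n)) -> sqint f -> sqint g ->
  ip (fun x => f_ n x - f x) (fun x => f_ n x - f x) @[n --> \oo] --> 0 ->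
  ip (fun x => g_ n x - g x) (fun x => g_ n x - g x) @[n --> \oo] --> 0 ->
  ip (f_ n) (g_ n) @[n --> \oo] --> ip f g.
Proof.
move=> hf_ hg_ hf hg cf cg.
have hdf n : sqint (fun x => f_ n x - f x) by exact: sqintB.
have hdg n : sqint (fun x => g_ n x - g x) by exact: sqintB.
have E n : ip (f_ n) (g_ n) = ip f g + (ip f (fun x => g_ n x - g x) +
   (ip g (fun x => f_ n x - f x) + ip (fun x => f_ n x - f x) (fun x => g_ n x - g x))).
  rewrite !(ipBl,ipBr)//.
  by rewrite (ipC (f_ n) g) (ipC f g); ring.
have to0 (u v w : nat -> R) : (forall n, u n ^+ 2 <= v n * w n) ->
    v n * w n @[n --> \oo] --> 0 -> u n @[n --> \oo] --> 0.
  move=> uvw vw0; apply/norm_cvg0P.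
  have : Num.sqrt (v n * w n) @[n --> \oo] --> Num.sqrt 0.
    by apply: continuous_cvg => //; exact: sqrt_continuous.
  rewrite sqrtr0; apply: squeeze_cvgr; last exact: cvg_cst.
  near=> n; rewrite normr_ge0/= -sqrtr_sqr.
  by rewrite ler_wsqrtr.
have -> : (fun n => ip (f_ n) (g_ n)) = (fun n => ip f g + (ip f (fun x => g_ n x - g x) +
   (ip g (fun x => f_ n x - f x) + ip (fun x => f_ n x - f x) (fun x => g_ n x - g x)))).
  by apply/funext => n; exact: E.
suff H : (fun n => ip f g + (ip f (fun x => g_ n x - g x) +
   (ip g (fun x => f_ n x - f x) + ip (fun x => f_ n x - f x) (fun x => g_ n x - g x)))) @ \oo --> ip f g + (0 + (0 + 0)).
  by rewrite !addr0 in H.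
apply: cvgD; first exact: cvg_cst.
apply: cvgD.
  apply: (to0 _ (fun=> ip f f)) => [n|]; first exact: ip_CauchySchwarz.
  by rewrite -[X in _ --> X](mulr0 (ip f f)); apply: cvgM => //; exact: cvg_cst.
apply: cvgD.
  apply: (to0 _ (fun=> ip g g)) => [n|]; first exact: ip_CauchySchwarz.
  by rewrite -[X in _ --> X](mulr0 (ip g g)); apply: cvgM => //; exact: cvg_cst.
apply: to0 => [n|]; first exact: ip_CauchySchwarz.
by rewrite -[X in _ --> X](mulr0 0); exact: cvgM.
Unshelve. all: by end_near. Qed.

(** From (x + y)^2 <= 2 x^2 + 2 y^2: the factor 2 is the price of working with squared distances,
    and is harmless in closure arguments. *)
Lemma ip_dist_triangle f g h : sqint f -> sqint g -> sqint h ->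
  ip (fun x => f x - h x) (fun x => f x - h x) <=
  2 * ip (fun x => f x - g x) (fun x => f x - g x) +
  2 * ip (fun x => g x - h x) (fun x => g x - h x).
Proof.
move=> hf hg hh.
have h1 := sqintB hf hg; have h2 := sqintB hg hh; have h3 := sqintB hf hh.
have i1 := sqint_integrableM h1 h1; have i2 := sqint_integrableM h2 h2.
have z1 : mu.-integrable setT (EFin \o (fun x => 2 * ((f x - g x) * (f x - g x)))).
  by have := integrableZl measurableT 2 i1; apply: eq_integrable => // x _; rewrite /= EFinM.
have z2 : mu.-integrable setT (EFin \o (fun x => 2 * ((g x - h x) * (g x - h x)))).
  by have := integrableZl measurableT 2 i2; apply: eq_integrable => // x _; rewrite /= EFinM.
rewrite /ip -!RintegralZl// -RintegralD//; apply: le_Rintegral => //.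
- exact: sqint_integrableM.
- by have := integrableD measurableT z1 z2; apply: eq_integrable.
- move=> x _; have := sqr_ge0 ((f x - g x) - (g x - h x)); nra.
Qed.

(** Convergence of the extended integrals makes them finite from some rank on, and only there does
    the real-valued [ip] carry the same information. *)
Lemma sqint_cvg0 (a : nat -> T -> R) : (forall n, measurable_fun setT (a n)) ->
  (\int[mu]_x ((a n x) ^+ 2)%:E @[n --> \oo] --> 0)%E ->
  (\forall n \near \oo, sqint (a n)) /\ ip (a n) (a n) @[n --> \oo] --> 0.
Proof.
move=> ma ca.
have near_s : \forall n \near \oo, sqint (a n).
  have : \forall n \near \oo, (\int[mu]_x ((a n x) ^+ 2)%:E < 1)%E.
    move/fine_cvgP : ca => [fa /cvgrPdist_lt/(_ _ (@ltr01 R))].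
    move=> h; near=> n.
    have fn : (\int[mu]_x ((a n x) ^+ 2)%:E)%E \is a fin_num by near: n.
    rewrite -(fineK fn) lte_fin; apply: le_lt_trans (ler_norm _) _.
    by rewrite -normrN -sub0r; near: n.
  apply: filterS => n h; apply: sqint_lty => //; apply: lt_trans h _.
  exact: ltry.
split => //; move/fine_cvgP : ca => [_]; apply: cvg_trans; apply: near_eq_cvg.
by apply: filterS near_s => n sn /=; rewrite sqint_EFin.
Unshelve. all: by end_near. Qed.

Lemma sqint_cvg0B (a b : nat -> T -> R) : (forall n, measurable_fun setT (a n)) ->
  (forall n, measurable_fun setT (b n)) ->
  (\int[mu]_x ((a n x) ^+ 2)%:E @[n --> \oo] --> 0)%E ->
  (\int[mu]_x ((b n x) ^+ 2)%:E @[n --> \oo] --> 0)%E ->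
  (\int[mu]_x ((a n x - b n x) ^+ 2)%:E @[n --> \oo] --> 0)%E.
Proof.
move=> ma mb ca cb.
have sq0 (f : T -> R) x : (0 <= (f x ^+ 2)%:E)%E by rewrite lee_fin sqr_ge0.
have msq (f : T -> R) : measurable_fun setT f -> measurable_fun setT (fun x => (f x ^+ 2)%:E).
  by move=> mf; apply/measurable_EFinP; exact: measurable_funX.
apply: (squeeze_cvge (f := cst 0%E)
  (h := fun n => 2%:E * \int[mu]_x ((a n x) ^+ 2)%:E + 2%:E * \int[mu]_x ((b n x) ^+ 2)%:E)%E).
- near=> n; apply/andP; split; first by apply: integral_ge0 => x _; exact: (sq0 (fun x => a n x - b n x)).
  rewrite -!ge0_integralZl//; try exact: msq.
  rewrite -ge0_integralD//.
  + apply: ge0_le_integral => //.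
    * by move=> x _; exact: (sq0 (fun x => a n x - b n x)).
    * by apply: (msq (fun x => a n x - b n x)); exact: measurable_funB.
    * by apply: emeasurable_funD; apply: emeasurable_funM => //; exact: msq.
    * move=> x _; rewrite -!EFinM -EFinD lee_fin.
      by have := sqr_ge0 (a n x + b n x); nra.
  + by move=> x _; rewrite mule_ge0.
  + by apply: emeasurable_funM => //; exact: msq.
  + by move=> x _; rewrite mule_ge0.
  + by apply: emeasurable_funM => //; exact: msq.
- exact: cvg_cst.
- rewrite -[X in _ --> X](adde0 0%E); apply: cvgeD => //.
    by rewrite -[X in _ --> X](mule0 2%:E); apply: cvgeZl.
  by rewrite -[X in _ --> X](mule0 2%:E); apply: cvgeZl.
Unshelve. all: by end_near. Qed.

(** The integral of the sum of the [D n] is at most a geometric series, so the sum is finite almost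
    everywhere and its terms tend to 0. It serves to turn fast L^2 convergence into almost sure
    convergence. *)
Lemma ae_cvg_geometric (D : nat -> T -> R) :
  (forall n, measurable_fun setT (D n)) -> (forall n x, 0 <= D n x) ->
  (forall n, (\int[mu]_x (D n x)%:E <= (2^-1 ^+ n)%:E)%E) ->
  {ae mu, forall x, D n x @[n --> \oo] --> 0}.
Proof.
move=> mD D0 Dn.
have mE n : measurable_fun setT (fun x => (D n x)%:E) by exact/measurable_EFinP.
have int_lt : (\int[mu]_x (\sum_(n <oo) (D n x)%:E) < +oo)%E.
  rewrite integral_nneseries//; last by move=> n x _; rewrite lee_fin.
  apply: (@le_lt_trans _ _ (\sum_(n <oo) (2^-1 ^+ n : R)%:E)%E).
    apply: lee_nneseries; last by move=> n _; exact: Dn.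
  by move=> n _ _; apply: integral_ge0 => x _; rewrite lee_fin.
  have cg : cvgn (series (geometric (1 : R) 2^-1)).
    by apply: is_cvg_geometric_series; rewrite ger0_norm// invf_lt1// ltr1n.
  rewrite (_ : (fun n => \sum_(0 <= i < n) _)%E =
     EFin \o series (geometric (1 : R) 2^-1)); last first.
    apply/funext => n /=; rewrite sumEFin /series/=; congr EFin.
    by apply: eq_bigr => i _; rewrite mul1r.
  by rewrite EFin_lim// ltry.
have msum : measurable_fun setT (fun x => \sum_(n <oo) (D n x)%:E)%E.
  by apply: ge0_emeasurable_sum => // n x _ _; rewrite lee_fin.
have : mu.-integrable setT (fun x => \sum_(n <oo) (D n x)%:E)%E.
  apply/integrableP; split => //.
  rewrite (eq_integral (fun x => \sum_(n <oo) (D n x)%:E)%E)// => x _.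
  by rewrite gee0_abs//; apply: nneseries_ge0 => n _ _; rewrite lee_fin.
move/(integrable_ae measurableT); apply: filterS => x /(_ I) fx.
have cs : cvgn (series (fun n => D n x)).
  apply: nondecreasing_is_cvgn.
    by apply/nondecreasing_seqP => n; rewrite /series/= big_nat_recr//= lerDl.
  exists (fine (\sum_(n <oo) (D n x)%:E)%E) => _ [n _ <-].
  rewrite -lee_fin fineK// /series/= -sumEFin.
  by apply: nneseries_lim_ge => i _ _; rewrite lee_fin.
exact: cvg_series_cvg_0.
Qed.

End square_integrable.

(** * Bounded convergence on a probability space *)

Section bounded_convergence.
Context {d} {T : measurableType d} {R : realType} (Q : probability T R).

Lemma bounded_cvg_prob (f_ : nat -> T -> R) (f : T -> R) (M : R) :
  (forall n, measurable_fun setT (f_ n)) -> measurable_fun setT f ->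
  {ae Q, forall x, f_ n x @[n --> \oo] --> f x} -> (forall n x, `|f_ n x| <= M) ->
  (\int[Q]_x (f_ n x)%:E @[n --> \oo] --> \int[Q]_x (f x)%:E)%E.
Proof.
move=> mf_ mf aef fM.
have [|||||_ _] := @dominated_convergence _ _ _ Q setT measurableT
  (fun n x => (f_ n x)%:E) (fun x => (f x)%:E) (cst M%:E); last by [].
- by move=> n; exact/measurable_EFinP.
- exact/measurable_EFinP.
- apply: filterS aef => x h _; apply/fine_cvgP; split; last exact: h.
  exact: nearW.
- exact: finite_measure_integrable_cst.
- by apply: aeW => x n _; rewrite /= lee_fin.
Qed.

Lemma bounded_integrable (f : T -> R) (M : R) : measurable_fun setT f ->
  (forall x, `|f x| <= M) -> Q.-integrable setT (EFin \o f).
Proof.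
move=> mf fM.
have iM : Q.-integrable setT (cst M%:E) by exact: finite_measure_integrable_cst.
apply: (le_integrable _ _ _ iM) => //.
- exact/measurable_EFinP.
- by move=> x _ /=; rewrite lee_fin (le_trans (fM x))// ler_norm.
Qed.

Lemma bounded_Rintegral_cvg (f_ : nat -> T -> R) (f : T -> R) (M : R) :
  (forall n, measurable_fun setT (f_ n)) -> measurable_fun setT f ->
  {ae Q, forall x, f_ n x @[n --> \oo] --> f x} -> (forall n x, `|f_ n x| <= M) ->
  (forall x, `|f x| <= M) ->
  \int[Q]_x f_ n x @[n --> \oo] --> \int[Q]_x f x.
Proof.
move=> mf_ mf aef fM fM'; apply: fine_cvg.
rewrite fineK; last exact/integrable_fin_num/(bounded_integrable mf fM').
exact: bounded_cvg_prob fM.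
Qed.

End bounded_convergence.

(** * The second moment of the standard normal law *)

Section standard_normal_moments.
Context {R : realType}.
Notation mu := (@lebesgue_measure R).

Lemma derive_gauss (x : R) :
  is_derive x 1 (fun t : R => expR (- (t ^+ 2 / 2))) (- (x * expR (- (x ^+ 2 / 2)))).
Proof.
have h : is_derive x 1 (fun t : R => - (t ^+ 2 / 2)) (- x).
  have -> : (fun t : R => - (t ^+ 2 / 2)) = (fun t => - 2^-1 *: (t ^+ 2)).
    by apply/funext => t; rewrite /GRing.scale/=; field.
  apply: is_derive_eq.
  by rewrite scaler1 /GRing.scale/=; field.
have := @is_derive1_comp R expR (fun t : R => - (t ^+ 2 / 2)) x _ _ (is_derive_expR (- (x ^+ 2 / 2))) h.
by rewrite mulrN mulrC.
Qed.

Lemma cvg_gauss_y : expR (- (t ^+ 2 / 2)) @[t --> +oo] --> (0 : R).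
Proof.
apply: (@squeeze_cvgr _ _ _ _ (cst 0) (fun t => expR (- t))); [|exact: cvg_cst|exact: cvgr_expR].
near=> t; rewrite expR_ge0/= ler_expR lerN2.
have t2 : 2 <= t by near: t; exact: nbhs_pinfty_ge.
nra.
Unshelve. all: by end_near. Qed.

Lemma integral_gauss_tail (u : R) : 0 <= u ->
  (\int[mu]_(x in `[u, +oo[) (x * expR (- (x ^+ 2 / 2)))%:E = (expR (- (u ^+ 2 / 2)))%:E)%E.
Proof.
move=> u0; rewrite (@ge0_continuous_FTC2y _ _ (fun t => - expR (- (t ^+ 2 / 2))) u 0).
- by rewrite add0e -EFinN opprK.
- by move=> x ux; rewrite mulr_ge0 ?expR_ge0// (le_trans u0).
- apply: continuous_subspaceT => x; apply: cvgM; first exact: cvg_id.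
  apply: continuous_comp; last exact: continuous_expR.
  by apply: cvgN; apply: cvgM; [exact: exprn_continuous|exact: cvg_cst].
- by rewrite -oppr0; apply: cvgN; exact: cvg_gauss_y.
- by move=> x _; apply: derivableN; apply: ex_derive; exact: derive_gauss.
- apply: cvgN; apply: cvg_at_right_filter.
  by have /derivable1_diffP/differentiable_continuous := @ex_derive _ _ _ _ _ _ _ (derive_gauss u).
- move=> x _; rewrite derive1E deriveN; last by apply: ex_derive; exact: derive_gauss.
  by rewrite (@derive_val _ _ _ _ _ _ _ (derive_gauss x)) opprK.
Qed.

(** Integration by parts done as a Tonelli exchange: x^2 is the integral of x over u in [0, x], and
    for fixed u the integral of x e^(-x^2/2) over x >= u is e^(-u^2/2). *)
Lemma half_line_gauss :
  (\int[mu]_(x in `[0%R, +oo[) (x ^+ 2 * expR (- (x ^+ 2 / 2)))%:E =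
   \int[mu]_(x in `[0%R, +oo[) (expR (- (x ^+ 2 / 2)))%:E)%E.
Proof.
pose A : set (R * R) := [set z | 0 <= z.1 /\ z.1 <= z.2].
have mA : measurable A.
  have -> : A = (fun z : R * R => z.1) @^-1` `[0%R, +oo[ `&` (fun z : R * R => z.2 - z.1) @^-1` `[0%R, +oo[.
    by apply/seteqP; split => z /=; rewrite !in_itv/= !andbT subr_ge0.
  apply: measurableI.
    rewrite -[X in measurable X]setTI.
    by apply: (measurable_fst) => //; exact: measurable_itv.
  rewrite -[X in measurable X]setTI.
  have : measurable_fun [set: R * R] (fun z : R * R => z.2 - z.1).
    by apply: measurable_funB; [exact: measurable_snd|exact: measurable_fst].
  by apply => //; exact: measurable_itv.
have mg : measurable_fun [set: R] (fun x : R => expR (- (x ^+ 2 / 2))).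
  apply: measurableT_comp => //; apply: measurableT_comp => //.
  by apply: measurable_funM => //; exact: measurable_funX.
pose K (z : R * R) : \bar R := ((\1_A z) * (`|z.2| * expR (- (z.2 ^+ 2 / 2))))%:E.
have mK : measurable_fun [set: R * R] K.
  apply/measurable_EFinP; apply: measurable_funM; first exact: measurable_indic.
  apply: measurable_funM; first by apply: measurableT_comp => //; exact: measurable_snd.
  by apply: (measurableT_comp mg); exact: measurable_snd.
have K0 z : (0 <= K z)%E by rewrite lee_fin !mulr_ge0 ?expR_ge0.
have := @lebesgue_tonelli R K mK K0.
rewrite [X in _ = X -> _](_ : _ = \int[mu]_(x in `[0%R, +oo[) (expR (- (x ^+ 2 / 2)))%:E)%E; last first.
  rewrite [RHS]integral_mkcond; apply: eq_integral => u _; rewrite patchE.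
  case: ifPn => hu.
    have u0 : 0 <= u by move: hu; rewrite inE/= in_itv/= andbT.
    rewrite -integral_gauss_tail// [RHS]integral_mkcond; apply: eq_integral => x _.
    rewrite /K patchE indicE /A; case: ifPn => hx.
      have ux : u <= x by move: hx; rewrite inE/= in_itv/= andbT.
      by rewrite mem_set//= mul1r ger0_norm// (le_trans u0).
    rewrite memNset ?mul0r//= => -[_ ux]; move: hx; rewrite notin_setE/= in_itv/= andbT.
    by rewrite ux.
  rewrite integral0_eq// => x _; rewrite /K indicE memNset ?mul0r//= => -[u0 _].
  by move: hu; rewrite notin_setE/= in_itv/= andbT u0.
move=> <-; rewrite integral_mkcond; apply: eq_integral => x _; rewrite patchE.
case: ifPn => hx.
  have x0 : 0 <= x by move: hx; rewrite inE/= in_itv/= andbT.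
  transitivity (\int[mu]_(u in `[0%R, x]) (x * expR (- (x ^+ 2 / 2)))%:E)%E.
    rewrite integral_cst//= lebesgue_measure_itv/= lte_fin oppr0 addr0.
    case: ifPn => xx; first by rewrite -EFinM; congr EFin; ring.
    have -> : x = 0 by apply/eqP; rewrite eq_le x0 andbT leNgt.
    by rewrite mule0 expr0n mul0r.
  rewrite integral_mkcond; apply: eq_integral => u _; rewrite /K patchE indicE /A.
  case: ifPn => hu.
    by move: hu; rewrite inE/= in_itv/= => /andP[u0 ux]; rewrite mem_set//= mul1r ger0_norm.
  rewrite memNset ?mul0r//= => -[u0 ux]; move: hu; rewrite notin_setE/= in_itv/=.
  by rewrite u0 ux.
rewrite integral0_eq// => u _; rewrite /K indicE memNset ?mul0r//= => -[u0 ux].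
by move: hx; rewrite notin_setE/= in_itv/= andbT (le_trans u0).
Qed.

Lemma even_ge0_integral (f : R -> R) : measurable_fun [set: R] f -> (forall x, 0 <= f x) ->
  (forall x, f (- x) = f x) ->
  (\int[mu]_x (f x)%:E = 2%:E * \int[mu]_(x in `[0%R, +oo[) (f x)%:E)%E.
Proof.
move=> mf f0 fN.
have mEf : measurable_fun [set: R] (fun x => (f x)%:E) by exact/measurable_EFinP.
transitivity (\int[mu]_(x in `]-oo, 0%R] `|` `]0%R, +oo[) (f x)%:E)%E.
  by congr (integral _ _ _); apply/seteqP; split => x //= _; rewrite !in_itv/= andbT; case: (leP x 0) => h; [left|right].
rewrite ge0_integral_setU//=; first last.
- apply/disj_setPS => x /=; rewrite !in_itv/= andbT => -[x0 x1].
  by move: (le_lt_trans x0 x1); rewrite ltxx.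
- by move=> x _; rewrite lee_fin.
- exact: measurable_funTS.
rewrite integral_itv_obnd_cbnd; last exact: measurable_funTS.
have := @ge0_integration_by_substitution0 R (fun x => (f x)%:E) mEf (fun x => _).
move=> /(_ (fun x => _)) ->; last by move=> x; rewrite lee_fin.
rewrite mule_natl mule2n; congr (_ + _)%E.
by apply: eq_integral => x _; rewrite fN.
Qed.

Lemma stdn_second_moment : (\int[@stdn R]_x (x ^+ 2)%:E = 1)%E.
Proof.
have msq : measurable_fun [set: R] (fun x : R => x ^+ 2) by exact: measurable_funX.
have mpdf : measurable_fun [set: R] (fun x : R => normal_pdf 0 1 x) by exact: measurable_normal_pdf.
rewrite ge0_integral_stdn; [|exact/measurable_EFinP|by move=> x; rewrite lee_fin sqr_ge0].
rewrite ge0_integral_normal; [|exact/measurable_EFinP|by move=> x; rewrite lee_fin sqr_ge0].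
have peak0 : 0 <= normal_peak (1 : R) by exact: normal_peak_ge0.
have sym (x : R) : normal_pdf 0 1 (- x) = normal_pdf 0 1 x.
  by rewrite !normal_pdf01E sqrrN.
have := integral_normal_pdf (0 : R) 1.
rewrite even_ge0_integral//; last by move=> x; exact: normal_pdf_ge0.
move=> H1.
transitivity (\int[mu]_x (x ^+ 2 * normal_pdf 0 1 x)%:E)%E.
  by apply: eq_integral => x _.
rewrite even_ge0_integral; first last.
- by move=> x; rewrite sym sqrrN.
- by move=> x; rewrite mulr_ge0 ?sqr_ge0 ?normal_pdf_ge0.
- exact: measurable_funM.
rewrite -H1; congr (_ * _)%E.
have mg : measurable_fun [set: R] (fun x : R => expR (- (x ^+ 2 / 2))).
  apply: measurableT_comp => //; apply: measurableT_comp => //.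
  by apply: measurable_funM => //; exact: measurable_funX.
transitivity ((normal_peak (1 : R))%:E * \int[mu]_(x in `[0%R, +oo[) (x ^+ 2 * expR (- (x ^+ 2 / 2)))%:E)%E.
  rewrite -ge0_integralZl//=.
  - by apply: eq_integral => x _; rewrite -EFinM normal_pdf01E mulrCA.
  - apply/measurable_EFinP/measurable_funTS; exact: measurable_funM.
  - by move=> x _; rewrite lee_fin mulr_ge0 ?sqr_ge0 ?expR_ge0.
rewrite half_line_gauss -ge0_integralZl//=.
- by apply: eq_integral => x _; rewrite -EFinM normal_pdf01E.
- by apply/measurable_EFinP/measurable_funTS.
Qed.

End standard_normal_moments.

(** * Wiener integrals *)

Section step_functions.
Context {R : realType}.

(** Taking for [g] a Wiener path gives the step integral, and taking for [g] the indicator of {u : x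
    <= u} gives the step function at x, so one change of grid serves both. *)
Definition increments (phi : step_data R) (g : R -> R) : R :=
  \sum_(p <- phi) p.1.1 * (g p.2 - g p.1.2).

(** Each interval of the list is cut at all grid points and its increment telescopes; the
    coefficients do not depend on [g]. *)
Lemma step_grid1 (s : seq R) (phi : step_data R) :
  sorted <%R s -> well_ordered_step phi ->
  (forall p, p \in phi -> p.1.2 \in s /\ p.2 \in s) ->
  exists c : nat -> R, forall g, increments phi g =
    \sum_(i < (size s).-1) c i * (g (nth 0 s i.+1) - g (nth 0 s i)).
Proof.
move=> ss; elim: phi => [|p phi IH] wo hs.
  by exists (fun=> 0) => g; rewrite /increments big_nil big1// => i _; rewrite mul0r.
move: wo; rewrite /well_ordered_step/= => /andP[wop wo].
have [c hc] := IH wo (fun q hq => hs q (@mem_behead _ (p :: phi) q hq)).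
have [ps pt] := hs p (mem_head _ _).
pose j := index p.1.2 s; pose k := index p.2 s.
have js : (j < size s)%N by rewrite index_mem.
have ks : (k < size s)%N by rewrite index_mem.
have jk : (j <= k)%N.
  rewrite leqNgt; apply/negP => kj.
  have := sorted_ltn_nth lt_trans 0 ss; move/(_ k j ks js kj).
  by rewrite !nth_index// ltNge wop.
exists (fun i => c i + p.1.1 * ((j <= i) && (i < k))%N%:R) => g.
rewrite /increments big_cons -/(increments phi g) hc.
under [RHS]eq_bigr do rewrite mulrDl.
rewrite big_split/= addrC; congr (_ + _).
under [RHS]eq_bigr do rewrite -mulrA.
rewrite -mulr_sumr; congr (_ * _).
pose F i := g (nth 0 s i).
(* Clamping the index to [j, k] extends the telescoping sum to the whole grid with zero terms
   outside. *)
pose G i := F (maxn j (minn i k)).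
transitivity (\sum_(i < (size s).-1) (G i.+1 - G i)).
  rewrite -(big_mkord xpredT (fun i => G i.+1 - G i)) telescope_sumr//.
  rewrite /G /F; congr (g _ - g _).
    have -> : maxn j (minn (size s).-1 k) = k.
      by move: js ks jk; case: (size s) => // m; lia.
    by rewrite nth_index.
  by rewrite min0n maxn0 nth_index.
apply: eq_bigr => i _; rewrite /G.
case: (leqP j i) => ji; case: (ltnP i k) => ik /=; rewrite ?mul1r ?mul0r /F.
- by congr (g (nth 0 s _) - g (nth 0 s _)); lia.
- by apply/eqP; rewrite subr_eq0; apply/eqP; congr (g (nth 0 s _)); lia.
- by apply/eqP; rewrite subr_eq0; apply/eqP; congr (g (nth 0 s _)); lia.
- by apply/eqP; rewrite subr_eq0; apply/eqP; congr (g (nth 0 s _)); lia.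
Qed.

Lemma step_grid (phi psi : step_data R) :
  well_ordered_step phi -> well_ordered_step psi ->
  exists (n : nat) (t c e : nat -> R), [/\ forall i, (i < n)%N -> t i < t i.+1,
    forall g, increments phi g = \sum_(i < n) c i * (g (t i.+1) - g (t i)) &
    forall g, increments psi g = \sum_(i < n) e i * (g (t i.+1) - g (t i))].
Proof.
move=> w1 w2.
pose ends (chi : step_data R) := [seq p.1.2 | p <- chi] ++ [seq p.2 | p <- chi].
(* Without duplicates the grid is strictly increasing, so each Wiener increment on it has positive
   variance. *)
pose s := sort <=%R (undup (ends phi ++ ends psi)).
have ss : sorted <%R s by rewrite sort_lt_sorted undup_uniq.
have h1 p : p \in phi -> p.1.2 \in s /\ p.2 \in s.
  move=> hp; rewrite !mem_sort !mem_undup !mem_cat.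
  by rewrite (map_f (fun p => p.1.2) hp) (map_f (fun p => p.2) hp) ?orbT.
have h2 p : p \in psi -> p.1.2 \in s /\ p.2 \in s.
  move=> hp; rewrite !mem_sort !mem_undup !mem_cat.
  by rewrite (map_f (fun p => p.1.2) hp) (map_f (fun p => p.2) hp) ?orbT.
have [c hc] := step_grid1 ss w1 h1; have [e he] := step_grid1 ss w2 h2.
exists (size s).-1, (nth 0 s), c, e; split => // i im.
have hi : (i.+1 < size s)%N by move: im; case: (size s).
by apply: (sorted_ltn_nth lt_trans 0 ss) => //; rewrite inE (ltn_trans _ hi).
Qed.

Lemma step_funE (phi : step_data R) x : well_ordered_step phi ->
  step_fun phi x = increments phi (fun u => (x <= u)%R%:R).
Proof.
move=> wo; rewrite /step_fun /increments big_seq [RHS]big_seq.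
apply: eq_bigr => p hp; congr (_ * _).
have pp : p.1.2 <= p.2 by exact: (allP wo).
rewrite indicE; case: (boolP (x \in _)).
  by rewrite inE/= in_itv/= => /andP[x1 x2]; rewrite x2 leNgt x1/= subr0.
rewrite notin_setE/= in_itv/= => /negP; rewrite negb_and -leNgt -ltNge.
case: (leP x p.1.2) => x1 /=; first by rewrite (le_trans x1 pp) subrr.
by rewrite leNgt => ->; rewrite subr0.
Qed.

Lemma step_fun_measurable (phi : step_data R) : measurable_fun [set: R] (step_fun phi).
Proof.
by apply: measurable_sum => p; apply: measurable_funM => //; exact: measurable_indic.
Qed.

Lemma grid_monotone (n : nat) (t : nat -> R) :
  (forall i, (i < n)%N -> t i < t i.+1) ->
  forall i j, (i <= j)%N -> (j <= n)%N -> t i <= t j.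
Proof.
move=> ht i j /subnKC <-; elim: (j - i)%N => [|m IHm]; first by rewrite addn0.
rewrite addnS => h; apply: (le_trans (IHm (ltnW h))).
exact/ltW/ht.
Qed.

Lemma grid_cell_orthogonal (n : nat) (t c : nat -> R) (x : R) :
  (forall i, (i < n)%N -> t i < t i.+1) ->
  (\sum_(i < n) c i * \1_(`]t i, t i.+1]) x) ^+ 2 =
  \sum_(i < n) c i ^+ 2 * \1_(`]t i, t i.+1]) x.
Proof.
move=> ht; have tm := grid_monotone ht.
rewrite expr2 big_distrlr/=; apply: eq_bigr => i _.
rewrite (bigD1 i)//= big1 ?addr0 => [|j ji].
  by rewrite indicE; case: (x \in _) => /=; ring.
rewrite !indicE.
have [hi|hi] := boolP (x \in `]t i, t i.+1]%classic); last by rewrite mulr0 mul0r.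
have [hj|hj] := boolP (x \in `]t j, t j.+1]%classic); last by rewrite !mulr0.
exfalso; move: hi hj; rewrite !inE/= !in_itv/= => /andP[i1 i2] /andP[j1 j2].
move: ji; rewrite neq_ltn => /orP[ij|ji].
  have := tm j.+1 i ij (ltnW (ltn_ord i)).
  by move=> /(le_trans j2)/(lt_le_trans i1); rewrite ltxx.
have := tm i.+1 j ji (ltnW (ltn_ord j)).
by move=> /(le_trans i2)/(lt_le_trans j1); rewrite ltxx.
Qed.

Lemma grid_indicator (n : nat) (t c : nat -> R) (x : R) :
  (forall i, (i < n)%N -> t i < t i.+1) ->
  \sum_(i < n) c i * ((x <= t i.+1)%R%:R - (x <= t i)%R%:R) =
  \sum_(i < n) c i * \1_(`]t i, t i.+1]) x.
Proof.
move=> ht; apply: eq_bigr => i _; congr (_ * _).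
have ti := ltW (ht i (ltn_ord i)).
rewrite indicE; case: (boolP (x \in _)).
  by rewrite inE/= in_itv/= => /andP[x1 x2]; rewrite x2 leNgt x1/= subr0.
rewrite notin_setE/= in_itv/= => /negP; rewrite negb_and -leNgt -ltNge.
case: (leP x (t i)) => x1 /=; first by rewrite (le_trans x1 ti) subrr.
by rewrite leNgt => ->; rewrite subr0.
Qed.

Lemma integral_step_sqr (phi : step_data R) (n : nat) (t c : nat -> R) :
  well_ordered_step phi -> (forall i, (i < n)%N -> t i < t i.+1) ->
  (forall g, increments phi g = \sum_(i < n) c i * (g (t i.+1) - g (t i))) ->
  (\int[lebesgue_measure]_x (step_fun phi x ^+ 2)%:E =
    (\sum_(i < n) c i ^+ 2 * (t i.+1 - t i))%:E)%E.
Proof.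
move=> wo ht hc.
transitivity (\int[lebesgue_measure]_x (\sum_(i < n) (c i ^+ 2)%:E * (\1_(`]t i, t i.+1]) x)%:E))%E.
  apply: eq_integral => x _; rewrite step_funE// hc grid_indicator// grid_cell_orthogonal//.
  by rewrite -sumEFin.
rewrite ge0_integral_sum//=; first last.
- by move=> i x _; rewrite mule_ge0// lee_fin ?sqr_ge0.
- by move=> i; apply/measurable_EFinP; apply: measurable_funM => //; exact: measurable_indic.
rewrite -sumEFin; apply: eq_bigr => i _.
rewrite ge0_integralZl//=; first last.
- by rewrite lee_fin sqr_ge0.
- by apply/measurable_EFinP; exact: measurable_indic.
rewrite integral_indic//= setIT lebesgue_measure_itv/= lte_fin ht//.
Qed.

End step_functions.

(** * Gaussian pairs of step integrals and their closure in L^2 *)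

Section step_wiener.
Context {R : realType} {d} {Omega : measurableType d} (P : probability Omega R).
Variables (W : R -> {RV P >-> R}).
Hypothesis hW : two_sided_wiener W.

Lemma step_wiener_integralE (phi : step_data R) w :
  step_wiener_integral W phi w = increments phi (fun u => W u w).
Proof. by []. Qed.

Lemma step_wiener_measurable (phi : step_data R) :
  measurable_fun setT (step_wiener_integral W phi).
Proof.
by apply: measurable_sum => p; apply: measurable_funM => //; exact: measurable_funB.
Qed.

(** On a common grid both step integrals are linear combinations of the same independent increments;
    these are added one by one to the constant pair (0, 0). *)
Lemma step_wiener_gauss_pair (phi psi : step_data R) :
  well_ordered_step phi -> well_ordered_step psi ->
  exists abc : R * R * R,
  [/\ 0 <= abc.1.1, 0 <= abc.2,
    (\int[lebesgue_measure]_x (step_fun phi x ^+ 2)%:E = (abc.1.1 ^+ 2)%:E)%E &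
   gauss_pair P (step_wiener_integral W phi) (step_wiener_integral W psi)
     abc.1.1 abc.1.2 abc.2].
Proof.
move=> w1 w2; have [n [t [c [e [ht hc he]]]]] := step_grid w1 w2.
pose X i w := W (t i.+1) w - W (t i) w.
have [|||abc [[h1 h2 h3 h4 h5] g]] := @gauss_pair_sum R d Omega P n X c e (fun i => t i.+1 - t i)
  (fun=> 0) (fun=> 0) 0 0 0 (lexx _) (lexx _) (measurable_cst _) (measurable_cst _).
- move=> F mF F0.
  rewrite -[LHS]/(\int[P]_w cst (F (0%R, 0%R)) w)%E integral_cst//= probability_setT mule1.
  transitivity (\int[@stdn R]_y cst (F (0%R, 0%R)) y)%E.
    by rewrite integral_cst//= probability_setT mule1.
  apply: eq_integral => y _.
  transitivity (\int[@stdn R]_x cst (F (0%R, 0%R)) x)%E.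
    by rewrite integral_cst//= probability_setT mule1.
  by apply: eq_integral => x _; rewrite !mul0r addr0.
- move=> i im; split; first by rewrite subr_gt0 ht.
  exact: (wiener_increment_law hW) (ht i im).
- move=> C A mC mA.
  have := (wiener_increment_indep hW) n t (fun i im => ltW (ht i im)) A mA.
  move=> <-; have [C0|C0] := pselect (C (0, 0)).
    rewrite (_ : (fun=> _) @^-1` C = setT) ?setTI ?probability_setT ?mul1e//.
    by apply/seteqP; split.
  rewrite (_ : (fun=> _) @^-1` C = set0) ?set0I ?measure0 ?mul0e//.
  by apply/seteqP; split.
exists abc; split => //.
  rewrite (integral_step_sqr w1 ht hc) h3 expr0n add0r.
  by congr EFin; apply: eq_bigr.
move=> F mF F0; rewrite -(g F mF F0); apply: eq_integral => w _.
by rewrite !step_wiener_integralE hc he !add0r.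
Qed.


(** Positive and negative parts extend the defining identity to signed functions. *)
Lemma gauss_pair_integral (S1 S2 : Omega -> R) (a b c : R) (F : R * R -> \bar R) :
  gauss_pair P S1 S2 a b c -> measurable_fun setT F ->
  (\int[P]_w F (S1 w, S2 w) = \int[stdn \x stdn]_z F (a * z.1, b * z.1 + c * z.2)%R)%E.
Proof.
move=> g mF.
have mT : measurable_fun setT (fun z : R * R => (a * z.1, b * z.1 + c * z.2)).
  apply/measurable_fun_pairP; split => /=.
    by apply: measurable_funM => //; exact: measurable_fst.
  apply: measurable_funD; apply: measurable_funM => //.
have K (G : R * R -> \bar R) : measurable_fun setT G -> (forall z, 0 <= G z)%E ->
  (\int[P]_w G (S1 w, S2 w) = \int[stdn \x stdn]_z G (a * z.1, b * z.1 + c * z.2)%R)%E.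
  move=> mG G0; rewrite (g G mG G0).
  rewrite (fubini_tonelli2 (fun z : R * R => G (a * z.1, b * z.1 + c * z.2)%R))//.
  exact: (measurableT_comp mG mT).
rewrite integralE [RHS]integralE; congr (_ - _)%E.
- apply: etrans (etrans _ (K (F^\+)%E (measurable_funepos mF) (fun=> funepos_ge0 _ _))) _;
    by apply: eq_integral => x _; rewrite !funeposE.
- apply: etrans (etrans _ (K (F^\-)%E (measurable_funeneg mF) (fun=> funeneg_ge0 _ _))) _;
    by apply: eq_integral => x _; rewrite !funenegE.
Qed.

(* Joint centered normality: (x, y) |-> (sqrt p x, (q / sqrt p) x + sqrt (r - q^2 / p) y)
   with p = E X^2, q = E X Y, r = E Y^2 maps the standard Gaussian law to the law of
   (X, Y).  Only p > 0 is covered, where these coefficients are continuous. *)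
Definition normal_coeff (p q r : R) (z : R * R) : R * R :=
  (Num.sqrt p * z.1, q / Num.sqrt p * z.1 + Num.sqrt (r - q ^+ 2 / p) * z.2).

(** Testing on bounded continuous functions rather than on sets makes the property stable under L^2
    limits. *)
Definition jgauss (X Y : Omega -> R) : Prop :=
  [/\ sqint P X, sqint P Y & 0 < ip P X X ->
    forall F : R * R -> R, measurable_fun setT F -> continuous F -> (exists M, forall z, `|F z| <= M) ->
    (\int[P]_w (F (X w, Y w))%:E =
     \int[stdn \x stdn]_z (F (normal_coeff (ip P X X) (ip P X Y) (ip P Y Y) z))%:E)%E].

Lemma stdn_sqr (a : R) : (\int[@stdn R]_x ((a * x) ^+ 2)%:E = (a ^+ 2)%:E)%E.
Proof.
have msq : measurable_fun [set: R] (fun x : R => x ^+ 2) by exact: measurable_funX.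
under eq_integral do rewrite exprMn EFinM.
rewrite ge0_integralZl//=.
- by rewrite stdn_second_moment mule1.
- exact/measurable_EFinP.
- by move=> x _; rewrite lee_fin sqr_ge0.
- by rewrite lee_fin sqr_ge0.
Qed.

Lemma gauss_pair_sqr1 (S1 S2 : Omega -> R) (a b c : R) :
  gauss_pair P S1 S2 a b c -> (\int[P]_w (S1 w ^+ 2)%:E = (a ^+ 2)%:E)%E.
Proof.
move=> g.
have msq : measurable_fun [set: R] (fun x : R => x ^+ 2) by exact: measurable_funX.
have m1sq : measurable_fun setT (fun z : R * R => ((z.1) ^+ 2)%:E).
  by apply/measurable_EFinP; apply: (measurableT_comp msq); exact: measurable_fst.
rewrite (g (fun z => (z.1 ^+ 2)%:E) m1sq); last by move=> z; rewrite lee_fin sqr_ge0.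
transitivity (\int[@stdn R]_y cst ((a ^+ 2)%:E) y)%E; last first.
  by rewrite integral_cst//= probability_setT mule1.
by apply: eq_integral => y _ /=; exact: stdn_sqr.
Qed.

(** Used with [k = 0] for the variance of [S2] and with [k = 1] for the covariance, by
    polarisation. *)
Lemma gauss_pair_sqr2 (S1 S2 : Omega -> R) (a b c k : R) : 0 <= c ->
  gauss_pair P S1 S2 a b c ->
  (\int[P]_w ((k * S1 w + S2 w) ^+ 2)%:E = (c ^+ 2 + (k * a + b) ^+ 2)%:E)%E.
Proof.
move=> c0 g.
have msq : measurable_fun [set: R] (fun x : R => x ^+ 2) by exact: measurable_funX.
have mEsq : measurable_fun [set: R] (fun x : R => (x ^+ 2)%:E) by exact/measurable_EFinP.
have msum (k1 k2 : R) : measurable_fun setT (fun z : R * R => ((k1 * z.1 + k2 * z.2) ^+ 2)%:E).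
  apply/measurable_EFinP; apply: (measurableT_comp msq).
  by apply: measurable_funD; apply: measurable_funM.
have m1 : measurable_fun setT (fun z : R * R => ((k * z.1 + z.2) ^+ 2)%:E).
  by have := msum k 1; congr (measurable_fun _ _); apply/funext => z; rewrite mul1r.
rewrite (g _ m1); last by move=> z; rewrite lee_fin sqr_ge0.
transitivity (\int[@stdn R]_y \int[@stdn R]_x (((k * a + b) * x + c * y) ^+ 2)%:E)%E.
  by apply: eq_integral => y _; apply: eq_integral => x _ /=; congr (_ ^+ 2)%:E; ring.
rewrite (@stdn_swap _ (fun z => (((k * a + b) * z.1 + c * z.2) ^+ 2)%:E) (msum _ _));
  last by move=> z; rewrite lee_fin sqr_ge0.
transitivity (\int[@stdn R]_x \int[@stdn R]_y ((c * y + (k * a + b) * x) ^+ 2)%:E)%E.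
  by apply: eq_integral => y _; apply: eq_integral => x _ /=; rewrite addrC.
rewrite (@stdn_combine _ (fun t => (t ^+ 2)%:E) c _ c0 mEsq); last by move=> z; rewrite lee_fin sqr_ge0.
by rewrite stdn_sqr sqr_sqrtr// addr_ge0 ?sqr_ge0.
Qed.

Lemma step_wiener_sqint (phi : step_data R) : well_ordered_step phi ->
  sqint P (step_wiener_integral W phi).
Proof.
move=> wo; have [abc [_ _ _ g]] := step_wiener_gauss_pair wo wo.
have m := step_wiener_measurable phi.
apply: sqint_lty => //.
by rewrite (gauss_pair_sqr1 g) ltry.
Qed.

Lemma step_fun_sqint (phi : step_data R) : well_ordered_step phi ->
  sqint (@lebesgue_measure R) (step_fun phi).
Proof.
move=> wo; have [abc [_ _ e g]] := step_wiener_gauss_pair wo wo.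
by apply: sqint_lty; [exact: step_fun_measurable|rewrite e ltry].
Qed.

Lemma wiener_isometry (phi : step_data R) : well_ordered_step phi ->
  ip P (step_wiener_integral W phi) (step_wiener_integral W phi) =
  ip (@lebesgue_measure R) (step_fun phi) (step_fun phi).
Proof.
move=> wo; have [abc [_ _ e g]] := step_wiener_gauss_pair wo wo.
have m := step_wiener_measurable phi.
apply: EFin_inj; rewrite -sqint_EFin; last exact: step_wiener_sqint.
rewrite -sqint_EFin; last exact: step_fun_sqint.
by rewrite (gauss_pair_sqr1 g) e.
Qed.

Lemma step_cat_well_ordered (phi psi : step_data R) :
  well_ordered_step (phi ++ psi) = well_ordered_step phi && well_ordered_step psi.
Proof. exact: all_cat. Qed.

Lemma step_wiener_cat (phi psi : step_data R) :
  step_wiener_integral W (phi ++ psi) =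
  (fun w => step_wiener_integral W phi w + step_wiener_integral W psi w).
Proof. by apply/funext => w; rewrite /step_wiener_integral big_cat. Qed.

Lemma step_fun_cat (phi psi : step_data R) :
  step_fun (phi ++ psi) = (fun x => step_fun phi x + step_fun psi x).
Proof. by apply/funext => w; rewrite /step_fun big_cat. Qed.

Definition step_scale (k : R) (phi : step_data R) : step_data R :=
  [seq (k * p.1.1, p.1.2, p.2) | p <- phi].

Lemma step_scale_well_ordered k (phi : step_data R) :
  well_ordered_step (step_scale k phi) = well_ordered_step phi.
Proof. by rewrite /well_ordered_step all_map. Qed.

Lemma step_wiener_scale k (phi : step_data R) :
  step_wiener_integral W (step_scale k phi) = (fun w => k * step_wiener_integral W phi w).
Proof.
apply/funext => w; rewrite /step_wiener_integral big_map mulr_sumr.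
by apply: eq_bigr => p _; rewrite mulrA.
Qed.

Lemma step_fun_scale k (phi : step_data R) :
  step_fun (step_scale k phi) = (fun x => k * step_fun phi x).
Proof.
apply/funext => w; rewrite /step_fun big_map mulr_sumr.
by apply: eq_bigr => p _; rewrite mulrA.
Qed.

(** A triangular matrix with nonnegative diagonal and positive first entry is determined by the
    covariances: a^2 = p, a b = q and b^2 + c^2 = r. *)
Lemma step_wiener_jgauss (phi psi : step_data R) :
  well_ordered_step phi -> well_ordered_step psi ->
  jgauss (step_wiener_integral W phi) (step_wiener_integral W psi).
Proof.
move=> w1 w2.
have s1 := step_wiener_sqint w1; have s2 := step_wiener_sqint w2.
split => // p0 F mF cF _.
have [[[a b] c] [a0 c0 e g]] := step_wiener_gauss_pair w1 w2.
rewrite [(a, b, c).1.1]/= [(a, b, c).1.2]/= [(a, b, c).2]/= in a0 c0 e g.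
set X := step_wiener_integral W phi in s1 p0 g *; set Y := step_wiener_integral W psi in s2 g *.
have pE : ip P X X = a ^+ 2.
  by apply: EFin_inj; rewrite -sqint_EFin// (gauss_pair_sqr1 g).
have rE : ip P Y Y = b ^+ 2 + c ^+ 2.
  apply: EFin_inj; rewrite -sqint_EFin// addrC.
  have := gauss_pair_sqr2 0 c0 g; rewrite mul0r add0r => <-.
  by apply: eq_integral => w _; rewrite mul0r add0r.
have qE : ip P X Y = a * b.
  have s3 := sqintD s1 s2.
  have : ip P (fun w => X w + Y w) (fun w => X w + Y w) = c ^+ 2 + (a + b) ^+ 2.
    apply: EFin_inj; rewrite -sqint_EFin//.
    have := gauss_pair_sqr2 1 c0 g; rewrite mul1r => <-.
    by apply: eq_integral => w _; rewrite mul1r.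
  rewrite ipDl// ipDr// ipDr// pE rE (ipC P Y X); lra.
have ap : 0 < a.
  by rewrite lt0r a0 andbT; move: p0; rewrite pE => /lt0r_neq0; rewrite sqrf_eq0.
rewrite pE qE rE (@gauss_pair_integral X Y a b c (fun z => (F z)%:E) g); last exact/measurable_EFinP.
apply: eq_integral => z _; congr (F _)%:E; rewrite /normal_coeff sqrtr_sqr gtr0_norm//.
rewrite (_ : b ^+ 2 + c ^+ 2 - (a * b) ^+ 2 / a ^+ 2 = c ^+ 2); last first.
  by field; exact: lt0r_neq0.
by rewrite sqrtr_sqr (ger0_norm c0) -[a * b]mulrC mulfK// lt0r_neq0.
Qed.

Lemma normal_coeff_integral_cvg (p_ q_ r_ : nat -> R) (p q r : R) (F : R * R -> R) (M : R) :
  p_ n @[n --> \oo] --> p -> q_ n @[n --> \oo] --> q -> r_ n @[n --> \oo] --> r -> 0 < p ->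
  measurable_fun [set: R * R] F -> continuous F -> (forall z, `|F z| <= M) ->
  (\int[@stdn R \x @stdn R]_z (F (normal_coeff (p_ n) (q_ n) (r_ n) z))%:E @[n --> \oo] -->
   \int[@stdn R \x @stdn R]_z (F (normal_coeff p q r z))%:E)%E.
Proof.
move=> cp cq cr p0 mF cF FM.
have sqrt_cvg (u : nat -> R) (l : R) : u n @[n --> \oo] --> l ->
    Num.sqrt (u n) @[n --> \oo] --> Num.sqrt l.
  by move=> ul; apply: continuous_cvg => //; exact: sqrt_continuous.
have mco p' q' r' : measurable_fun setT (fun z => F (normal_coeff p' q' r' z)).
  apply: (measurableT_comp mF); apply: measurable_pairR; first exact: measurable_funM.
  by apply: measurable_funD; exact: measurable_funM.
apply: (@bounded_cvg_prob _ _ _ [the probability _ _ of (@stdn R \x @stdn R)%E] _ _ M) => //.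
apply: aeW => z.
apply: (cvg_comp (fun n => normal_coeff (p_ n) (q_ n) (r_ n) z) F _ (cF _)).
have c1 : Num.sqrt (p_ n) * z.1 @[n --> \oo] --> Num.sqrt p * z.1.
  by apply: cvgM; [exact: sqrt_cvg|exact: cvg_cst].
have c2 : q_ n / Num.sqrt (p_ n) * z.1 + Num.sqrt (r_ n - q_ n ^+ 2 / p_ n) * z.2
    @[n --> \oo] --> q / Num.sqrt p * z.1 + Num.sqrt (r - q ^+ 2 / p) * z.2.
  apply: cvgD; apply: cvgM; try exact: cvg_cst.
    apply: cvgM => //; apply: cvgV; last exact: sqrt_cvg.
    by rewrite sqrtr_eq0 -ltNge.
  apply: sqrt_cvg; apply: cvgB => //; apply: cvgM.
    by rewrite expr2; under eq_fun do rewrite expr2; exact: cvgM.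
  by apply: cvgV => //; rewrite gt_eqF.
exact: (cvg_pair c1 c2).
Qed.

(** A subsequence with squared distances at most 2^-n converges almost surely, so the integrals of
    [F] converge; on the Gaussian side the covariances converge and [normal_coeff] is continuous in
    them. *)
Lemma jgauss_closed (X_ Y_ : nat -> Omega -> R) (X Y : Omega -> R) :
  (forall n, jgauss (X_ n) (Y_ n)) -> sqint P X -> sqint P Y ->
  ip P (fun w => X_ n w - X w) (fun w => X_ n w - X w) @[n --> \oo] --> 0 ->
  ip P (fun w => Y_ n w - Y w) (fun w => Y_ n w - Y w) @[n --> \oo] --> 0 ->
  jgauss X Y.
Proof.
move=> jg sX sY cX cY; split => // p0 F mF cF [M FM].
have sX_ n : sqint P (X_ n) by have [] := jg n.
have sY_ n : sqint P (Y_ n) by have [] := jg n.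
have cp := ip_cvg sX_ sX_ sX sX cX cX.
have cq := ip_cvg sX_ sY_ sX sY cX cY.
have cr := ip_cvg sY_ sY_ sY sY cY cY.
pose dX n := ip P (fun w => X_ n w - X w) (fun w => X_ n w - X w).
pose dY n := ip P (fun w => Y_ n w - Y w) (fun w => Y_ n w - Y w).
have cd : dX n + dY n @[n --> \oo] --> 0.
  by rewrite -[X in _ --> X](addr0 0); exact: cvgD.
(* Positive variance is part of the choice because [jgauss] describes the law only in that case. *)
have /choice[k hk] n : exists k, [/\ (n <= k)%N, dX k + dY k <= 2^-1 ^+ n & 0 < ip P (X_ k) (X_ k)].
  have h1 : \forall k \near \oo, dX k + dY k <= 2^-1 ^+ n.
    have e0 : 0 < (2^-1 : R) ^+ n by rewrite exprn_gt0// invr_gt0.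
    move/cvgrPdist_le : cd => /(_ _ e0); apply: filterS => j.
    by rewrite sub0r normrN; exact: (le_trans (ler_norm _)).
  have h2 : \forall k \near \oo, 0 < ip P (X_ k) (X_ k) by exact: (cvgr_gt _ cp).
  near \oo => j; exists j; split; first by near: j; exact: nbhs_infty_ge.
    by near: j.
  by near: j.
have kinf : k n @[n --> \oo] --> \oo.
  by apply/cvgnyPge => A; near=> n; apply: (@leq_trans n); [near: n; exact: nbhs_infty_ge|have [] := hk n].
have sDX n : sqint P (fun w => X_ (k n) w - X w) by exact: sqintB.
have sDY n : sqint P (fun w => Y_ (k n) w - Y w) by exact: sqintB.
pose D n w := (X_ (k n) w - X w) ^+ 2 + (Y_ (k n) w - Y w) ^+ 2.
have mX2 n : measurable_fun setT (fun w => (X_ (k n) w - X w) ^+ 2).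
  by apply: measurable_funX; exact: (sqint_measurable (sDX n)).
have mY2 n : measurable_fun setT (fun w => (Y_ (k n) w - Y w) ^+ 2).
  by apply: measurable_funX; exact: (sqint_measurable (sDY n)).
have D0 n w : 0 <= D n w by rewrite addr_ge0 ?sqr_ge0.
have ae : {ae P, forall w, D n w @[n --> \oo] --> 0}.
  apply: ae_cvg_geometric => // n; first exact: measurable_funD.
  rewrite /D; under eq_integral do rewrite EFinD.
  rewrite ge0_integralD//=; [|by move=> w _; rewrite lee_fin sqr_ge0|exact/measurable_EFinP
    |by move=> w _; rewrite lee_fin sqr_ge0|exact/measurable_EFinP].
  rewrite (sqint_EFin (sDX n)) (sqint_EFin (sDY n)) -EFinD lee_fin.
  by have [] := hk n.
have sqr_cvg (u : nat -> R) (l : R) (v : nat -> R) : (forall n, (u n - l) ^+ 2 <= v n) ->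
    v n @[n --> \oo] --> 0 -> u n @[n --> \oo] --> l.
  move=> uv v0; apply/subr_cvg0/norm_cvg0P.
  have : Num.sqrt (v n) @[n --> \oo] --> Num.sqrt 0.
    by apply: continuous_cvg => //; exact: sqrt_continuous.
  rewrite sqrtr0; apply: squeeze_cvgr; last exact: cvg_cst.
  near=> n; rewrite normr_ge0/= -sqrtr_sqr.
  by rewrite ler_wsqrtr.
have mEF : measurable_fun setT (fun z => (F z)%:E) by exact/measurable_EFinP.
have mXY (U V : Omega -> R) : sqint P U -> sqint P V -> measurable_fun setT (fun w => (F (U w, V w))%:E).
  by move=> [mU _] [mV _]; apply: (measurableT_comp mEF); exact: measurable_pairR.
have ucvg w : D n w @[n --> \oo] --> 0 ->
    X_ (k n) w @[n --> \oo] --> X w /\ Y_ (k n) w @[n --> \oo] --> Y w.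
  move=> Dw; split; apply: sqr_cvg Dw => n; rewrite /D.
    by rewrite lerDl sqr_ge0.
  by rewrite lerDr sqr_ge0.
have mFU (U V : Omega -> R) : sqint P U -> sqint P V -> measurable_fun setT (fun w => F (U w, V w)).
  by move=> [mU _] [mV _]; apply: (measurableT_comp mF); exact: measurable_pairR.
have L1 : (\int[P]_w (F (X_ (k n) w, Y_ (k n) w))%:E @[n --> \oo] --> \int[P]_w (F (X w, Y w))%:E)%E.
  apply: (bounded_cvg_prob (M := M)) => //; [by move=> n; exact: mFU|exact: mFU|].
  apply: filterS ae => w /ucvg[cXw cYw].
  have cpair : (X_ (k n) w, Y_ (k n) w) @[n --> \oo] --> (X w, Y w) by exact: (cvg_pair cXw cYw).
  exact: (cvg_comp (fun n => (X_ (k n) w, Y_ (k n) w)) F cpair (cF _)).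
have ck (u : nat -> R) (l : R) : u n @[n --> \oo] --> l -> u (k n) @[n --> \oo] --> l.
  by move=> ul; exact: (cvg_comp _ _ kinf ul).
have L2 := normal_coeff_integral_cvg (ck _ _ cp) (ck _ _ cq) (ck _ _ cr) p0 mF cF FM.
apply: (@cvg_unique _ (@ereal_hausdorff R) _ _ _ _ L1).
move: L2; apply: cvg_eq1 => n.
have [_ _ jgn] := jg (k n); rewrite jgn//; last by exists M.
by have [] := hk n.
Unshelve. all: by end_near. Qed.

(** The L^2 closure of the step integrals, that is the Gaussian space (first chaos) of [W]; any two
    of its members are jointly Gaussian. *)
Definition wiener_space (X : Omega -> R) : Prop := sqint P X /\
  forall e : R, 0 < e -> exists2 phi : step_data R, well_ordered_step phi &
    ip P (fun w => X w - step_wiener_integral W phi w)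
         (fun w => X w - step_wiener_integral W phi w) < e.

Lemma wiener_space_sqint X : wiener_space X -> sqint P X.
Proof. by case. Qed.

Lemma wiener_spaceD X Y : wiener_space X -> wiener_space Y ->
  wiener_space (fun w => X w + Y w).
Proof.
move=> [sX hX] [sY hY]; split; first exact: sqintD.
move=> e e0; have e4 : 0 < e / 4 by rewrite divr_gt0.
have [phi w1 d1] := hX _ e4; have [psi w2 d2] := hY _ e4.
exists (phi ++ psi); first by rewrite step_cat_well_ordered w1.
rewrite step_wiener_cat.
have s1 := step_wiener_sqint w1; have s2 := step_wiener_sqint w2.
have := @ip_dist_triangle _ _ _ P (fun w => X w + Y w)
  (fun w => step_wiener_integral W phi w + Y w)
  (fun w => step_wiener_integral W phi w + step_wiener_integral W psi w)
  (sqintD sX sY) (sqintD s1 sY) (sqintD s1 s2).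
move/le_lt_trans; apply.
set A := ip P _ _; set C := ip P _ _.
have -> : A = ip P (fun w => X w - step_wiener_integral W phi w) (fun w => X w - step_wiener_integral W phi w).
  by rewrite /A; congr ip; apply/funext => w; ring.
have -> : C = ip P (fun w => Y w - step_wiener_integral W psi w) (fun w => Y w - step_wiener_integral W psi w).
  by rewrite /C; congr ip; apply/funext => w; ring.
lra.
Qed.

Lemma wiener_spaceZ k X : wiener_space X -> wiener_space (fun w => k * X w).
Proof.
move=> [sX hX]; split; first exact: sqintZ.
(* Dividing by k^2 + 1 instead of k^2 covers [k = 0]. *)
move=> e e0; have k1 : 0 < k ^+ 2 + 1 by rewrite ltr_wpDl ?sqr_ge0.
have [phi w1 d1] := hX _ (divr_gt0 e0 k1).
exists (step_scale k phi); first by rewrite step_scale_well_ordered.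
have s1 := sqintB sX (step_wiener_sqint w1).
rewrite step_wiener_scale.
have -> : (fun w => k * X w - k * step_wiener_integral W phi w) =
  (fun w => k * (X w - step_wiener_integral W phi w)) by apply/funext => w; ring.
rewrite ipZl ?ipZr//; last exact: sqintZ.
have d0 := ip_ge0 P (fun w => X w - step_wiener_integral W phi w).
move: d1; rewrite ltr_pdivlMr//; set dd := ip _ _ _ in d0 *.
by nra.
Qed.

Lemma wiener_space0 : wiener_space (fun=> 0).
Proof.
split.
  by have := @step_wiener_sqint [::] isT; congr sqint; apply/funext => w; rewrite /step_wiener_integral big_nil.
move=> e e0; exists [::] => //.
rewrite /ip (eq_Rintegral _ (g := fun=> 0)); first by rewrite Rintegral_cst// mul0r.
by move=> w _; rewrite /step_wiener_integral big_nil subrr mul0r.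
Qed.

Lemma wiener_space_closed X : sqint P X ->
  (forall e : R, 0 < e -> exists2 Y, wiener_space Y & ip P (fun w => X w - Y w) (fun w => X w - Y w) < e) ->
  wiener_space X.
Proof.
move=> sX hX; split => // e e0.
have e4 : 0 < e / 4 by rewrite divr_gt0.
have [Y [sY hY] d1] := hX _ e4; have [phi w1 d2] := hY _ e4.
exists phi => //.
have := ip_dist_triangle sX sY (step_wiener_sqint w1).
by move/le_lt_trans; apply; lra.
Qed.

Lemma wiener_space_jgauss X Y : wiener_space X -> wiener_space Y -> jgauss X Y.
Proof.
move=> [sX hX] [sY hY].
have n0 n : (0 : R) < n.+1%:R^-1 by rewrite invr_gt0.
have /choice[phi hphi] n : exists phi, well_ordered_step phi /\
    ip P (fun w => X w - step_wiener_integral W phi w) (fun w => X w - step_wiener_integral W phi w) < n.+1%:R^-1.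
  by have [phi] := hX _ (n0 n); exists phi.
have /choice[psi hpsi] n : exists phi, well_ordered_step phi /\
    ip P (fun w => Y w - step_wiener_integral W phi w) (fun w => Y w - step_wiener_integral W phi w) < n.+1%:R^-1.
  by have [p] := hY _ (n0 n); exists p.
have cv (U : Omega -> R) (p : nat -> step_data R) : (forall n,
    ip P (fun w => U w - step_wiener_integral W (p n) w) (fun w => U w - step_wiener_integral W (p n) w) < n.+1%:R^-1) ->
    ip P (fun w => step_wiener_integral W (p n) w - U w) (fun w => step_wiener_integral W (p n) w - U w) @[n --> \oo] --> 0.
  move=> h; apply: squeeze_cvgr; [|exact: cvg_cst|exact: (@cvg_harmonic R)].
  near=> n; rewrite ip_ge0/=; apply: le_trans (ltW (h n)).
  by rewrite le_eqVlt; apply/orP; left; apply/eqP; apply: eq_Rintegral => w _; ring.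
apply: (@jgauss_closed (fun n => step_wiener_integral W (phi n)) (fun n => step_wiener_integral W (psi n))) => //.
- by move=> n; apply: step_wiener_jgauss; [have [] := hphi n|have [] := hpsi n].
- by apply: cv => n; have [] := hphi n.
- by apply: cv => n; have [] := hpsi n.
Unshelve. all: by end_near. Qed.

Lemma is_wiener_integralB h1 h2 X1 X2 : measurable_fun [set: R] h1 -> measurable_fun [set: R] h2 ->
  measurable_fun setT X1 -> measurable_fun setT X2 ->
  is_wiener_integral W h1 X1 -> is_wiener_integral W h2 X2 ->
  is_wiener_integral W (fun x => h1 x - h2 x) (fun w => X1 w - X2 w).
Proof.
move=> mh1 mh2 mX1 mX2 [phi [wo1 c1 d1]] [psi [wo2 c2 d2]].
exists (fun n => phi n ++ step_scale (-1) (psi n)); split.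
- by move=> n; rewrite step_cat_well_ordered wo1 step_scale_well_ordered wo2.
- have := @sqint_cvg0B _ (measurableTypeR R) _ lebesgue_measure (fun n x => h1 x - step_fun (phi n) x)
    (fun n x => h2 x - step_fun (psi n) x) (fun n => measurable_funB mh1 (step_fun_measurable (phi n)))
    (fun n => measurable_funB mh2 (step_fun_measurable (psi n))) c1 c2.
  apply: cvg_eq1 => n; apply: eq_integral => x _ /=.
  by rewrite step_fun_cat step_fun_scale; congr (_ ^+ 2)%:E; ring.
- have := @sqint_cvg0B _ _ _ P (fun n w => X1 w - step_wiener_integral W (phi n) w)
    (fun n w => X2 w - step_wiener_integral W (psi n) w) (fun n => measurable_funB mX1 (step_wiener_measurable (phi n)))
    (fun n => measurable_funB mX2 (step_wiener_measurable (psi n))) d1 d2.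
  apply: cvg_eq1 => n; apply: eq_integral => x _ /=.
  by rewrite step_wiener_cat step_wiener_scale; congr (_ ^+ 2)%:E; ring.
Qed.

(** On step functions the two inner products agree, and both sides are limits along the same
    sequence [phi]. *)
Lemma wiener_integral_isometry h X : measurable_fun [set: R] h -> measurable_fun setT X ->
  is_wiener_integral W h X ->
  [/\ wiener_space X, sqint (@lebesgue_measure R) h & ip P X X = ip (@lebesgue_measure R) h h].
Proof.
move=> mh mX [phi [wo c1 d1]].
have [nh ch] := @sqint_cvg0 _ (measurableTypeR R) _ lebesgue_measure
    (fun n x => h x - step_fun (phi n) x) (fun n => measurable_funB mh (step_fun_measurable (phi n))) c1.
have [nX cX] := @sqint_cvg0 _ _ _ P (fun n w => X w - step_wiener_integral W (phi n) w)
    (fun n => measurable_funB mX (step_wiener_measurable (phi n))) d1.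
have sh : sqint (@lebesgue_measure R) h.
  near \oo => n; have h1 : sqint (@lebesgue_measure R) (fun x => h x - step_fun (phi n) x) by near: n.
  have := sqintD h1 (step_fun_sqint (wo n)).
  by congr sqint; apply/funext => x; rewrite subrK.
have sX : sqint P X.
  near \oo => n; have h1 : sqint P (fun x => X x - step_wiener_integral W (phi n) x) by near: n.
  have := sqintD h1 (step_wiener_sqint (wo n)).
  by congr sqint; apply/funext => x; rewrite subrK.
have cX' : ip P (fun w => step_wiener_integral W (phi n) w - X w)
    (fun w => step_wiener_integral W (phi n) w - X w) @[n --> \oo] --> 0.
  move: cX; apply: cvg_eq1 => n.
  by apply: eq_Rintegral => w _; ring.
have ch' : ip (@lebesgue_measure R) (fun w => step_fun (phi n) w - h w)
    (fun w => step_fun (phi n) w - h w) @[n --> \oo] --> 0.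
  move: ch; apply: cvg_eq1 => n.
  by apply: eq_Rintegral => w _; ring.
split => //.
  split => // e e0; near \oo => n; exists (phi n) => //.
  near: n; move/cvgrPdist_lt : cX => /(_ _ e0); apply: filterS => n.
  by rewrite sub0r normrN ger0_norm// ip_ge0.
have e1 := ip_cvg (fun n => step_wiener_sqint (wo n)) (fun n => step_wiener_sqint (wo n)) sX sX cX' cX'.
have e2 := ip_cvg (fun n => step_fun_sqint (wo n)) (fun n => step_fun_sqint (wo n)) sh sh ch' ch'.
apply: (cvg_unique _ e1) => //; move: e2; apply: cvg_eq1 => n.
by rewrite wiener_isometry.
Unshelve. all: by end_near. Qed.

End step_wiener.

(** * Averages of Gaussian processes *)

Section joint_measurability.
Context {R : realType} {d} {Omega : measurableType d}.

Lemma truncn_cell (x : R) (n k : nat) : 0 <= x ->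
  (Num.truncn (n%:R * x) == k) = (k%:R <= n%:R * x < k.+1%:R).
Proof. by move=> x0; rewrite truncn_eq// mulr_ge0. Qed.

(** The discretised time takes countably many values, and on each cell of time the map depends on
    the outcome through a single random variable. *)
Lemma measurable_discretized (X : R -> Omega -> R) (n : nat) :
  (forall t, measurable_fun setT (X t)) ->
  measurable_fun [set: R * Omega]
    (fun z => X ((Num.truncn (n.+1%:R * Num.max z.1 0))%:R / n.+1%:R) z.2).
Proof.
move=> mX _ A mA; rewrite setTI.
have mmax : measurable_fun [set: R] (fun t : R => n.+1%:R * Num.max t 0).
  by apply: measurable_funM => //; apply: measurable_maxr.
have -> : (fun z : R * Omega => X ((Num.truncn (n.+1%:R * Num.max z.1 0))%:R / n.+1%:R) z.2) @^-1` A =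
    \bigcup_k (((fun t : R => n.+1%:R * Num.max t 0) @^-1` `[k%:R, k.+1%:R[) `*` (X (k%:R / n.+1%:R) @^-1` A)).
  apply/seteqP; split => [[t w] /= h|[t w] [k _] [/= h1 h2]].
    exists (Num.truncn (n.+1%:R * Num.max t 0)) => //; split => //=.
    by rewrite in_itv/= -truncn_cell// le_max lexx orbT.
  move: h1; rewrite in_itv/= -truncn_cell; last by rewrite le_max lexx orbT.
  by move=> /eqP ->.
apply: bigcupT_measurable => k; apply: measurableX.
  by rewrite -[X in measurable X]setTI; apply: mmax => //; exact: measurable_itv.
by rewrite -[X in measurable X]setTI; exact: mX.
Qed.

Lemma cvg_discretized (t : R) : 0 <= t ->
  (Num.truncn (n.+1%:R * t))%:R / n.+1%:R @[n --> \oo] --> t.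
Proof.
move=> t0; apply/subr_cvg0/norm_cvg0P.
apply: squeeze_cvgr; [|exact: cvg_cst|exact: (@cvg_harmonic R)].
near=> n; rewrite normr_ge0/=.
have := truncn_itv (mulr_ge0 (ler0n R n.+1) t0); set k := Num.truncn _ => /andP[k1 k2].
have n0 : (0 : R) < n.+1%:R by rewrite ltr0n.
rewrite distrC ger0_norm; last by rewrite subr_ge0 ler_pdivrMr// mulrC.
rewrite lerBlDl -[X in _ + X]mul1r -mulrDl natr1 ler_pdivlMr// mulrC.
exact: ltW.
Unshelve. all: by end_near. Qed.

(* Processes on [0, +oo[ are extended to negative times by their value at 0. *)
Lemma joint_measurable (X : R -> Omega -> R) :
  (forall t, measurable_fun setT (X t)) -> (forall w, continuous (X ^~ w)) ->
  (forall t w, X (Num.max t 0) w = X t w) ->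
  measurable_fun [set: R * Omega] (fun z => X z.1 z.2).
Proof.
move=> mX cX X0.
apply: (measurable_fun_cvg (fun n => @measurable_discretized X n mX)) => -[t w] _ /=.
rewrite -X0; apply: (cvg_comp (fun n => (Num.truncn (n.+1%:R * Num.max t 0))%:R / n.+1%:R) (X ^~ w)); last exact: cX.
by apply: cvg_discretized; rewrite le_max lexx orbT.
Qed.

(** Clamping time at 0 turns one-sided continuity at 0 into continuity on the whole line. *)
Lemma within_continuous_max (f : R -> R) : {within `[(0 : R), +oo[, continuous f} ->
  continuous (fun t : R => f (Num.max t 0)).
Proof.
move=> /subspace_continuousP cf t.
have t0 : (`[(0:R), +oo[%classic : set R) (Num.max t 0) by rewrite /= in_itv/= le_max lexx orbT.
apply: (cvg_comp (fun t : R => Num.max t 0) f); last exact: (cf _ t0).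
move=> A /= nA; rewrite /nbhs/=.
have cm : {for t, continuous (fun t : R => Num.max t 0)}.
  by apply: continuous_max; [exact: cvg_id|exact: cvg_cst].
have : \forall s \near t, (`[(0:R), +oo[%classic : set R) (Num.max s 0) -> A (Num.max s 0) := cm _ nA.
apply: filterS => s; apply.
by rewrite /= in_itv/= andbT le_max lexx orbT.
Qed.

End joint_measurability.

(** * Averages of a process over a random time *)

Section averaged_process.
Context {R : realType} {d} {Omega : measurableType d} (P : probability Omega R).
Context {dI} {I : measurableType dI}.
Variables (eps : probability I R) (X : I -> Omega -> R) (C : R).
Hypothesis mX : measurable_fun [set: I * Omega] (fun z => X z.1 z.2).
Hypothesis bX : forall w, exists M : R, forall t, `|X t w| <= M.
Hypothesis vX : forall t, (\int[P]_w (X t w ^+ 2)%:E <= C%:E)%E.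

Let mXt t : measurable_fun setT (X t).
Proof. exact: (measurableT_comp mX (pair1_measurable t)). Qed.

Let mXw w : measurable_fun setT (X ^~ w).
Proof. exact: (measurableT_comp mX (pair2_measurable w)). Qed.

Definition average (w : Omega) : R := \int[eps]_t X t w.

Lemma sqint_process t : sqint P (X t).
Proof. by apply: sqint_lty => //; apply: le_lt_trans (vX t) _; exact: ltry. Qed.

Let mEX2 : measurable_fun [set: I * Omega] (fun z => (X z.1 z.2 ^+ 2)%:E).
Proof. by apply/measurable_EFinP; exact: measurable_funX. Qed.

Lemma average_measurable : measurable_fun setT average.
Proof.
apply: measurableT_comp => //.
have mEX : measurable_fun [set: I * Omega] (fun z => (X z.1 z.2)%:E) by exact/measurable_EFinP.
have -> : (fun w => \int[eps]_t (X t w)%:E)%E =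
    (fun w => \int[eps]_t ((fun z : I * Omega => (X z.1 z.2)%:E)^\+ (t, w)) -
              \int[eps]_t ((fun z : I * Omega => (X z.1 z.2)%:E)^\- (t, w)))%E.
  apply/funext => w; rewrite [LHS]integralE.
  by congr (_ - _)%E; apply: eq_integral => t _; rewrite ?funeposE ?funenegE.
apply: emeasurable_funB.
- apply: (@measurable_fun_fubini_tonelli_G _ _ I Omega R eps
    (fun z : I * Omega => (X z.1 z.2)%:E)^\+%E) => //; exact: measurable_funepos.
- apply: (@measurable_fun_fubini_tonelli_G _ _ I Omega R eps
    (fun z : I * Omega => (X z.1 z.2)%:E)^\-%E) => //; exact: measurable_funeneg.
Qed.

Lemma path_sqint w : sqint eps (X ^~ w).
Proof.
have [M XM] := bX w; split => //; apply: (@bounded_integrable _ _ _ eps _ (M ^+ 2)).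
  exact: measurable_funX.
by move=> t; rewrite normrX lerXn2r ?nnegrE// (le_trans _ (XM t)).
Qed.

(** Cauchy-Schwarz against the constant 1, that is Jensen's inequality for the square. *)
Lemma average_sqr_le w : (average w ^+ 2 <= \int[eps]_t (X t w ^+ 2)).
Proof.
have s1 : sqint eps (cst (1 : R)).
  split => //; apply: (@bounded_integrable _ _ _ eps _ 1) => [|t]; first exact: measurable_funX.
  by rewrite /= expr1n ger0_norm.
have := ip_CauchySchwarz (path_sqint w) s1.
have -> : ip eps (X ^~ w) (cst 1) = average w.
  by apply: eq_Rintegral => t _; rewrite mulr1.
have -> : ip eps (cst 1) (cst 1) = 1.
  rewrite /ip /Rintegral; under eq_integral do rewrite mulr1.
  rewrite -[X in fine X]/(\int[eps]_x cst 1%E x)%E.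
  by rewrite integral_cst//= mul1e probability_setT.
rewrite mulr1; congr (_ <= _); apply: eq_Rintegral => t _; by rewrite expr2.
Qed.

Lemma integral_average_sqr :
  (\int[P]_w (average w ^+ 2)%:E <= \int[eps]_t \int[P]_w (X t w ^+ 2)%:E)%E.
Proof.
rewrite (@fubini_tonelli _ _ I Omega R eps P (fun z : I * Omega => (X z.1 z.2 ^+ 2)%:E)) //.
apply: ge0_le_integral => //.
- by move=> w _; rewrite lee_fin sqr_ge0.
- by apply/measurable_EFinP; apply: measurable_funX; exact: average_measurable.
- apply: (@measurable_fun_fubini_tonelli_G _ _ I Omega R eps
    (fun z : I * Omega => (X z.1 z.2 ^+ 2)%:E)) => // z; by rewrite lee_fin sqr_ge0.
- move=> w _; rewrite (sqint_EFin (path_sqint w)) lee_fin.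
  apply: le_trans (average_sqr_le w) _; rewrite le_eqVlt; apply/orP; left; apply/eqP.
  by apply: eq_Rintegral => t _; rewrite expr2.
- by move=> z; rewrite lee_fin sqr_ge0.
Qed.

Lemma integral_process_sqr_le : (\int[eps]_t \int[P]_w (X t w ^+ 2)%:E <= C%:E)%E.
Proof.
apply: (@le_trans _ _ (\int[eps]_t (cst C%:E t))%E).
  apply: ge0_le_integral => //.
  - by move=> t _; apply: integral_ge0 => w _; rewrite lee_fin sqr_ge0.
  - apply: (@measurable_fun_fubini_tonelli_F _ _ I Omega R P
      (fun z : I * Omega => (X z.1 z.2 ^+ 2)%:E)) => // z; by rewrite lee_fin sqr_ge0.
by rewrite integral_cst//= probability_setT mule1.
Qed.

Lemma average_sqint : sqint P average.
Proof.
apply: sqint_lty; first exact: average_measurable.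
apply: le_lt_trans integral_average_sqr _.
by apply: le_lt_trans integral_process_sqr_le _; exact: ltry.
Qed.

(** Fubini; integrability on the product space follows from |Q X| <= Q^2 + X^2 and the uniform bound
    on second moments. *)
Lemma ip_average (Q : Omega -> R) : sqint P Q ->
  ip P Q average = \int[eps]_t ip P Q (X t).
Proof.
move=> sQ; have [mQ iQ] := sQ.
pose f (z : I * Omega) := (Q z.2 * X z.1 z.2)%:E.
have mf : measurable_fun setT f.
  apply/measurable_EFinP; apply: measurable_funM => //.
  exact: (measurableT_comp mQ measurable_snd).
have fint : (eps \x P)%E.-integrable setT f.
  apply/(integrable12ltyP _ _ mf).
  apply: (@le_lt_trans _ _ (\int[eps]_t (cst ((ip P Q Q)%:E + C%:E) t))%E); last first.
    by rewrite integral_cst//= probability_setT mule1 -EFinD ltry.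
  apply: ge0_le_integral => //.
  - by move=> t _; apply: integral_ge0 => w _; exact: abse_ge0.
  - apply: (@measurable_fun_fubini_tonelli_F _ _ I Omega R P (abse \o f)) => [|z]; last exact: abse_ge0.
    exact: measurableT_comp.
  - move=> t _; rewrite /= -(sqint_EFin sQ).
    apply: (@le_trans _ _ (\int[P]_w ((Q w ^+ 2)%:E + (X t w ^+ 2)%:E))%E).
      apply: ge0_le_integral => //.
      - apply/measurable_EFinP; apply: measurableT_comp => //; exact: measurable_funM.
      - by apply: emeasurable_funD; apply/measurable_EFinP; exact: measurable_funX.
      - move=> w _; rewrite /f/= -EFinD lee_fin ler_norml; apply/andP; split; nra.
    rewrite ge0_integralD//=.
    + by rewrite leeD2l.
    + by move=> w _; rewrite lee_fin sqr_ge0.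
    + by apply/measurable_EFinP; exact: measurable_funX.
    + by move=> w _; rewrite lee_fin sqr_ge0.
    + by apply/measurable_EFinP; exact: measurable_funX.
have /(congr1 fine) := Fubini fint.
rewrite /ip /Rintegral /f/= => F1.
transitivity (fine (\int[P]_w \int[eps]_t (Q w * X t w)%:E)%E).
  congr fine; apply: eq_integral => w _.
  under eq_integral do rewrite EFinM.
  rewrite integralZl//; last first.
    have [M XM] := bX w; exact: (@bounded_integrable _ _ _ eps _ M).
  rewrite EFinM /average /Rintegral fineK//.
  apply: integrable_fin_num => //.
  have [M XM] := bX w; exact: (@bounded_integrable _ _ _ eps _ M).
rewrite -F1; congr fine; apply: eq_integral => t _.
rewrite fineK//; apply: integrable_fin_num => //.
exact: (sqint_integrableM sQ (sqint_process t)).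
Qed.

End averaged_process.

(** * Averages remain in the Gaussian space *)

Section wiener_average.
Context {R : realType} {d} {Omega : measurableType d} {P : probability Omega R}.
Variable W : R -> {RV P >-> R}.
Hypothesis hW : two_sided_wiener W.
Let wsp := wiener_space W.

Lemma wiener_space_sum (N : nat) (c : nat -> R) (Z : nat -> Omega -> R) :
  (forall k, wsp (Z k)) -> wsp (fun w => \sum_(k < N) c k * Z k w).
Proof.
move=> hZ; elim: N => [|N IH].
  have := wiener_space0 hW; congr wsp; apply/funext => w; by rewrite big_ord0.
have := wiener_spaceD hW IH (wiener_spaceZ hW (c N) (hZ N)).
by congr wsp; apply/funext => w; rewrite big_ord_recr.
Qed.

Section closed.
Context {dI} {I : measurableType dI} (eps : probability I R).

Lemma average_finite_sum (N : nat) (a : nat -> I -> R) (Z : nat -> Omega -> R) :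
  (forall k, measurable_fun setT (a k)) -> (forall k t, `|a k t| <= 1) ->
  average eps (fun t w => \sum_(k < N) a k t * Z k w) =
  (fun w => \sum_(k < N) (\int[eps]_t a k t) * Z k w).
Proof.
move=> ma a1; apply/funext => w; rewrite /average.
have ia k : eps.-integrable setT (EFin \o (fun t => a k t * Z k w)).
  apply: (@bounded_integrable _ _ _ eps _ `|Z k w|); first exact: measurable_funM.
  by move=> t; rewrite normrM ler_piMl.
have mS n : measurable_fun setT (fun t => \sum_(k < n) a k t * Z k w).
  by apply: measurable_sum => k; exact: measurable_funM.
have iS n : eps.-integrable setT (EFin \o (fun t => \sum_(k < n) a k t * Z k w)).
  apply: (@bounded_integrable _ _ _ eps _ (\sum_(k < n) `|Z k w|)) => // t.
  apply: le_trans (ler_norm_sum _ _ _) _; apply: ler_sum => k _.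
  by rewrite normrM ler_piMl.
elim: N => [|N IH].
  under eq_Rintegral do rewrite big_ord0.
  by rewrite big_ord0 Rintegral_cst//= mul0r.
rewrite big_ord_recr/= -IH -RintegralZr//=.
  rewrite -RintegralD//=.
  by apply: eq_Rintegral => t _; rewrite big_ord_recr.
  exact: iS.
exact: (@bounded_integrable _ _ _ eps _ 1).
Qed.

Variables (X : I -> Omega -> R) (X_ : nat -> I -> Omega -> R) (C : R).
Hypothesis mX : measurable_fun [set: I * Omega] (fun z => X z.1 z.2).
Hypothesis bX : forall w, exists M : R, forall t, `|X t w| <= M.
Hypothesis vX : forall t, (\int[P]_w (X t w ^+ 2)%:E <= C%:E)%E.
Hypothesis mX_ : forall n, measurable_fun [set: I * Omega] (fun z => X_ n z.1 z.2).
Hypothesis bX_ : forall n w, exists M : R, forall t, `|X_ n t w| <= M.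
Hypothesis vX_ : forall n t, (\int[P]_w (X_ n t w ^+ 2)%:E <= C%:E)%E.
Hypothesis cX : forall t, ip P (fun w => X t w - X_ n t w) (fun w => X t w - X_ n t w) @[n --> \oo] --> 0.
Hypothesis wX_ : forall n, wsp (average eps (X_ n)).

(** By Jensen's inequality the squared distance of two averages is at most the average over [t] of
    the squared distances, which tends to 0 by bounded convergence. *)
Lemma wiener_space_average : wsp (average eps X).
Proof.
have sX := average_sqint eps mX bX vX.
apply: wiener_space_closed => // e e0.
have C0 : 0 <= C.
  rewrite -lee_fin; apply: le_trans (vX point).
  by apply: integral_ge0 => w _; rewrite lee_fin sqr_ge0.
pose D n (t : I) := ip P (fun w => X t w - X_ n t w) (fun w => X t w - X_ n t w).
have mDX n : measurable_fun [set: I * Omega] (fun z => X z.1 z.2 - X_ n z.1 z.2).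
  exact: measurable_funB.
have bDX n w : exists M : R, forall t, `|X t w - X_ n t w| <= M.
  have [M XM] := bX w; have [M' XM'] := bX_ n w; exists (M + M') => t.
  by apply: le_trans (ler_normB _ _) _; exact: lerD.
have sXt t : sqint P (X t) by exact: (sqint_process mX vX).
have sX_t n t : sqint P (X_ n t) by exact: (sqint_process (mX_ n) (vX_ n)).
have ipC_ t : ip P (X t) (X t) <= C by rewrite -lee_fin -(sqint_EFin (sXt t)).
have ipC_' n t : ip P (X_ n t) (X_ n t) <= C by rewrite -lee_fin -(sqint_EFin (sX_t n t)).
have s0 : sqint P (fun=> 0) by exact: (wiener_space_sqint (wiener_space0 hW)).
(* The triangle inequality through 0 gives twice [C] plus twice [C]. *)
have DC n t : D n t <= 4 * C.
  have := ip_dist_triangle (sXt t) s0 (sX_t n t).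
  have -> : ip P (fun w => X t w - 0) (fun w => X t w - 0) = ip P (X t) (X t).
    by apply: eq_Rintegral => w _; rewrite subr0.
  have -> : ip P (fun w => 0 - X_ n t w) (fun w => 0 - X_ n t w) = ip P (X_ n t) (X_ n t).
    by apply: eq_Rintegral => w _; rewrite sub0r mulrNN.
  move=> h; apply: le_trans h _; have := ipC_ t; have := ipC_' n t; lra.
have vDX n t : (\int[P]_w ((X t w - X_ n t w) ^+ 2)%:E <= (4 * C)%:E)%E.
  by rewrite (sqint_EFin (sqintB (sXt t) (sX_t n t))) lee_fin DC.
have mD n : measurable_fun setT (D n).
  rewrite /D /ip /Rintegral; apply: measurableT_comp => //.
  apply: (@measurable_fun_fubini_tonelli_F _ _ I Omega R P
    (fun z : I * Omega => ((X z.1 z.2 - X_ n z.1 z.2) * (X z.1 z.2 - X_ n z.1 z.2))%:E)).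
    by apply/measurable_EFinP; exact: measurable_funM.
  by move=> z; rewrite lee_fin -expr2 sqr_ge0.
have cD : \int[eps]_t D n t @[n --> \oo] --> 0.
  have -> : 0 = \int[eps]_t (cst 0 t) :> R by rewrite Rintegral_cst//= mul0r.
  apply: (@bounded_Rintegral_cvg _ _ _ eps D (cst 0) (4 * C)) => //.
  - by apply: aeW => t; exact: cX.
  - by move=> n t; rewrite ger0_norm ?ip_ge0//; exact: DC.
  - by move=> t; rewrite normr0 mulr_ge0.
near \oo => n.
exists (average eps (X_ n)); first exact: wX_.
have sA := average_sqint eps (mDX n) (bDX n) (vDX n).
have E : average eps (fun t w => X t w - X_ n t w) = (fun w => average eps X w - average eps (X_ n) w).
  apply/funext => w; rewrite /average RintegralB//.
    have [M XM] := bX w; apply: (@bounded_integrable _ _ _ eps _ M) => //.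
    exact: (measurableT_comp mX (pair2_measurable w)).
  have [M XM] := bX_ n w; apply: (@bounded_integrable _ _ _ eps _ M) => //.
  exact: (measurableT_comp (mX_ n) (pair2_measurable w)).
rewrite -E; apply: le_lt_trans (_ : _ <= \int[eps]_t D n t) _; last first.
  near: n; move/cvgrPdist_lt : cD => /(_ _ e0); apply: filterS => k.
  by rewrite sub0r normrN; exact: le_lt_trans (ler_norm _).
have iD : eps.-integrable setT (EFin \o D n).
  apply: (@bounded_integrable _ _ _ eps _ (4 * C)) => // t.
  by rewrite ger0_norm ?ip_ge0//; exact: DC.
rewrite -lee_fin -(sqint_EFin sA) /Rintegral fineK; last exact: integrable_fin_num.
have H := @integral_average_sqr _ _ _ P _ _ eps (fun t w => X t w - X_ n t w) (mDX n) (bDX n).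
apply: (le_trans H).
rewrite le_eqVlt; apply/orP; left; apply/eqP; apply: eq_integral => t _.
by rewrite (sqint_EFin (sqintB (sXt t) (sX_t n t))).
Unshelve. all: by end_near. Qed.

End closed.
End wiener_average.

(** * Averages of a mean-square continuous process over a bounded interval *)

Section wiener_process_average.
Context {R : realType} {d} {Omega : measurableType d} {P : probability Omega R}.
Variable W : R -> {RV P >-> R}.
Hypothesis hW : two_sided_wiener W.
Variables (eps : probability R R) (Z : R -> Omega -> R) (T C : R).
Hypothesis T0 : 0 <= T.
Hypothesis Zmax : forall t w, Z (Num.max t 0) w = Z t w.
Hypothesis cZ : forall w, continuous (Z ^~ w).
Hypothesis wZ : forall t, wiener_space W (Z t).
Hypothesis vZ : forall t, 0 <= t <= T -> ip P (Z t) (Z t) <= C.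
Hypothesis mcZ : forall (s : nat -> R) t, (forall n, 0 <= s n) -> s n @[n --> \oo] --> t ->
  ip P (fun w => Z t w - Z (s n) w) (fun w => Z t w - Z (s n) w) @[n --> \oo] --> 0.

(** Restricting to [0, T[ makes paths and variances bounded in [t], although the random time is
    unbounded. *)
Definition cut (t : R) (w : Omega) : R := \1_(`[0, T[) t * Z t w.
Let disc (n : nat) (t : R) : R := (Num.truncn (n.+1%:R * Num.max t 0))%:R / n.+1%:R.
Definition cut_disc (n : nat) (t : R) (w : Omega) : R := \1_(`[0, T[) t * Z (disc n t) w.

Let mI : measurable_fun [set: R * Omega] (fun z => \1_(`[0, T[) z.1 : R).
Proof. by apply: (measurableT_comp (measurable_indic _) measurable_fst). Qed.

Let mZ t : measurable_fun setT (Z t).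
Proof. exact: (sqint_measurable (wiener_space_sqint (wZ t))). Qed.

Lemma cut_measurable : measurable_fun [set: R * Omega] (fun z => cut z.1 z.2).
Proof. by apply: measurable_funM => //; exact: joint_measurable. Qed.

Lemma cut_disc_measurable n : measurable_fun [set: R * Omega] (fun z => cut_disc n z.1 z.2).
Proof. by apply: measurable_funM => //; exact: measurable_discretized. Qed.

Lemma disc_ge0 n t : 0 <= disc n t.
Proof. by rewrite divr_ge0. Qed.

Lemma disc_le n t : 0 <= t <= T -> disc n t <= T.
Proof.
move=> /andP[t0 tT]; apply: le_trans tT.
rewrite /disc ler_pdivrMr ?ltr0n// [leRHS]mulrC (max_idPl _)//.
by have /andP[] := truncn_itv (mulr_ge0 (ler0n R n.+1) t0).
Qed.

Lemma bounded_on_itv w : exists2 M : R, 0 <= M & forall t, 0 <= t <= T -> `|Z t w| <= M.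
Proof.
have [c _ cM] : exists2 c, c \in `[0, T] & forall t, t \in `[0, T] -> `|Z t w| <= `|Z c w|.
  apply: EVT_max => //; apply: continuous_subspaceT => t.
  apply: (cvg_comp (Z ^~ w) (fun x : R => `|x|)); first exact: cZ.
  exact: norm_continuous.
by exists `|Z c w| => // t tT; apply: cM; rewrite in_itv.
Qed.

Let ind01 t : (\1_(`[0, T[) t : R) = 1 /\ 0 <= t <= T \/ (\1_(`[0, T[) t : R) = 0.
Proof.
rewrite indicE; case: (boolP (t \in _)) => [|_]; last by right.
by rewrite inE/= in_itv/= => /andP[t0 tT]; left; rewrite t0 ltW.
Qed.

Lemma cut_bounded w : exists M : R, forall t, `|cut t w| <= M.
Proof.
have [M M0 ZM] := bounded_on_itv w; exists M => t; rewrite /cut.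
by case: (ind01 t) => [[-> h]|->]; rewrite ?mul1r ?mul0r ?normr0//; exact: ZM.
Qed.

Lemma cut_disc_bounded n w : exists M : R, forall t, `|cut_disc n t w| <= M.
Proof.
have [M M0 ZM] := bounded_on_itv w; exists M => t; rewrite /cut_disc.
case: (ind01 t) => [[-> h]|->]; rewrite ?mul1r ?mul0r ?normr0//; apply: ZM.
by rewrite disc_ge0 disc_le.
Qed.

Let C0 : 0 <= C.
Proof. by apply: le_trans (ip_ge0 P (Z 0)) (vZ _); rewrite lexx. Qed.

Let sqZ t : (\int[P]_w (Z t w ^+ 2)%:E = (ip P (Z t) (Z t))%:E)%E.
Proof. exact: (sqint_EFin (wiener_space_sqint (wZ t))). Qed.

Let int0 : (\int[P]_w ((0 : R) ^+ 2)%:E = 0)%E.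
Proof. by rewrite expr0n/= integral0. Qed.

Lemma cut_variance t : (\int[P]_w (cut t w ^+ 2)%:E <= C%:E)%E.
Proof.
rewrite /cut; case: (ind01 t) => [[-> h]|->].
  by under eq_integral do rewrite mul1r; rewrite sqZ lee_fin vZ.
by under eq_integral do rewrite mul0r; rewrite int0 lee_fin.
Qed.

Lemma cut_disc_variance n t : (\int[P]_w (cut_disc n t w ^+ 2)%:E <= C%:E)%E.
Proof.
rewrite /cut_disc; case: (ind01 t) => [[-> h]|->].
  by under eq_integral do rewrite mul1r; rewrite sqZ lee_fin vZ// disc_ge0 disc_le.
by under eq_integral do rewrite mul0r; rewrite int0 lee_fin.
Qed.

(** Only finitely many multiples of 1/(n+1) occur before [T], so the average of the discretised
    process is a finite combination of its values. *)
Lemma cut_disc_sum n : exists N : nat, exists a : nat -> R -> R,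
  [/\ forall k, measurable_fun setT (a k), forall k t, `|a k t| <= 1 &
   cut_disc n = fun t w => \sum_(k < N) a k t * Z (k%:R / n.+1%:R) w].
Proof.
exists (Num.truncn (n.+1%:R * T)).+1.
exists (fun k => \1_(`[0, T[ `&` `[k%:R / n.+1%:R, k.+1%:R / n.+1%:R[)).
have n0 : 0 < n.+1%:R :> R by rewrite ltr0n.
split.
- by move=> k; apply: measurable_indic; apply: measurableI.
- by move=> k t; rewrite indicE; case: (_ \in _); rewrite ?normr1 ?normr0.
apply/funext => t; apply/funext => w; rewrite /cut_disc.
have cellE k : 0 <= t -> (t \in (`[k%:R / n.+1%:R, k.+1%:R / n.+1%:R[%classic : set R)) =
    (Num.truncn (n.+1%:R * Num.max t 0) == k).
  move=> t0; rewrite (max_idPl t0) truncn_cell//.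
  by apply/idP/idP; rewrite inE/= in_itv/= ler_pdivrMr// ltr_pdivlMr// (mulrC t).
case: (ind01 t) => [[e /andP[t0 tT]]|e]; last first.
  rewrite e mul0r big1// => k _; rewrite indicI/= e mul0r mul0r//.
rewrite e mul1r /disc.
set j := Num.truncn _.
have jN : (j < (Num.truncn (n.+1%:R * T)).+1)%N.
  by rewrite ltnS; apply: le_truncn; rewrite (max_idPl t0) ler_pM2l.
rewrite (bigD1 (Ordinal jN))//= big1 ?addr0.
  by rewrite indicI/= e mul1r indicE cellE// eqxx mul1r.
move=> k kj; rewrite indicI/= e mul1r indicE cellE// -/j.
have /negbTE -> : j != k by apply: contra kj => /eqP jk; apply/eqP/val_inj.
by rewrite mul0r.
Qed.

Lemma wiener_space_average_cut : wiener_space W (average eps cut).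
Proof.
apply: (@wiener_space_average _ _ _ _ W hW _ _ eps cut cut_disc C).
- exact: cut_measurable.
- exact: cut_bounded.
- exact: cut_variance.
- exact: cut_disc_measurable.
- exact: cut_disc_bounded.
- exact: cut_disc_variance.
- move=> t; rewrite /cut /cut_disc; case: (ind01 t) => [[-> /andP[t0 tT]]|->].
    have := mcZ (disc_ge0^~ t) (_ : disc n t @[n --> \oo] --> t).
    have h : disc n t @[n --> \oo] --> t.
      by rewrite /disc (max_idPl t0); exact: cvg_discretized.
    move=> /(_ h); apply: cvg_eq1 => n; apply: eq_Rintegral => w _.
    by rewrite !mul1r.
  have h : (fun=> 0 : R) n @[n --> \oo] --> (0 : R) by exact: cvg_cst.
  move: h; apply: cvg_eq1 => n; rewrite /ip.
  under eq_Rintegral do rewrite !mul0r subr0 mul0r.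
  by rewrite Rintegral_cst//= mul0r.
- move=> n; have [N [a [ma a1 ->]]] := cut_disc_sum n.
  rewrite (average_finite_sum eps N (fun k => Z (k%:R / n.+1%:R)) ma a1).
  exact: (wiener_space_sum hW N (fun k => \int[eps]_t a k t) (fun k => wZ (k%:R / n.+1%:R))).
Qed.

Lemma ip_average_cut Q : sqint P Q ->
  ip P Q (average eps cut) = \int[eps]_t (\1_(`[0, T[) t * ip P Q (Z t)).
Proof.
move=> sQ; rewrite (ip_average eps cut_measurable cut_bounded cut_variance sQ).
apply: eq_Rintegral => t _; rewrite /cut -ipZr//.
exact: (wiener_space_sqint (wZ t)).
Qed.

End wiener_process_average.

(** * The variance of the tempered process *)

Section change_of_variables.
Context {R : realType}.
Notation mu := (@lebesgue_measure R).
Local Open Scope ereal_scope.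

Lemma lebesgue_measure_opp (A : set R) : measurable A ->
  pushforward mu (fun x : R => (- x)%R : measurableTypeR R) A = mu A.
Proof.
have mf : measurable_fun [set: R] (fun x : R => (- x)%R : measurableTypeR R).
  exact: measurableT_comp.
pose m' : {measure set (measurableTypeR R) -> \bar R} :=
  measure_function_pushforward__canonical__measure_function_Measure mu mf.
move=> mA; apply/esym; apply: (@lebesgue_measure_unique _ m') => //= _ [[a b]] _ <-.
rewrite /m' /= /pushforward.
rewrite (_ : _ @^-1` _ = `[(- b)%R, (- a)%R[%classic); last first.
  by apply/seteqP; split=> x /=; rewrite !in_itv/= ltrNr lerNl andbC.
rewrite !lebesgue_measure_itv/= !lte_fin ltrN2; case: ifP => // _.
by congr (_%:E); ring.
Qed.

Lemma ge0_integral_opp (f : R -> \bar R) :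
  measurable_fun [set: R] f -> (forall r, 0 <= f r) ->
  \int[mu]_x f (- x)%R = \int[mu]_x f x.
Proof.
move=> mf f0.
have mp : measurable_fun [set: R] (fun x : R => (- x)%R : measurableTypeR R).
  exact: measurableT_comp.
rewrite -[LHS](@ge0_integral_pushforward _ _ (measurableTypeR R) (measurableTypeR R) R _ mp mu setT f)//=.
by apply: eq_measure_integral => //= A mA AS; exact/lebesgue_measure_opp.
Qed.

Section density_measure.
Variable f : R -> R.
Hypothesis cf : continuous f.
Hypothesis f0 : forall x, (0 <= f x)%R.

Definition density_measure (A : set (measurableTypeR R)) := \int[mu]_(x in A) (f x)%:E.

Let mf : measurable_fun [set: R] (EFin \o f).
Proof. by apply/measurable_EFinP; exact: continuous_measurable_fun. Qed.

Let density0 : density_measure set0 = 0.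
Proof. by rewrite /density_measure integral_set0. Qed.

Let density_ge0 A : 0 <= density_measure A.
Proof. by apply: integral_ge0 => x _; rewrite lee_fin. Qed.

Let density_sigma_additive : semi_sigma_additive density_measure.
Proof.
move=> /= F mF tF mUF; rewrite /density_measure ge0_integral_bigcup//=.
- apply: is_cvg_ereal_nneg_natsum_cond => n _ _.
  by apply: integral_ge0 => x _; rewrite lee_fin.
- apply: measurable_funTS; exact: mf.
- by move=> x _; rewrite lee_fin.
Qed.

HB.instance Definition _ := isMeasure.Build _ _ _
  density_measure density0 density_ge0 density_sigma_additive.

Variable F : R -> R.
Hypothesis dF : forall x : R, is_derive x (1%R : R) F (f x).
Hypothesis incrF : {homo F : x y / (x < y)%R}.
Hypothesis surjF : forall y, exists x y', (F x <= y <= F y')%R.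

Let cF : continuous F.
Proof.
move=> x; apply: differentiable_continuous; apply/derivable1_diffP.
by have [] := dF x.
Qed.

(** The measure with density [f], pushed forward by [F], gives ]F x, F y] the mass F y - F x by the
    fundamental theorem of calculus; as [F] is an increasing bijection of the line, the image is
    Lebesgue measure. *)
Lemma ge0_change_of_variables (K : R -> \bar R) :
  measurable_fun [set: R] K -> (forall y, 0 <= K y) ->
  \int[mu]_y K y = \int[mu]_x (K (F x) * (f x)%:E).
Proof.
move=> mK K0.
have mF : measurable_fun [set: R] (F : R -> measurableTypeR R).
  exact: (continuous_measurable_fun cF).
have onto y : exists x, F x = y.
  have [x1 [x2 /andP[h1 h2]]] := surjF y.
  have x12 : (x1 <= x2)%R.
    by rewrite leNgt; apply/negP => /incrF h; have := lt_le_trans h (le_trans h1 h2); rewrite ltxx.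
  have [||c _ <-] := @IVT R F x1 x2 y x12; last by exists c.
    by apply: continuous_subspaceT => x; exact: cF.
  by rewrite ge_min le_max h1 h2 orbT.
have leF x y : (F x <= F y)%R = (x <= y)%R.
  apply/idP/idP; last by rewrite le_eqVlt => /orP[/eqP->//|/incrF/ltW].
  by apply: contraLR; rewrite -!ltNge => /incrF.
have ltF x y : (F x < F y)%R = (x < y)%R by rewrite !ltNge leF.
pose m' : {measure set (measurableTypeR R) -> \bar R} :=
  measure_function_pushforward__canonical__measure_function_Measure
    [the measure _ _ of density_measure] mF.
have m'E A : measurable A -> mu A = m' A.
  move=> mA; apply: (@lebesgue_measure_unique _ m') => //= _ [[a b]] _ <-.
  have [a' <-] := onto a; have [b' <-] := onto b.
  rewrite /m' /= /pushforward.
  rewrite (_ : _ @^-1` _ = `]a', b']%classic); last first.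
    by apply/seteqP; split=> x /=; rewrite !in_itv/= ltF leF.
  rewrite lebesgue_measure_itv/= lte_fin ltF; case: ifPn => [ab|]; last first.
    by rewrite -leNgt => ba; rewrite /density_measure set_itv_ge ?integral_set0// bnd_simp -leNgt.
  rewrite /density_measure integral_itv_obnd_cbnd; last exact: (measurable_funTS mf).
  rewrite (@continuous_FTC2 _ f F a' b' ab)//.
  - by apply: continuous_subspaceT => x; exact: cf.
  - split.
    + by move=> x _; have [] := dF x.
    + by apply: cvg_at_right_filter; exact: cF.
    + by apply: cvg_at_left_filter; exact: cF.
  - by move=> x _; rewrite derive1E; have [] := dF x.
have -> : \int[mu]_y K y = \int[m']_y K y.
  by apply: eq_measure_integral => A mA _; exact: m'E.
rewrite /m' (@ge0_integral_pushforward _ _ (measurableTypeR R) (measurableTypeR R) R _ mF _ setT K)//=.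
apply: (@ge0_integral_density _ (measurableTypeR R) R mu _ f) => //.
- exact: continuous_measurable_fun.
- exact: (measurableT_comp mK mF).
Qed.

End density_measure.
End change_of_variables.

(** * Gaussian, inverse Gaussian and Gamma integrals *)

Section gaussian_kernel.
Context {R : realType}.
Notation mu := (@lebesgue_measure R).

Lemma ge0_integral_gauss_scale (c : R) : 0 < c ->
  (\int[mu]_p (expR (- (c * p ^+ 2)))%:E = (Num.sqrt (pi / c))%:E)%E.
Proof.
move=> c0; have s0 : 0 < Num.sqrt c by rewrite sqrtr_gt0.
transitivity (\int[mu]_p ((gauss_fun (Num.sqrt c * p))%:E))%E.
  by apply: eq_integral => p _; rewrite /gauss_fun exprMn sqr_sqrtr// ltW.
rewrite (@ge0_integral_scale R (fun p => (gauss_fun p)%:E) _ s0).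
- rewrite integralT_gauss -EFinM; congr EFin.
  by rewrite sqrtrM ?pi_ge0// sqrtrV ?ltW// mulrC.
- by apply/measurable_EFinP; exact: measurable_gauss_fun.
- by move=> r; rewrite lee_fin gauss_fun_ge0.
Qed.

Let mexpl (k : R) : measurable_fun [set: R] (fun s : R => expR (k * s)).
Proof. by apply: measurableT_comp => //; exact: measurable_funM. Qed.

(** With t = e^s this is the exponent -(z/2) (t + eta^2 / t) of the generalized inverse Gaussian
    law. *)
Definition gig_exponent (z eta s : R) : R := - (z / 2 * (expR s + eta ^+ 2 * expR (- s))).

Lemma measurable_gig_exponent z eta : measurable_fun [set: R] (gig_exponent z eta).
Proof.
rewrite /gig_exponent; apply: measurableT_comp => //; apply: measurable_funM => //.
apply: measurable_funD; first exact: measurable_expR.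
apply: measurable_funM => //; apply: measurableT_comp; first exact: measurable_expR.
exact: oppr_measurable.
Qed.

(** The reflection s |-> 2 ln eta - s exchanges e^s and eta^2 e^(-s), hence fixes the exponent. *)
Lemma gig_symmetry (z eta : R) : 0 < eta ->
  (\int[mu]_s (expR (s / 2) * expR (gig_exponent z eta s))%:E =
   \int[mu]_s (eta * expR (- (s / 2)) * expR (gig_exponent z eta s))%:E)%E.
Proof.
move=> e0; pose f s := (expR (s / 2) * expR (gig_exponent z eta s))%:E.
have mf : measurable_fun [set: R] f.
  apply/measurable_EFinP; apply: measurable_funM.
    by apply: measurableT_comp => //; exact: measurable_funM.
  by apply: measurableT_comp => //; exact: measurable_gig_exponent.
have f0 s : (0 <= f s)%E by rewrite lee_fin mulr_ge0 ?expR_ge0.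
rewrite -[LHS](ge0_integral_shift (2 * ln eta) mf f0).
rewrite -(ge0_integral_opp (f := fun s => f (s + 2 * ln eta))).
- apply: eq_integral => s _; rewrite /f; congr EFin.
  have eE : expR (2 * ln eta) = eta ^+ 2 by rewrite expRM_natl lnK.
  congr (_ * _).
    by rewrite mulrDl expRD mulrAC divff ?pnatr_eq0// mul1r lnK// mulNr mulrC.
  congr expR; rewrite /gig_exponent expRD eE opprD expRD [expR (- (2 * _))]expRN eE opprK.
  by field; rewrite gt_eqF.
- by apply: (measurableT_comp mf); exact: measurable_funD.
- by move=> r; exact: f0.
Qed.

(* The substitution p = e^(s/2) - eta e^(-s/2), for which
   p^2 = e^s + eta^2 e^(-s) - 2 eta, turns the Gaussian integral into the half sum of
   the two sides of [gig_symmetry]. *)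
Lemma gig_integral (z eta : R) : 0 < z -> 0 < eta ->
  (\int[mu]_s (expR (- (s / 2)) * expR (gig_exponent z eta s))%:E =
   (Num.sqrt (pi / (z / 2)) * expR (- (z * eta)) / eta)%:E)%E.
Proof.
move=> z0 e0.
pose F (s : R) : R := expR (s / 2) - eta * expR (- (s / 2)).
pose f (s : R) : R := 2^-1 * (expR (s / 2) + eta * expR (- (s / 2))).
have dF (s : R) : is_derive s (1 : R) F (f s).
  have d1 : is_derive s (1 : R) (fun s : R => s / 2) (2^-1).
    have -> : (fun s : R => s / 2) = (fun s => 2^-1 *: s) by apply/funext => x; rewrite /GRing.scale/= mulrC.
    by apply: is_derive_eq; rewrite /GRing.scale/= mulr1.
  have d2 : is_derive s (1 : R) (fun s : R => - (s / 2)) (- 2^-1) by apply: is_deriveN.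
  have d3 : is_derive s (1 : R) (fun s : R => expR (s / 2)) (2^-1 * expR (s / 2)).
    by have := @is_derive1_comp R expR (fun s : R => s / 2) s _ _ (is_derive_expR _) d1; rewrite mulrC.
  have d4 : is_derive s (1 : R) (fun s : R => expR (- (s / 2))) (- 2^-1 * expR (- (s / 2))).
    by have := @is_derive1_comp R expR (fun s : R => - (s / 2)) s _ _ (is_derive_expR _) d2; rewrite mulrC.
  have -> : F = (fun s => expR (s / 2) - eta *: expR (- (s / 2))) by [].
  by apply: is_derive_eq; rewrite /f /GRing.scale/=; ring.
have f0 s : 0 <= f s by rewrite mulr_ge0// addr_ge0 ?mulr_ge0 ?expR_ge0// ltW.
have ce (k : R) : continuous (fun s : R => expR (k * s)).
  move=> s; apply: continuous_comp; last exact: continuous_expR.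
  by apply: continuousM; [exact: cst_continuous|move=> ?; exact: cvg_id].
have cf : continuous f.
  have -> : f = (fun s => 2^-1 * (expR (2^-1 * s) + eta * expR (- 2^-1 * s))).
    by apply/funext => s; rewrite /f !(mulrC s) mulNr.
  move=> s; apply: cvgM; first exact: cvg_cst.
  apply: cvgD; first exact: ce.
  by apply: cvgM; [exact: cvg_cst|exact: ce].
have incF : {homo F : x y / x < y}.
  move=> x y xy; rewrite /F; apply: ltrB.
    by rewrite ltr_expR ltr_pM2r.
  by rewrite ltr_pM2l// ltr_expR ltrN2 ltr_pM2r.
have sF y : exists x y', F x <= y <= F y'.
  (* Here eta w = 1 + |y|; since e^(t/2) >= 1 + t/2, the value of [F] at [- t] is then at most -|y|.
     The other terms of [t] serve the value at [t]. *)
  pose w := (1 + `|y|) / eta.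
  have w0 : 0 <= w by rewrite divr_ge0 ?addr_ge0// ltW.
  have ew : eta * w = 1 + `|y| by rewrite /w; field; rewrite gt_eqF.
  pose t := 2 * `|y| + 2 * eta + 2 * w.
  have yn := normr_ge0 y.
  have t0 : 0 <= t by rewrite /t; lra.
  have e1 : 1 + t / 2 <= expR (t / 2) := expR_ge1Dx _.
  have e2 : expR (- (t / 2)) <= 1 by rewrite expR_le1 oppr_le0 divr_ge0.
  have e3 := expR_ge0 (- (t / 2)).
  have [y1 y2] : - `|y| <= y /\ y <= `|y| by split; [rewrite lerNl -normrN ler_norm|exact: ler_norm].
  exists (- t), t; rewrite /F mulNr opprK; apply/andP; split.
    have h : eta * (1 + t / 2) <= eta * expR (t / 2) by rewrite ler_pM2l.
    have h3 : eta * (1 + t / 2) = eta + eta * `|y| + eta * eta + eta * w by rewrite /t; field.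
    have h4 : 0 <= eta * `|y| by rewrite mulr_ge0// ltW.
    have h5 : 0 <= eta * eta by rewrite mulr_ge0// ltW.
    by rewrite ew in h3; lra.
  have h : eta * expR (- (t / 2)) <= eta by rewrite ler_piMr// ltW.
  by rewrite /t in e1 *; lra.
have key := @ge0_change_of_variables R f cf f0 F dF incF sF (fun p => (expR (- (z / 2 * p ^+ 2)))%:E).
have mg : measurable_fun [set: R] (fun p : R => (expR (- (z / 2 * p ^+ 2)))%:E).
  apply/measurable_EFinP; apply: measurableT_comp => //; apply: measurableT_comp => //.
  by apply: measurable_funM => //; exact: measurable_funX.
have K0 (p : R) : (0 <= (expR (- (z / 2 * p ^+ 2)))%:E)%E by rewrite lee_fin expR_ge0.
have {key mg} := key mg K0.
rewrite ge0_integral_gauss_scale ?divr_gt0//.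
pose gE s := expR (gig_exponent z eta s).
have mgE : measurable_fun [set: R] gE.
  by apply: measurableT_comp; [exact: measurable_expR|exact: measurable_gig_exponent].
have meh (k : R) : measurable_fun [set: R] (fun s : R => expR (k * s)).
  exact: mexpl.
have -> : (\int[mu]_s ((expR (- (z / 2 * F s ^+ 2)))%:E * (f s)%:E) =
    \int[mu]_s ((expR (z * eta) / 2)%:E * ((expR (s / 2) * gE s)%:E + (eta * expR (- (s / 2)) * gE s)%:E)))%E.
  apply: eq_integral => s _; rewrite -EFinD -!EFinM; congr EFin.
  have E1 : expR (s / 2) * expR (- (s / 2)) = 1 by rewrite -expRD subrr expR0.
  have E2 : expR (s / 2) * expR (s / 2) = expR s by rewrite -expRD -splitr.
  have E3 : expR (- (s / 2)) * expR (- (s / 2)) = expR (- s) by rewrite -expRD -opprD -splitr.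
  have E4 : F s ^+ 2 = expR s + eta ^+ 2 * expR (- s) - 2 * eta.
    rewrite /F sqrrB -!expr2 in E2 E3 *; rewrite exprMn E2 E3 mulrCA E1; ring.
  have -> : - (z / 2 * F s ^+ 2) = z * eta + gig_exponent z eta s.
    by rewrite E4 /gig_exponent; field.
  by rewrite expRD /f -/(gE s); field.
have m1 : measurable_fun [set: R] (fun s => (expR (s / 2) * gE s)%:E).
  apply/measurable_EFinP; apply: measurable_funM => //.
  by have := meh 2^-1; under eq_fun do rewrite mulrC.
have m2 : measurable_fun [set: R] (fun s => (expR (- (s / 2)) * gE s)%:E).
  apply/measurable_EFinP; apply: measurable_funM => //.
  by have := meh (- 2^-1); under eq_fun do rewrite mulNr mulrC.
have m3 : measurable_fun [set: R] (fun s => (eta * expR (- (s / 2)) * gE s)%:E).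
  apply/measurable_EFinP; under eq_fun do rewrite -mulrA; apply: measurable_funM => //.
  exact/measurable_EFinP.
have p1 s : (0 <= (expR (s / 2) * gE s)%:E)%E by rewrite lee_fin mulr_ge0 ?expR_ge0.
have p2 s : (0 <= (expR (- (s / 2)) * gE s)%:E)%E by rewrite lee_fin mulr_ge0 ?expR_ge0.
have p3 s : (0 <= (eta * expR (- (s / 2)) * gE s)%:E)%E.
  by rewrite lee_fin !mulr_ge0 ?expR_ge0// ltW.
rewrite ge0_integralZl//; last 2 first.
- by apply: emeasurable_funD; [exact: m1|exact: m3].
- by move=> s _; apply: adde_ge0; [exact: p1|exact: p3].
rewrite ge0_integralD; [|exact: measurableT|by move=> s _; exact: p1|exact: m1|by move=> s _; exact: p3|exact: m3].
rewrite gig_symmetry// -/gE.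
have -> : (\int[mu]_s (eta * expR (- (s / 2)) * gE s)%:E =
    eta%:E * \int[mu]_s (expR (- (s / 2)) * gE s)%:E)%E.
  rewrite -ge0_integralZl; [|exact: measurableT|exact: m2|by move=> s _; exact: p2|by rewrite lee_fin ltW].
  by apply: eq_integral => s _; rewrite -EFinM mulrA.
(* The Gaussian integral equals (e^(z eta) / 2) (eta A + eta A). As [A] is not yet known to be
   finite, the equation is solved for it in the extended reals. *)
set A := (\int[mu]_s _)%E => key.
have A0 : (0 <= A)%E by apply: integral_ge0.
have E0 : expR (z * eta) * eta != 0 by rewrite mulf_neq0 ?gt_eqF ?expR_gt0.
have -> : A = (((expR (z * eta) * eta)^-1)%:E * ((expR (z * eta) * eta)%:E * A))%E.
  by rewrite muleA -EFinM mulVf// mul1e.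
have -> : ((expR (z * eta) * eta)%:E * A = (expR (z * eta) / 2)%:E * (eta%:E * A + eta%:E * A))%E.
  rewrite -ge0_muleDl ?lee_fin ?ltW// muleA -EFinD -EFinM; congr (_%:E * _)%E.
  by field.
rewrite -key -EFinM; congr EFin; rewrite expRN.
by field; rewrite !gt_eqF ?expR_gt0.
Qed.

(** With q = |p| + 1 one has t^p <= t^q for t >= 1, and ln x <= x at x = k t / q gives t^q <=
    (q/k)^q e^(k t). *)
Lemma powR_expR_bound (p k : R) : 0 < k -> exists2 M : R, 0 < M &
  forall t, 1 <= t -> t `^ p <= M * expR (k * t).
Proof.
move=> k0; pose q := `|p| + 1.
have q0 : 0 < q by rewrite /q ltr_wpDl.
exists (expR (q * ln (q / k))); first exact: expR_gt0.
move=> t t1; have t0 : 0 < t by exact: lt_le_trans t1.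
have pq : t `^ p <= t `^ q by apply: ler_powR => //; rewrite /q (le_trans (ler_norm p))// lerDl.
apply: (le_trans pq); rewrite /powR gt_eqF// -expRD ler_expR.
have h : ln (k * t / q) <= k * t / q.
  by apply: ltW; apply: ln_sublinear; rewrite divr_gt0// mulr_gt0.
have e : ln t = ln (k * t / q) + ln (q / k).
  rewrite -lnM ?posrE ?divr_gt0 ?mulr_gt0//; congr ln; field.
  by rewrite !gt_eqF.
rewrite e mulrDr addrC lerD2l.
have E : q * (k * t / q) = k * t by field; rewrite gt_eqF.
by rewrite -[leRHS]E ler_pM2l.
Qed.

(** The integrand of [Gamma] extended by 0, so that substitutions can be made on the whole line. *)
Definition gamma_density (p t : R) : R := if 0 < t then t `^ (p - 1) * expR (- t) else 0.

Lemma gamma_density_ge0 p t : 0 <= gamma_density p t.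
Proof. by rewrite /gamma_density; case: ifP => // _; rewrite mulr_ge0 ?powR_ge0 ?expR_ge0. Qed.

Lemma measurable_pos_powR (p : R) : measurable_fun [set: R] (fun y : R => pos_powR y p).
Proof.
rewrite /pos_powR; apply: measurable_fun_ifT => //.
exact: measurable_fun_ltr.
Qed.

Lemma gamma_densityE p t : gamma_density p t = pos_powR t (p - 1) * expR (- t).
Proof. by rewrite /gamma_density /pos_powR; case: ifP; rewrite ?mul0r. Qed.

Lemma measurable_gamma_density p : measurable_fun [set: R] (gamma_density p).
Proof.
have -> : gamma_density p = (fun t => pos_powR t (p - 1) * expR (- t)).
  by apply/funext => t; exact: gamma_densityE.
by apply: measurable_funM; [exact: measurable_pos_powR|apply: measurableT_comp].
Qed.

Lemma Gamma_gamma_density (p : R) : Gamma p = \int[mu]_t gamma_density p t.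
Proof.
rewrite /Gamma /Rintegral integral_mkcond; congr fine; apply: eq_integral => t _.
rewrite patchE /gamma_density; case: ifPn.
  by rewrite inE/= in_itv/= andbT => ->.
by rewrite notin_setE/= in_itv/= andbT => /negP/negbTE ->.
Qed.

Definition unit_power (p t : R) : R := if 0 < t <= 1 then t `^ (p - 1) else 0.

Lemma measurable_unit_power p : measurable_fun [set: R] (unit_power p).
Proof.
rewrite /unit_power; apply: measurable_fun_ifT; last exact: measurable_cst.
  apply: measurable_and; first exact: measurable_fun_ltr.
  exact: measurable_fun_ler.
exact: measurable_powR.
Qed.

Lemma unit_power_ge0 p t : 0 <= unit_power p t.
Proof. by rewrite /unit_power; case: ifP => // _; exact: powR_ge0. Qed.

(** The substitution t = y^3 triples the exponent; an odd power is taken because it is a bijection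
    of the whole line. *)
Lemma unit_power_cube (p : R) :
  (\int[mu]_t (unit_power p t)%:E = 3%:E * \int[mu]_t (unit_power (3 * p) t)%:E)%E.
Proof.
pose f (y : R) : R := 3 * y ^+ 2.
have cf : continuous f.
  by move=> y; apply: cvgM; [exact: cvg_cst|exact: exprn_continuous].
have f0 y : 0 <= f y by rewrite mulr_ge0// sqr_ge0.
have dF (y : R) : is_derive y (1 : R) (fun y : R => y ^+ 3) (f y).
  by apply: is_derive_eq; rewrite /f /GRing.scale/=; ring.
have incF : {homo (fun y : R => y ^+ 3) : x y / x < y}.
  move=> x y xy; rewrite -subr_gt0.
  have -> : y ^+ 3 - x ^+ 3 = (y - x) * (y ^+ 2 + x * y + x ^+ 2) by ring.
  have d0 : 0 < y - x by rewrite subr_gt0.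
  apply: mulr_gt0 => //; have := mulr_gt0 d0 d0; have := sqr_ge0 (x + y); nra.
have sF (y : R) : exists x y', x ^+ 3 <= y <= y' ^+ 3.
  exists (- (1 + `|y|)), (1 + `|y|); have yn := normr_ge0 y.
  have [y1 y2] : - `|y| <= y /\ y <= `|y| by split; [rewrite lerNl -normrN ler_norm|exact: ler_norm].
  have h : `|y| <= (1 + `|y|) ^+ 3.
    by rewrite !exprS expr0 mulr1; nra.
  have -> : (- (1 + `|y|)) ^+ 3 = - (1 + `|y|) ^+ 3 by ring.
  by lra.
have mU : measurable_fun [set: R] (fun t => (unit_power p t)%:E).
  by apply/measurable_EFinP; exact: measurable_unit_power.
have U0 t : (0 <= (unit_power p t)%:E)%E by rewrite lee_fin unit_power_ge0.
rewrite (ge0_change_of_variables cf f0 dF incF sF mU U0).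
rewrite -ge0_integralZl//; last 2 first.
- by apply/measurable_EFinP; exact: measurable_unit_power.
- by move=> t _; rewrite lee_fin unit_power_ge0.
apply: eq_integral => y _; rewrite -!EFinM; congr EFin; rewrite /unit_power /f.
have -> : (0 < y ^+ 3 <= 1) = (0 < y <= 1).
  rewrite exprn_odd_gt0//; case: ltP => //= y0.
  apply/idP/idP => y1; last by rewrite exprn_ile1// ltW.
  by apply: contraLR y1; rewrite -!ltNge => y1; rewrite exprn_egt1.
case: ifPn => [/andP[y0 y1]|]; last by rewrite mul0r mulr0.
rewrite -(powR_mulrn 3 (ltW y0)) -(powR_mulrn 2 (ltW y0)) -powRrM mulrCA -powRD; last first.
  by rewrite (gt_eqF y0) implybT.
by congr (_ * _ `^ _); ring.
Qed.

(** Iterating the substitution brings the exponent to at least 1, where the integrand is bounded by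
    1 on ]0, 1]. *)
Lemma unit_power_lty (p : R) : 0 < p -> (\int[mu]_t (unit_power p t)%:E < +oo)%E.
Proof.
move=> p0.
have base q : 1 <= q -> (\int[mu]_t (unit_power q t)%:E < +oo)%E.
  move=> q1; apply: (@le_lt_trans _ _ (\int[mu]_t (\1_(`[0%R, 1%R]) t)%:E)%E); last first.
    by rewrite integral_indic//= setIT lebesgue_measure_itv/= lte01 oppr0 adde0 ltry.
  apply: ge0_le_integral => //.
  - by move=> t _; rewrite lee_fin unit_power_ge0.
  - by apply/measurable_EFinP; exact: measurable_unit_power.
  - by apply/measurable_EFinP; exact: measurable_indic.
  - move=> t _; rewrite lee_fin /unit_power indicE mem_setE in_itv/=.
    case: ifPn => [/andP[t0 t1]|_]; last by case: (_ && _).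
    by rewrite (ltW t0) t1/= -[leRHS](powRr0 t) ger_powR ?t0// subr_ge0.
have [n pn] : exists n : nat, 1 <= 3 ^+ n * p.
  have [n hn] : exists n : nat, p^-1 <= 3 ^+ n.
    exists (Num.truncn p^-1).+1; apply: ltW; apply: lt_trans (truncnS_gt _) _.
    by rewrite -natrX ltr_nat; apply: ltn_expl.
  by exists n; rewrite -ler_pdivrMr// div1r.
elim: n p p0 pn => [|n IH] p p0 pn; first by apply: base; rewrite expr0 mul1r in pn.
rewrite unit_power_cube; apply: lte_mul_pinfty => //.
by apply: IH; rewrite ?mulr_gt0// mulrA -exprSr.
Qed.

(** On ]0, 1] the exponential is at most 1; beyond 1 the power is absorbed by e^(t/2), leaving a
    multiple of the exponential density of rate 1/2. *)
Lemma gamma_density_lty (p : R) : 0 < p -> (\int[mu]_t (gamma_density p t)%:E < +oo)%E.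
Proof.
move=> p0; have h0 : (0 : R) < 2^-1 by rewrite invr_gt0.
have [M M0 hM] := powR_expR_bound (p - 1) h0.
have mE : measurable_fun [set: R] (fun t => (exponential_pdf (2^-1 : R) t)%:E).
  by apply/measurable_EFinP; exact: measurable_exponential_pdf.
have E0 (t : R) : 0 <= exponential_pdf (2^-1 : R) t by apply: exponential_pdf_ge0; exact: ltW.
have mU : measurable_fun [set: R] (fun t => (unit_power p t)%:E).
  by apply/measurable_EFinP; exact: measurable_unit_power.
apply: (@le_lt_trans _ _ (\int[mu]_t ((unit_power p t)%:E + (2 * M)%:E * (exponential_pdf (2^-1 : R) t)%:E))%E).
  apply: ge0_le_integral => //.
  - by move=> t _; rewrite lee_fin gamma_density_ge0.
  - by apply/measurable_EFinP; exact: measurable_gamma_density.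
  - by apply: emeasurable_funD => //; exact: emeasurable_funM.
  move=> t _; rewrite -EFinM -EFinD lee_fin /gamma_density; case: ifPn => t0; last first.
    by rewrite addr_ge0 ?unit_power_ge0// mulr_ge0// mulr_ge0// ltW.
  rewrite /unit_power t0/=; case: (leP t 1) => t1.
    apply: ler_wpDr; first by rewrite mulr_ge0// mulr_ge0// ltW.
    by rewrite ler_piMr ?powR_ge0// expR_le1 oppr_le0 ltW.
  rewrite add0r exponential_pdfE /=; last exact: ltW.
  have := ler_pM (powR_ge0 _ _) (expR_ge0 _) (hM _ (ltW t1)) (lexx (expR (- t))).
  move/le_trans; apply; rewrite -mulrA -expRD le_eqVlt; apply/orP; left; apply/eqP.
  have -> : 2^-1 * t - t = - 2^-1 * t by field.
  by field.
rewrite ge0_integralD//; last 3 first.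
- by move=> t _; rewrite lee_fin unit_power_ge0.
- by move=> t _; rewrite mule_ge0// lee_fin ?mulr_ge0// ltW.
- exact: emeasurable_funM.
apply: lte_add_pinfty; first exact: unit_power_lty.
rewrite ge0_integralZl//; last 2 first.
- by move=> t _; rewrite lee_fin.
- by rewrite lee_fin mulr_ge0// ltW.
by rewrite (integral_exponential_pdf h0) mule1 ltry.
Qed.

(** On [1, 2] one has 0 <= ln t <= 2, so the power is at least e^(-2|p-1|) there. *)
Lemma gamma_density_gt0 (p : R) : (0 < \int[mu]_t (gamma_density p t)%:E)%E.
Proof.
pose c : R := expR (- (2 * `|p - 1|)) * expR (- 2).
have c0 : 0 < c by rewrite mulr_gt0// expR_gt0.
apply: (@lt_le_trans _ _ (\int[mu]_t (c%:E * (\1_(`[1%R, 2%R]) t)%:E))%E).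
  rewrite ge0_integralZl//; last 2 first.
  - by apply/measurable_EFinP; exact: measurable_indic.
  - by rewrite lee_fin ltW.
  rewrite integral_indic//= setIT lebesgue_measure_itv/= lte_fin ltr1n/= -EFinB -EFinM lte_fin mulr_gt0//.
apply: ge0_le_integral => //.
- by move=> t _; rewrite mule_ge0// lee_fin ltW.
- by apply: emeasurable_funM => //; apply/measurable_EFinP; exact: measurable_indic.
- by apply/measurable_EFinP; exact: measurable_gamma_density.
move=> t _; rewrite -EFinM lee_fin indicE mem_setE in_itv/=.
case: (boolP (1 <= t <= 2)) => [/andP[t1 t2]|_]; last by rewrite mulr0 gamma_density_ge0.
have t0 : 0 < t by exact: lt_le_trans t1.
rewrite mulr1 /gamma_density t0 /c ler_pM ?expR_ge0//; last by rewrite ler_expR lerN2.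
rewrite /powR gt_eqF// ler_expR.
have l0 : 0 <= ln t by exact: ln_ge0.
have l2 : ln t <= 2 by apply: le_trans t2; apply: ltW; exact: ln_sublinear.
have := ler_norm (- (p - 1)); rewrite normrN.
have := normr_ge0 (p - 1); nra.
Qed.

End gaussian_kernel.

Section mul_normr.
Context {R : realType}.

(** x |x| continues the square to an increasing differentiable bijection of the line, so that a
    substitution by x^2 + u x on x > 0 extends to all real x. *)
Lemma is_derive_mul_normr (x : R) : is_derive x (1 : R) (fun y : R => y * `|y|) (2 * `|x|).
Proof.
have [x0|x0|->] := ltgtP x 0.
- apply: (@near_eq_is_derive _ _ _ (fun y : R => - (y ^+ 2))).
    near=> y; have y0 : y < 0 by near: y; exact: lt_nbhsl.
    by rewrite ltr0_norm// expr2 mulrN.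
  by apply: is_derive_eq; rewrite /GRing.scale/= ltr0_norm//; ring.
- apply: (@near_eq_is_derive _ _ _ (fun y : R => y ^+ 2)).
    near=> y; have y0 : 0 < y by near: y; exact: lt_nbhsr.
    by rewrite gtr0_norm// expr2.
  by apply: is_derive_eq; rewrite /GRing.scale/= gtr0_norm//; ring.
- have h : (fun h : R => h^-1 *: (((fun y : R => y * `|y|) \o shift (0 : R)) (h *: (1 : R)) - (0 : R) * `|0 : R|)) @ (0 : R)^' --> (0 : R).
    apply: (@cvg_trans _ ((fun h : R => `|h|) @ (0 : R)^')).
      apply: near_eq_cvg; near=> h; rewrite /GRing.scale/= !mulr1 addr0 mul0r subr0.
      by rewrite mulrA mulVf ?mul1r//; near: h; exact: nbhs_dnbhs_neq.
    have hn : `|h| @[h --> (0:R)] --> `|0 : R| := @norm_continuous _ _ _.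
    by rewrite normr0 in hn; exact: cvg_within_filter.
  rewrite normr0 mulr0; split; first by apply/cvg_ex; exists 0.
  by apply/cvg_lim.
Unshelve. all: by end_near. Qed.

End mul_normr.

(** * The moving-average kernel and its autocovariance *)

Section kernel.
Context {R : realType}.
Notation mu := (@lebesgue_measure R).
Variables (H lambda : R).
Hypotheses (hH : 0 < H) (hl : 0 < lambda).

Definition kern (y : R) : R := expR (- (lambda * Num.max y 0)) * pos_powR y (H - 2^-1).

Lemma tfbm_kernelE t x : tfbm_kernel H lambda t x = kern (t - x) - kern (- x).
Proof. by []. Qed.

Lemma measurable_kern : measurable_fun [set: R] kern.
Proof.
apply: measurable_funM; last exact: measurable_pos_powR.
apply: measurableT_comp; first exact: measurable_expR.
apply: measurableT_comp => //; apply: measurable_funM => //.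
exact: measurable_maxr.
Qed.

Lemma kern_ge0 y : 0 <= kern y.
Proof. by rewrite /kern /pos_powR mulr_ge0 ?expR_ge0//; case: ifP => // _; exact: powR_ge0. Qed.

Lemma kern_neg y : y <= 0 -> kern y = 0.
Proof. by rewrite /kern /pos_powR ltNge => ->; rewrite mulr0. Qed.

Lemma kern_pos y : 0 < y -> kern y = expR (- (lambda * y)) * y `^ (H - 2^-1).
Proof. by move=> y0; rewrite /kern /pos_powR y0 (max_idPl (ltW y0)). Qed.

Lemma measurable_tfbm_kernel t : measurable_fun [set: R] (tfbm_kernel H lambda t).
Proof.
have -> : tfbm_kernel H lambda t = (fun x => kern (t - x) - kern (- x)) by [].
apply: measurable_funB; apply: (measurableT_comp measurable_kern).
  exact: measurable_funB.
exact: oppr_measurable.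
Qed.

(** Squaring doubles the tempering and the exponent: up to a constant, the square is the Gamma
    integrand of parameter 2H in the variable 2 lambda x. *)
Lemma integral_kern_sqr :
  (\int[mu]_x (kern x ^+ 2)%:E = (Gamma (2 * H) / (2 * lambda) `^ (2 * H))%:E)%E.
Proof.
have l2 : 0 < 2 * lambda by rewrite mulr_gt0.
have Hp : 0 < 2 * H by rewrite mulr_gt0.
have mg : measurable_fun [set: R] (fun t => (gamma_density (2 * H) t)%:E).
  by apply/measurable_EFinP; exact: measurable_gamma_density.
have g0 t : (0 <= (gamma_density (2 * H) t)%:E)%E by rewrite lee_fin gamma_density_ge0.
transitivity (\int[mu]_x (((2 * lambda) `^ (1 - 2 * H))%:E * (gamma_density (2 * H) (2 * lambda * x))%:E))%E.
  apply: eq_integral => x _; rewrite -EFinM; congr EFin.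
  rewrite /gamma_density; case: (ltP 0 x) => x0; last first.
    have -> : (0 < 2 * lambda * x) = false by apply/negbTE; rewrite -leNgt mulr_ge0_le0// ltW.
    by rewrite kern_neg// expr0n mulr0.
  rewrite kern_pos// mulr_gt0// (powRM _ (ltW l2) (ltW x0)) exprMn.
  have -> : expR (- (lambda * x)) ^+ 2 = expR (- (2 * lambda * x)).
    by rewrite -expRM_natl; congr expR; ring.
  have -> : (x `^ (H - 2^-1)) ^+ 2 = x `^ (2 * H - 1).
    by rewrite -powR_mulrn ?powR_ge0// -powRrM; congr (_ `^ _); field.
  rewrite !mulrA -powRD; last by rewrite (gt_eqF l2) implybT.
  have e0 : 1 - 2 * H + (2 * H - 1) = 0 by ring.
  by rewrite e0 powRr0 mul1r mulrC.
rewrite ge0_integralZl; [|exact: measurableT| |by move=> x _; exact: g0|by rewrite lee_fin powR_ge0]; last first.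
  by apply: (measurableT_comp mg); exact: measurable_funM.
rewrite (@ge0_integral_scale R (fun t => (gamma_density (2 * H) t)%:E) _ l2 mg g0) muleA -EFinM.
have fin : (\int[mu]_t (gamma_density (2 * H) t)%:E \is a fin_num)%E.
  by rewrite ge0_fin_numE ?gamma_density_lty// integral_ge0.
rewrite Gamma_gamma_density /Rintegral -(fineK fin) -EFinM; congr EFin.
rewrite fineK// [RHS]mulrC; congr (_ * _).
rewrite powRB; last by rewrite (gt_eqF l2) implybT.
by rewrite powRr1 ?ltW//; field; rewrite !gt_eqF// powR_gt0.
Qed.

Lemma kern_sqint : sqint mu kern.
Proof. by apply: sqint_lty; [exact: measurable_kern|rewrite integral_kern_sqr ltry]. Qed.

Lemma kern_shift_sqint u : sqint mu (fun x => kern (x + u)).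
Proof.
apply: sqint_lty.
  by apply: (measurableT_comp measurable_kern); exact: measurable_funD.
rewrite (@ge0_integral_shift R (fun x => (kern x ^+ 2)%:E)).
- by rewrite integral_kern_sqr ltry.
- by apply/measurable_EFinP; apply: measurable_funX; exact: measurable_kern.
- by move=> x; rewrite lee_fin sqr_ge0.
Qed.

(** Again a Gamma integrand, now of parameter H + 1/2; integrability of the kernel itself gives the
    decay of its autocovariance. *)
Lemma kern_integrable_lty : (\int[mu]_x (kern x)%:E < +oo)%E.
Proof.
have hp : 0 < H + 2^-1 by rewrite addr_gt0.
have mg : measurable_fun [set: R] (fun t => (gamma_density (H + 2^-1) t)%:E).
  by apply/measurable_EFinP; exact: measurable_gamma_density.
have g0 t : (0 <= (gamma_density (H + 2^-1) t)%:E)%E by rewrite lee_fin gamma_density_ge0.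
have e1 : H + 2^-1 - 1 = H - 2^-1 by field.
have -> : (\int[mu]_x (kern x)%:E = \int[mu]_x ((lambda `^ (2^-1 - H))%:E * (gamma_density (H + 2^-1) (lambda * x))%:E))%E.
  apply: eq_integral => x _; rewrite -EFinM; congr EFin.
  rewrite /gamma_density e1; case: (ltP 0 x) => x0; last first.
    have -> : (0 < lambda * x) = false by apply/negbTE; rewrite -leNgt mulr_ge0_le0// ltW.
    by rewrite kern_neg// mulr0.
  rewrite kern_pos// mulr_gt0// (powRM _ (ltW hl) (ltW x0)).
  rewrite !mulrA -powRD; last by rewrite (gt_eqF hl) implybT.
  have e0 : 2^-1 - H + (H - 2^-1) = 0 by ring.
  by rewrite e0 powRr0 mul1r mulrC.
rewrite ge0_integralZl; [|exact: measurableT| |by move=> x _; exact: g0|by rewrite lee_fin powR_ge0]; last first.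
  by apply: (measurableT_comp mg); exact: measurable_funM.
rewrite (@ge0_integral_scale R (fun t => (gamma_density (H + 2^-1) t)%:E) _ hl mg g0).
apply: lte_mul_pinfty; rewrite ?lee_fin ?powR_ge0//.
apply: lte_mul_pinfty; rewrite ?lee_fin ?invr_ge0 ?ltW//.
by have := gamma_density_lty hp.
Qed.

Definition kern_cov (u : R) : R := ip mu kern (fun x => kern (x + u)).

(** With kappa the autocovariance [kern_cov], the square of kern(x + u) - kern(x) integrates to 2
    kappa(0) - 2 kappa(u). [tfbm_varE] identifies this with C_u^2 u^(2H). *)
Definition tfbm_var (u : R) : R := 2 * kern_cov 0 - 2 * kern_cov u.

Lemma kern_cov0 : kern_cov 0 = Gamma (2 * H) / (2 * lambda) `^ (2 * H).
Proof.
apply: EFin_inj; rewrite -integral_kern_sqr (sqint_EFin kern_sqint).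
by congr (ip _ _ _)%:E; apply/funext => x; rewrite addr0.
Qed.

Lemma kern_cov_ge0 u : 0 <= kern_cov u.
Proof. by apply: Rintegral_ge0 => x _; rewrite mulr_ge0 ?kern_ge0. Qed.

(** Half of the tempering absorbs the power, so kern(x + u) <= M e^(-lambda u / 2) for x > 0 and u
    >= 1; the other factor kern(x) is integrable. *)
Lemma kern_cov_cvg0 : kern_cov u @[u --> +oo] --> 0.
Proof.
have l2 : 0 < lambda / 2 by rewrite divr_gt0.
have [M M0 hM] := powR_expR_bound (H - 2^-1) l2.
pose I := fine (\int[mu]_x (kern x)%:E)%E.
have I0 : (0 <= \int[mu]_x (kern x)%:E)%E by apply: integral_ge0 => x _; rewrite lee_fin kern_ge0.
have Ik : mu.-integrable setT (EFin \o kern).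
  apply/integrableP; split; first by apply/measurable_EFinP; exact: measurable_kern.
  apply: le_lt_trans kern_integrable_lty; rewrite le_eqVlt; apply/orP; left; apply/eqP.
  by apply: eq_integral => x _; rewrite /= ger0_norm ?kern_ge0.
have bound u : 1 <= u -> kern_cov u <= M * (\int[mu]_x kern x) * expR (- (lambda / 2 * u)).
  move=> u1; rewrite mulrAC -RintegralZl; [|exact: measurableT|exact: Ik].
  apply: le_Rintegral => //.
  - exact: (sqint_integrableM kern_sqint (kern_shift_sqint u)).
  - exact: (integrableZl measurableT (M * expR (- (lambda / 2 * u))) Ik).
  - move=> x _; case: (leP x 0) => x0; first by rewrite kern_neg// !mul0r mulr0.
    rewrite mulrC; apply: ler_wpM2r; first exact: kern_ge0.
    have xu0 : 0 < x + u by rewrite addr_gt0// (lt_le_trans ltr01).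
    have xu1 : 1 <= x + u by apply: (le_trans u1); rewrite lerDr ltW.
    rewrite kern_pos// mulrC.
    have := ler_wpM2r (expR_ge0 (- (lambda * (x + u)))) (hM _ xu1).
    rewrite -[X in _ <= X]mulrA -expRD => h; apply: (le_trans h).
    by rewrite ler_pM2l// ler_expR; nra.
apply: (@squeeze_cvgr _ _ _ _ (cst 0) (fun u => M * (\int[mu]_x kern x) * expR (- (lambda / 2 * u)))).
- near=> u; rewrite kern_cov_ge0/= bound//.
- exact: cvg_cst.
- rewrite -[X in _ --> X](mulr0 (M * (\int[mu]_x kern x))).
  apply: cvgM; first exact: cvg_cst.
  apply: (cvg_comp (fun u : R => lambda / 2 * u) (fun t => expR (- t))); last exact: cvgr_expR.
  apply/cvgryPge => A; near=> u; rewrite mulrC -ler_pdivrMr//.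
Unshelve. all: by end_near. Qed.

(** The terms kern(-x) cancel; a reflection and a translation by s then leave only the lag t - s. *)
Lemma ip_kernelB s t : s <= t ->
  ip mu (fun x => tfbm_kernel H lambda t x - tfbm_kernel H lambda s x)
        (fun x => tfbm_kernel H lambda t x - tfbm_kernel H lambda s x) = tfbm_var (t - s).
Proof.
move=> st; pose D u x := kern (x + u) - kern x.
have sD u : sqint mu (D u) by apply: sqintB; [exact: kern_shift_sqint|exact: kern_sqint].
have mD u : measurable_fun [set: R] (fun x => (D u x ^+ 2)%:E).
  by apply/measurable_EFinP; apply: measurable_funX; exact: (sqint_measurable (sD u)).
have D0 u x : (0 <= (D u x ^+ 2)%:E)%E by rewrite lee_fin sqr_ge0.
transitivity (ip mu (D (t - s)) (D (t - s))).
  rewrite /ip /Rintegral; congr fine.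
  transitivity (\int[mu]_x (D (t - s) (- x + s)%R ^+ 2)%:E)%E.
    apply: eq_integral => x _; congr EFin; rewrite /D !tfbm_kernelE -expr2.
    have -> : - x + s + (t - s) = t - x by ring.
    have -> : - x + s = s - x by ring.
    by congr (_ ^+ 2); ring.
  rewrite (@ge0_integral_opp R (fun x => (D (t - s) (x + s) ^+ 2)%:E)).
  - rewrite (@ge0_integral_shift R (fun x => (D (t - s) x ^+ 2)%:E))//.
  - by apply: (measurableT_comp (mD (t - s))); exact: measurable_funD.
  - by move=> x; exact: D0.
have sk := kern_sqint; have sku := kern_shift_sqint (t - s).
rewrite /D ipBl// ?ipBr//; last exact: sqintB.
rewrite /tfbm_var.
have -> : ip mu (fun x => kern (x + (t - s))) (fun x => kern (x + (t - s))) = kern_cov 0.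
  have e := sqint_EFin sku.
  rewrite (@ge0_integral_shift R (fun x => (kern x ^+ 2)%:E)) in e.
  - by move: e; rewrite integral_kern_sqr -kern_cov0 => e1; exact: (esym (EFin_inj e1)).
  - by apply/measurable_EFinP; apply: measurable_funX; exact: measurable_kern.
  - by move=> x; rewrite lee_fin sqr_ge0.
have -> : ip mu kern kern = kern_cov 0.
  by congr (ip _ _ _); apply/funext => x; rewrite addr0.
have -> : ip mu (fun x => kern (x + (t - s))) kern = kern_cov (t - s) by exact: ipC.
by rewrite -/(kern_cov (t - s)); move: (kern_cov _) (kern_cov _) => p q; ring.
Qed.

End kernel.

(** * The autocovariance of the kernel as a Bessel function *)

Section bessel.
Context {R : realType}.
Notation mu := (@lebesgue_measure R).
Variables (H lambda : R).
Hypotheses (hH : 0 < H) (hl : 0 < lambda).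

Definition bessel_exponent (z s : R) : R := - (z / 2 * (expR s + expR (- s))).

Lemma measurable_bessel_exponent z : measurable_fun [set: R] (bessel_exponent z).
Proof.
have -> : bessel_exponent z = gig_exponent z 1.
  by apply/funext => s; rewrite /gig_exponent expr1n mul1r.
exact: measurable_gig_exponent.
Qed.

Let invr_powR (x p : R) : 0 <= x -> x^-1 `^ p = (x `^ p)^-1.
Proof. by move=> x0; rewrite -powR_inv1// -powRrM mulN1r powRN. Qed.

Let bessel_weight (z s : R) : R := expR (bessel_exponent z s) * expR (H * s).

Let measurable_bessel_weight z : measurable_fun [set: R] (bessel_weight z).
Proof.
apply: measurable_funM; apply: measurableT_comp; [exact: measurable_expR| |exact: measurable_expR|].
  exact: measurable_bessel_exponent.
exact: measurable_funM.
Qed.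

Let bessel_weight_ge0 z s : 0 <= bessel_weight z s.
Proof. by rewrite mulr_ge0 ?expR_ge0. Qed.

(** The integrand of K_H is the even part of [bessel_weight], so its half-line integral is half of
    the full one. Finiteness allows the passage from extended to real integrals. *)
Lemma besselK_integral (z : R) :
  (\int[mu]_s (bessel_weight z s)%:E < +oo)%E ->
  besselK H z = 2^-1 * \int[mu]_s bessel_weight z s.
Proof.
move=> fin; set I := (\int[mu]_s (bessel_weight z s)%:E)%E in fin *.
have I0 : (0 <= I)%E by apply: integral_ge0 => s _; rewrite lee_fin.
have mb : measurable_fun [set: R] (fun s => (bessel_weight z s)%:E) by exact/measurable_EFinP.
have mbN : measurable_fun [set: R] (fun s : R => (bessel_weight z (- s))%:E).
  by apply: (measurableT_comp mb); exact: oppr_measurable.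
have IN : (\int[mu]_s (bessel_weight z (- s))%:E = I)%E.
  by apply: (ge0_integral_opp mb) => s; rewrite lee_fin bessel_weight_ge0.
pose q s := expR (- (z * cosh s)) * cosh (H * s).
have qE s : q s = 2^-1 * (bessel_weight z s + bessel_weight z (- s)).
  rewrite /q /bessel_weight /bessel_exponent /cosh opprK mulrN (addrC (expR (- s))).
  have -> : - (z * ((expR s + expR (- s)) / 2)) = - (z / 2 * (expR s + expR (- s))) by field.
  by field.
have q0 s : 0 <= q s by rewrite qE mulr_ge0// addr_ge0.
have mq : measurable_fun [set: R] q.
  have -> : q = (fun s => 2^-1 * (bessel_weight z s + bessel_weight z (- s))) by apply/funext.
  apply: measurable_funM => //; apply: measurable_funD => //.
  exact/measurable_EFinP.
have Iq : (\int[mu]_s (q s)%:E = I)%E.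
  transitivity (\int[mu]_s ((2^-1)%:E * ((bessel_weight z s)%:E + (bessel_weight z (- s))%:E)))%E.
    by apply: eq_integral => s _; rewrite qE.
  rewrite ge0_integralZl; last 4 first.
  - exact: measurableT.
  - by apply: emeasurable_funD; [exact: mb|exact: mbN].
  - by move=> s _; rewrite -EFinD lee_fin addr_ge0.
  - by rewrite lee_fin invr_ge0.
  rewrite ge0_integralD; last 5 first.
  - exact: measurableT.
  - by move=> s _; rewrite lee_fin.
  - exact: mb.
  - by move=> s _; rewrite lee_fin.
  - exact: mbN.
  rewrite IN -/I -(fineK (_ : I \is a fin_num)%E); last by rewrite ge0_fin_numE.
  by rewrite -EFinD -EFinM; congr EFin; field.
have := even_ge0_integral mq q0.
have qN s : q (- s) = q s by rewrite !qE opprK [X in _ * X]addrC.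
move=> /(_ qN); rewrite Iq => E.
rewrite /besselK /Rintegral -/I.
have -> : I = (2%:E * \int[mu]_(t in `[0%R, +oo[) (q t)%:E)%E by [].
set J := (\int[mu]_(t in _) _)%E; have J0 : (0 <= J)%E by apply: integral_ge0 => s _; rewrite lee_fin.
have Jfin : (J < +oo)%E.
  apply: le_lt_trans fin; rewrite E -[leLHS]mul1e; apply: lee_wpmul2r => //.
  by rewrite lee_fin ler1n.
rewrite -[in RHS](fineK (_ : J \is a fin_num)%E); last by rewrite ge0_fin_numE.
by rewrite -EFinM /= mulrA mulVf ?mul1r// pnatr_eq0.
Qed.

Let measurable_gig_weight z e : measurable_fun [set: R]
  (fun s => (expR (- (s / 2)) * expR (gig_exponent z e s))%:E).
Proof.
apply/measurable_EFinP; apply: measurable_funM; apply: measurableT_comp.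
- exact: measurable_expR.
- by apply: measurableT_comp => //; exact: measurable_funM.
- exact: measurable_expR.
- exact: measurable_gig_exponent.
Qed.

(** The product of the integrands of Gamma(H + 1/2) and of 2 K_H(lambda u), in separate
    variables. *)
Definition gamma_bessel (u s t : R) : R := gamma_density (H + 2^-1) t * bessel_weight (lambda * u) s.

(** For x > 0, F(u, x) = 4 x (x + u) / u^2 = eta^2 - 1, and [f] is the derivative of [F] in x. [kk]
    is the product of two kernels with the tempering removed, and [K] collects the factors depending
    on u alone. *)
Let eta (u x : R) : R := (2 * x + u) / u.
Let kk (u x : R) : R := kern H lambda x * kern H lambda (x + u) * expR (lambda * (2 * x + u)).
Let K (u : R) : R := (lambda * u / 2) `^ (H + 2^-1) * (4 / u ^+ 2) `^ (H - 2^-1) * (4 / u).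
Let F (u x : R) : R := 4 / u ^+ 2 * (x * `|x| + u * x).
Let f (u x : R) : R := 4 / u ^+ 2 * (2 * `|x| + u).

Let kkE u x : 0 < u -> 0 < x -> kk u x = x `^ (H - 2^-1) * (x + u) `^ (H - 2^-1).
Proof.
move=> u0 x0; rewrite /kk !kern_pos ?addr_gt0//.
have -> : expR (lambda * (2 * x + u)) = (expR (- (lambda * x)))^-1 * (expR (- (lambda * (x + u))))^-1.
  by rewrite -!expRN !opprK -expRD; congr expR; ring.
by field; rewrite !gt_eqF ?expR_gt0.
Qed.

(** As F = eta^2 - 1, the factor e^(-t) with t = (lambda u / 2) e^(-s) F turns e^s + e^(-s) in the
    Bessel exponent into e^s + eta^2 e^(-s). For x <= 0 both sides vanish. *)
Let pointwise (u s x : R) : 0 < u ->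
  lambda * u / 2 * expR (- s) * gamma_bessel u s (lambda * u / 2 * expR (- s) * F u x) * f u x =
  K u * kk u x * eta u x * (expR (- (s / 2)) * expR (gig_exponent (lambda * u) (eta u x) s)).
Proof.
move=> u0; have A0 : 0 < lambda * u / 2 by rewrite divr_gt0// mulr_gt0.
have u2 : 0 < 4 / u ^+ 2 by rewrite divr_gt0// exprn_gt0.
have c0 : 0 < lambda * u / 2 * expR (- s) by rewrite mulr_gt0// expR_gt0.
rewrite /gamma_bessel /gamma_density.
case: (ltP 0 x) => x0; last first.
  have F0 : F u x <= 0.
    have -> : F u x = 4 / u ^+ 2 * (x * (`|x| + u)) by rewrite /F; ring.
    apply: mulr_ge0_le0; first exact: ltW.
    by apply: mulr_le0_ge0 => //; rewrite addr_ge0// ltW.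
  have -> : (0 < lambda * u / 2 * expR (- s) * F u x) = false.
    by apply/negbTE; rewrite -leNgt mulr_ge0_le0// ltW.
  by rewrite /kk kern_neg// !(mul0r, mulr0).
have F0 : F u x = 4 / u ^+ 2 * (x * (x + u)).
  by rewrite /F gtr0_norm//; ring.
have xu0 : 0 < x + u by rewrite addr_gt0.
have xxu : 0 < x * (x + u) by rewrite mulr_gt0.
have FF : 0 < F u x by rewrite F0 mulr_gt0.
rewrite mulr_gt0// kkE// /f gtr0_norm//.
have e1 : H + 2^-1 - 1 = H - 2^-1 by field.
rewrite e1 (powRM _ (ltW c0) (ltW FF)) {1}F0 (powRM _ (ltW u2) (ltW xxu)) (powRM _ (ltW x0) (ltW xu0)).
rewrite (powRM _ (ltW A0) (expR_ge0 _)) -expRM.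
have -> : K u = (lambda * u / 2) `^ (H - 2^-1) * (lambda * u / 2) * (4 / u ^+ 2) `^ (H - 2^-1) * (4 / u).
  rewrite /K; congr (_ * _ * _); rewrite -[X in _ = _ * X]powRr1 ?ltW// -powRD ?(gt_eqF A0) ?implybT//.
  by congr (_ `^ _); field.
have E1 : bessel_weight (lambda * u) s * expR (- (lambda * u / 2 * expR (- s) * F u x)) =
    expR (H * s) * expR (gig_exponent (lambda * u) (eta u x) s).
  rewrite /bessel_weight -!expRD; congr expR.
  rewrite /bessel_exponent /gig_exponent F0 /eta; field; exact: lt0r_neq0.
have E2 : expR (- s) * expR (- s * (H - 2^-1)) * expR (H * s) = expR (- (s / 2)).
  by rewrite -!expRD; congr expR; field.
have E3 : 4 / u ^+ 2 * (2 * x + u) = 4 / u * eta u x.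
  by rewrite /eta; field; exact: lt0r_neq0.
rewrite E3 -E2.
move: E1; move: (bessel_weight _ _) (expR (- (_ * F u x))) (expR (gig_exponent _ _ _)) => p q r E1.
move: (_ `^ _) (_ `^ _) (_ `^ _) (_ `^ _) => q1 q2 q3 q4.
transitivity (lambda * u / 2 * expR (- s) * (q1 * expR (- s * (H - 2^-1)) * (q2 * (q3 * q4)) * (p * q)) * (4 / u * eta u x)); first by ring.
by rewrite E1; ring.
Qed.

Let gamma_bessel_substitution (u s : R) : 0 < u ->
  (\int[mu]_t (gamma_bessel u s t)%:E =
   \int[mu]_x (K u * kk u x * eta u x *
     (expR (- (s / 2)) * expR (gig_exponent (lambda * u) (eta u x) s)))%:E)%E.
Proof.
move=> u0; have A0 : 0 < lambda * u / 2 by rewrite divr_gt0// mulr_gt0.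
have u2 : 0 < 4 / u ^+ 2 by rewrite divr_gt0// exprn_gt0.
have c0 : 0 < lambda * u / 2 * expR (- s) by rewrite mulr_gt0// expR_gt0.
set c := lambda * u / 2 * expR (- s) in c0.
have mg : measurable_fun [set: R] (fun t => (gamma_bessel u s t)%:E).
  by apply/measurable_EFinP; apply: measurable_funM => //; exact: measurable_gamma_density.
have g0 t : (0 <= (gamma_bessel u s t)%:E)%E by rewrite lee_fin mulr_ge0// gamma_density_ge0.
have S := ge0_integral_scale c0 mg g0.
have -> : (\int[mu]_t (gamma_bessel u s t)%:E = c%:E * \int[mu]_t (gamma_bessel u s (c * t))%:E)%E.
  by rewrite S muleA -EFinM mulfV ?mul1e// gt_eqF.
have cf : continuous (f u).
  move=> x; apply: cvgM; first exact: cvg_cst.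
  apply: cvgD; last exact: cvg_cst.
  by apply: cvgM; [exact: cvg_cst|exact: norm_continuous].
have f0 x : 0 <= f u x by rewrite mulr_ge0 ?(ltW u2)// addr_ge0 ?mulr_ge0// ltW.
have dF (x : R) : is_derive x (1 : R) (F u) (f u x).
  have d1 := is_derive_mul_normr x.
  have -> : F u = (fun x => (4 / u ^+ 2) *: (x * `|x| + u *: x)) by [].
  by apply: is_derive_eq; rewrite /f /GRing.scale/= mulr1.
have incF : {homo (F u) : x y / x < y}.
  move=> x y xy; rewrite /F ltr_pM2l// -subr_gt0.
  have -> : y * `|y| + u * y - (x * `|x| + u * x) = (y * `|y| - x * `|x|) + u * (y - x) by ring.
  apply: ltr_wpDl; last by rewrite mulr_gt0// subr_gt0.
  rewrite subr_ge0; case: (leP 0 x) => x0.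
    rewrite (ger0_norm x0) (ger0_norm (le_trans x0 (ltW xy))); nra.
  rewrite (ltr0_norm x0); case: (leP 0 y) => y0.
    rewrite (ger0_norm y0); nra.
  rewrite (ltr0_norm y0); nra.
have sF y : exists x y', F u x <= y <= F u y'.
  (* The linear part of [F u] at this [w] is exactly |y|. *)
  pose w := u / 4 * `|y|.
  have w0 : 0 <= w by rewrite mulr_ge0// divr_ge0// ltW.
  have [y1 y2] : - `|y| <= y /\ y <= `|y| by split; [rewrite lerNl -normrN ler_norm|exact: ler_norm].
  have Fw : `|y| <= F u w.
    have -> : F u w = 4 / u ^+ 2 * (w * w) + `|y|.
      by rewrite /F ger0_norm// /w; field; exact: lt0r_neq0.
    by rewrite lerDr mulr_ge0 ?(ltW u2)// mulr_ge0.
  have FN : F u (- w) = - F u w by rewrite /F normrN; ring.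
  exists (- w), w; rewrite FN; apply/andP; split; first by lra.
  by lra.
have mgc : measurable_fun [set: R] (fun t => (gamma_bessel u s (c * t))%:E).
  by apply: (measurableT_comp mg); exact: measurable_funM.
have gc0 t : (0 <= (gamma_bessel u s (c * t))%:E)%E by exact: g0.
rewrite (ge0_change_of_variables cf f0 dF incF sF mgc gc0).
rewrite -ge0_integralZl; last 4 first.
- exact: measurableT.
- apply: emeasurable_funM.
    apply: (measurableT_comp mgc); apply: continuous_measurable_fun => x.
    by apply: differentiable_continuous; apply/derivable1_diffP; have [] := dF x.
  by apply/measurable_EFinP; exact: continuous_measurable_fun.
- by move=> x _; apply: mule_ge0; [exact: g0|rewrite lee_fin].
- by rewrite lee_fin ltW.
by apply: eq_integral => x _; rewrite -!EFinM -(pointwise s x u0) mulrA.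
Qed.

Let constant_simpl u : 0 < u ->
  K u * Num.sqrt (pi / (lambda * u / 2)) = 2 * Num.sqrt pi * ((u / (2 * lambda)) `^ H)^-1.
Proof.
move=> u0; have A0 : 0 < lambda * u / 2 by rewrite divr_gt0// mulr_gt0.
have u2 : 0 < 4 / u ^+ 2 by rewrite divr_gt0// exprn_gt0.
have l2 : 0 < 2 * lambda by rewrite mulr_gt0.
have -> : u / (2 * lambda) = (lambda * u / 2 * (4 / u ^+ 2))^-1.
  by field; rewrite !gt_eqF.
rewrite invr_powR; last exact: mulr_ge0 (ltW A0) (ltW u2).
rewrite invrK (powRM H (ltW A0) (ltW u2)) /K.
set A := lambda * u / 2 in A0 *.
rewrite powRD ?(gt_eqF A0) ?implybT// powRB ?(gt_eqF u2) ?implybT//.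
rewrite (powR12_sqrt (ltW A0)) (powR12_sqrt (ltW u2)).
have -> : Num.sqrt (pi / A) = Num.sqrt pi / Num.sqrt A by rewrite sqrtrM ?pi_ge0// sqrtrV// ltW.
have -> : Num.sqrt (4 / u ^+ 2) = 2 / u.
  have -> : 4 / u ^+ 2 = (2 / u) ^+ 2 by field; exact: lt0r_neq0.
  by rewrite sqrtr_sqr ger0_norm// divr_ge0// ltW.
have sA : Num.sqrt A != 0 by rewrite gt_eqF// sqrtr_gt0.
move: (A `^ H) (_ `^ H) (Num.sqrt pi) => p q r.
by field; rewrite sA gt_eqF.
Qed.

Let eta_gt0 (u x : R) : 0 < u -> 0 < x -> 0 < eta u x.
Proof. by move=> u0 x0; apply: divr_gt0 => //; apply: addr_gt0 => //; apply: mulr_gt0. Qed.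

(** Since u eta = 2 x + u, the factor e^(-lambda u eta) of [gig_integral] is the tempering missing
    from [kk], and eta cancels. *)
Let gig_simpl (u x : R) : 0 < u -> 0 < x ->
  K u * kk u x * eta u x *
    (Num.sqrt (pi / (lambda * u / 2)) * expR (- (lambda * u * eta u x)) / eta u x) =
  K u * Num.sqrt (pi / (lambda * u / 2)) * (kern H lambda x * kern H lambda (x + u)).
Proof.
move=> u0 x0; have e0 := eta_gt0 u0 x0.
have -> : lambda * u * eta u x = lambda * (2 * x + u) by rewrite /eta; field; exact: lt0r_neq0.
have E1 : expR (lambda * (2 * x + u)) * expR (- (lambda * (2 * x + u))) = 1 by rewrite expRxMexpNx_1.
transitivity (K u * Num.sqrt (pi / (lambda * u / 2)) * (kern H lambda x * kern H lambda (x + u)) *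
  (expR (lambda * (2 * x + u)) * expR (- (lambda * (2 * x + u))))).
  by rewrite /kk; field; exact: lt0r_neq0.
by rewrite E1 mulr1.
Qed.

Let kern_cov_solve (u g b k : R) : 0 < u ->
  g * b = K u * Num.sqrt (pi / (lambda * u / 2)) * k ->
  k = g / Num.sqrt pi * (u / (2 * lambda)) `^ H * (2^-1 * b).
Proof.
move=> u0; rewrite constant_simpl// => gb.
have pi0 : Num.sqrt (pi : R) != 0 by rewrite gt_eqF// sqrtr_gt0 pi_gt0.
have p0 : (u / (2 * lambda)) `^ H != 0 by rewrite gt_eqF// powR_gt0// divr_gt0// mulr_gt0.
transitivity (g * b / (2 * Num.sqrt pi / (u / (2 * lambda)) `^ H)).
  by rewrite gb; field; rewrite pi0 p0.
by field; rewrite pi0 p0.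
Qed.

(** The double integral of [gamma_bessel] is Gamma(H + 1/2) times 2 K_H(lambda u). Replacing t by x
    and integrating first in s, by [gig_integral], turns it into a multiple of the
    autocovariance. *)
Lemma kern_cov_bessel (u : R) : 0 < u ->
  kern_cov H lambda u =
  Gamma (H + 2^-1) / Num.sqrt pi * (u / (2 * lambda)) `^ H * besselK H (lambda * u).
Proof.
move=> u0.
have z0 : 0 < lambda * u by rewrite mulr_gt0.
have K0 : 0 < K u.
  have A0 : 0 < lambda * u / 2 by rewrite divr_gt0.
  have u2 : 0 < 4 / u ^+ 2 by rewrite divr_gt0// exprn_gt0.
  by apply: mulr_gt0; [apply: mulr_gt0; exact: powR_gt0|exact: divr_gt0].
have kk0 x : 0 <= kk u x by rewrite /kk; apply: mulr_ge0; [apply: mulr_ge0; exact: kern_ge0|exact: expR_ge0].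
have mkk : measurable_fun [set: R] (kk u).
  apply: measurable_funM.
    apply: measurable_funM; first exact: measurable_kern.
    by apply: (measurableT_comp (measurable_kern H lambda)); exact: measurable_funD.
  apply: measurableT_comp; first exact: measurable_expR.
  by apply: measurable_funM => //; apply: measurable_funD => //; exact: measurable_funM.
have meta : measurable_fun [set: R] (eta u).
  by apply: measurable_funM => //; apply: measurable_funD => //; exact: measurable_funM.
pose a (x : R) : R := K u * kk u x * eta u x.
have a0 x : 0 <= a x.
  case: (leP x 0) => x0; first by rewrite /a /kk kern_neg// !(mul0r, mulr0).
  apply: mulr_ge0; first by rewrite mulr_ge0 ?(ltW K0).
  by rewrite divr_ge0 ?(ltW u0)// addr_ge0 ?(ltW u0)// mulr_ge0// ltW.
pose g (z : R * R) : R := a z.1 * (expR (- (z.2 / 2)) * expR (gig_exponent (lambda * u) (eta u z.1) z.2)).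
have g0 z : (0 <= (g z)%:E)%E by rewrite lee_fin; apply: mulr_ge0; [exact: a0|apply: mulr_ge0; exact: expR_ge0].
have mg : measurable_fun [set: R * R] (fun z => (g z)%:E).
  have me2 : measurable_fun [set: R * R] (fun z : R * R => expR z.2).
    by apply: measurableT_comp; [exact: measurable_expR|exact: measurable_snd].
  have meN2 : measurable_fun [set: R * R] (fun z : R * R => expR (- z.2)).
    by apply: measurableT_comp; [exact: measurable_expR|apply: measurableT_comp => //; exact: measurable_snd].
  have meta2 : measurable_fun [set: R * R] (fun z : R * R => eta u z.1).
    exact: (measurableT_comp meta measurable_fst).
  apply/measurable_EFinP; apply: measurable_funM.
    apply: (@measurableT_comp _ _ _ _ _ _ a); last exact: measurable_fst.
    by apply: measurable_funM => //; exact: measurable_funM.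
  apply: measurable_funM.
    apply: measurableT_comp; first exact: measurable_expR.
    apply: measurableT_comp => //; apply: measurable_funM => //; exact: measurable_snd.
  apply: measurableT_comp; first exact: measurable_expR.
  apply: measurableT_comp => //; apply: measurable_funM => //; apply: measurable_funD => //.
  by apply: measurable_funM => //; exact: measurable_funX.
have mgam : measurable_fun [set: R] (fun t => (gamma_density (H + 2^-1) t)%:E).
  by apply/measurable_EFinP; exact: measurable_gamma_density.
have mbw : measurable_fun [set: R] (fun s => (bessel_weight (lambda * u) s)%:E).
  exact/measurable_EFinP.
set G := (\int[mu]_t (gamma_density (H + 2^-1) t)%:E)%E.
set B := (\int[mu]_s (bessel_weight (lambda * u) s)%:E)%E.
have G0 : (0 <= G)%E by apply: integral_ge0 => t _; rewrite lee_fin gamma_density_ge0.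
have B0 : (0 <= B)%E by apply: integral_ge0 => t _; rewrite lee_fin.
have hp : 0 < H + 2^-1 by rewrite addr_gt0.
have J1 : (\int[mu]_s \int[mu]_t (gamma_bessel u s t)%:E = G * B)%E.
  transitivity (\int[mu]_s (G * (bessel_weight (lambda * u) s)%:E))%E.
    apply: eq_integral => s _; rewrite muleC.
    rewrite -ge0_integralZl; [|exact: measurableT|exact: mgam
      |by move=> t _; rewrite lee_fin gamma_density_ge0|by rewrite lee_fin].
    by apply: eq_integral => t _; rewrite -EFinM mulrC.
  by rewrite ge0_integralZl; [|exact: measurableT|exact: mbw|by move=> s _; rewrite lee_fin|exact: G0].
have J2 : (\int[mu]_s \int[mu]_t (gamma_bessel u s t)%:E =
    \int[mu]_x \int[mu]_s (g (x, s))%:E)%E.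
  under eq_integral => s _ do rewrite gamma_bessel_substitution//.
  exact: (lebesgue_tonelli mg g0).
pose C := K u * Num.sqrt (pi / (lambda * u / 2)).
have C0 : 0 < C.
  apply: mulr_gt0; first exact: K0.
  by rewrite sqrtr_gt0; apply: divr_gt0; [exact: pi_gt0|apply: divr_gt0; [exact: z0|exact: ltr0Sn]].
have sk := kern_sqint hH hl; have sku := kern_shift_sqint hH hl u.
have J3 : (\int[mu]_x \int[mu]_s (g (x, s))%:E = (C * kern_cov H lambda u)%:E)%E.
  transitivity (\int[mu]_x (C%:E * (kern H lambda x * kern H lambda (x + u))%:E))%E.
    apply: eq_integral => x _; rewrite /g/=.
    have mgig := measurable_gig_weight (lambda * u) (eta u x).
    under eq_integral => s _ do rewrite EFinM.
    rewrite ge0_integralZl; [|exact: measurableT|exact: mgig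
      |by move=> s _; rewrite lee_fin mulr_ge0 ?expR_ge0|by rewrite lee_fin a0].
    case: (leP x 0) => x0.
      have k0 : kern H lambda x = 0 by exact: kern_neg.
      have ax : a x = 0 by rewrite /a /kk k0 !mul0r mulr0 mul0r.
      by rewrite ax k0 mul0r mul0e mule0.
    rewrite (gig_integral z0 (eta_gt0 u0 x0)) -!EFinM; congr EFin; exact: gig_simpl.
  have ikk := sqint_integrableM sk sku.
  rewrite (integralZl measurableT ikk) [RHS]EFinM; congr (_ * _)%E.
  rewrite /kern_cov /ip /Rintegral fineK; first by [].
  exact: (integrable_fin_num measurableT ikk).
have fG : (G < +oo)%E by exact: gamma_density_lty.
have pG : (0 < G)%E by exact: gamma_density_gt0.
have GB : (G * B = (C * kern_cov H lambda u)%:E)%E by rewrite -J1 J2 J3.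
(* Finiteness of the Bessel integral comes out of the identity: [G] is positive and the product is
   finite. *)
have fB : (B < +oo)%E.
  rewrite ltey; apply/eqP => BE; move: GB; rewrite BE gt0_muley//.
have GE : Gamma (H + 2^-1) = fine G by rewrite Gamma_gamma_density.
have BE : besselK H (lambda * u) = 2^-1 * fine B by rewrite (besselK_integral fB).
have fnG : G \is a fin_num by rewrite ge0_fin_numE.
have fnB : B \is a fin_num by rewrite ge0_fin_numE.
have {}GB : fine G * fine B = C * kern_cov H lambda u.
  by apply: EFin_inj; rewrite EFinM (fineK fnG) (fineK fnB).
by rewrite GE BE; exact: (kern_cov_solve u0 GB).
Qed.

Lemma tfbm_varE (u : R) : 0 <= u -> tfbm_var H lambda u = tfbm_C2_t2H H lambda u.
Proof.
rewrite le_eqVlt => /predU1P[<-|u0].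
  by rewrite /tfbm_var /tfbm_C2_t2H ltxx subrr.
rewrite /tfbm_var /tfbm_C2_t2H u0 /tfbm_C2 kern_cov0// kern_cov_bessel//.
have l2 : 0 < 2 * lambda by rewrite mulr_gt0.
have l2' : 0 <= (2 * lambda)^-1 by rewrite invr_ge0 ltW.
rewrite (powRM (2 * H) (ltW l2) (ltW u0)) (powRM H (ltW l2) (ltW u0)) (powRM H (ltW u0) l2').
have -> : (2 * lambda)^-1 `^ H = ((2 * lambda) `^ H)^-1.
  by rewrite invr_powR// ltW.
have -> : u `^ (2 * H) = u `^ H * u `^ H.
  by rewrite -powRD ?(gt_eqF u0) ?implybT//; congr (_ `^ _); ring.
have p1 : u `^ H != 0 by rewrite gt_eqF// powR_gt0.
have p2 : (2 * lambda) `^ H != 0 by rewrite gt_eqF// powR_gt0.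
have p3 : (2 * lambda) `^ (2 * H) != 0 by rewrite gt_eqF// powR_gt0.
have p4 : Num.sqrt (pi : R) != 0 by rewrite gt_eqF// sqrtr_gt0 pi_gt0.
by field; rewrite p1 p2 p3 p4.
Qed.

End bessel.

(** * Exponential averages and their limiting covariances *)

Section exponential_average.
Context {R : realType}.
Notation mu := (@lebesgue_measure R).
Variable b : R.
Hypothesis b0 : 0 < b.
Local Open Scope ereal_scope.

Let expo : probability (measurableTypeR R) R :=
  exponential_distribution_exponential_prob__canonical__probability_measure_Probability b0.

Let measurable_toR : measurable_fun [set: measurableTypeR R] (fun x : measurableTypeR R => x : R).
Proof. exact: (@measurable_id _ R). Qed.

Let expo_id : {mfun measurableTypeR R >-> R} :=
  HB.pack (fun x : measurableTypeR R => x : R) (isMeasurableFun.Build _ _ _ _ _ measurable_toR).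

(* As for [stdn], a copy of the exponential law on [R] with its Borel structure. *)
Definition eps : probability R R := distribution expo expo_id.

Lemma ge0_integral_eps (f : R -> \bar R) :
  measurable_fun [set: R] f -> (forall x, 0 <= f x) ->
  \int[eps]_x f x = \int[mu]_x (f x * (exponential_pdf b x)%:E).
Proof.
move=> mf f0; rewrite /eps /= ge0_integral_distribution//.
apply: (@ge0_integral_density _ (measurableTypeR R) R mu expo (exponential_pdf b)) => //.
- exact: measurable_exponential_pdf.
- by move=> x; apply: exponential_pdf_ge0; exact: ltW.
Qed.

Let pdf0 (t : R) : (t < 0)%R -> exponential_pdf b t = 0%R.
Proof. exact: lt0_exponential_pdf. Qed.

Let pdf_pos (t : R) : (0 <= t)%R -> exponential_pdf b t = (b * expR (- b * t))%R.
Proof. by move=> t0; rewrite exponential_pdfE. Qed.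

Lemma eps_ae_ge0 : {ae eps, forall t : R, (0 <= t)%R}.
Proof.
exists (`]-oo, 0%R[%classic : set R); split => //.
  rewrite -[X in eps X]setIT -integral_indic// ge0_integral_eps.
  - apply: integral0_eq => t _; rewrite indicE mem_setE in_itv/=.
    by case: ltP => t0; rewrite ?mul0e// pdf0// mule0.
  - by apply/measurable_EFinP; exact: measurable_indic.
  - by move=> t; rewrite lee_fin.
by move=> t /= /negP; rewrite -ltNge in_itv.
Qed.

(** The probability that one of two independent exponential times exceeds the other. *)
Lemma integral_eps_expR : \int[eps]_t (expR (- b * t))%:E = (2^-1)%:E.
Proof.
have b20 : (0 < 2 * b)%R by rewrite mulr_gt0.
rewrite ge0_integral_eps; last 2 first.
- apply/measurable_EFinP; apply: measurableT_comp; first exact: measurable_expR.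
  exact: measurable_funM.
- by move=> t; rewrite lee_fin expR_ge0.
transitivity (\int[mu]_t ((2^-1)%:E * (exponential_pdf (2 * b) t)%:E)).
  apply: eq_integral => t _; rewrite -!EFinM; congr EFin.
  case: (leP 0%R t) => t0.
    rewrite pdf_pos// exponential_pdfE// mulrCA -expRD.
    have -> : (- b * t + - b * t = - (2 * b) * t)%R by ring.
    by field.
  by rewrite pdf0// lt0_exponential_pdf// !mulr0.
rewrite ge0_integralZl; last 4 first.
- exact: measurableT.
- by apply/measurable_EFinP; exact: measurable_exponential_pdf.
- by move=> t _; rewrite lee_fin exponential_pdf_ge0// ltW.
- by rewrite lee_fin invr_ge0.
by rewrite (integral_exponential_pdf b20) mule1.
Qed.

Section memoryless.
Variable v : R -> R.
Hypothesis mv : measurable_fun [set: R] v.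
Hypothesis v_ge0 : forall t, (0 <= v t)%R.
Hypothesis v0 : v 0%R = 0%R.

(** Cutting [v] off at negative arguments splits v(|t - s|) according to the order of s and t. *)
Let V (t : R) : R := if (0 < t)%R then v t else 0%R.

Let mV : measurable_fun [set: R] (fun t => (V t)%:E).
Proof.
apply/measurable_EFinP; apply: measurable_fun_ifT => //; exact: measurable_fun_ltr.
Qed.

Let V0 t : 0 <= (V t)%:E.
Proof. by rewrite lee_fin /V; case: ifP. Qed.

Let integral_eps_V : \int[eps]_t (V t)%:E = \int[eps]_t (v t)%:E.
Proof.
rewrite ge0_integral_eps// [RHS]ge0_integral_eps; last 2 first.
- exact/measurable_EFinP.
- by move=> t; rewrite lee_fin.
apply: eq_integral => t _; rewrite /V; case: (ltgtP 0%R t) => t0 //.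
  by rewrite pdf0// !mule0.
by rewrite -t0 v0.
Qed.

(* Memorylessness of the exponential law. *)
Let integral_eps_shift (t : R) : (0 <= t)%R ->
  \int[eps]_s (V (s - t))%:E = (expR (- b * t))%:E * \int[eps]_s (V s)%:E.
Proof.
move=> t0.
have mVt : measurable_fun [set: R] (fun s : R => (V (s - t))%:E).
  by apply: (measurableT_comp mV); exact: measurable_funB.
have mp (c : R) : measurable_fun [set: R] (fun s : R => (exponential_pdf b (s + c))%:E).
  apply/measurable_EFinP; apply: (measurableT_comp (measurable_exponential_pdf b)).
  exact: measurable_funD.
have p0 s : 0 <= (exponential_pdf b s)%:E by rewrite lee_fin exponential_pdf_ge0// ltW.
rewrite ge0_integral_eps//.
have mVp : measurable_fun [set: R] (fun s : R => (V s)%:E * (exponential_pdf b (s + t))%:E).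
  exact: emeasurable_funM.
transitivity (\int[mu]_s ((fun s : R => (V s)%:E * (exponential_pdf b (s + t))%:E) (s + - t)%R)).
  by apply: eq_integral => s _ /=; rewrite subrK.
rewrite (@ge0_integral_shift R (fun s : R => (V s)%:E * (exponential_pdf b (s + t))%:E) (- t)%R mVp); last first.
  by move=> s; apply: mule_ge0; [exact: V0|exact: p0].
rewrite ge0_integral_eps// -ge0_integralZl; last 4 first.
- exact: measurableT.
- apply: emeasurable_funM => //; apply/measurable_EFinP; exact: measurable_exponential_pdf.
- by move=> s _; rewrite mule_ge0.
- by rewrite lee_fin expR_ge0.
apply: eq_integral => s _; rewrite -!EFinM; congr EFin; rewrite /V.
case: ltP => s0; last by rewrite !mul0r mulr0.
rewrite !pdf_pos ?addr_ge0// 1?ltW//.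
by rewrite mulrDr expRD; ring.
Qed.

(** Given that s exceeds t, the excess s - t is again exponential; each of the two orders has
    probability 1/2, so together they give one full mean of [v]. *)
Lemma integral_eps_dist :
  \int[eps]_t \int[eps]_s (v `|t - s|%R)%:E = \int[eps]_t (v t)%:E.
Proof.
have vE t s : (v `|t - s|%R)%:E = (V (s - t))%:E + (V (t - s))%:E.
  rewrite -EFinD; congr EFin; rewrite /V !subr_gt0.
  case: (ltgtP t s) => ts; rewrite ?addr0 ?add0r.
  - by rewrite distrC gtr0_norm// subr_gt0.
  - by rewrite gtr0_norm// subr_gt0.
  - by rewrite ts subrr normr0 v0.
have mV2 : measurable_fun [set: R * R] (fun z : R * R => (V (z.2 - z.1))%:E).
  by apply: (measurableT_comp mV); exact: measurable_funB.
have mV2' : measurable_fun [set: R * R] (fun z : R * R => (V (z.1 - z.2))%:E).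
  by apply: (measurableT_comp mV); exact: measurable_funB.
have E : \int[eps]_t \int[eps]_s (V (s - t))%:E = (2^-1)%:E * \int[eps]_t (V t)%:E.
  transitivity (\int[eps]_t ((expR (- b * t))%:E * \int[eps]_s (V s)%:E)).
    apply: ae_eq_integral => //.
    - exact: (@measurable_fun_fubini_tonelli_F _ _ R R R eps _ mV2 (fun z => V0 _)).
    - apply: emeasurable_funM => //; apply/measurable_EFinP.
      apply: measurableT_comp; first exact: measurable_expR.
      exact: measurable_funM.
    - apply: filterS eps_ae_ge0 => t t0 _; exact: integral_eps_shift.
  rewrite ge0_integralZr//.
  - by rewrite integral_eps_expR.
  - apply/measurable_EFinP; apply: measurableT_comp; first exact: measurable_expR.
    exact: measurable_funM.
  - exact: integral_ge0.
have mV1 t : measurable_fun [set: R] (fun s : R => (V (s - t))%:E).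
  by apply: (measurableT_comp mV); exact: measurable_funB.
have mV1' t : measurable_fun [set: R] (fun s : R => (V (t - s))%:E).
  by apply: (measurableT_comp mV); exact: measurable_funB.
transitivity (\int[eps]_t (\int[eps]_s (V (s - t))%:E + \int[eps]_s (V (t - s))%:E)).
  apply: eq_integral => t _; rewrite -ge0_integralD//.
  by apply: eq_integral => s _; exact: vE.
rewrite ge0_integralD//; last 4 first.
- by move=> t _; exact: integral_ge0.
- exact: (@measurable_fun_fubini_tonelli_F _ _ R R R eps _ mV2 (fun z => V0 _)).
- by move=> t _; exact: integral_ge0.
- exact: (@measurable_fun_fubini_tonelli_F _ _ R R R eps _ mV2' (fun z => V0 _)).
rewrite (@fubini_tonelli _ _ R R R eps eps (fun z : R * R => (V (z.1 - z.2))%:E) mV2' (fun z => V0 _))/=.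
rewrite E -ge0_muleDl ?lee_fin ?invr_ge0// -EFinD.
have -> : (2^-1 + 2^-1 = 1 :> R)%R by field.
by rewrite mul1e integral_eps_V.
Qed.

End memoryless.

End exponential_average.

(** Were it zero, z would vanish almost everywhere, against its second moment 1. This constant
    compares E min(D^2, 1) with min(E D^2, 1) for a centred normal D. *)
Lemma stdn_min_sqr_gt0 {R : realType} : 0 < \int[@stdn R]_z Num.min (z ^+ 2) 1.
Proof.
have mm : measurable_fun [set: R] (fun z : R => Num.min (z ^+ 2) 1).
  by apply: measurable_minr => //; exact: measurable_funX.
have m0 (z : R) : 0 <= Num.min (z ^+ 2) 1 by rewrite le_min sqr_ge0 ler01.
have i1 : (@stdn R).-integrable setT (EFin \o (fun z : R => Num.min (z ^+ 2) 1)).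
  apply: (@bounded_integrable _ _ _ (@stdn R) _ 1) => // z.
  by rewrite ger0_norm// ge_min lexx orbT.
have I0 : 0 <= \int[@stdn R]_z Num.min (z ^+ 2) 1 by exact: Rintegral_ge0.
rewrite lt0r I0 andbT; apply/eqP => e.
have E : (\int[@stdn R]_z `|(Num.min (z ^+ 2) 1)%:E| = 0)%E.
  have := congr1 EFin e; rewrite /Rintegral fineK; last exact: (integrable_fin_num measurableT i1).
  move=> h; rewrite -[RHS]h; apply: eq_integral => z _; by rewrite /= ger0_norm.
have mE : measurable_fun [set: R] (fun z : R => (Num.min (z ^+ 2) 1)%:E) by exact/measurable_EFinP.
have /(ae_eq_integral_abs _ measurableT mE) ae0 := E.
have := @stdn_second_moment R.
rewrite (ae_eq_integral (cst 0%E)) ?integral0//.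
- by move=> /eqP; rewrite eq_sym onee_eq0.
- by apply/measurable_EFinP; exact: measurable_funX.
- apply: filterS ae0 => z /(_ I) [] h _; congr EFin; apply/eqP.
  move/eqP: h; rewrite /Num.min; case: ifPn => //.
  by move=> _; rewrite oner_eq0.
Qed.

Lemma min_mul_le {R : realType} (p y : R) : 0 <= p -> 0 <= y ->
  Num.min p 1 * Num.min y 1 <= Num.min (p * y) 1.
Proof.
move=> p0 y0.
have m0 (x : R) : 0 <= x -> 0 <= Num.min x 1 by move=> x0; rewrite le_min x0 ler01.
have mx (x : R) : Num.min x 1 <= x by rewrite ge_min lexx.
have m1 (x : R) : Num.min x 1 <= 1 by rewrite ge_min lexx orbT.
rewrite le_min; apply/andP; split; first by apply: ler_pM; rewrite ?m0 ?mx.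
by rewrite -[leRHS]mulr1; apply: ler_pM; rewrite ?m0 ?m1.
Qed.

Lemma min1_lt {R : realType} (x e : R) : Num.min x 1 < Num.min e 1 -> x < e.
Proof.
rewrite lt_min => /andP[h1 h2]; move: h1 h2; case: (leP x 1) => x1; first by [].
by rewrite ltxx.
Qed.

(** * Covariances of the tempered process and of its time averages *)

Section tfbm.
Context {R : realType} {d} {Omega : measurableType d} {P : probability Omega R}.
Variables (H lambda : R) (W B : R -> {RV P >-> R}).
Hypotheses (hH : 0 < H) (hl : 0 < lambda) (hW : two_sided_wiener W).
Hypothesis hB : forall t : R, 0 <= t -> is_wiener_integral W (tfbm_kernel H lambda t) (B t).
Hypothesis cB : forall w, {within `[0, +oo[, continuous (fun t : R => B t w)}.
Notation mu := (@lebesgue_measure R).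
Notation v := (tfbm_var H lambda).

Lemma tfbm_wiener_space t : 0 <= t -> wiener_space W (B t).
Proof.
by move=> t0; have [] := wiener_integral_isometry hW (measurable_tfbm_kernel H lambda t) (measurable_funPT _) (hB t0).
Qed.

Let sB t : 0 <= t -> sqint P (B t).
Proof. by move=> /tfbm_wiener_space/wiener_space_sqint. Qed.

Lemma tfbm_incr_wiener_space s t : 0 <= s -> 0 <= t -> wiener_space W (fun w => B t w - B s w).
Proof.
move=> s0 t0; have := wiener_spaceD hW (tfbm_wiener_space t0) (wiener_spaceZ hW (-1) (tfbm_wiener_space s0)).
by congr wiener_space; apply/funext => w; rewrite mulN1r.
Qed.

(** The increment is the Wiener integral of a difference of kernels, to which the isometry
    applies. *)
Lemma tfbm_ip_incr s t : 0 <= s -> 0 <= t ->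
  ip P (fun w => B t w - B s w) (fun w => B t w - B s w) = v `|t - s|.
Proof.
wlog st : s t / s <= t => [hwlog s0 t0|s0 t0].
  have [st|/ltW ts] := leP s t; first exact: hwlog.
  rewrite distrC -hwlog//; apply: eq_Rintegral => w _; ring.
have mk := measurable_tfbm_kernel H lambda.
have hI := is_wiener_integralB (mk t) (mk s) (measurable_funPT (B t)) (measurable_funPT (B s)) (hB t0) (hB s0).
have [||_ _ ->] := wiener_integral_isometry hW _ _ hI.
- exact: measurable_funB.
- exact: measurable_funB.
by rewrite ger0_norm ?subr_ge0// ip_kernelB.
Qed.

Lemma tfbm_ip_var t : 0 <= t -> ip P (B t) (B t) = v t.
Proof.
move=> t0.
have [_ _ ->] := wiener_integral_isometry hW (measurable_tfbm_kernel H lambda t) (measurable_funPT _) (hB t0).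
rewrite -[in RHS](subr0 t) -ip_kernelB//.
have k0 x : tfbm_kernel H lambda 0 x = 0 by rewrite tfbm_kernelE sub0r subrr.
by congr ip; apply/funext => x; rewrite k0 subr0.
Qed.

Lemma tfbm_cov s t : 0 <= s -> 0 <= t ->
  ip P (B s) (B t) = 2^-1 * (v s + v t - v `|t - s|).
Proof.
move=> s0 t0; rewrite -tfbm_ip_incr// -!tfbm_ip_var//.
have hs := sB s0; have ht := sB t0.
rewrite ipBl ?ipBr//; last exact: sqintB.
by rewrite (ipC P (B t) (B s)); move: (ip _ _ _) (ip _ _ _) (ip _ _ _) => x y z; field.
Qed.

Lemma tfbm_var_ge0 t : 0 <= t -> 0 <= v t.
Proof. by move=> t0; rewrite -tfbm_ip_var// ip_ge0. Qed.

Definition tfbm_varoo : R := 2 * kern_cov H lambda 0.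

Lemma tfbm_var_le t : v t <= tfbm_varoo.
Proof. by rewrite /tfbm_var lerBlDr lerDl mulr_ge0// kern_cov_ge0. Qed.

Lemma tfbm_var_cvgy : v t @[t --> +oo] --> tfbm_varoo.
Proof.
rewrite -[X in _ --> X]subr0 -[X in _ --> _ - X](mulr0 2).
apply: cvgB; first exact: cvg_cst.
by apply: cvgM; [exact: cvg_cst|exact: kern_cov_cvg0].
Qed.

Let Bmax (t : R) (w : Omega) : R := B (Num.max t 0) w.

Let cBmax w : continuous (Bmax ^~ w).
Proof. exact: (within_continuous_max (@cB w)). Qed.

(** If D is centred normal with variance v, then E min(D^2, 1) >= c min(v, 1), with c > 0 the value
    for variance 1. Path continuity makes the left side tend to 0, hence v as well. *)
Lemma tfbm_var_cvg0 (s : nat -> R) : (forall n, 0 <= s n) -> s n @[n --> \oo] --> 0 ->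
  v (s n) @[n --> \oo] --> 0.
Proof.
move=> s0 cs.
pose D n w := B (s n) w - B 0 w.
have wD n : wiener_space W (D n) by apply: tfbm_incr_wiener_space.
have vD n : ip P (D n) (D n) = v (s n).
  by rewrite (tfbm_ip_incr (lexx 0) (s0 n)) subr0 ger0_norm.
pose f (z : R * R) : R := Num.min (z.1 ^+ 2) 1.
have cf : continuous f.
  have cg : continuous (fun x : R => Num.min (x ^+ 2) 1).
    by move=> x; apply: (@continuous_min R R (fun x : R => x ^+ 2) (fun=> 1) x); [exact: exprn_continuous|exact: cvg_cst].
  move=> z; apply: (cvg_comp (fun z : R * R => z.1) (fun x : R => Num.min (x ^+ 2) 1)); last exact: cg.
  exact: cvg_fst.
have mf : measurable_fun [set: R * R] f.
  by apply: measurable_minr => //; apply: measurable_funX; exact: measurable_fst.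
have f01 z : `|f z| <= 1.
  by rewrite ger0_norm /f ?ge_min ?lexx ?orbT// le_min sqr_ge0 ler01.
set c := \int[@stdn R]_z Num.min (z ^+ 2) 1.
have c0 : 0 < c := stdn_min_sqr_gt0.
pose a n := \int[P]_w f (D n w, D n w).
have mg : measurable_fun [set: R] (fun x : R => (Num.min (x ^+ 2) 1)%:E).
  by apply/measurable_EFinP; apply: measurable_minr => //; exact: measurable_funX.
have g0 (x : R) : 0 <= Num.min (x ^+ 2) 1 by rewrite le_min sqr_ge0 ler01.
have cE : (\int[@stdn R]_x (Num.min (x ^+ 2) 1)%:E = c%:E)%E.
  rewrite /c /Rintegral fineK//; apply: integrable_fin_num => //.
  apply: (@bounded_integrable _ _ _ (@stdn R) _ 1); first exact/measurable_EFinP.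
  by move=> z; rewrite ger0_norm// ge_min lexx orbT.
have mg1 : measurable_fun [set: R * R] (fun z : R * R => (Num.min (z.1 ^+ 2) 1)%:E).
  by apply: (measurableT_comp mg); exact: measurable_fst.
have cE2 : (\int[@stdn R \x @stdn R]_z (Num.min (z.1 ^+ 2) 1)%:E = c%:E)%E.
  rewrite (@fubini_tonelli1 _ _ R R R (@stdn R) (@stdn R) _ mg1); last by move=> z; rewrite lee_fin.
  rewrite -cE; apply: eq_integral => x _; rewrite /fubini_F/=.
  by rewrite integral_cst//= probability_setT mule1.
have lower n : Num.min (v (s n)) 1 <= a n / c.
  have a0 : 0 <= a n by apply: Rintegral_ge0 => w _; exact: g0.
  rewrite ler_pdivlMr//; have [p0|p0] := ltP 0 (v (s n)); last first.
    apply: le_trans a0; rewrite mulr_le0_ge0 ?(ltW c0)//.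
    by rewrite ge_min p0.
  have [_ _ jg] := wiener_space_jgauss hW (wD n) (wD n).
  have pD : 0 < ip P (D n) (D n) by rewrite vD.
  have := jg pD f mf cf (ex_intro _ 1 f01); rewrite vD.
  have mfD : measurable_fun setT (fun w => f (D n w, D n w)).
    apply: (measurableT_comp mf); apply: measurable_pairR;
    exact: (sqint_measurable (wiener_space_sqint (wD n))).
  have aE : (\int[P]_w (f (D n w, D n w))%:E = (a n)%:E)%E.
    rewrite /a /Rintegral fineK//; apply: integrable_fin_num => //.
    exact: (@bounded_integrable _ _ _ P _ 1).
  rewrite aE => E; rewrite -lee_fin E EFinM -cE2.
  rewrite -ge0_integralZl//; last 2 first.
  - by move=> z _; rewrite lee_fin.
  - by rewrite lee_fin le_min ler01 ltW.
  apply: ge0_le_integral => //.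
  - by move=> z _; rewrite -EFinM lee_fin mulr_ge0// le_min ler01 ltW.
  - exact: emeasurable_funM.
  - apply/measurable_EFinP; apply: (measurableT_comp mf); apply: measurable_pairR.
      by apply: measurable_funM => //; exact: measurable_fst.
    by apply: measurable_funD; apply: measurable_funM.
  - move=> z _; rewrite -EFinM lee_fin /f /normal_coeff/= exprMn sqr_sqrtr; last exact: ltW.
    by apply: min_mul_le; [exact: ltW|exact: sqr_ge0].
have ca : a n @[n --> \oo] --> 0.
  have -> : 0 = \int[P]_w (cst 0 w) :> R by rewrite Rintegral_cst//= mul0r.
  apply: (@bounded_Rintegral_cvg _ _ _ P _ _ 1) => //.
  - move=> n; apply: (measurableT_comp mf); apply: measurable_pairR;
    exact: (sqint_measurable (wiener_space_sqint (wD n))).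
  - apply: aeW => w.
    have cD : D n w @[n --> \oo] --> 0.
      rewrite -(subrr (B 0 w)); apply: cvgB; last exact: cvg_cst.
      have h : Bmax t w @[t --> (0 : R)] --> Bmax 0 w := @cBmax w 0.
      have E : Bmax 0 w = B 0 w by rewrite /Bmax (max_idPl (lexx 0)).
      have := cvg_comp s (Bmax ^~ w) cs h; rewrite E.
      by apply: cvg_eq1 => n /=; rewrite /Bmax (max_idPl (s0 n)).
    rewrite /cst (_ : 0 = f (0, 0)); last by rewrite /f/= expr0n/= min_l.
    have cp : (D n w, D n w) @[n --> \oo] --> ((0 : R), (0 : R)) by exact: (cvg_pair cD cD).
    exact: (cvg_comp (fun n => (D n w, D n w)) f cp (cf _)).
  - by move=> w; rewrite normr0.
apply/cvgrPdist_lt => e e0.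
have e1 : 0 < Num.min e 1 * c by rewrite mulr_gt0// lt_min e0 ltr01.
move/cvgrPdist_lt : ca => /(_ _ e1); apply: filterS => n.
have a0 : 0 <= a n by apply: Rintegral_ge0 => w _; exact: g0.
rewrite sub0r normrN ger0_norm// -ltr_pdivrMr// => h.
rewrite sub0r normrN ger0_norm ?tfbm_var_ge0//.
by apply: min1_lt; exact: le_lt_trans (lower n) h.
Qed.

Lemma tfbm_cvg_time (tau : nat -> R) (t : R) : (forall n, 0 <= tau n) -> 0 <= t ->
  tau n @[n --> \oo] --> t ->
  ip P (fun w => B t w - B (tau n) w) (fun w => B t w - B (tau n) w) @[n --> \oo] --> 0.
Proof.
move=> tau0 t0 ct.
have h0 : t - tau n @[n --> \oo] --> (0 : R).
  by rewrite -(subrr t); apply: cvgB; [exact: cvg_cst|exact: ct].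
have h : `|t - tau n| @[n --> \oo] --> 0.
  by have := cvg_comp _ (fun x : R => `|x|) h0 (@norm_continuous _ _ (0 : R)); rewrite normr0.
have := tfbm_var_cvg0 (fun n => normr_ge0 (t - tau n)) h.
by apply: cvg_eq1 => n; rewrite tfbm_ip_incr.
Qed.

(** The process read on a clock [tau]: the identity will give N_T and the reversal t |-> T - t will
    give P_T, both as averages over an exponential time. *)
Definition timed (tau : R -> R) (t : R) (w : Omega) : R := B (tau t) w.

Section time_change.
Variables (tau : R -> R) (T : R).
Hypotheses (T0 : 0 <= T) (ctau : continuous tau) (tau0 : forall t, 0 <= tau t).
Hypothesis tau_max : forall t, tau (Num.max t 0) = tau t.

Let tau_norm t : Num.max (tau t) 0 = tau t. Proof. exact/max_idPl. Qed.

Lemma timed_max t w : timed tau (Num.max t 0) w = timed tau t w.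
Proof. by rewrite /timed tau_max. Qed.

Lemma timed_continuous w : continuous (fun t => timed tau t w).
Proof.
have -> : (fun t => timed tau t w) = (fun t => Bmax (tau t) w).
  by apply/funext => t; rewrite /Bmax tau_norm.
move=> t; apply: (cvg_comp tau (Bmax ^~ w)); [exact: ctau|exact: cBmax].
Qed.

Lemma timed_wiener_space t : wiener_space W (timed tau t).
Proof. exact: tfbm_wiener_space. Qed.

Lemma timed_variance t : ip P (timed tau t) (timed tau t) <= tfbm_varoo.
Proof. by rewrite tfbm_ip_var// tfbm_var_le. Qed.

Lemma timed_mean_continuous (s : nat -> R) t : (forall n, 0 <= s n) -> s n @[n --> \oo] --> t ->
  ip P (fun w => timed tau t w - timed tau (s n) w) (fun w => timed tau t w - timed tau (s n) w)
    @[n --> \oo] --> 0.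
Proof.
move=> s0 cs; apply: (@tfbm_cvg_time (tau \o s) (tau t)).
- by move=> n; exact: tau0.
- exact: tau0.
- exact: (cvg_comp s tau cs (@ctau t)).
Qed.

Variable eps : probability R R.

Definition timed_average : Omega -> R := average eps (cut (timed tau) T).

Lemma timed_average_wiener_space : wiener_space W timed_average.
Proof.
apply: (@wiener_space_average_cut _ _ _ _ W hW eps (timed tau) T tfbm_varoo).
- exact: T0.
- exact: timed_max.
- exact: timed_continuous.
- exact: timed_wiener_space.
- by move=> t _; exact: timed_variance.
- exact: timed_mean_continuous.
Qed.

Lemma ip_timed_average Q : sqint P Q ->
  ip P Q timed_average = \int[eps]_t (\1_(`[0, T[) t * ip P Q (timed tau t)).
Proof.
apply: (@ip_average_cut _ _ _ _ W eps (timed tau) T tfbm_varoo).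
- exact: T0.
- exact: timed_max.
- exact: timed_continuous.
- exact: timed_wiener_space.
- by move=> t _; exact: timed_variance.
Qed.

End time_change.

Lemma ip_timed_average2 (tau1 tau2 : R -> R) (T : R) (eps : probability R R) : 0 <= T ->
  continuous tau1 -> (forall t, 0 <= tau1 t) -> (forall t, tau1 (Num.max t 0) = tau1 t) ->
  continuous tau2 -> (forall t, 0 <= tau2 t) -> (forall t, tau2 (Num.max t 0) = tau2 t) ->
  ip P (timed_average tau1 T eps) (timed_average tau2 T eps) =
  \int[eps]_t (\1_(`[0, T[) t * \int[eps]_s (\1_(`[0, T[) s *
     (2^-1 * (v (tau2 t) + v (tau1 s) - v `|tau1 s - tau2 t|)))).
Proof.
move=> T0 c1 p1 m1 c2 p2 m2.
have s1 := wiener_space_sqint (timed_average_wiener_space T0 c1 p1 m1 eps).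
rewrite (ip_timed_average T0 c2 p2 m2 eps s1); apply: eq_Rintegral => t _; congr (_ * _).
rewrite ipC (ip_timed_average T0 c1 p1 m1 eps); last exact: sB.
by apply: eq_Rintegral => s _; congr (_ * _); exact: tfbm_cov.
Qed.

(** The variance is the second moment of a jointly measurable process, so Tonelli's theorem makes it
    measurable in time. *)
Lemma measurable_tfbm_var : measurable_fun [set: R] (fun t => v (Num.max t 0)).
Proof.
have -> : (fun t => v (Num.max t 0)) = (fun t => fine (\int[P]_w (Bmax t w ^+ 2)%:E)).
  apply/funext => t; have t0 : 0 <= Num.max t 0 by rewrite le_max lexx orbT.
  by rewrite (sqint_EFin (sB t0)) tfbm_ip_var.
have mB : measurable_fun [set: R * Omega] (fun z => Bmax z.1 z.2).
  apply: joint_measurable.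
  - by move=> t; exact: measurable_funPT.
  - exact: cBmax.
  - by move=> t w; rewrite /Bmax (max_idPl _)// le_max lexx orbT.
apply: measurableT_comp => //.
apply: (@measurable_fun_fubini_tonelli_F _ _ R Omega R P (fun z : R * Omega => (Bmax z.1 z.2 ^+ 2)%:E)).
  by apply/measurable_EFinP; exact: measurable_funX.
by move=> z; rewrite lee_fin sqr_ge0.
Qed.

End tfbm.

Lemma probability_Rintegral_cst {R : realType} {d} {T : measurableType d}
  (Q : probability T R) (c : R) : \int[Q]_x c = c.
Proof.
rewrite /Rintegral -[X in fine X]/(\int[Q]_x cst c%:E x)%E integral_cst//=.
by rewrite probability_setT mule1.
Qed.

(** * Forward and backward clocks *)

Section time_changes.
Context {R : realType}.

(** Clamping at 0 keeps both clocks continuous and nonnegative on the whole line. *)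
Definition forward_time (t : R) : R := Num.max t 0.
Definition backward_time (T t : R) : R := Num.max (T - Num.max t 0) 0.

Lemma forward_time_ge0 (t : R) : 0 <= forward_time t.
Proof. by rewrite /forward_time le_max lexx orbT. Qed.

Lemma backward_time_ge0 (T t : R) : 0 <= backward_time T t.
Proof. by rewrite /backward_time le_max lexx orbT. Qed.

Lemma forward_timeE (t : R) : 0 <= t -> forward_time t = t.
Proof. by move=> t0; rewrite /forward_time (max_idPl t0). Qed.

Lemma backward_timeE (T t : R) : 0 <= t -> t <= T -> backward_time T t = T - t.
Proof.
move=> t0 tT; rewrite /backward_time (max_idPl t0) (max_idPl _)//.
by rewrite subr_ge0.
Qed.

Lemma forward_time_max (t : R) : forward_time (Num.max t 0) = forward_time t.
Proof. by rewrite {1}/forward_time (max_idPl (forward_time_ge0 t)). Qed.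

Lemma backward_time_max (T t : R) : backward_time T (Num.max t 0) = backward_time T t.
Proof. by rewrite {1}/backward_time (max_idPl (forward_time_ge0 t)). Qed.

Lemma forward_time_continuous : continuous forward_time.
Proof.
move=> t; apply: (@continuous_max R R id (fun=> 0) t); [exact: cvg_id|exact: cvg_cst].
Qed.

Lemma backward_time_continuous (T : R) : continuous (backward_time T).
Proof.
move=> t; apply: (@continuous_max R R (fun t => T - forward_time t) (fun=> 0) t); last exact: cvg_cst.
by apply: cvgB; [exact: cvg_cst|exact: forward_time_continuous].
Qed.

End time_changes.

(** * Limits of the exponentially averaged covariances *)

Section exponential_limits.
Context {R : realType}.
Variables (b : R) (b0 : 0 < b).
Notation E := (eps b0).
Variables (v : R -> R) (A : R).
Hypothesis mv : measurable_fun [set: R] (fun t => v (Num.max t 0)).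
Hypothesis v_ge0 : forall t, 0 <= t -> 0 <= v t.
Hypothesis v_le : forall t, v t <= A.
Hypothesis v0 : v 0 = 0.
Hypothesis v_cvgy : v t @[t --> +oo] --> A.

Let vx (t : R) := v (Num.max t 0).
(** E v(tau) for tau exponential of rate b; by [beta2E] it is twice beta^2. *)
Definition exp_mean : R := \int[E]_t vx t.

Let vx_ge0 t : 0 <= vx t. Proof. by apply: v_ge0; rewrite le_max lexx orbT. Qed.
Let vx_le t : vx t <= A. Proof. exact: v_le. Qed.
Let A0 : 0 <= A. Proof. exact: le_trans (vx_ge0 0) (vx_le 0). Qed.
Let vx_norm t : `|vx t| <= A. Proof. by rewrite ger0_norm. Qed.
Let vxE t : 0 <= t -> vx t = v t. Proof. by move=> t0; rewrite /vx (max_idPl t0). Qed.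

Let integrable_vx : E.-integrable setT (EFin \o vx).
Proof. exact: (@bounded_integrable _ _ _ E _ A). Qed.

Let mdist : measurable_fun [set: R * R] (fun z => vx `|z.1 - z.2|).
Proof.
apply: (@measurableT_comp _ _ _ _ _ _ vx) => //.
by apply: measurableT_comp => //; exact: measurable_funB.
Qed.

Let J (t : R) : R := \int[E]_s vx `|s - t|.

Let mJ : measurable_fun [set: R] J.
Proof. exact: (@average_measurable _ _ R _ R E (fun s t => vx `|s - t|) mdist). Qed.

Let mdist1 t : measurable_fun [set: R] (fun s => vx `|s - t|).
Proof. exact: (measurableT_comp mdist (pair2_measurable t)). Qed.

Let integrable_dist t : E.-integrable setT (EFin \o (fun s => vx `|s - t|)).
Proof. exact: (@bounded_integrable _ _ _ E _ A). Qed.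

Let average_cst (c : R) : \int[E]_s c = c.
Proof. exact: probability_Rintegral_cst. Qed.

Let bounded_average (f : R -> R) (M : R) : measurable_fun setT f -> (forall s, `|f s| <= M) ->
  `|\int[E]_s f s| <= M.
Proof.
move=> mf fM; have M0 : 0 <= M by exact: le_trans (fM 0).
have fi := bounded_integrable E mf fM.
apply: le_trans (le_normr_Rintegral measurableT fi) _.
apply: (@le_trans _ _ (\int[E]_s (cst M s))); last first.
  by rewrite -[leLHS]/(\int[E]_s M) average_cst.
apply: le_Rintegral => //.
- by apply: (@bounded_integrable _ _ _ E _ M) => [|s]; [exact: measurableT_comp|rewrite normr_id].
- by apply: (@bounded_integrable _ _ _ E _ M) => // s; rewrite ger0_norm.
Qed.

Let J_norm t : `|J t| <= A.
Proof. exact: bounded_average. Qed.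

Let integral_J : \int[E]_t J t = exp_mean.
Proof.
have vx0 : vx 0 = 0 by rewrite vxE.
have := @integral_eps_dist R b b0 vx mv vx_ge0 vx0.
move=> /(congr1 fine) h; rewrite /exp_mean {2}/Rintegral -h /Rintegral.
congr fine; apply: eq_integral => t _; rewrite /J /Rintegral fineK; last first.
  exact: (integrable_fin_num measurableT (integrable_dist t)).
by apply: eq_integral => s _; rewrite distrC.
Qed.

Lemma exp_mean_affine (c0 c1 : R) : \int[E]_t (c0 + c1 * vx t) = c0 + c1 * exp_mean.
Proof.
rewrite RintegralD//; last 2 first.
- by apply: (@bounded_integrable _ _ _ E _ `|c0|).
- by have := integrableZl measurableT c1 integrable_vx.
by rewrite RintegralZl// average_cst.
Qed.

(** For independent exponential t and s, the times t, s and |s - t| have the same law, so only the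
    sum of the coefficients counts. *)
Lemma exp_mean_affine2 (c0 c1 c2 c3 : R) :
  \int[E]_t \int[E]_s (c0 + c1 * vx t + c2 * vx s + c3 * vx `|s - t|) =
  c0 + (c1 + c2 + c3) * exp_mean.
Proof.
have inner t : \int[E]_s (c0 + c1 * vx t + c2 * vx s + c3 * vx `|s - t|) =
    c0 + c2 * exp_mean + c1 * vx t + c3 * J t.
  rewrite RintegralD//; last 2 first.
  - apply: (@bounded_integrable _ _ _ E _ (`|c0 + c1 * vx t| + `|c2| * A)).
      by apply: measurable_funD => //; exact: measurable_funM.
    by move=> s; apply: le_trans (ler_normD _ _) _; rewrite lerD2l normrM ler_wpM2l.
  - by have := integrableZl measurableT c3 (integrable_dist t).
  rewrite exp_mean_affine RintegralZl//; rewrite -/(J t); ring.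
under eq_Rintegral do rewrite inner.
rewrite RintegralD//; last 2 first.
- apply: (@bounded_integrable _ _ _ E _ (`|c0 + c2 * exp_mean| + `|c1| * A)).
    by apply: measurable_funD => //; exact: measurable_funM.
  by move=> s; apply: le_trans (ler_normD _ _) _; rewrite lerD2l normrM ler_wpM2l.
- apply: (@bounded_integrable _ _ _ E _ (`|c3| * A)); first exact: measurable_funM.
  by move=> s; rewrite normrM ler_wpM2l.
rewrite exp_mean_affine RintegralZl//; last exact: (@bounded_integrable _ _ _ E _ A).
rewrite integral_J; ring.
Qed.

Variable T_ : nat -> R.
Hypothesis T_y : T_ n @[n --> \oo] --> +oo.

Let ind (n : nat) (t : R) : R := \1_(`[0, T_ n[) t.

Let mind n : measurable_fun [set: R] (ind n).
Proof. exact: measurable_indic. Qed.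

Let ind_norm n t : `|ind n t| <= 1.
Proof. by rewrite /ind indicE; case: (_ \in _); rewrite ?normr1 ?normr0. Qed.

Let near_T (t : R) : \forall n \near \oo, t < T_ n.
Proof. by move/cvgryPgt : T_y; exact. Qed.

Let ind_cvg t : 0 <= t -> ind n t @[n --> \oo] --> (1 : R).
Proof.
move=> t0; apply: cvg_near_cst; apply: filterS (near_T t) => n tn.
by rewrite /ind indicE mem_setE in_itv/= t0 tn.
Qed.

(** For each t >= 0 the indicator of [0, T_n[ is eventually 1, and negative t have probability 0;
    bounded convergence concludes. *)
Lemma cut_integral_cvg (g_ : nat -> R -> R) (g : R -> R) (M : R) :
  (forall n, measurable_fun [set: R] (g_ n)) -> measurable_fun [set: R] g ->
  (forall n t, `|g_ n t| <= M) -> (forall t, `|g t| <= M) ->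
  (forall t, 0 <= t -> g_ n t @[n --> \oo] --> g t) ->
  \int[E]_t (ind n t * g_ n t) @[n --> \oo] --> \int[E]_t g t.
Proof.
move=> mg_ mg g_M gM cg; apply: (@bounded_Rintegral_cvg _ _ _ E _ _ M) => //.
- by move=> n; exact: measurable_funM.
- apply: filterS (eps_ae_ge0 b0) => t t0.
  by rewrite -[X in _ --> X]mul1r; apply: cvgM; [exact: ind_cvg|exact: cg].
- move=> n t; rewrite normrM -[leRHS]mul1r.
  by apply: ler_pM.
Qed.

Lemma cut_integral2_cvg (g_ : nat -> R -> R -> R) (g : R -> R -> R) (M : R) :
  (forall n, measurable_fun [set: R * R] (fun z => g_ n z.1 z.2)) ->
  measurable_fun [set: R * R] (fun z => g z.1 z.2) ->
  (forall n t s, `|g_ n t s| <= M) -> (forall t s, `|g t s| <= M) ->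
  (forall t s, 0 <= t -> 0 <= s -> g_ n t s @[n --> \oo] --> g t s) ->
  \int[E]_t (ind n t * \int[E]_s (ind n s * g_ n t s)) @[n --> \oo] -->
  \int[E]_t \int[E]_s g t s.
Proof.
move=> mg_ mg g_M gM cg.
have m1 n t : measurable_fun [set: R] (g_ n t).
  exact: (measurableT_comp (mg_ n) (pair1_measurable t)).
have m1' t : measurable_fun [set: R] (g t).
  exact: (measurableT_comp mg (pair1_measurable t)).
have swapm : measurable_fun [set: R * R] (fun z : R * R => (z.2, z.1)).
  by apply: measurable_pairR; [exact: measurable_snd|exact: measurable_fst].
apply: (@cut_integral_cvg (fun n t => \int[E]_s (ind n s * g_ n t s)) (fun t => \int[E]_s g t s) M).
- move=> n; apply: (@average_measurable _ _ R _ R E (fun s t => ind n s * g_ n t s)).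
  apply: measurable_funM; first exact: (measurableT_comp (mind n) measurable_fst).
  exact: (measurableT_comp (mg_ n) swapm).
- apply: (@average_measurable _ _ R _ R E (fun s t => g t s)).
  exact: (measurableT_comp mg swapm).
- move=> n t; apply: bounded_average; first exact: measurable_funM.
  by move=> s; rewrite normrM -[leRHS]mul1r; apply: ler_pM.
- by move=> t; apply: bounded_average.
- by move=> t t0; apply: (@cut_integral_cvg (fun n => g_ n t) (g t) M) => // s s0; exact: cg.
Qed.

Hypothesis T_ge0 : forall n, 0 <= T_ n.

Let vcomp_measurable {d} {X : measurableType d} (f : X -> R) :
  measurable_fun setT f -> (forall x, 0 <= f x) -> measurable_fun setT (fun x => v (f x)).
Proof.
move=> mf f0; have -> : (fun x => v (f x)) = vx \o f by apply/funext => x; rewrite /= vxE.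
exact: (measurableT_comp mv mf).
Qed.

Let cov_norm x y z : 0 <= x -> 0 <= y -> 0 <= z -> `|2^-1 * (v x + v y - v z)| <= 2 * A.
Proof.
move=> x0 y0 z0; have h1 := v_le x; have h2 := v_le y; have h3 := v_le z.
have h4 := v_ge0 x0; have h5 := v_ge0 y0; have h6 := v_ge0 z0.
rewrite ler_norml; move: (v x) (v y) (v z) h1 h2 h3 h4 h5 h6 A0 => p q r *.
by apply/andP; split; lra.
Qed.

Let cov_measurable {d} {X : measurableType d} (f g h : X -> R) :
  measurable_fun setT f -> measurable_fun setT g -> measurable_fun setT h ->
  (forall x, 0 <= f x) -> (forall x, 0 <= g x) -> (forall x, 0 <= h x) ->
  measurable_fun setT (fun x => 2^-1 * (v (f x) + v (g x) - v (h x))).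
Proof.
move=> mf mg mh f0 g0 h0; apply: measurable_funM; first exact: measurable_cst.
apply: measurable_funB; last exact: vcomp_measurable.
by apply: measurable_funD; exact: vcomp_measurable.
Qed.

Let norm_measurable {d} {X : measurableType d} (f g : X -> R) :
  measurable_fun setT f -> measurable_fun setT g -> measurable_fun setT (fun x => `|f x - g x|).
Proof. by move=> mf mg; apply: measurableT_comp => //; exact: measurable_funB. Qed.

Lemma cut_cov_cvg (tau : nat -> R -> R) (c0 c1 : R) :
  (forall n, measurable_fun setT (tau n)) -> (forall n t, 0 <= tau n t) ->
  (forall t, 0 <= t ->
    2^-1 * (v (T_ n) + v (tau n t) - v `|tau n t - T_ n|) @[n --> \oo] --> c0 + c1 * v t) ->
  \int[E]_t (ind n t * (2^-1 * (v (T_ n) + v (tau n t) - v `|tau n t - T_ n|)))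
    @[n --> \oo] --> c0 + c1 * exp_mean.
Proof.
move=> mtau tau0 ch; rewrite -exp_mean_affine.
apply: (@cut_integral_cvg (fun n t => 2^-1 * (v (T_ n) + v (tau n t) - v `|tau n t - T_ n|))
  (fun t => c0 + c1 * vx t) (2 * A + `|c0| + `|c1| * A)).
- move=> n; apply: (cov_measurable (f := fun=> T_ n)) => //.
  by apply: norm_measurable => //; exact: mtau.
- by apply: measurable_funD => //; exact: measurable_funM.
- move=> n t; apply: le_trans (cov_norm _ _ _) _ => //.
  by rewrite -addrA lerDl addr_ge0// mulr_ge0.
- move=> t; apply: le_trans (ler_normD _ _) _; rewrite normrM -addrA.
  by apply: ler_wpDl; [rewrite mulr_ge0|rewrite lerD2l ler_wpM2l].
- by move=> t t0; rewrite vxE//; exact: ch.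
Qed.

Lemma cut_cov2_cvg (tau1 tau2 : nat -> R -> R) (c0 c1 c2 c3 : R) :
  (forall n, measurable_fun setT (tau1 n)) -> (forall n t, 0 <= tau1 n t) ->
  (forall n, measurable_fun setT (tau2 n)) -> (forall n t, 0 <= tau2 n t) ->
  (forall t s, 0 <= t -> 0 <= s ->
    2^-1 * (v (tau2 n t) + v (tau1 n s) - v `|tau1 n s - tau2 n t|) @[n --> \oo] -->
      c0 + c1 * v t + c2 * v s + c3 * v `|s - t|) ->
  \int[E]_t (ind n t * \int[E]_s (ind n s *
      (2^-1 * (v (tau2 n t) + v (tau1 n s) - v `|tau1 n s - tau2 n t|))))
    @[n --> \oo] --> c0 + (c1 + c2 + c3) * exp_mean.
Proof.
move=> m1 p1 m2 p2 ch; rewrite -exp_mean_affine2.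
have mc (k : R) (f : R * R -> R) : measurable_fun setT f -> measurable_fun setT (fun z => k * f z).
  by move=> mf; exact: measurable_funM.
apply: (@cut_integral2_cvg
  (fun n t s => 2^-1 * (v (tau2 n t) + v (tau1 n s) - v `|tau1 n s - tau2 n t|))
  (fun t s => c0 + c1 * vx t + c2 * vx s + c3 * vx `|s - t|)
  (2 * A + `|c0| + `|c1| * A + `|c2| * A + `|c3| * A)).
- move=> n.
  have h1 : measurable_fun [set: R * R] (fun z : R * R => tau1 n z.2).
    exact: (measurableT_comp (m1 n) measurable_snd).
  have h2 : measurable_fun [set: R * R] (fun z : R * R => tau2 n z.1).
    exact: (measurableT_comp (m2 n) measurable_fst).
  apply: (cov_measurable (f := fun z : R * R => tau2 n z.1) (g := fun z : R * R => tau1 n z.2)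
     (h := fun z : R * R => `|tau1 n z.2 - tau2 n z.1|)) => //.
  exact: norm_measurable.
- have k1 : measurable_fun [set: R * R] (fun z : R * R => vx z.1).
    exact: (measurableT_comp mv measurable_fst).
  have k2 : measurable_fun [set: R * R] (fun z : R * R => vx z.2).
    exact: (measurableT_comp mv measurable_snd).
  have k3 : measurable_fun [set: R * R] (fun z : R * R => vx `|z.2 - z.1|).
    apply: (measurableT_comp (mv : measurable_fun setT vx)); apply: norm_measurable.
      exact: measurable_snd.
    exact: measurable_fst.
  apply: measurable_funD; last exact: mc.
  by apply: measurable_funD; [apply: measurable_funD => //; exact: mc|exact: mc].
- move=> n t s; apply: le_trans (cov_norm _ _ _) _ => //.
  by rewrite -!addrA lerDl !addr_ge0// mulr_ge0.
- move=> t s; have h (c x : R) : `|c * vx x| <= `|c| * A by rewrite normrM ler_wpM2l.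
  apply: le_trans (ler_normD _ _) _; apply: lerD (h _ _).
  apply: le_trans (ler_normD _ _) _; apply: lerD (h _ _).
  apply: le_trans (ler_normD _ _) _; apply: lerD (h _ _).
  by rewrite lerDr mulr_ge0.
- by move=> t s t0 s0; rewrite !vxE//; exact: ch.
Qed.

Let near_le (t : R) : \forall n \near \oo, t <= T_ n.
Proof. by move/cvgryPge : T_y; exact. Qed.

Let bt n t := backward_time (T_ n) t.

Let btE n t : 0 <= t -> t <= T_ n -> bt n t = T_ n - t.
Proof. exact: backward_timeE. Qed.

Lemma v_cvg_horizon : v (T_ n) @[n --> \oo] --> A.
Proof. exact: (cvg_comp T_ v T_y v_cvgy). Qed.

Let v_cvgB t : 0 <= t -> v (T_ n - t) @[n --> \oo] --> A.
Proof.
move=> t0; have h : T_ n - t @[n --> \oo] --> +oo.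
  by apply/cvgryPge => K; apply: filterS (near_le (K + t)) => n; rewrite lerBrDr.
exact: (cvg_comp _ v h v_cvgy).
Qed.

Let v_bt t : 0 <= t -> v (bt n t) @[n --> \oo] --> A.
Proof.
move=> t0; apply: cvg_trans (v_cvgB t0); apply: near_eq_cvg.
by apply: filterS (near_le t) => n tn; rewrite (btE t0 tn).
Qed.

Let v_bt_bt t s : 0 <= t -> 0 <= s -> v `|bt n s - bt n t| @[n --> \oo] --> v `|s - t|.
Proof.
move=> t0 s0; apply: cvg_near_cst.
apply: filterS2 (near_le t) (near_le s) => n tn sn.
rewrite (btE t0 tn) (btE s0 sn) distrC; congr (v `|_|); ring.
Qed.

Let v_bt_sub t s : 0 <= t -> 0 <= s -> v `|bt n s - t| @[n --> \oo] --> A.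
Proof.
move=> t0 s0; apply: cvg_trans (v_cvgB (addr_ge0 s0 t0)); apply: near_eq_cvg.
apply: filterS (near_le (s + t)) => n stn.
have sn : s <= T_ n by apply: le_trans stn; rewrite lerDl.
have h : T_ n - s - t = T_ n - (s + t) by ring.
by rewrite (btE s0 sn) h ger0_norm// subr_ge0.
Qed.

Let v_sub t : 0 <= t -> v `|t - T_ n| @[n --> \oo] --> A.
Proof.
move=> t0; apply: cvg_trans (v_cvgB t0); apply: near_eq_cvg.
by apply: filterS (near_le t) => n tn; rewrite distrC ger0_norm// subr_ge0.
Qed.

Let v_bt_horizon t : 0 <= t -> v `|bt n t - T_ n| @[n --> \oo] --> v t.
Proof.
move=> t0; apply: cvg_near_cst; apply: filterS (near_le t) => n tn.
have h : T_ n - t - T_ n = - t by ring.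
by rewrite (btE t0 tn) h normrN ger0_norm.
Qed.

Let cov_cvg (x y z : nat -> R) (x' y' z' l : R) : x n @[n --> \oo] --> x' -> y n @[n --> \oo] --> y' ->
  z n @[n --> \oo] --> z' -> 2^-1 * (x' + y' - z') = l ->
  2^-1 * (x n + y n - z n) @[n --> \oo] --> l.
Proof.
move=> hx hy hz <-; apply: cvgM; first exact: cvg_cst.
by apply: cvgB => //; exact: cvgD.
Qed.

Let mforward : measurable_fun [set: R] forward_time.
Proof. exact: (continuous_measurable_fun forward_time_continuous). Qed.

Let mbt n : measurable_fun [set: R] (bt n).
Proof. exact: (continuous_measurable_fun (@backward_time_continuous R (T_ n))). Qed.

(** v(T) and v(T - t) both tend to [A] and cancel, leaving v(t) / 2. *)
Lemma cov_forward_cvg :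
  \int[E]_t (ind n t * (2^-1 * (v (T_ n) + v (forward_time t) - v `|forward_time t - T_ n|)))
    @[n --> \oo] --> 2^-1 * exp_mean.
Proof.
rewrite -[X in _ --> X]add0r; apply: (cut_cov_cvg (tau := fun=> forward_time)).
- by [].
- by move=> _; exact: forward_time_ge0.
- move=> t t0; rewrite forward_timeE//.
  by apply: cov_cvg v_cvg_horizon (cvg_cst (v t)) (v_sub t0) _; field.
Qed.

(** Here the lag between T - t and T is t itself, so v(t) survives with a minus sign: the integrand
    tends to A - v(t) / 2. *)
Lemma cov_backward_cvg :
  \int[E]_t (ind n t * (2^-1 * (v (T_ n) + v (bt n t) - v `|bt n t - T_ n|)))
    @[n --> \oo] --> A - 2^-1 * exp_mean.
Proof.
rewrite -mulNr; apply: cut_cov_cvg.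
- exact: mbt.
- by move=> n t; exact: backward_time_ge0.
- move=> t t0; by apply: cov_cvg v_cvg_horizon (v_bt t0) (v_bt_horizon t0) _; field.
Qed.

Lemma cov_forward_forward_cvg :
  \int[E]_t (ind n t * \int[E]_s (ind n s *
      (2^-1 * (v (forward_time t) + v (forward_time s) - v `|forward_time s - forward_time t|))))
    @[n --> \oo] --> 2^-1 * exp_mean.
Proof.
have -> : 2^-1 * exp_mean = 0 + (2^-1 + 2^-1 + - 2^-1) * exp_mean by ring.
apply: (cut_cov2_cvg (tau1 := fun=> forward_time) (tau2 := fun=> forward_time)).
- by [].
- by move=> _; exact: forward_time_ge0.
- by [].
- by move=> _; exact: forward_time_ge0.
- move=> t s t0 s0; rewrite (forward_timeE t0) (forward_timeE s0).
  by apply: cov_cvg (cvg_cst (v t)) (cvg_cst (v s)) (cvg_cst (v `|s - t|)) _; ring.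
Qed.

(** Reversal preserves the lag |s - t|, while each of the two variances tends to [A]. *)
Lemma cov_backward_backward_cvg :
  \int[E]_t (ind n t * \int[E]_s (ind n s * (2^-1 * (v (bt n t) + v (bt n s) - v `|bt n s - bt n t|))))
    @[n --> \oo] --> A - 2^-1 * exp_mean.
Proof.
have -> : A - 2^-1 * exp_mean = A + (0 + 0 + - 2^-1) * exp_mean by ring.
apply: cut_cov2_cvg.
- exact: mbt.
- by move=> n t; exact: backward_time_ge0.
- exact: mbt.
- by move=> n t; exact: backward_time_ge0.
- move=> t s t0 s0.
  by apply: cov_cvg (v_bt t0) (v_bt s0) (v_bt_bt t0 s0) _; field.
Qed.

(** The times T - s and t drift apart, so v(T - s) and v(T - s - t) cancel in the limit. *)
Lemma cov_backward_forward_cvg :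
  \int[E]_t (ind n t * \int[E]_s (ind n s *
      (2^-1 * (v (forward_time t) + v (bt n s) - v `|bt n s - forward_time t|))))
    @[n --> \oo] --> 2^-1 * exp_mean.
Proof.
have -> : 2^-1 * exp_mean = 0 + (2^-1 + 0 + 0) * exp_mean by ring.
apply: (cut_cov2_cvg (tau2 := fun=> forward_time)).
- exact: mbt.
- by move=> n t; exact: backward_time_ge0.
- by [].
- by move=> _; exact: forward_time_ge0.
- move=> t s t0 s0; rewrite (forward_timeE t0).
  by apply: cov_cvg (cvg_cst (v t)) (v_bt s0) (v_bt_sub t0 s0) _; ring.
Qed.

End exponential_limits.

(** * Limiting covariances of B_T, N_T and P_T *)

Section tfbm_averages.
Context {R : realType} {d} {Omega : measurableType d} {P : probability Omega R}.
Variables (H lambda b : R) (W B : R -> {RV P >-> R}).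
Hypotheses (hH : 0 < H) (hl : 0 < lambda) (b0 : 0 < b) (hW : two_sided_wiener W).
Hypothesis hB : forall t : R, 0 <= t -> is_wiener_integral W (tfbm_kernel H lambda t) (B t).
Hypothesis cB : forall w, {within `[0, +oo[, continuous (fun t : R => B t w)}.
Notation v := (tfbm_var H lambda).
Notation A := (tfbm_varoo H lambda).
Notation E := (eps b0).
Notation m := (exp_mean b0 v).

(* N_T = b int_0^T e^(-bs) B_s ds and P_T = b int_0^T e^(-b(T-s)) B_s ds. *)
Definition forward_average (T : R) : Omega -> R := timed_average B forward_time T E.
Definition backward_average (T : R) : Omega -> R := timed_average B (backward_time T) T E.

Lemma forward_average_wiener_space T : 0 <= T -> wiener_space W (forward_average T).
Proof.
move=> T0; apply: (timed_average_wiener_space hH hl hW hB cB T0).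
- exact: forward_time_continuous.
- exact: forward_time_ge0.
- exact: forward_time_max.
Qed.

Lemma backward_average_wiener_space T : 0 <= T -> wiener_space W (backward_average T).
Proof.
move=> T0; apply: (timed_average_wiener_space hH hl hW hB cB T0).
- exact: backward_time_continuous.
- exact: backward_time_ge0.
- exact: backward_time_max.
Qed.

Let mv := measurable_tfbm_var hH hl hW hB cB.
Let v_ge0 := tfbm_var_ge0 hH hl hW hB.
Let v_le := tfbm_var_le H lambda.
Let v_y := tfbm_var_cvgy hH hl.
Let v0 : v 0 = 0. Proof. by rewrite /tfbm_var subrr. Qed.

Variable T_ : nat -> R.
Hypotheses (T_ge0 : forall n, 0 <= T_ n) (T_y : T_ n @[n --> \oo] --> +oo).

Let Bn n : Omega -> R := B (T_ n).
Let Nn n := forward_average (T_ n).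
Let Pn n := backward_average (T_ n).

Let sB n : sqint P (Bn n).
Proof. exact: (wiener_space_sqint (tfbm_wiener_space hW hB (T_ge0 n))). Qed.

Let sN n : sqint P (Nn n).
Proof. exact: (wiener_space_sqint (forward_average_wiener_space (T_ge0 n))). Qed.

Let sP n : sqint P (Pn n).
Proof. exact: (wiener_space_sqint (backward_average_wiener_space (T_ge0 n))). Qed.

Let cf : continuous (@forward_time R) := @forward_time_continuous R.
Let cb n : continuous (backward_time (T_ n)) := @backward_time_continuous R (T_ n).

Let lim_BB : ip P (Bn n) (Bn n) @[n --> \oo] --> A.
Proof.
apply: cvg_trans (v_cvg_horizon v_y T_y); apply: near_eq_cvg; apply: nearW => n.
by rewrite (tfbm_ip_var hH hl hW hB (T_ge0 n)).
Qed.

Let lim_BN : ip P (Bn n) (Nn n) @[n --> \oo] --> 2^-1 * m.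
Proof.
have := cov_forward_cvg (b0 := b0) mv v_ge0 v_le v_y T_y T_ge0; apply: cvg_eq1 => n.
rewrite (ip_timed_average hH hl hW hB cB (T_ge0 n) cf (@forward_time_ge0 R) (@forward_time_max R) E (sB n)).
apply: eq_Rintegral => t _; congr (_ * _).
exact/esym/(tfbm_cov hH hl hW hB (T_ge0 n) (forward_time_ge0 t)).
Qed.

Let lim_BP : ip P (Bn n) (Pn n) @[n --> \oo] --> A - 2^-1 * m.
Proof.
have := cov_backward_cvg (b0 := b0) mv v_ge0 v_le v_y T_y T_ge0; apply: cvg_eq1 => n.
rewrite (ip_timed_average hH hl hW hB cB (T_ge0 n) (@cb n) (@backward_time_ge0 R (T_ n))
  (@backward_time_max R (T_ n)) E (sB n)).
apply: eq_Rintegral => t _; congr (_ * _).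
exact/esym/(tfbm_cov hH hl hW hB (T_ge0 n) (backward_time_ge0 (T_ n) t)).
Qed.

Let lim_NN : ip P (Nn n) (Nn n) @[n --> \oo] --> 2^-1 * m.
Proof.
have := cov_forward_forward_cvg (b0 := b0) mv v_ge0 v_le v0 T_y; apply: cvg_eq1 => n.
exact/esym/(ip_timed_average2 hH hl hW hB cB E (T_ge0 n) cf (@forward_time_ge0 R) (@forward_time_max R)
  cf (@forward_time_ge0 R) (@forward_time_max R)).
Qed.

Let lim_PP : ip P (Pn n) (Pn n) @[n --> \oo] --> A - 2^-1 * m.
Proof.
have := cov_backward_backward_cvg (b0 := b0) mv v_ge0 v_le v0 v_y T_y; apply: cvg_eq1 => n.
exact/esym/(ip_timed_average2 hH hl hW hB cB E (T_ge0 n)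
  (@cb n) (@backward_time_ge0 R (T_ n)) (@backward_time_max R (T_ n))
  (@cb n) (@backward_time_ge0 R (T_ n)) (@backward_time_max R (T_ n))).
Qed.

Let lim_PN : ip P (Pn n) (Nn n) @[n --> \oo] --> 2^-1 * m.
Proof.
have := cov_backward_forward_cvg (b0 := b0) mv v_ge0 v_le v0 v_y T_y; apply: cvg_eq1 => n.
exact/esym/(ip_timed_average2 hH hl hW hB cB E (T_ge0 n)
  (@cb n) (@backward_time_ge0 R (T_ n)) (@backward_time_max R (T_ n))
  cf (@forward_time_ge0 R) (@forward_time_max R)).
Qed.

Lemma bounded_second_moments : exists C : R, \forall n \near \oo,
  ip P (Bn n) (Bn n) + ip P (Nn n) (Nn n) + ip P (Pn n) (Pn n) <= C.
Proof.
exists (A + 2^-1 * m + (A - 2^-1 * m) + 1).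
have h : ip P (Bn n) (Bn n) + ip P (Nn n) (Nn n) + ip P (Pn n) (Pn n) @[n --> \oo] -->
    A + 2^-1 * m + (A - 2^-1 * m).
  apply: cvgD; last exact: lim_PP.
  by apply: cvgD; [exact: lim_BB|exact: lim_NN].
have e1 : (0 : R) < 1 by [].
move/cvgrPdist_le : h => /(_ _ e1); apply: filterS => n.
by rewrite ler_norml => /andP[+ _]; move: (_ + ip P (Pn n) (Pn n)) => x; lra.
Qed.

Lemma forward_variance_cvg : ip P (Nn n) (Nn n) @[n --> \oo] --> 2^-1 * m.
Proof. exact: lim_NN. Qed.

Lemma remainder_variance_cvg :
  ip P (fun w => Bn n w - Pn n w) (fun w => Bn n w - Pn n w) @[n --> \oo] --> 2^-1 * m.
Proof.
have h : ip P (Bn n) (Bn n) - (ip P (Bn n) (Pn n) + ip P (Bn n) (Pn n) - ip P (Pn n) (Pn n)) @[n --> \oo] -->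
    A - (A - 2^-1 * m + (A - 2^-1 * m) - (A - 2^-1 * m)).
  apply: cvgB; first exact: lim_BB.
  apply: cvgB; last exact: lim_PP.
  by apply: cvgD; exact: lim_BP.
have e : A - (A - 2^-1 * m + (A - 2^-1 * m) - (A - 2^-1 * m)) = 2^-1 * m by ring.
rewrite -e; move: h; apply: cvg_eq1 => n.
rewrite (ipBl (sB n) (sP n) (sqintB (sB n) (sP n))) (ipBr (sB n) (sB n) (sP n)) (ipBr (sP n) (sB n) (sP n)).
rewrite (ipC P (Pn n) (Bn n)).
by move: (ip _ _ _) (ip _ _ _) (ip _ _ _) => x y z; rewrite /=; ring.
Qed.

(** B_T and P_T have the same limiting covariance beta^2 with N_T; this is the source of the
    independence of numerator and denominator in (ii). *)
Lemma remainder_forward_cov_cvg :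
  ip P (fun w => Bn n w - Pn n w) (Nn n) @[n --> \oo] --> 0.
Proof.
have h : ip P (Bn n) (Nn n) - ip P (Pn n) (Nn n) @[n --> \oo] --> 2^-1 * m - 2^-1 * m.
  by apply: cvgB; [exact: lim_BN|exact: lim_PN].
rewrite -(subrr (2^-1 * m)); move: h; apply: cvg_eq1 => n.
by rewrite (ipBl (sB n) (sP n) (sN n)).
Qed.

(** The variance of P_T and its covariance with B_T have the same limit, so 4 E P_T^2 and -4 E B_T
    P_T cancel and only E B_T^2 remains. *)
Lemma numerator_variance_cvg :
  ip P (fun w => 2 * Pn n w - Bn n w) (fun w => 2 * Pn n w - Bn n w) @[n --> \oo] --> A.
Proof.
have h2 (u : nat -> R) (l : R) : u n @[n --> \oo] --> l -> 4 * u n @[n --> \oo] --> 4 * l.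
  by move=> hu; apply: cvgM => //; exact: cvg_cst.
have h : 4 * ip P (Pn n) (Pn n) - 4 * ip P (Bn n) (Pn n) + ip P (Bn n) (Bn n) @[n --> \oo] -->
    4 * (A - 2^-1 * m) - 4 * (A - 2^-1 * m) + A.
  apply: cvgD; last exact: lim_BB.
  by apply: cvgB; apply: h2; [exact: lim_PP|exact: lim_BP].
have e : 4 * (A - 2^-1 * m) - 4 * (A - 2^-1 * m) + A = A by ring.
rewrite -[X in _ --> X]e; move: h; apply: cvg_eq1 => n.
have s2 := sqintZ 2 (sP n).
rewrite (ipBl s2 (sB n) (sqintB s2 (sB n))) (ipBr s2 s2 (sB n)) (ipBr (sB n) s2 (sB n)).
rewrite (ipZl 2 (sP n) s2) (ipZr 2 (sP n) (sP n)) (ipZl 2 (sP n) (sB n)) (ipZr 2 (sB n) (sP n)).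
rewrite (ipC P (Pn n) (Bn n)).
by move: (ip _ _ _) (ip _ _ _) (ip _ _ _) => x y z; rewrite /=; ring.
Qed.

End tfbm_averages.

(** * The constants alpha^2 and beta^2 *)

Section constants.
Context {R : realType}.
Variables (H lambda b : R).
Hypotheses (hH : 0 < H) (hl : 0 < lambda) (b0 : 0 < b).
Notation v := (tfbm_var H lambda).

Lemma alpha2E : alpha2 H lambda = tfbm_varoo H lambda.
Proof. by rewrite /alpha2 /tfbm_varoo kern_cov0// mulrA. Qed.

Lemma alpha2_gt0 : 0 < alpha2 H lambda.
Proof.
have h2 : 0 < 2 * H by rewrite mulr_gt0.
rewrite /alpha2 divr_gt0 ?powR_gt0 ?mulr_gt0// Gamma_gamma_density /Rintegral.
rewrite fine_gt0// gamma_density_gt0/=.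
exact: gamma_density_lty.
Qed.

Hypothesis mv : measurable_fun [set: R] (fun t => v (Num.max t 0)).
Hypothesis v_ge0 : forall t, 0 <= t -> 0 <= v t.

Let vx0 (t : R) : (0 <= (v (Num.max t 0))%:E)%E.
Proof. by rewrite lee_fin v_ge0// le_max lexx orbT. Qed.

Let mEv : measurable_fun [set: R] (fun t => (v (Num.max t 0))%:E).
Proof. exact/measurable_EFinP. Qed.

Let mpdf : measurable_fun [set: R] (fun t => (exponential_pdf b t)%:E).
Proof. by apply/measurable_EFinP; exact: measurable_exponential_pdf. Qed.

Let pdf_ge0 (t : R) : (0 <= (exponential_pdf b t)%:E)%E.
Proof. by rewrite lee_fin exponential_pdf_ge0// ltW. Qed.

Let mean_fin : (\int[eps b0]_t (v (Num.max t 0))%:E \is a fin_num)%E.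
Proof.
have h : (eps b0).-integrable setT (EFin \o (fun t => v (Num.max t 0))).
  apply: (@bounded_integrable _ _ _ (eps b0) _ (tfbm_varoo H lambda)) => // t.
  by rewrite ger0_norm; [exact: tfbm_var_le|rewrite -lee_fin; exact: vx0].
exact: (integrable_fin_num measurableT h).
Qed.

Lemma beta2E : beta2 H lambda b = 2^-1 * exp_mean b0 v.
Proof.
rewrite /beta2 /exp_mean /Rintegral.
have -> : (\int[@lebesgue_measure R]_(u in `[0%R, +oo[) (expR (- (b * u)) * tfbm_C2_t2H H lambda u)%:E =
    (b^-1)%:E * \int[eps b0]_t (v (Num.max t 0))%:E)%E.
  rewrite (ge0_integral_eps b0 mEv vx0) integral_mkcond -ge0_integralZl.
  - apply: eq_integral => t _; rewrite patchE mem_setE in_itv/= andbT.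
    case: ifPn => t0; last first.
      by rewrite lt0_exponential_pdf ?mule0// ltNge.
    rewrite exponential_pdfE// (max_idPl t0) tfbm_varE// -!EFinM; congr EFin.
    by rewrite mulNr; field; exact: lt0r_neq0.
  - exact: measurableT.
  - exact: emeasurable_funM.
  - by move=> t _; apply: mule_ge0; [exact: vx0|exact: pdf_ge0].
  - by rewrite lee_fin invr_ge0 ltW.
rewrite -(fineK mean_fin) -EFinM /=.
by field; exact: lt0r_neq0.
Qed.

(** Beyond some K the variance is at least half of its positive limit, and [K, K + 1] has positive
    exponential mass. *)
Lemma beta2_gt0 : 0 < beta2 H lambda b.
Proof.
rewrite beta2E mulr_gt0// /exp_mean /Rintegral.
have A0 : 0 < tfbm_varoo H lambda by rewrite -alpha2E alpha2_gt0.
have [K [K0 vK]] : exists K, 0 <= K /\ forall t, K <= t -> tfbm_varoo H lambda / 2 <= v t.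
  have A2 : 0 < tfbm_varoo H lambda / 2 by rewrite divr_gt0.
  move/cvgrPdist_le : (tfbm_var_cvgy hH hl) => /(_ _ A2) [K [Kr hK]].
  exists (Num.max K 0 + 1); split; first by rewrite addr_ge0// le_max lexx orbT.
  move=> t Kt; have : K < t.
    by apply: lt_le_trans Kt; rewrite ltr_pwDr// le_max lexx.
  by move=> /hK; rewrite ler_norml => /andP[_]; lra.
pose c := tfbm_varoo H lambda / 2 * exponential_pdf b (K + 1).
have K1 : 0 <= K + 1 by rewrite addr_ge0.
have p0 : 0 < exponential_pdf b (K + 1).
  by rewrite exponential_pdfE// mulr_gt0// expR_gt0.
have c0 : 0 < c by rewrite mulr_gt0// divr_gt0.
have fin : (\int[eps b0]_t (v (Num.max t 0))%:E < +oo)%E.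
  by rewrite -ge0_fin_numE//; apply: integral_ge0 => t _; exact: vx0.
apply: fine_gt0; rewrite fin andbT (ge0_integral_eps b0 mEv vx0).
apply: (@lt_le_trans _ _ (\int[@lebesgue_measure R]_t (c%:E * (\1_(`[K, K + 1]) t)%:E))%E).
  rewrite ge0_integralZl//; last 2 first.
  - by apply/measurable_EFinP; exact: measurable_indic.
  - by rewrite lee_fin ltW.
  rewrite integral_indic//= setIT lebesgue_measure_itv/= lte_fin ltrDl ltr01 -EFinB -EFinM lte_fin.
  by rewrite mulr_gt0// addrC addKr.
apply: ge0_le_integral => //.
- by move=> t _; rewrite mule_ge0// lee_fin ltW.
- by apply: emeasurable_funM => //; apply/measurable_EFinP; exact: measurable_indic.
- exact: emeasurable_funM.
move=> t _; rewrite -!EFinM lee_fin indicE mem_setE in_itv/=.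
case: (boolP (K <= t <= K + 1)) => [/andP[t1 t2]|_]; last first.
  by rewrite mulr0 mulr_ge0// -lee_fin; [exact: vx0|exact: pdf_ge0].
have t0 : 0 <= t by exact: le_trans t1.
rewrite mulr1 (max_idPl t0) /c; apply: ler_pM; [by rewrite divr_ge0// ltW|exact: ltW|exact: vK|].
rewrite !exponential_pdfE// ler_pM2l// ler_expR !mulNr lerN2 ler_pM2l//.
Qed.

End constants.

(** * Path integrals of the Vasicek process *)

Section antiderivatives.
Context {R : realType}.
Notation mu := (@lebesgue_measure R).
Implicit Types (f g F G : R -> R).

(** Continuity is two-sided even at 0, which suits paths extended to negative times and makes
    derivatives at 0 ordinary ones. *)
Definition continuous_ge0 f := forall x : R, 0 <= x -> {for x, continuous f}.

Definition antiderivative F f := forall x : R, 0 <= x -> is_derive x 1 F (f x).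

Lemma antiderivative_continuous F f : antiderivative F f -> continuous_ge0 F.
Proof.
move=> dF x x0; apply/differentiable_continuous/derivable1_diffP.
by have [] := dF _ x0.
Qed.

Lemma continuous_ge0_within f (t : R) : continuous_ge0 f -> {within `[0, t], continuous f}.
Proof.
move=> cf; apply: continuous_in_subspaceT => x.
by rewrite inE/= in_itv/= => /andP[x0 _]; exact: cf.
Qed.

Lemma continuous_ge0_integrable f (t : R) : continuous_ge0 f ->
  mu.-integrable `[0, t] (EFin \o f).
Proof.
move=> cf; apply: continuous_compact_integrable; first exact: segment_compact.
exact: continuous_ge0_within.
Qed.

Lemma increment_integral F f (t : R) : {within `[0, t], continuous f} ->
  (forall x, 0 <= x <= t -> is_derive x 1 F (f x)) ->
  0 <= t -> \int[mu]_(x in `[0, t]) f x = F t - F 0.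
Proof.
move=> cf dF; rewrite le_eqVlt => /predU1P[<-|t0].
  by rewrite set_itv1 Rintegral_set1 subrr.
have cF x : 0 <= x <= t -> {for x, continuous F}.
  move=> xt; apply/differentiable_continuous/derivable1_diffP.
  by have [] := dF _ xt.
rewrite /Rintegral (@continuous_FTC2 _ f F 0 t t0 cf)//.
- split => [x| |].
  + by rewrite in_itv/= => /andP[/ltW x0 /ltW xt]; have [|] := dF x; first exact/andP.
  + by apply: cvg_at_right_filter; apply: cF; rewrite lexx ltW.
  + by apply: cvg_at_left_filter; apply: cF; rewrite lexx ltW.
- move=> x; rewrite in_itv/= => /andP[/ltW x0 /ltW xt].
  by rewrite derive1E; apply: derive_val; apply: dF; exact/andP.
Qed.

Lemma antiderivative_increment F f (t : R) : continuous_ge0 f -> antiderivative F f ->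
  0 <= t -> \int[mu]_(x in `[0, t]) f x = F t - F 0.
Proof.
move=> cf dF; apply: increment_integral; first exact: continuous_ge0_within.
by move=> x /andP[x0 _]; exact: dF.
Qed.

Lemma continuous_max_id (f : R -> R) : continuous_ge0 f -> continuous (fun x : R => f (Num.max x 0)).
Proof.
move=> cf x; apply: (@continuous_comp _ _ _ (fun x : R => Num.max x 0) f).
  by apply: (@continuous_max R R id (fun=> 0) x); [exact: cvg_id|exact: cvg_cst].
by apply: cf; rewrite le_max lexx orbT.
Qed.

Lemma antiderivative_exists f : continuous_ge0 f -> exists F,
  [/\ F 0 = 0, antiderivative F f &
      forall t, 0 <= t -> \int[mu]_(x in `[0, t]) f x = F t].
Proof.
move=> cf; have cm := continuous_max_id cf.
(* Starting the integral at -1 makes 0 an interior point, so that the derivative there is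
   two-sided. *)
pose F0 (x : R) : R := \int[mu]_(t in `[(-1)%R, x]) f (Num.max t 0).
pose F x := F0 x - F0 0.
have dF0 : antiderivative F0 f.
  move=> x x0.
  have x1 : (-1 < x) by exact: lt_le_trans x0.
  have xu : x < x + 1 by rewrite ltrDl.
  have fi : mu.-integrable `[(-1)%R, x + 1] (EFin \o (fun x => f (Num.max x 0))).
    apply: continuous_compact_integrable; first exact: segment_compact.
    exact: continuous_subspaceT.
  have [d1 d2] := continuous_FTC1_closed xu fi x1 (cm x).
  by apply: DeriveDef => //; rewrite -derive1E d2 (max_idPl x0).
have dF : antiderivative F f.
  move=> x x0; have h := dF0 x x0; rewrite -[f x]subr0; apply: is_deriveB.
have F00 : F 0 = 0 by rewrite /F subrr.
exists F; split => // t t0; rewrite (antiderivative_increment cf dF t0) F00 subr0//.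
Qed.

Lemma antiderivativeD F f G g : antiderivative F f -> antiderivative G g ->
  antiderivative (fun x => F x + G x) (fun x => f x + g x).
Proof. by move=> dF dG x x0; have h1 := dF x x0; have h2 := dG x x0; exact: is_deriveD. Qed.

Lemma antiderivative_cst (c : R) : antiderivative (fun=> c) (fun=> 0).
Proof. by move=> x _; exact: is_derive_cst. Qed.

Lemma antiderivative_id : antiderivative (fun x => x) (fun=> 1).
Proof. by move=> x _; exact: is_derive_id. Qed.

Lemma antiderivativeM F f G g : antiderivative F f -> antiderivative G g ->
  antiderivative (fun x => F x * G x) (fun x => F x * g x + f x * G x).
Proof.
move=> dF dG x x0; have h1 := dF x x0; have h2 := dG x x0.
by apply: is_derive_eq; rewrite /GRing.scale/= (mulrC (f x)).
Qed.

Lemma antiderivativeZ c F f : antiderivative F f ->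
  antiderivative (fun x => c * F x) (fun x => c * f x).
Proof.
move=> dF x x0; have h := antiderivativeM (antiderivative_cst c) dF x0.
by move: h; rewrite mul0r addr0.
Qed.

Lemma antiderivative_expR c : antiderivative (fun x => expR (c * x)) (fun x => c * expR (c * x)).
Proof.
move=> x x0; have h : is_derive x 1 (fun x : R => c * x) c.
  by have := antiderivativeZ c antiderivative_id x0; rewrite mulr1.
have h2 : is_derive (c * x) 1 (@expR R) (expR (c * x)) by exact: is_derive_expR.
have := @is_derive1_comp R expR (fun x => c * x) x (expR (c * x)) c h2 h.
by rewrite mulrC.
Qed.

Lemma antiderivative_eq F f g : antiderivative F f -> (forall x, 0 <= x -> f x = g x) ->
  antiderivative F g.
Proof. by move=> dF fg x x0; rewrite -fg//; exact: dF. Qed.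

Lemma antiderivative0 F t : antiderivative F (fun=> 0) -> 0 <= t -> F t = F 0.
Proof.
move=> dF t0; apply/eqP; rewrite -subr_eq0; apply/eqP.
rewrite -(antiderivative_increment _ dF t0); first by rewrite /Rintegral integral0.
by move=> x _; exact: cvg_cst.
Qed.

Lemma antiderivative_ge0 F f t : continuous_ge0 f -> antiderivative F f ->
  (forall x, 0 <= f x) -> 0 <= t -> F 0 <= F t.
Proof.
move=> cf dF f0 t0; rewrite -subr_ge0 -(antiderivative_increment cf dF t0).
by apply: Rintegral_ge0 => x _.
Qed.

End antiderivatives.

(** * Deterministic identities along one path *)

Section vasicek_path.
Context {R : realType}.
Notation mu := (@lebesgue_measure R).
Variables (a b sigma y0 : R) (b0 : 0 < b) (s0 : 0 < sigma).
Variables (beta y : R -> R).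
Hypotheses (cbeta : continuous_ge0 beta) (cy : continuous_ge0 y).
Hypothesis y_eq : forall t, 0 <= t ->
  y t = y0 + \int[mu]_(s in `[0, t]) (a + b * y s) + sigma * beta t.

Definition path_forward (T : R) : R := b * \int[mu]_(s in `[0, T]) (expR (- b * s) * beta s).
Definition path_backward (T : R) : R :=
  b * expR (- b * T) * \int[mu]_(s in `[0, T]) (expR (b * s) * beta s).
Definition path_zeta (T : R) : R := y0 + a / b + sigma * path_forward T.
Definition path_int (T : R) : R := \int[mu]_(s in `[0, T]) y s.
Definition path_sqr (T : R) : R := \int[mu]_(s in `[0, T]) y s ^+ 2.
Definition noise_sqr (T : R) : R := \int[mu]_(s in `[0, T]) beta s ^+ 2.

Let cexp c : continuous_ge0 (fun s : R => expR (c * s)).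
Proof. by apply: antiderivative_continuous; exact: antiderivative_expR. Qed.

Let cM f g : continuous_ge0 f -> continuous_ge0 g -> @continuous_ge0 R (fun s => f s * g s).
Proof. by move=> cf cg x x0; apply: cvgM; [exact: cf|exact: cg]. Qed.

Let cD f g : continuous_ge0 f -> continuous_ge0 g -> @continuous_ge0 R (fun s => f s + g s).
Proof. by move=> cf cg x x0; apply: cvgD; [exact: cf|exact: cg]. Qed.

Let cC (c : R) : @continuous_ge0 R (fun=> c).
Proof. by move=> x x0; exact: cvg_cst. Qed.

Let cE : continuous_ge0 (fun s => expR (- b * s) * beta s). Proof. exact: cM. Qed.
Let cF : continuous_ge0 (fun s => expR (b * s) * beta s). Proof. exact: cM. Qed.
Let cay : continuous_ge0 (fun s => a + b * y s). Proof. by apply: cD => //; exact: cM. Qed.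

Lemma path_equation (t : R) : 0 <= t -> y t = y0 + a * t + b * path_int t + sigma * beta t.
Proof.
move=> t0; rewrite y_eq//; congr (_ + _); rewrite -addrA; congr (_ + _).
have [U [U0 dU iU]] := antiderivative_exists cy.
rewrite /path_int iU//.
rewrite (@antiderivative_increment _ (fun t => a * t + b * U t) _ t cay _ t0); last first.
  have := antiderivativeD (antiderivativeZ a (@antiderivative_id R)) (antiderivativeZ b dU).
  by move/antiderivative_eq; apply => x _; rewrite mulr1.
by rewrite U0 !mulr0 addr0 subr0.
Qed.

(** The integrating factor e^(-bs): by [path_equation] the function [h] of the proof has derivative
    0. *)
Lemma path_int_zeta (t : R) : 0 <= t ->
  b * path_int t = expR (b * t) * path_zeta t - (y0 + a / b + a * t).
Proof.
move=> t0.
have [U [U0 dU iU]] := antiderivative_exists cy.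
have [E [E0 dE iE]] := antiderivative_exists cE.
have Ueq x : 0 <= x -> y x = y0 + a * x + b * U x + sigma * beta x.
  by move=> x0; rewrite path_equation// /path_int iU.
rewrite /path_zeta /path_forward /path_int iU// iE//.
pose h s := expR (- b * s) * (b * U s + (y0 + a / b + a * s)) + - (sigma * b) * E s.
have dh : antiderivative h (fun=> 0).
  have := antiderivativeD (antiderivativeM (antiderivative_expR (- b))
    (antiderivativeD (antiderivativeZ b dU) (antiderivativeD (antiderivative_cst (y0 + a / b))
      (antiderivativeZ a (@antiderivative_id R))))) (antiderivativeZ (- (sigma * b)) dE).
  move/antiderivative_eq; apply => x x0 /=; rewrite (Ueq x x0).
  by move: (expR _) (beta x) (U x) => e be u; field; exact: lt0r_neq0.
have := antiderivative0 dh t0; rewrite /h U0 E0 !mulr0 expR0 mul1r add0r !addr0.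
move=> h1.
have ee : expR (b * t) * expR (- b * t) = 1 by rewrite -expRD mulNr subrr expR0.
have : expR (b * t) * (expR (- b * t) * (b * U t + (y0 + a / b + a * t)) + - (sigma * b) * E t)
   = expR (b * t) * (y0 + a / b) by rewrite h1.
rewrite mulrDr mulrA ee mul1r => h2; rewrite -[LHS](addrK (y0 + a / b + a * t)); congr (_ - _).
move: h2; move: (a / b) (expR (b * t)) (U t) (E t) => c e u v h2.
have -> : e * (y0 + c + sigma * (b * v)) = e * (y0 + c) + e * (sigma * b * v) by ring.
by rewrite -h2; ring.
Qed.

(** Let Q, S, V be the integrals of p beta, p^2 and beta^2, with p the backward average. The
    remainder is -(a/b) sigma beta + sigma^2 beta^2 / 2 + sigma^2 b (Q - V). From p' = b (beta - p)
    follows 0 <= S <= Q, and from (p - beta)^2 >= 0 then Q <= V, so the last term is bounded by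
    sigma^2 b V. *)
Lemma path_remainder (T : R) : 0 <= T ->
  `|2^-1 * (y T ^+ 2 - y0 ^+ 2) - a * path_int T - b * path_sqr T
    - sigma * expR (b * T) * path_zeta T * (beta T - path_backward T)| <=
  `|a / b| * sigma * `|beta T| + 2^-1 * sigma ^+ 2 * beta T ^+ 2
    + sigma ^+ 2 * b * noise_sqr T.
Proof.
move=> T0.
have cX : continuous_ge0 (fun x => y x ^+ 2) by exact: cM.
have cV : continuous_ge0 (fun x => beta x ^+ 2) by exact: cM.
have [U [U0 dU iU]] := antiderivative_exists cy.
have [E [E0 dE iE]] := antiderivative_exists cE.
have [F [F0 dF iF]] := antiderivative_exists cF.
have [X [X0 dX iX]] := antiderivative_exists cX.
have [V [V0 dV iV]] := antiderivative_exists cV.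
pose z x := y0 + a / b + sigma * b * E x.
pose p x := b * (expR (- b * x) * F x).
have dz : antiderivative z (fun x => sigma * b * (expR (- b * x) * beta x)).
  have := antiderivativeD (antiderivative_cst (y0 + a / b)) (antiderivativeZ (sigma * b) dE).
  by move/antiderivative_eq; apply => x _; rewrite add0r.
have ee x : expR (b * x) * expR (- b * x) = 1 by rewrite -expRD mulNr subrr expR0.
have dp : antiderivative p (fun x => b * beta x - b * p x).
  have := antiderivativeZ b (antiderivativeM (antiderivative_expR (- b)) dF).
  move/antiderivative_eq; apply => x _; rewrite /p.
  move: (ee x); move: (expR (b * x)) (expR (- b * x)) (beta x) (F x) => e f be w ef.
  have -> : b * (f * (e * be) + - b * f * w) = b * ((e * f) * be) - b * (b * (f * w)) by ring.
  by rewrite ef mul1r.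
have cz := antiderivative_continuous dz.
have cp := antiderivative_continuous dp.
have cQ : continuous_ge0 (fun x => p x * beta x) by exact: cM.
have cp2 : continuous_ge0 (fun x => p x * p x) by exact: cM.
have [Q [Q0 dQ iQ]] := antiderivative_exists cQ.
have [S [S0 dS iS]] := antiderivative_exists cp2.
have cx : continuous_ge0 (fun x => beta x * (expR (b * x) * z x)) by apply: cM => //; exact: cM.
have [K [K0 dK iK]] := antiderivative_exists cx.
have zE x : 0 <= x -> path_zeta x = z x.
  by move=> x0; rewrite /path_zeta /path_forward iE// /z mulrA.
have yE x : 0 <= x -> y x = expR (b * x) * z x - a / b + sigma * beta x.
  move=> x0; rewrite path_equation// path_int_zeta// zE//.
  by move: (a / b) (expR (b * x)) (z x) (beta x) => c e w be; ring.
(* Integration by parts for the products F z, p^2 and for y (b y + a) = y x', where x = e^(bt) z. *)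
have i1 : F T * z T = K T + sigma * Q T.
  have : antiderivative (fun x => F x * z x + -1 * (K x + sigma * Q x)) (fun=> 0).
    have := antiderivativeD (antiderivativeM dF dz)
      (antiderivativeZ (-1) (antiderivativeD dK (antiderivativeZ sigma dQ))).
    move/antiderivative_eq; apply => x _; rewrite /p.
    by move: (expR _) (expR _) (beta x) (F x) (z x) => e f be w u; ring.
  move/(fun h => antiderivative0 h T0); rewrite F0 K0 Q0 !(mulr0, mul0r, addr0) => /eqP.
  by rewrite mulN1r subr_eq0 => /eqP.
have i2 : 2^-1 * p T ^+ 2 = b * (Q T - S T).
  have : antiderivative (fun x => 2^-1 * (p x * p x) + - b * (Q x + -1 * S x)) (fun=> 0).
    have := antiderivativeD (antiderivativeZ 2^-1 (antiderivativeM dp dp))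
      (antiderivativeZ (- b) (antiderivativeD dQ (antiderivativeZ (-1) dS))).
    move/antiderivative_eq; apply => x _.
    by move: (p x) (beta x) => u be; field.
  move/(fun h => antiderivative0 h T0).
  rewrite Q0 S0 {3 4}/p F0 !(mulr0, mul0r, addr0) mulN1r mulNr => /eqP.
  by rewrite subr_eq0 expr2 => /eqP.
have i3 : S 0 <= S T.
  by apply: (antiderivative_ge0 cp2 dS) => // x; rewrite -expr2 sqr_ge0.
have i4 : 0 <= S T + V T - 2 * Q T.
  have c4 : continuous_ge0 (fun x => (p x + -1 * beta x) * (p x + -1 * beta x)).
    by apply: cM; apply: cD => //; exact: cM.
  have d4 : antiderivative (fun x => S x + V x + - 2 * Q x)
      (fun x => (p x + -1 * beta x) * (p x + -1 * beta x)).
    have := antiderivativeD (antiderivativeD dS dV) (antiderivativeZ (- 2) dQ).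
    move/antiderivative_eq; apply => x _.
    by move: (p x) (beta x) => u be; ring.
  have := antiderivative_ge0 c4 d4 _ T0; rewrite S0 V0 Q0 mulr0 !addr0 mulNr; apply => x.
  by rewrite -expr2 sqr_ge0.
have i5 : a * U T + b * X T = 2^-1 * ((expR (b * T) * z T - a / b) ^+ 2 - y0 ^+ 2)
    + sigma * b * K T + sigma ^+ 2 * b * V T.
  pose w x := expR (b * x) * z x + - (a / b).
  have dw : antiderivative w (fun x => b * y x + a).
    have := antiderivativeD (antiderivativeM (antiderivative_expR b) dz) (antiderivative_cst (- (a / b))).
    move/antiderivative_eq; apply => x x0; rewrite (yE x x0).
    move: (ee x); move: (expR (b * x)) (expR (- b * x)) (beta x) (z x) => e f be u ef.
    have -> : e * (sigma * b * (f * be)) + b * e * u + 0 = sigma * b * (e * f * be) + b * e * u by ring.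
    by rewrite ef; field; exact: lt0r_neq0.
  have : antiderivative (fun x => 2^-1 * (w x * w x) + sigma * b * K x + sigma ^+ 2 * b * V x
       + -1 * (a * U x + b * X x)) (fun=> 0).
    have := antiderivativeD (antiderivativeD (antiderivativeD
      (antiderivativeZ 2^-1 (antiderivativeM dw dw)) (antiderivativeZ (sigma * b) dK))
      (antiderivativeZ (sigma ^+ 2 * b) dV))
      (antiderivativeZ (-1) (antiderivativeD (antiderivativeZ a dU) (antiderivativeZ b dX))).
    move/antiderivative_eq; apply => x x0; rewrite (yE x x0) /w.
    by move: (expR (b * x)) (beta x) (z x) => e be u; field; exact: lt0r_neq0.
  move/(fun h => antiderivative0 h T0).
  have w0 : w 0 = y0 by rewrite /w /z E0 !mulr0 addr0 expR0 mul1r addrK.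
  rewrite w0 K0 V0 U0 X0 !(mulr0, mul0r, addr0) => /eqP.
  rewrite mulN1r subr_eq => /eqP h.
  rewrite -/(w T) !expr2; move: h; move: (w T * w T) (_ * V T) (_ * K T) => r s u; lra.
have pT : path_backward T = p T by rewrite /path_backward iF// /p mulrA.
rewrite pT /path_int /path_sqr /noise_sqr iU// iX// iV// zE// (yE T T0).
have bS : 0 <= S T by rewrite -S0.
have SQ : S T <= Q T.
  by rewrite -subr_ge0 -(pmulr_rge0 _ b0) -i2 mulr_ge0// sqr_ge0.
have QV : Q T <= V T by move: i4 SQ; lra.
have -> : 2^-1 * ((expR (b * T) * z T - a / b + sigma * beta T) ^+ 2 - y0 ^+ 2) - a * U T - b * X T
   - sigma * expR (b * T) * z T * (beta T - p T) =
   - (a / b * sigma * beta T) + 2^-1 * sigma ^+ 2 * beta T ^+ 2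
   + sigma ^+ 2 * b * (Q T - V T).
  have -> : b * X T = 2^-1 * ((expR (b * T) * z T - a / b) ^+ 2 - y0 ^+ 2)
    + sigma * b * K T + sigma ^+ 2 * b * V T - a * U T by rewrite -i5 addrC addKr.
  have -> : sigma * expR (b * T) * z T * (beta T - p T) =
     sigma * expR (b * T) * z T * beta T - sigma * b * (expR (b * T) * expR (- b * T)) * (F T * z T).
    by rewrite /p; move: (expR _) (expR _) => e f; ring.
  rewrite ee i1; move: (a / b) (expR (b * T)) (beta T) (z T) => c e be u.
  by field.
apply: le_trans (ler_normD _ _) _; apply: lerD.
  apply: le_trans (ler_normD _ _) _; apply: lerD.
    by rewrite normrN !normrM (gtr0_norm s0).
  by rewrite ger0_norm// mulr_ge0// ?sqr_ge0// mulr_ge0// sqr_ge0.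
have sb : 0 <= sigma ^+ 2 * b by rewrite mulr_ge0 ?sqr_ge0// ltW.
rewrite normrM (ger0_norm sb); apply: ler_wpM2l => //.
rewrite ler0_norm; last by rewrite subr_le0.
by move: bS SQ QV; lra.
Qed.

End vasicek_path.

(** * Exponential averages as path integrals *)

Section exponential_integral.
Context {R : realType}.
Notation mu := (@lebesgue_measure R).
Variables (b : R) (b0 : 0 < b).

Lemma integral_eps (g : R -> R) : measurable_fun [set: R] g ->
  (\int[eps b0]_t (g t)%:E = \int[mu]_t (g t * exponential_pdf b t)%:E)%E.
Proof.
move=> mg.
have p0 (t : R) : 0 <= exponential_pdf b t by rewrite exponential_pdf_ge0// ltW.
have mge : measurable_fun [set: R] (EFin \o g) by exact/measurable_EFinP.
rewrite integralE [RHS]integralE; congr (_ - _)%E; rewrite ge0_integral_eps.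
- by apply: eq_integral => t _; rewrite !funeposE/= -!EFin_max -EFinM maxr_pMl ?mul0r.
- exact: measurable_funepos.
- exact: funepos_ge0.
- by apply: eq_integral => t _; rewrite !funenegE/= -[RHS]/(maxe (- (g t * exponential_pdf b t))%:E 0%:E)%E -[X in (maxe X _)]/((- g t)%:E) -!EFin_max -EFinM maxr_pMl ?mul0r ?mulNr.
- exact: measurable_funeneg.
- exact: funeneg_ge0.
Qed.

Lemma integral_eps_cut (f : R -> R) (T : R) : measurable_fun [set: R] f -> continuous_ge0 f -> 0 <= T ->
  \int[eps b0]_t (\1_(`[0, T[) t * f t) =
  b * \int[mu]_(s in `[0, T]) (expR (- b * s) * f s).
Proof.
move=> mf cf T0.
have cexp : continuous_ge0 (fun s => expR (- b * s) * f s).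
  move=> x x0; apply: cvgM; last exact: cf.
  by apply: (antiderivative_continuous (@antiderivative_expR R (- b))).
have fi := continuous_ge0_integrable T cexp.
have fi' : mu.-integrable `[0, T[ (EFin \o (fun s => b * (expR (- b * s) * f s))).
  have fi2 : mu.-integrable `[0, T] (EFin \o (fun s => b * (expR (- b * s) * f s))).
    by apply: continuous_ge0_integrable => x x0; apply: cvgM; [exact: cvg_cst|exact: cexp].
  by apply: (integrableS _ _ _ fi2) => //; exact: subset_itv_co_cc.
rewrite -RintegralZl// -Rintegral_itv_bndo_bndc//.
have mg : measurable_fun [set: R] (fun t => \1_(`[0, T[) t * f t : R).
  by apply: measurable_funM => //; exact: measurable_indic.
rewrite [RHS]Rintegral_mkcond.
transitivity (fine (\int[mu]_t (\1_(`[0, T[) t * f t * exponential_pdf b t)%:E)%E).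
  by congr fine; exact: (integral_eps mg).
congr fine; apply: eq_integral => t _; congr EFin; rewrite patchE indicE.
case: (boolP (t \in _)); rewrite ?mul0r// mem_setE in_itv/= => /andP[t0 _].
by rewrite exponential_pdfE//; move: (expR _) (f t) => e u; ring.
Qed.

End exponential_integral.

Section averages_as_path_integrals.
Context {R : realType} {d} {Omega : measurableType d} {P : probability Omega R}.
Notation mu := (@lebesgue_measure R).
Variables (b : R) (b0 : 0 < b) (B : R -> {RV P >-> R}).
Hypothesis cB : forall w, {within `[0, +oo[, continuous (fun t : R => B t w)}.

Let beta (w : Omega) (t : R) : R := B (Num.max t 0) w.
Let cbeta w : continuous (beta w). Proof. exact: (within_continuous_max (@cB w)). Qed.
Let mbeta w : measurable_fun [set: R] (beta w). Proof. exact: (continuous_measurable_fun (@cbeta w)). Qed.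

Lemma forward_averageE T w : 0 <= T -> forward_average B b0 T w = path_forward b (beta w) T.
Proof.
move=> T0; rewrite /path_forward -(integral_eps_cut b0 (mbeta w) _ T0)// => x _.
exact: cbeta.
Qed.

(** Time reversal s |-> T - s, carried out by exhibiting an antiderivative of the reversed
    integrand. *)
Lemma backward_averageE T w : 0 <= T -> backward_average B b0 T w = path_backward b (beta w) T.
Proof.
move=> T0.
pose f t := B (backward_time T t) w.
have cf : continuous f.
  move=> t; have -> : f = beta w \o backward_time T.
    by apply/funext => s; rewrite /f /beta /= (max_idPl (backward_time_ge0 T s)).
  by apply: continuous_comp; [exact: backward_time_continuous|exact: cbeta].
have cf0 : continuous_ge0 f by move=> x _; exact: cf.
transitivity (b * \int[mu]_(s in `[0, T]) (expR (- b * s) * f s)).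
  by rewrite -(integral_eps_cut b0 _ cf0 T0)//; exact: continuous_measurable_fun.
rewrite /path_backward -mulrA; congr (_ * _).
rewrite -RintegralZl//; last first.
  apply: continuous_ge0_integrable => x x0; apply: cvgM; last exact: cbeta.
  exact: (antiderivative_continuous (@antiderivative_expR R b)).
have cg : continuous_ge0 (fun s => expR (b * s) * beta w s).
  move=> x x0; apply: cvgM; last exact: cbeta.
  exact: (antiderivative_continuous (@antiderivative_expR R b)).
have [F [F0 dF iF]] := antiderivative_exists cg.
rewrite [LHS](@increment_integral _ (fun s => - expR (- b * T) * F (T - s)) _ T _ _ T0); last 2 first.
- apply: continuous_ge0_within => x x0; apply: cvgM; last exact: cf.
  exact: (antiderivative_continuous (@antiderivative_expR R (- b))).
- move=> x /andP[x0 xT].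
  have d1 : is_derive x 1 (fun s : R => T - s) (-1).
    have := @is_deriveB R R R (fun=> T) id x 1 0 1 _ _; rewrite sub0r; apply.
  have Tx : 0 <= T - x by rewrite subr_ge0.
  have d2 := @is_derive1_comp R F (fun s => T - s) x _ _ (dF _ Tx) d1.
  have d3 : is_derive x 1 (fun s => - expR (- b * T) * F (T - s))
     (- expR (- b * T) * (expR (b * (T - x)) * beta w (T - x) * -1)).
    exact: is_deriveZ.
  move: d3; congr (is_derive _ _ _ _).
  have -> : expR (- b * x) = expR (- b * T) * expR (b * (T - x)).
    by rewrite -expRD; congr expR; ring.
  rewrite /f backward_timeE// /beta (max_idPl Tx).
  by move: (B _ _) (expR _) (expR _) => u e e'; ring.
rewrite subrr subr0 F0 mulr0 sub0r -mulNr opprK RintegralZl ?iF//.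
exact: continuous_ge0_integrable.
Qed.

End averages_as_path_integrals.

(** * Convergence of integrals *)

Section gaussian_integrals.
Context {R : realType}.

Let measurable_toR : measurable_fun [set: measurableTypeR R] (fun x : measurableTypeR R => x : R).
Proof. exact: (@measurable_id _ R). Qed.

Lemma integral_normal_law (m v : R) (f : R -> R) (M : R) : 0 < v ->
  measurable_fun [set: R] f -> (forall x, `|f x| <= M) ->
  (\int[normal_law m v]_x (f x)%:E = \int[@stdn R]_x (f (m + Num.sqrt v * x))%:E)%E.
Proof.
move=> v0 mf fM; have s0 : 0 < Num.sqrt v by rewrite sqrtr_gt0.
have mphi : measurable_fun [set: R] (fun x : R => m + Num.sqrt v * x).
  by apply: measurable_funD => //; exact: measurable_funM.
have mEf : measurable_fun [set: R] (EFin \o f) by exact/measurable_EFinP.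
have fi : (@stdn R).-integrable setT ((EFin \o f) \o (fun x => m + Num.sqrt v * x)).
  apply: (@bounded_integrable _ _ _ (@stdn R) (fun x => f (m + Num.sqrt v * x)) M) => //.
  exact: (measurableT_comp mf mphi).
have e1 := @integral_pushforward _ _ _ _ _ _ mphi (@stdn R) setT (EFin \o f) mEf fi measurableT.
rewrite -[RHS]e1.
apply: (eq_measure_integral
  (measure_function_pushforward__canonical__measure_function_Measure (@stdn R) mphi)
  (m1 := measure_function_pushforward__canonical__measure_function_Measure
    (normal_prob m (Num.sqrt v)) measurable_toR)) => A mA _.
rewrite -[LHS]/(normal_prob m (Num.sqrt v) A) (normal_prob_standard m s0 mA).
exact/esym/stdnE.
Qed.

Lemma integral_stdn2_fst (f : R -> R) (M : R) : measurable_fun [set: R] f -> (forall x, `|f x| <= M) ->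
  (\int[@stdn R \x @stdn R]_z (f z.1)%:E = \int[@stdn R]_x (f x)%:E)%E.
Proof.
move=> mf fM.
have fi : ((@stdn R \x @stdn R)%E).-integrable setT (fun z : R * R => (f z.1)%:E).
  apply: (@bounded_integrable _ _ _ [the probability _ _ of (@stdn R \x @stdn R)%E] (fun z : R * R => f z.1) M) => //.
  exact: (measurableT_comp mf measurable_fst).
rewrite -integral12_prod_meas1//; apply: eq_integral => x _ /=.
by rewrite /fubini_F/= integral_cst//= probability_setT mule1.
Qed.

Lemma integral_stdn2_snd (f : R -> R) (M : R) : measurable_fun [set: R] f -> (forall x, `|f x| <= M) ->
  (\int[@stdn R \x @stdn R]_z (f z.2)%:E = \int[@stdn R]_x (f x)%:E)%E.
Proof.
move=> mf fM.
have fi : ((@stdn R \x @stdn R)%E).-integrable setT (fun z : R * R => (f z.2)%:E).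
  apply: (@bounded_integrable _ _ _ [the probability _ _ of (@stdn R \x @stdn R)%E] (fun z : R * R => f z.2) M) => //.
  exact: (measurableT_comp mf measurable_snd).
rewrite -integral12_prod_meas1//.
transitivity (\int[@stdn R]_x (cst (\int[@stdn R]_y (f y)%:E) x))%E => //.
by rewrite integral_cst//= probability_setT mule1.
Qed.

(** A normal law has no atoms; applied to the limit of zeta_T, this makes the cutoff near 0
    negligible. *)
Lemma stdn_ae_neq (c : R) : {ae @stdn R, forall x, x != c}.
Proof.
exists [set c]; split => //; last by move=> x /= /negP; rewrite negbK => /eqP.
rewrite stdnE /normal_prob.
by rewrite integral_set1.
Qed.

End gaussian_integrals.

Section joint_normal_convergence.
Context {R : realType} {d} {Omega : measurableType d} (P : probability Omega R).

(** The variances are positive only from some rank on; there the Gaussian formula applies, and it is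
    continuous in the covariances. *)
Lemma jgauss_cvg (X Y : nat -> Omega -> R) (p q r : R) (F : R * R -> R) (M : R) :
  (forall n, jgauss P (X n) (Y n)) ->
  ip P (X n) (X n) @[n --> \oo] --> p -> ip P (X n) (Y n) @[n --> \oo] --> q ->
  ip P (Y n) (Y n) @[n --> \oo] --> r -> 0 < p ->
  measurable_fun [set: R * R] F -> continuous F -> (forall z, `|F z| <= M) ->
  (\int[P]_w (F (X n w, Y n w))%:E @[n --> \oo] -->
   \int[@stdn R \x @stdn R]_z (F (normal_coeff p q r z))%:E)%E.
Proof.
move=> jg cp cq cr p0 mF cF FM.
have lim := normal_coeff_integral_cvg cp cq cr p0 mF cF FM.
apply: cvg_trans lim; apply: near_eq_cvg.
have : \forall n \near \oo, 0 < ip P (X n) (X n) by exact: (cvgr_gt p).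
apply: filterS => n pn; have [_ _ h] := jg n.
by rewrite h//; exists M.
Qed.

End joint_normal_convergence.

(** * Cutoffs near the zero of the denominator *)

Section cutoff.
Context {R : realType}.

(** A continuous substitute for the indicator of [-delta, delta]: it is 1 there, 0 outside
    [-2 delta, 2 delta], and linear in |z| between. *)
Definition cutoff (delta z : R) : R := Num.max 0 (Num.min 1 (2 - `|z| / delta)).

Lemma cutoff_ge0 delta z : 0 <= cutoff delta z.
Proof. by rewrite /cutoff le_max lexx. Qed.

Lemma cutoff_le1 delta z : cutoff delta z <= 1.
Proof. by rewrite /cutoff ge_max ler01 ge_min lexx. Qed.

Lemma cutoff_eq1 delta z : 0 < delta -> `|z| <= delta -> cutoff delta z = 1.
Proof.
move=> d0 zd; rewrite /cutoff (min_idPl _) ?(max_idPr _)//.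
by have : `|z| / delta <= 1 by [rewrite ler_pdivrMr// mul1r]; lra.
Qed.

Lemma cutoff_eq0 delta z : 0 < delta -> 2 * delta <= `|z| -> cutoff delta z = 0.
Proof.
move=> d0 zd; rewrite /cutoff; apply/max_idPl; rewrite ge_min; apply/orP; right.
by have : 2 <= `|z| / delta by [rewrite ler_pdivlMr]; lra.
Qed.

Lemma cutoff_continuous delta : continuous (cutoff delta).
Proof.
move=> z; apply: (@continuous_max R R (fun=> 0) (fun z => Num.min 1 (2 - `|z| / delta)) z); first exact: cvg_cst.
apply: (@continuous_min R R (fun=> 1) (fun z => 2 - `|z| / delta) z); first exact: cvg_cst.
apply: cvgB; first exact: cvg_cst.
by apply: cvgM; [apply: cvg_norm; exact: cvg_id|exact: cvg_cst].
Qed.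

Lemma cutoff_cvg0 (delta : nat -> R) z : (forall k, 0 < delta k) -> delta k @[k --> \oo] --> 0 ->
  z != 0 -> cutoff (delta k) z @[k --> \oo] --> 0.
Proof.
move=> dp d0 z0; apply: cvg_near_cst.
have zp : 0 < `|z| / 2 by rewrite divr_gt0// normr_gt0.
have : \forall k \near \oo, delta k < `|z| / 2 by apply: (cvgr_lt 0).
apply: filterS => k kz; rewrite cutoff_eq0//.
by move: kz; move: (`|z|) => u; lra.
Qed.

(** Where the second coordinate is near 0 the factor 1 - cutoff vanishes identically, which removes
    the singularity of the quotient. *)
Lemma cutoff_quotient_continuous (delta : R) (f : R -> R) : 0 < delta -> continuous f ->
  continuous (fun z : R * R => f (z.1 / z.2) * (1 - cutoff delta z.2)).
Proof.
move=> d0 cf [x y]; have [y0|y0] := eqVneq y 0.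
  rewrite /continuous_at/= y0.
  have -> : f (x / 0) * (1 - cutoff delta 0) = 0.
    by rewrite cutoff_eq1 ?normr0 ?ltW// subrr mulr0.
  apply: cvg_near_cst.
  have : \forall z \near (x, 0 : R), `|z.2| < delta.
    have c2 : `|z.2| @[z --> (x, 0 : R)] --> `|0 : R|.
      by apply: cvg_norm; exact: cvg_snd.
    by apply: (cvgr_lt _ c2); rewrite normr0.
  by apply: filterS => z zd; rewrite cutoff_eq1 ?(ltW zd)// subrr mulr0.
apply: cvgM.
  apply: continuous_cvg; first exact: cf.
  apply: cvgM; first exact: cvg_fst.
  by apply: cvgV => //; exact: cvg_snd.
apply: cvgB; first exact: cvg_cst.
apply: continuous_cvg; first exact: cutoff_continuous.
exact: cvg_snd.
Qed.

End cutoff.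

(** * Convergence of means by approximation outside small events *)

Section approximation.
Context {R : realType} {d} {Omega : measurableType d} (P : probability Omega R).
Variables (M C L : R) (f : nat -> Omega -> R) (G : nat -> Omega -> R).
Variables (h chi : nat -> nat -> Omega -> R) (l e : nat -> R).
Hypotheses (M0 : 0 <= M).
Hypotheses (mf : forall n, measurable_fun setT (f n)) (fM : forall n w, `|f n w| <= M).
Hypotheses (mh : forall k n, measurable_fun setT (h k n)) (hM : forall k n w, `|h k n w| <= M).
Hypotheses (mchi : forall k n, measurable_fun setT (chi k n)).
Hypotheses (chi_ge0 : forall k n w, 0 <= chi k n w) (chi_le1 : forall k n w, chi k n w <= 1).
Hypotheses (G0 : forall n w, 0 <= G n w) (intG : forall n, P.-integrable setT (EFin \o G n)).
Hypothesis GC : \forall n \near \oo, \int[P]_w G n w <= C.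
Hypothesis near_h : forall k (eta K : R), 0 < eta -> 0 < K -> \forall n \near \oo,
  forall w, G n w <= K -> `|f n w - h k n w| <= eta + 2 * M * chi k n w.
Hypotheses (h_cvg : forall k, \int[P]_w h k n w @[n --> \oo] --> l k).
Hypotheses (chi_cvg : forall k, \int[P]_w chi k n w @[n --> \oo] --> e k).
Hypotheses (e_cvg : e k @[k --> \oo] --> 0) (l_e : forall k, `|l k - L| <= M * e k).

(** Where [G] is at most K, hypothesis [near_h] compares [f] with [h]; elsewhere the trivial bound 2
    M is at most 2 M G / K, whose mean is small for large K. *)
Lemma integral_approximation : \int[P]_w f n w @[n --> \oo] --> L.
Proof.
have fi n : P.-integrable setT (EFin \o f n) by exact: (bounded_integrable P (mf n) (fM n)).
have hi k n : P.-integrable setT (EFin \o h k n) by exact: (bounded_integrable P (mh k n) (hM k n)).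
have ci k n : P.-integrable setT (EFin \o chi k n).
  apply: (@bounded_integrable _ _ _ P (chi k n) 1) => // w.
  by rewrite ger0_norm.
apply/cvgrPdist_le => eps eps0.
(* The accumulated error is 7 M eta + 2 eta, while this choice gives eps = 16 M eta + 8 eta. *)
pose a := 8 * (2 * M + 1).
have a0 : 0 < a by rewrite mulr_gt0// ltr_wpDl// mulr_ge0.
pose eta := eps / a.
have eta0 : 0 < eta by rewrite divr_gt0.
have [k [_ hk]] : exists k : nat, True /\ e k <= eta.
  have : \forall k \near \oo, e k <= eta by apply: (cvgr_le 0).
  by case=> k _ hk; exists k; split => //; apply: hk => /=.
pose K := (`|C| + 1) / eta.
have K0 : 0 < K by rewrite divr_gt0// ltr_wpDl.
have near1 : \forall n \near \oo, `|l k - \int[P]_w h k n w| <= eta.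
  by move/cvgrPdist_le : (@h_cvg k); exact.
have near2 : \forall n \near \oo, `|e k - \int[P]_w chi k n w| <= eta.
  by move/cvgrPdist_le : (@chi_cvg k); exact.
near=> n.
have n1 : `|l k - \int[P]_w h k n w| <= eta by near: n; exact: near1.
have n2 : \int[P]_w G n w <= C by near: n; exact: GC.
have n3 : `|e k - \int[P]_w chi k n w| <= eta by near: n; exact: near2.
have n4 : forall w, G n w <= K -> `|f n w - h k n w| <= eta + 2 * M * chi k n w.
  by near: n; exact: near_h.
have n3' : \int[P]_w chi k n w <= 2 * eta.
  by move: n3 hk; rewrite ler_norml => /andP[n3 _]; move: n3; move: (\int[P]_w _) => u; lra.
have GK : \int[P]_w G n w / K <= eta.
  rewrite ler_pdivrMr// /K mulrCA mulfV ?gt_eqF// mulr1.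
  by apply: le_trans n2 _; have := ler_norm C; lra.
have bound : `|\int[P]_w f n w - \int[P]_w h k n w| <=
    eta + (2 * M * \int[P]_w chi k n w + 2 * M * (\int[P]_w G n w / K)).
  rewrite -RintegralB//.
  have fhi : P.-integrable setT (EFin \o (fun w => f n w - h k n w)).
    have := integrableB measurableT (fi n) (hi k n); by apply: eq_integrable.
  apply: le_trans (le_normr_Rintegral measurableT fhi) _.
  have gi : P.-integrable setT (EFin \o (fun w => 2 * M * chi k n w + 2 * M * (G n w / K))).
    have i1 := integrableZl measurableT (2 * M) (ci k n).
    have i2 := integrableZl measurableT (2 * M / K) (intG n).
    have := integrableD measurableT i1 i2; apply: eq_integrable => // w _ /=.
    rewrite -!EFinM -EFinD; congr EFin; move: (chi k n w) (G n w) => u v.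
    by rewrite -!mulrA (mulrC _ v).
  have eti : P.-integrable setT (EFin \o (fun w : Omega => eta)).
    by apply: (@bounded_integrable _ _ _ P _ `|eta|).
  have -> : eta + (2 * M * \int[P]_w chi k n w + 2 * M * (\int[P]_w G n w / K)) =
     \int[P]_w (eta + (2 * M * chi k n w + 2 * M * (G n w / K))).
    rewrite RintegralD// probability_Rintegral_cst; congr (_ + _).
    rewrite RintegralD//; last 2 first.
    - by have := integrableZl measurableT (2 * M) (ci k n).
    - have := integrableZl measurableT (2 * M / K) (intG n); apply: eq_integrable => // w _ /=.
      by rewrite -!EFinM; congr EFin; move: (G n w) => v; rewrite -!mulrA (mulrC _ v).
    rewrite RintegralZl//; congr (_ + _).
    rewrite RintegralZl//; last first.
      have := integrableZl measurableT (K^-1) (intG n); apply: eq_integrable => // w _ /=.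
      by rewrite -EFinM mulrC.
    by rewrite RintegralZr.
  apply: le_Rintegral => //.
  - by have := integrable_norm fhi.
  - by have := integrableD measurableT eti gi.
  move=> w _; have [GwK|GwK] := leP (G n w) K.
    apply: le_trans (n4 w GwK) _; rewrite addrA lerDl mulr_ge0//; first by rewrite mulr_ge0.
    by rewrite divr_ge0// ltW.
  apply: (@le_trans _ _ (2 * M)).
    apply: le_trans (ler_normB _ _) _; have := fM n w; have := hM k n w.
    by move: (`|f n w|) (`|h k n w|) => u v; lra.
  have G1 : 1 <= G n w / K by rewrite ler_pdivlMr// mul1r ltW.
  have G2 : 2 * M <= 2 * M * (G n w / K) by rewrite ler_peMr// mulr_ge0.
  have G3 : 0 <= 2 * M * chi k n w by rewrite mulr_ge0// mulr_ge0.
  by move: G2 G3; move: (_ * chi k n w) (_ * (G n w / K)) => u v; lra.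
rewrite -(subrK (l k) L) -addrA.
have -> : L - l k + (l k - \int[P]_w f n w) =
   (L - l k) + ((l k - \int[P]_w h k n w) + (\int[P]_w h k n w - \int[P]_w f n w)).
  by move: (\int[P]_w f n w) (\int[P]_w h k n w) => u v; ring.
apply: le_trans (ler_normD _ _) _.
have q1 : `|L - l k| <= M * eta.
  by rewrite distrC; apply: le_trans (l_e k) _; rewrite ler_wpM2l.
have q2 := ler_normD (l k - \int[P]_w h k n w) (\int[P]_w h k n w - \int[P]_w f n w).
have q3 : 2 * M * \int[P]_w chi k n w <= 2 * M * (2 * eta) by rewrite ler_wpM2l// mulr_ge0.
have q4 : 2 * M * (\int[P]_w G n w / K) <= 2 * M * eta by rewrite ler_wpM2l// mulr_ge0.
move: bound; rewrite distrC => bound.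
have Me : 0 <= M * eta by rewrite mulr_ge0// ltW.
have ea : eps = 16 * (M * eta) + 8 * eta.
  have -> : eps = a * eta by rewrite /eta mulrC divfK// gt_eqF.
  by rewrite /a; ring.
have eta1 : 0 < eta := eta0; move: q1 q2 q3 q4 bound n1 Me ea eta1.
move: (`|L - l k|) (`|_ + _|) (`|_ - \int[P]_w f n w|) (`|_ - _|) (\int[P]_w chi k n w) (_ / K) => u1 u2 u3 u4 u5 u6.
rewrite -!mulrA; move: (M * u5) (M * u6) => v1 v2.
rewrite (mulrCA M 2 eta).
move: (M * eta) => v3.
by lra.
Unshelve. all: by end_near. Qed.

End approximation.

(** * Independent normal pairs as affine images of the standard one *)

Section independent_normals.
Context {R : realType} {d} {Omega : measurableType d} (P : probability Omega R).
Variables (X Y : Omega -> R) (mX mY vX vY : R).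
Hypotheses (vX0 : 0 < vX) (vY0 : 0 < vY).
Hypotheses (lawX : has_law P X (normal_law mX vX)) (lawY : has_law P Y (normal_law mY vY)).
Hypothesis indep : independent P X Y.

Let affine (z : R * R) : R * R := (mX + Num.sqrt vX * z.1, mY + Num.sqrt vY * z.2).

Let mXf : measurable_fun setT X. Proof. by case: lawX. Qed.
Let mYf : measurable_fun setT Y. Proof. by case: lawY. Qed.
Let pair (w : Omega) : R * R := (X w, Y w).
Let mpair : measurable_fun setT pair. Proof. exact: measurable_pairR. Qed.
Let maffine : measurable_fun setT affine.
Proof. by apply: measurable_pairR; apply: measurable_funD => //; exact: measurable_funM. Qed.

Let rvX : {mfun Omega >-> R} := HB.pack X (isMeasurableFun.Build _ _ _ _ _ mXf).
Let rvY : {mfun Omega >-> R} := HB.pack Y (isMeasurableFun.Build _ _ _ _ _ mYf).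
Let nuX : probability R R := distribution P rvX.
Let nuY : probability R R := distribution P rvY.

Let affine_law (m v : R) (A : set R) : 0 < v -> measurable A ->
  normal_law m v A = stdn ((fun x => m + Num.sqrt v * x) @^-1` A).
Proof. by move=> v0 mA; rewrite stdnE /normal_law normal_prob_standard// sqrtr_gt0. Qed.

(** Uniqueness of product measures, applied once to the law of the pair and once to the affine image
    of the standard law. *)
Let pair_law (A : set (R * R)) : measurable A -> P (pair @^-1` A) = (@stdn R \x @stdn R)%E (affine @^-1` A).
Proof.
move=> mA; transitivity ((nuX \x nuY)%E A).
  apply/esym.
  apply: (@product_measure_unique _ _ _ _ _ nuX nuY
    (measure_function_pushforward__canonical__measure_function_Measure P mpair)) => //.
apply: (@product_measure_unique _ _ _ _ _ nuX nuY
    (measure_function_pushforward__canonical__measure_function_Measure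
      [the probability _ _ of (@stdn R \x @stdn R)%E] maffine)) => //.
move=> A1 A2 mA1 mA2.
rewrite -[LHS]/((@stdn R \x @stdn R)%E (affine @^-1` (A1 `*` A2))).
rewrite -[RHS]/(P (X @^-1` A1) * P (Y @^-1` A2))%E.
have -> : affine @^-1` (A1 `*` A2) =
    ((fun x => mX + Num.sqrt vX * x) @^-1` A1) `*` ((fun x => mY + Num.sqrt vY * x) @^-1` A2).
  by apply/seteqP; split.
have mpre (m v : R) (A' : set R) : measurable A' -> measurable ((fun x : R => m + Num.sqrt v * x) @^-1` A').
  move=> mA'; rewrite -[X in measurable X]setTI.
  have h : measurable_fun [set: R] (fun x : R => m + Num.sqrt v * x).
    by apply: measurable_funD => //; exact: measurable_funM.
  exact: h.
rewrite product_measure1E//; try exact: mpre.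
have [_ lX] := lawX; have [_ lY] := lawY.
by rewrite (lX _ mA1) (lY _ mA2) (affine_law _ vX0 mA1) (affine_law _ vY0 mA2).
Qed.

Lemma integral_independent_normals (F : R * R -> R) (M : R) :
  measurable_fun setT F -> (forall z, `|F z| <= M) ->
  (\int[P]_w (F (X w, Y w))%:E =
   \int[@stdn R \x @stdn R]_z (F (mX + Num.sqrt vX * z.1, mY + Num.sqrt vY * z.2))%:E)%E.
Proof.
move=> mF FM; have mEF : measurable_fun setT (fun z => (F z)%:E) by exact/measurable_EFinP.
have i1 : P.-integrable setT ((EFin \o F) \o pair).
  apply: (@bounded_integrable _ _ _ P (F \o pair) M) => //.
  - exact: (measurableT_comp mF mpair).
  - by move=> w; exact: FM.
have i2 : ((@stdn R \x @stdn R)%E).-integrable setT ((EFin \o F) \o affine).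
  apply: (@bounded_integrable _ _ _ [the probability _ _ of (@stdn R \x @stdn R)%E] (F \o affine) M) => //.
  - exact: (measurableT_comp mF maffine).
  - by move=> w; exact: FM.
have e1 := @integral_pushforward _ _ _ _ _ pair mpair P setT (EFin \o F) mEF i1 measurableT.
have e2 := @integral_pushforward _ _ _ _ _ affine maffine
  [the probability _ _ of (@stdn R \x @stdn R)%E] setT (EFin \o F) mEF i2 measurableT.
rewrite -[LHS]e1 -[RHS]e2.
apply: (eq_measure_integral
  (measure_function_pushforward__canonical__measure_function_Measure
      [the probability _ _ of (@stdn R \x @stdn R)%E] maffine)
  (m1 := measure_function_pushforward__canonical__measure_function_Measure P mpair)) => A mA _.
exact: pair_law.
Qed.

End independent_normals.

(** Joint convergence at a point gives uniformity near that point; compactness makes finitely many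
    points suffice. *)
Lemma compact_uniform_cvg {R : realType} {U V : topologicalType} (K : set U) (F : set_system V)
    {FF : Filter F} (Phi : V -> U -> R) (h : U -> R) : compact K ->
  (forall p, K p -> Phi z.2 z.1 - h z.1 @[z --> (nbhs p, F)] --> (0 : R)) ->
  forall eta, 0 < eta -> \forall e \near F, forall p, K p -> `|Phi e p - h p| <= eta.
Proof.
move=> /compact_near_coveringP cK hK eta eta0.
apply: (cK V F (fun e p => `|Phi e p - h p| <= eta) FF) => p Kp.
move/cvgr0Pnorm_le : (hK p Kp) => /(_ _ eta0).
by [].
Qed.

(** * The estimators as perturbations of Gaussian functionals *)

Section scaled_estimators.
Context {R : realType}.
Variables (a b sigma y0 : R) (b0 : 0 < b) (s0 : 0 < sigma).

(* With E = e^(bT) and q = 1 / E, the arguments stand for q, q (y0 + a / b + a T), q R_T, 1 / T,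
   B_T, P_T and zeta_T; the values are q int Y, q^2 int Y^2, and so on. *)
Definition scaled_int (k z : R) : R := (z - k) / b.
Definition scaled_num (r x p z : R) : R := sigma * z * (x - p) + r.
Definition scaled_sqr (q k r x p z : R) : R :=
  (2^-1 * ((z + q * (sigma * x - a / b)) ^+ 2 - q ^+ 2 * y0 ^+ 2)
   - a * q * scaled_int k z - q * scaled_num r x p z) / b.
Definition scaled_den (q k r t x p z : R) : R :=
  scaled_sqr q k r x p z - scaled_int k z ^+ 2 * t.
Definition scaled_a (q k r t x p z : R) : R :=
  (sigma * x * scaled_sqr q k r x p z - scaled_int k z * scaled_num r x p z) / scaled_den q k r t x p z.
Definition scaled_b (q k r t x p z : R) : R :=
  (scaled_num r x p z - sigma * x * scaled_int k z * t) / scaled_den q k r t x p z.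

Section identities.
Variables (T E Y I1 I2 x p z : R).
Hypotheses (E0 : E != 0) (T0 : T != 0).
Let k := y0 + a / b + a * T.
Hypothesis I1E : b * I1 = E * z - k.
Hypothesis YE : Y = y0 + a * T + b * I1 + sigma * x.
Let r := 2^-1 * (Y ^+ 2 - y0 ^+ 2) - a * I1 - b * I2 - sigma * E * z * (x - p).
Let D := T * I2 - I1 ^+ 2.

Let bn0 : b != 0. Proof. exact: lt0r_neq0. Qed.

Let I1_eq : I1 = (E * z - k) / b.
Proof. by rewrite -I1E mulrC mulKf. Qed.

Let Y_eq : Y = E * z - a / b + sigma * x.
Proof. by rewrite YE I1E /k; ring. Qed.

Let int_eq : scaled_int (E^-1 * k) z = E^-1 * I1.
Proof. by rewrite /scaled_int I1_eq; field; rewrite E0 bn0. Qed.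

Let num_eq : scaled_num (E^-1 * r) x p z = E^-1 * (2^-1 * (Y ^+ 2 - y0 ^+ 2) - a * I1 - b * I2).
Proof.
rewrite /scaled_num /r; move: (2^-1 * _ - _ - _) => m.
by field.
Qed.

Let sqr_eq : scaled_sqr E^-1 (E^-1 * k) (E^-1 * r) x p z = E^-1 ^+ 2 * I2.
Proof.
rewrite /scaled_sqr int_eq num_eq.
have -> : z + E^-1 * (sigma * x - a / b) = E^-1 * Y.
  by rewrite Y_eq; field; rewrite E0 bn0.
by field; rewrite E0 bn0.
Qed.

Lemma scaled_den_eq : scaled_den E^-1 (E^-1 * k) (E^-1 * r) T^-1 x p z = E^-1 ^+ 2 * D / T.
Proof. by rewrite /scaled_den sqr_eq int_eq /D; field; rewrite E0 T0. Qed.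

Hypothesis D0 : D != 0.

(** The estimators solve Y - y0 = a_hat T + b_hat I1 and (Y^2 - y0^2) / 2 = a_hat I1 + b_hat I2.
    Subtracting the same combinations of a and b leaves sigma x and m = (Y^2 - y0^2) / 2 - a I1 - b
    I2 on the left, and Cramer's rule gives the errors (sigma x I2 - m I1) / D and (T m - sigma x
    I1) / D. *)
Lemma scaled_a_eq :
  T * ((Y - y0) * (I2 - 2^-1 * (Y + y0) * I1) / D - a) =
  scaled_a E^-1 (E^-1 * k) (E^-1 * r) T^-1 x p z.
Proof.
rewrite /scaled_a scaled_den_eq sqr_eq int_eq num_eq.
have -> : sigma * x = Y - y0 - a * T - b * I1 by rewrite YE; ring.
move: D0; rewrite /D => D1; field.
by rewrite D1 E0 T0.
Qed.

Lemma scaled_b_eq :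
  E * ((Y - y0) * (2^-1 * T * (Y + y0) - I1) / D - b) =
  scaled_b E^-1 (E^-1 * k) (E^-1 * r) T^-1 x p z.
Proof.
rewrite /scaled_b scaled_den_eq int_eq num_eq.
have -> : sigma * x = Y - y0 - a * T - b * I1 by rewrite YE; ring.
move: D0; rewrite /D => D1; field.
by rewrite D1 E0 T0.
Qed.

End identities.

Section limits.
Context {J : Type} {F : set_system J} {FF : Filter F}.
Variables (q k r t x p z : J -> R) (x0 p0 z0 : R).
Hypotheses (cq : q j @[j --> F] --> 0) (ck : k j @[j --> F] --> 0).
Hypotheses (cr : r j @[j --> F] --> 0) (ct : t j @[j --> F] --> 0).
Hypotheses (cx : x j @[j --> F] --> x0) (cp : p j @[j --> F] --> p0) (cz : z j @[j --> F] --> z0).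

Let cvgC (c : R) : c @[_ --> F] --> c. Proof. exact: cvg_cst. Qed.

Let cvg_sqr (u : J -> R) (l : R) : u j @[j --> F] --> l -> u j ^+ 2 @[j --> F] --> l ^+ 2.
Proof. by move=> ul; rewrite expr2; under eq_fun do rewrite expr2; exact: cvgM. Qed.

Let c_int : scaled_int (k j) (z j) @[j --> F] --> z0 / b.
Proof.
have h : scaled_int (k j) (z j) @[j --> F] --> (z0 - 0) / b.
  by apply: cvgM => //; exact: cvgB.
by move: h; rewrite subr0.
Qed.

Let c_num : scaled_num (r j) (x j) (p j) (z j) @[j --> F] --> sigma * z0 * (x0 - p0).
Proof.
rewrite -[X in _ --> X]addr0; apply: cvgD => //; apply: cvgM; last exact: cvgB.
by apply: cvgM => //.
Qed.

Let c_sqr : scaled_sqr (q j) (k j) (r j) (x j) (p j) (z j) @[j --> F] --> z0 ^+ 2 / (2 * b).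
Proof.
have h : scaled_sqr (q j) (k j) (r j) (x j) (p j) (z j) @[j --> F] -->
  (2^-1 * ((z0 + 0 * (sigma * x0 - a / b)) ^+ 2 - 0 ^+ 2 * y0 ^+ 2)
   - a * 0 * (z0 / b) - 0 * (sigma * z0 * (x0 - p0))) / b.
  apply: cvgM; last exact: cvgC.
  apply: cvgB; last by apply: cvgM; [exact: cq|exact: c_num].
  apply: cvgB; last first.
    by apply: cvgM; [apply: cvgM; [exact: cvgC|exact: cq]|exact: c_int].
  apply: cvgM; first exact: cvgC.
  apply: cvgB; last by apply: cvgM; [exact: cvg_sqr|exact: cvgC].
  apply: cvg_sqr; apply: cvgD; first exact: cz.
  apply: cvgM; first exact: cq.
  by apply: cvgB; [apply: cvgM; [exact: cvgC|exact: cx]|exact: cvgC].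
have e : (2^-1 * ((z0 + 0 * (sigma * x0 - a / b)) ^+ 2 - 0 ^+ 2 * y0 ^+ 2)
   - a * 0 * (z0 / b) - 0 * (sigma * z0 * (x0 - p0))) / b = z0 ^+ 2 / (2 * b).
  by field; exact: lt0r_neq0.
by rewrite -e.
Qed.

Lemma scaled_den_cvg : scaled_den (q j) (k j) (r j) (t j) (x j) (p j) (z j) @[j --> F] --> z0 ^+ 2 / (2 * b).
Proof.
rewrite -[X in _ --> X]subr0 -[X in _ - X](mulr0 ((z0 / b) ^+ 2)).
apply: cvgB; first exact: c_sqr.
by apply: cvgM; [apply: cvg_sqr; exact: c_int|exact: ct].
Qed.

Hypothesis zn0 : z0 != 0.

Let den0 : z0 ^+ 2 / (2 * b) != 0.
Proof. by rewrite mulf_neq0// ?expf_neq0// invr_eq0 mulf_neq0// lt0r_neq0. Qed.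

(** The scaled integral tends to z/b, and both the scaled square integral and the denominator to z^2
    / (2b). All powers of z cancel in the quotient, which is why the limit law in (i) is normal. *)
Lemma scaled_a_cvg :
  scaled_a (q j) (k j) (r j) (t j) (x j) (p j) (z j) @[j --> F] --> sigma * (2 * p0 - x0).
Proof.
have -> : sigma * (2 * p0 - x0) =
    (sigma * x0 * (z0 ^+ 2 / (2 * b)) - z0 / b * (sigma * z0 * (x0 - p0))) / (z0 ^+ 2 / (2 * b)).
  by field; rewrite zn0 lt0r_neq0.
apply: cvgM; last by apply: cvgV; [exact: den0|exact: scaled_den_cvg].
apply: cvgB; last by apply: cvgM; [exact: c_int|exact: c_num].
by apply: cvgM; [apply: cvgM; [exact: cvgC|exact: cx]|exact: c_sqr].
Qed.

Lemma scaled_b_cvg :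
  scaled_b (q j) (k j) (r j) (t j) (x j) (p j) (z j) @[j --> F] --> 2 * b * sigma * (x0 - p0) / z0.
Proof.
have -> : 2 * b * sigma * (x0 - p0) / z0 =
    (sigma * z0 * (x0 - p0) - sigma * x0 * (z0 / b) * 0) / (z0 ^+ 2 / (2 * b)).
  by field; rewrite zn0 lt0r_neq0.
apply: cvgM; last by apply: cvgV; [exact: den0|exact: scaled_den_cvg].
apply: cvgB; first exact: c_num.
apply: cvgM; last exact: ct.
by apply: cvgM; [apply: cvgM; [exact: cvgC|exact: cx]|exact: c_int].
Qed.

End limits.

Section uniformity.
Variables (f : R -> R) (K delta : R).
Hypotheses (cf : continuous f) (delta0 : 0 < delta).

(** The lower bound on |z| keeps the limits continuous on this compact set. *)
Let U : set (R * R * R) := [set u | `|u.1.1| <= K /\ `|u.1.2| <= K /\ delta <= `|u.2| /\ `|u.2| <= K].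

Let compact_U : compact U.
Proof.
have -> : U = (`[- K, K]%classic `*` `[- K, K]%classic) `*`
    (`[- K, K]%classic `&` (@Num.norm R R) @^-1` [set x | delta <= x]).
  apply/seteqP; split => -[[u1 u2] u3]; rewrite /U /= !in_itv/= -!ler_norml.
    by move=> [h1 [h2 [h3 h4]]].
  by move=> [[h1 h2] [h3 h4]].
apply: compact_setX; first by apply: compact_setX; exact: segment_compact.
apply: compact_closedI; first exact: segment_compact.
apply: closed_comp; last exact: closed_ge.
by move=> x _; exact: norm_continuous.
Qed.

Let V0 : R * R * R * R := (0, 0, 0, 0).

Let coords (u0 : R * R * R) (F := filter_prod (nbhs u0) (nbhs V0)) :
  [/\ z.2.1.1.1 @[z --> F] --> 0, z.2.1.1.2 @[z --> F] --> 0, z.2.1.2 @[z --> F] --> 0 &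
      z.2.2 @[z --> F] --> 0] /\
  [/\ z.1.1.1 @[z --> F] --> u0.1.1, z.1.1.2 @[z --> F] --> u0.1.2 & z.1.2 @[z --> F] --> u0.2].
Proof.
have c2 : z.2 @[z --> F] --> V0 by exact: cvg_snd.
have c1 : z.1 @[z --> F] --> u0 by exact: cvg_fst.
have fs (A B : topologicalType) (w0 : A * B) (g : (R * R * R) * (R * R * R * R) -> A * B) :
    g z @[z --> F] --> w0 -> (g z).1 @[z --> F] --> w0.1.
  by move=> h; apply: (cvg_comp g fst h); exact: cvg_fst.
have sn (A B : topologicalType) (w0 : A * B) (g : (R * R * R) * (R * R * R * R) -> A * B) :
    g z @[z --> F] --> w0 -> (g z).2 @[z --> F] --> w0.2.
  by move=> h; apply: (cvg_comp g snd h); exact: cvg_snd.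
have c21 := fs _ _ _ _ c2; have c211 := fs _ _ _ _ c21.
have c11 := fs _ _ _ _ c1.
split; split.
- exact: (fs _ _ _ _ c211).
- exact: (sn _ _ _ _ c211).
- exact: (sn _ _ _ _ c21).
- exact: (sn _ _ _ _ c2).
- exact: (fs _ _ _ _ c11).
- exact: (sn _ _ _ _ c11).
- exact: (sn _ _ _ _ c1).
Qed.

Let U_neq0 u : U u -> u.2 != 0.
Proof.
by move=> [_ [_ [d _]]]; rewrite -normr_gt0; exact: lt_le_trans d.
Qed.

Let uniform (Phi : R -> R -> R -> R -> R -> R -> R -> R) (h : R -> R -> R -> R) :
  (forall u0, U u0 -> let F := filter_prod (nbhs u0) (nbhs V0) in
    Phi z.2.1.1.1 z.2.1.1.2 z.2.1.2 z.2.2 z.1.1.1 z.1.1.2 z.1.2 @[z --> F] --> h u0.1.1 u0.1.2 u0.2 /\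
    h z.1.1.1 z.1.1.2 z.1.2 @[z --> F] --> h u0.1.1 u0.1.2 u0.2) ->
  forall eta, 0 < eta -> \forall e \near V0, forall u, U u ->
  `|Phi e.1.1.1 e.1.1.2 e.1.2 e.2 u.1.1 u.1.2 u.2 - h u.1.1 u.1.2 u.2| <= eta.
Proof.
move=> H; apply: (compact_uniform_cvg (F := nbhs V0) (Phi := fun e u => Phi e.1.1.1 e.1.1.2 e.1.2 e.2 u.1.1 u.1.2 u.2)
  (h := fun u => h u.1.1 u.1.2 u.2) compact_U).
move=> u0 Uu0; have [h1 h2] := H u0 Uu0.
by rewrite -(subrr (h u0.1.1 u0.1.2 u0.2)); apply: cvgB.
Qed.

(** Joint continuity at vanishing perturbations (q, k, r, t), together with compactness, gives one
    radius for all admissible (x, p, z). *)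
Lemma uniform_estimates (eta : R) : 0 < eta -> exists2 rad : R, 0 < rad &
  forall q k r t x p z, `|q| < rad -> `|k| < rad -> `|r| < rad -> `|t| < rad ->
  `|x| <= K -> `|p| <= K -> delta <= `|z| -> `|z| <= K ->
  [/\ scaled_den q k r t x p z != 0,
      `|f (scaled_a q k r t x p z) - f (sigma * (2 * p - x))| <= eta &
      `|f (scaled_b q k r t x p z) - f (2 * b * sigma * (x - p) / z)| <= eta].
Proof.
move=> eta0.
have nA := @uniform (fun q k r t x p z => f (scaled_a q k r t x p z))
  (fun x p z => f (sigma * (2 * p - x))) _ _ eta0.
have nB := @uniform (fun q k r t x p z => f (scaled_b q k r t x p z))
  (fun x p z => f (2 * b * sigma * (x - p) / z)) _ _ eta0.
(* Half of the least value delta^2 / (2b) of the limiting denominator, so that the true one stays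
   positive. *)
have dl0 : 0 < delta ^+ 2 / (4 * b) by rewrite divr_gt0 ?exprn_gt0// mulr_gt0.
have nD := @uniform scaled_den (fun x p z => z ^+ 2 / (2 * b)) _ _ dl0.
have {}nA : \forall e \near V0, forall u, U u -> `|f (scaled_a e.1.1.1 e.1.1.2 e.1.2 e.2 u.1.1 u.1.2 u.2)
    - f (sigma * (2 * u.1.2 - u.1.1))| <= eta.
  apply: nA => u0 /U_neq0 u0n F; have [[h1 h2 h3 h4] [h5 h6 h7]] := coords u0; split.
    by apply: continuous_cvg; [exact: cf|exact: (scaled_a_cvg h1 h2 h3 h4 h5 h6 h7 u0n)].
  apply: continuous_cvg; first exact: cf.
  apply: cvgM; first exact: cvg_cst.
  by apply: cvgB; [apply: cvgM; [exact: cvg_cst|exact: h6]|exact: h5].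
have {}nB : \forall e \near V0, forall u, U u -> `|f (scaled_b e.1.1.1 e.1.1.2 e.1.2 e.2 u.1.1 u.1.2 u.2)
    - f (2 * b * sigma * (u.1.1 - u.1.2) / u.2)| <= eta.
  apply: nB => u0 /U_neq0 u0n F; have [[h1 h2 h3 h4] [h5 h6 h7]] := coords u0; split.
    by apply: continuous_cvg; [exact: cf|exact: (scaled_b_cvg h1 h2 h3 h4 h5 h6 h7 u0n)].
  apply: continuous_cvg; first exact: cf.
  apply: cvgM; last by apply: cvgV.
  apply: cvgM; first exact: cvg_cst.
  by apply: cvgB; [exact: h5|exact: h6].
have {}nD : \forall e \near V0, forall u, U u -> `|scaled_den e.1.1.1 e.1.1.2 e.1.2 e.2 u.1.1 u.1.2 u.2
    - u.2 ^+ 2 / (2 * b)| <= delta ^+ 2 / (4 * b).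
  apply: nD => u0 _ F; have [[h1 h2 h3 h4] [h5 h6 h7]] := coords u0; split.
    exact: (scaled_den_cvg h1 h2 h3 h4 h5 h6 h7).
  apply: cvgM; last exact: cvg_cst.
  by rewrite expr2; under eq_fun do rewrite expr2; exact: cvgM.
have nABD := filterI nA (filterI nB nD).
have [rad /= rad0 hrad] := (nbhs_ballP _ _).1 (nABD _ _).
exists rad => // q k r t x p z hq hk hr ht hx hp hz1 hz2.
have Uu : U (x, p, z) by [].
have be : ball V0 rad (q, k, r, t).
  by split; [split; [split|]|]; rewrite /ball/= sub0r normrN.
have [h1 [h2 h3]] := hrad _ be.
split; [|exact: (h1 (x, p, z) Uu)|exact: (h2 (x, p, z) Uu)].
have := h3 (x, p, z) Uu => /=.
have hz : delta ^+ 2 <= z ^+ 2.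
  by rewrite -(real_normK (num_real z)) ler_pXn2r// nnegrE ltW.
move: (scaled_den _ _ _ _ _ _ _) => den hden; apply: lt0r_neq0.
have i1 : delta ^+ 2 / (2 * b) <= z ^+ 2 / (2 * b).
  by rewrite ler_wpM2r// invr_ge0 ltW// mulr_gt0.
have i2 : delta ^+ 2 / (2 * b) = 2 * (delta ^+ 2 / (4 * b)).
  by field; exact: lt0r_neq0.
move: hden; rewrite ler_norml => /andP[hden _].
by move: hden i1 i2 dl0; lra.
Qed.

End uniformity.

End scaled_estimators.

(** * Means of integrals of a squared process *)

Section time_integrals.
Context {R : realType} {d} {Omega : measurableType d} (P : probability Omega R).
Notation mu := (@lebesgue_measure R).
Variables (X : R -> Omega -> R) (T : R).
Hypothesis mX : measurable_fun [set: R * Omega] (fun z => X z.1 z.2).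
Hypothesis cX : forall w, continuous (X ^~ w).
Hypothesis T0 : 0 <= T.

Let cut_sqr (z : R * Omega) : \bar R := (\1_(`[0, T]) z.1 * X z.1 z.2 ^+ 2)%:E.

Let measurable_cut_sqr : measurable_fun [set: R * Omega] cut_sqr.
Proof.
apply/measurable_EFinP; apply: measurable_funM; last exact: measurable_funX.
exact: (measurableT_comp (measurable_indic (measurable_itv `[0, T])) measurable_fst).
Qed.

Let cut_sqr_ge0 z : (0 <= cut_sqr z)%E.
Proof. by rewrite lee_fin mulr_ge0 ?sqr_ge0. Qed.

Let cut_sqrE w :
  (\int[mu]_(s in `[0%R, T]) (X s w ^+ 2)%:E = \int[mu]_s cut_sqr (s, w))%E.
Proof.
rewrite integral_mkcond; apply: eq_integral => s _; rewrite patchE /cut_sqr indicE /=.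
by case: (s \in _); rewrite ?mul1r ?mul0r.
Qed.

Lemma time_integral_measurable :
  measurable_fun setT (fun w => \int[mu]_(s in `[0, T]) (X s w ^+ 2)).
Proof.
apply: measurableT_comp => //.
under eq_fun do rewrite cut_sqrE.
exact: (@measurable_fun_fubini_tonelli_G _ _ (measurableTypeR R) Omega R mu cut_sqr
  measurable_cut_sqr cut_sqr_ge0).
Qed.

Variable A : R.
Hypothesis XA : forall t, 0 <= t -> (\int[P]_w (X t w ^+ 2)%:E <= A%:E)%E.

Let finite w : (\int[mu]_(s in `[0%R, T]) (X s w ^+ 2)%:E \is a fin_num)%E.
Proof.
apply: integrable_fin_num => //.
apply: continuous_ge0_integrable => s _.
have h : X u w * X u w @[u --> s] --> X s w * X s w by apply: cvgM; exact: cX.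
exact: h.
Qed.

Let fineE w : (\int[mu]_(s in `[0, T]) (X s w ^+ 2))%:E = (\int[mu]_(s in `[0%R, T]) (X s w ^+ 2)%:E)%E.
Proof. by rewrite /Rintegral (fineK (finite w)). Qed.

Let bound : (\int[P]_w \int[mu]_(s in `[0%R, T]) (X s w ^+ 2)%:E <= (A * T)%:E)%E.
Proof.
under eq_integral do rewrite cut_sqrE.
rewrite -(@fubini_tonelli _ _ (measurableTypeR R) Omega R mu P cut_sqr measurable_cut_sqr cut_sqr_ge0).
have A0 : 0 <= A.
  by rewrite -lee_fin; apply: le_trans (XA (lexx 0)); apply: integral_ge0 => w _; rewrite lee_fin sqr_ge0.
apply: (@le_trans _ _ (\int[mu]_(s in `[0%R, T]) (cst A%:E s))%E); last first.
  by rewrite integral_cst//= lebesgue_measure_itv/= lte_fin; case: ltP => // _; rewrite ?oppr0 ?adde0 ?EFinM ?subr0 -?EFinB ?subr0 ?mule0 // lee_fin mulr_ge0.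
rewrite [leRHS]integral_mkcond; apply: ge0_le_integral => //.
- by move=> s _; apply: integral_ge0.
- exact: (@measurable_fun_fubini_tonelli_F _ _ (measurableTypeR R) Omega R P cut_sqr
    measurable_cut_sqr cut_sqr_ge0).
- apply/(measurable_restrictT _ _).1 => //.
- move=> s _; rewrite /cut_sqr patchE /= indicE.
  case: (boolP (s \in _)) => [|_]; last by under eq_integral do rewrite mul0r; rewrite integral0.
  rewrite mem_setE in_itv/= => /andP[s0 _].
  by under eq_integral do rewrite mul1r; exact: XA.
Qed.

Lemma time_integral_integrable :
  P.-integrable setT (EFin \o (fun w => \int[mu]_(s in `[0, T]) (X s w ^+ 2))).
Proof.
apply/integrableP; split.
  by apply/measurable_EFinP; exact: time_integral_measurable.
apply: le_lt_trans (ltry (A * T)); apply: le_trans bound.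
rewrite le_eqVlt; apply/orP; left; apply/eqP; apply: eq_integral => w _.
rewrite /= ger0_norm; first exact: fineE.
by apply: Rintegral_ge0 => s _; exact: sqr_ge0.
Qed.

Lemma time_integral_le : \int[P]_w \int[mu]_(s in `[0, T]) (X s w ^+ 2) <= A * T.
Proof.
rewrite -lee_fin; apply: le_trans bound.
rewrite le_eqVlt; apply/orP; left; apply/eqP; rewrite fineK.
  by apply: eq_integral => w _; exact: fineE.
exact: (integrable_fin_num measurableT time_integral_integrable).
Qed.

End time_integrals.

(** A pointwise limit of the continuous functions x / (x^2 + c), also at 0, where the inverse is 0
    by convention. *)
Lemma measurable_inv {R : realType} : measurable_fun [set: R] (fun x : R => x^-1).
Proof.
pose c (n : nat) : R := n.+1%:R^-1.
have c0 n : 0 < c n by rewrite invr_gt0.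
apply: (measurable_fun_cvg (h := fun n (x : R) => x / (x ^+ 2 + c n))) => [n|x _].
  apply: continuous_measurable_fun => x; apply: cvgM; first exact: cvg_id.
  apply: cvgV; first by rewrite gt_eqF// ltr_wpDl// sqr_ge0.
  by apply: cvgD; [exact: exprn_continuous|exact: cvg_cst].
have [->|x0] := eqVneq x 0; first by rewrite invr0; apply: cvg_near_cst; apply: nearW => n; rewrite mul0r.
have -> : x^-1 = x / (x ^+ 2 + 0) by rewrite addr0 expr2 invfM mulrA mulfV// mul1r.
apply: cvgM; first exact: cvg_cst.
apply: cvgV; first by rewrite addr0 expf_neq0.
by apply: cvgD; [exact: cvg_cst|exact: cvg_harmonic].
Qed.

Section horizon.
Context {R : realType}.
Variables (b : R) (b0 : 0 < b).

(** e^(bT) >= (bT/2)^2 by squaring e^(bT/2) >= 1 + bT/2. Hence perturbations of order T e^(-bT) are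
    still of order 1/T. *)
Lemma expR_decay (T : R) : 1 <= T -> T * (expR (b * T))^-1 <= 4 / b ^+ 2 / T.
Proof.
move=> T1; have T0 : 0 < T by exact: lt_le_trans T1.
have bT : 0 <= b * T / 2 by rewrite divr_ge0// mulr_ge0// ltW.
have h : (b * T / 2) ^+ 2 <= expR (b * T).
  have -> : b * T = b * T / 2 + b * T / 2 by field.
  rewrite expRD -expr2 [X in X ^+ 2 <= _](_ : _ = b * T / 2); last by field.
  rewrite ler_pXn2r ?nnegrE ?expR_ge0//.
  by apply: le_trans (expR_ge1Dx _); rewrite lerDr.
have h0 : 0 < (b * T / 2) ^+ 2 by rewrite exprn_gt0// divr_gt0// mulr_gt0.
have h2 : (expR (b * T))^-1 <= ((b * T / 2) ^+ 2)^-1.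
  by rewrite lef_pV2// posrE// expR_gt0.
have -> : 4 / b ^+ 2 / T = T * ((b * T / 2) ^+ 2)^-1.
  by field; rewrite !lt0r_neq0.
by rewrite ler_wpM2l// ltW.
Qed.

End horizon.

(** * The estimators as random variables *)

Section model.
Context {R : realType} {d} {Omega : measurableType d} {P : probability Omega R}.
Notation mu := (@lebesgue_measure R).
Variables (H lambda a b sigma y0 : R) (W B : R -> {RV P >-> R}) (Y : R -> Omega -> R).
Hypotheses (hH : 0 < H) (hl : 0 < lambda) (b0 : 0 < b) (s0 : 0 < sigma) (hW : two_sided_wiener W).
Hypothesis hB : forall t : R, 0 <= t -> is_wiener_integral W (tfbm_kernel H lambda t) (B t).
Hypothesis cB : forall w, {within `[0, +oo[, continuous (fun t : R => B t w)}.
Hypothesis hY : is_tf_vasicek a b sigma y0 B Y.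

Let beta (w : Omega) (t : R) : R := B (Num.max t 0) w.
Let y (w : Omega) (t : R) : R := Y (Num.max t 0) w.
Let cbeta w : continuous (beta w). Proof. exact: (within_continuous_max (@cB w)). Qed.
Let cy w : continuous (y w). Proof. exact: (within_continuous_max (@tf_vasicek_continuous _ _ _ _ _ _ _ _ hY w)). Qed.

Let path_eq w t : 0 <= t -> y w t = y0 + \int[mu]_(s in `[0, t]) (a + b * y w s) + sigma * beta w t.
Proof.
move=> t0; rewrite /y /beta (max_idPl t0) (tf_vasicek_equation hY)//; congr (_ + _ + _).
apply: eq_Rintegral => s; rewrite inE/= in_itv/= => /andP[s1 _].
by rewrite (max_idPl s1).
Qed.

Let int_max (g : R -> R) w T : \int[mu]_(s in `[0, T]) g (y w s) = \int[mu]_(s in `[0, T]) g (Y s w).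
Proof.
apply: eq_Rintegral => s; rewrite inE/= in_itv/= => /andP[s1 _].
by rewrite /y (max_idPl s1).
Qed.

Definition zeta (T : R) (w : Omega) : R := y0 + a / b + sigma * forward_average B b0 T w.
Definition noise_integral (T : R) (w : Omega) : R := noise_sqr (beta w) T.

Let zetaE T w : 0 <= T -> path_zeta a b sigma y0 (beta w) T = zeta T w.
Proof. by move=> T0; rewrite /zeta (forward_averageE b0 cB w T0). Qed.

Let cbeta0 w : continuous_ge0 (beta w). Proof. by move=> x _; exact: cbeta. Qed.
Let cy0 w : continuous_ge0 (y w). Proof. by move=> x _; exact: cy. Qed.

Let drift_eq T w : 0 <= T ->
  b * path_int (y w) T = expR (b * T) * zeta T w - (y0 + a / b + a * T).
Proof.
by move=> T0; rewrite -zetaE//; exact: (path_int_zeta b0 (@cbeta0 w) (@cy0 w) (@path_eq w) T0).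
Qed.

Let y_eq T w : 0 <= T -> Y T w = y0 + a * T + b * path_int (y w) T + sigma * B T w.
Proof.
move=> T0; have := path_equation (@cy0 w) (@path_eq w) T0.
by rewrite {1}/y /beta (max_idPl T0).
Qed.

Let a_hatE T w : a_hat y0 (fun t => Y t w) T =
  (Y T w - y0) * (path_sqr (y w) T - 2^-1 * (Y T w + y0) * path_int (y w) T) /
  (T * path_sqr (y w) T - path_int (y w) T ^+ 2).
Proof.
rewrite /a_hat /estimator_denominator /path_sqr /path_int (int_max id) (int_max (fun x => x ^+ 2)).
by [].
Qed.

Let b_hatE T w : b_hat y0 (fun t => Y t w) T =
  (Y T w - y0) * (2^-1 * T * (Y T w + y0) - path_int (y w) T) /
  (T * path_sqr (y w) T - path_int (y w) T ^+ 2).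
Proof.
rewrite /b_hat /estimator_denominator /path_sqr /path_int (int_max id) (int_max (fun x => x ^+ 2)).
by [].
Qed.

Notation E T := (expR (b * T)).
Notation den q k r t x p z := (scaled_den a b sigma y0 q k r t x p z).

(** [r] is the remainder of [path_remainder] on the path of [w]. The denominator is assumed nonzero
    in its scaled form, since that is what [uniform_estimates] provides. *)
Lemma vasicek_scaled T w : 0 < T -> exists2 r : R,
  `|r| <= `|a / b| * sigma * `|B T w| + 2^-1 * sigma ^+ 2 * B T w ^+ 2
    + sigma ^+ 2 * b * noise_integral T w &
  let q := (E T)^-1 in let k := y0 + a / b + a * T in
  let p := backward_average B b0 T w in
  scaled_den a b sigma y0 q (q * k) (q * r) T^-1 (B T w) p (zeta T w) != 0 ->
  T * (a_hat y0 (fun t => Y t w) T - a) =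
    scaled_a a b sigma y0 q (q * k) (q * r) T^-1 (B T w) p (zeta T w) /\
  E T * (b_hat y0 (fun t => Y t w) T - b) =
    scaled_b a b sigma y0 q (q * k) (q * r) T^-1 (B T w) p (zeta T w).
Proof.
move=> T1; have T0 := ltW T1.
have yT : y w T = Y T w by rewrite /y (max_idPl T0).
have bT : beta w T = B T w by rewrite /beta (max_idPl T0).
have := path_remainder b0 s0 (@cbeta0 w) (@cy0 w) (@path_eq w) T0.
rewrite yT bT (zetaE _ T0) -(backward_averageE b0 cB w T0) => hr.
eexists; first exact: hr.
move=> q k p.
have Tn0 : T != 0 by exact: lt0r_neq0.
have En0 : E T != 0 by rewrite gt_eqF// expR_gt0.
rewrite (scaled_den_eq b0 _ _ En0 Tn0 (drift_eq w T0) (y_eq w T0)) => D0.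
have {}D0 : T * path_sqr (y w) T - path_int (y w) T ^+ 2 != 0.
  by apply: contra D0 => /eqP ->; rewrite mulr0 mul0r.
rewrite a_hatE b_hatE; split.
- exact: (scaled_a_eq b0 p En0 Tn0 (drift_eq w T0) (y_eq w T0) D0).
- exact: (scaled_b_eq b0 p En0 Tn0 (drift_eq w T0) (y_eq w T0) D0).
Qed.

Lemma measurable_zeta T : 0 <= T -> measurable_fun setT (zeta T).
Proof.
move=> T0; apply: measurable_funD; first exact: measurable_cst.
apply: measurable_funM; first exact: measurable_cst.
apply: sqint_measurable; apply: wiener_space_sqint.
exact: (forward_average_wiener_space hH hl b0 hW hB cB T0).
Qed.

Let mint T : 0 <= T -> measurable_fun setT (fun w => path_int (y w) T).
Proof.
move=> T0; have -> : (fun w => path_int (y w) T) =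
    (fun w => (expR (b * T) * zeta T w - (y0 + a / b + a * T)) / b).
  by apply/funext => w; rewrite -drift_eq// mulrAC mulfV ?mul1r// gt_eqF.
apply: measurable_funM; last exact: measurable_cst.
apply: measurable_funB; last exact: measurable_cst.
by apply: measurable_funM; [exact: measurable_cst|exact: measurable_zeta].
Qed.

Let mY T : 0 <= T -> measurable_fun setT (Y T).
Proof.
move=> T0; have -> : Y T = (fun w => y0 + a * T + b * path_int (y w) T + sigma * B T w).
  by apply/funext => w; exact: y_eq.
apply: measurable_funD; apply: measurable_funD || apply: measurable_funM.
- exact: measurable_cst.
- by apply: measurable_funM; [exact: measurable_cst|exact: mint].
- exact: measurable_cst.
- exact: measurable_funPT.
Qed.

Let msqr T : 0 <= T -> measurable_fun setT (fun w => path_sqr (y w) T).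
Proof.
move=> T0; apply: (@time_integral_measurable _ _ _ (fun t w => Y (Num.max t 0) w) T).
apply: (@joint_measurable _ _ _ (fun t w => Y (Num.max t 0) w)).
- by move=> t; apply: mY; rewrite le_max lexx orbT.
- exact: cy.
- by move=> t w; rewrite (max_idPl (_ : 0 <= Num.max t 0))// le_max lexx orbT.
Qed.

Let mden T : 0 <= T -> measurable_fun setT (fun w => (T * path_sqr (y w) T - path_int (y w) T ^+ 2)^-1).
Proof.
move=> T0; apply: (@measurableT_comp _ _ _ _ _ _ (fun x : R => x^-1)); first exact: measurable_inv.
apply: measurable_funB; first by apply: measurable_funM; [exact: measurable_cst|exact: msqr].
by apply: measurable_funX; exact: mint.
Qed.

Let mYB T c : 0 <= T -> measurable_fun setT (fun w => Y T w + c).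
Proof. by move=> T0; apply: measurable_funD; [exact: mY|exact: measurable_cst]. Qed.

Lemma measurable_a_hat T : 0 <= T ->
  measurable_fun setT (fun w => T * (a_hat y0 (fun t => Y t w) T - a)).
Proof.
move=> T0; under eq_fun do rewrite a_hatE.
apply: measurable_funM; first exact: measurable_cst.
apply: measurable_funB; last exact: measurable_cst.
apply: measurable_funM; last exact: mden.
apply: measurable_funM; first exact: mYB.
apply: measurable_funB; first exact: msqr.
apply: measurable_funM; last exact: mint.
by apply: measurable_funM; [exact: measurable_cst|exact: mYB].
Qed.

Lemma measurable_b_hat T : 0 <= T ->
  measurable_fun setT (fun w => expR (b * T) * (b_hat y0 (fun t => Y t w) T - b)).
Proof.
move=> T0; under eq_fun do rewrite b_hatE.
apply: measurable_funM; first exact: measurable_cst.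
apply: measurable_funB; last exact: measurable_cst.
apply: measurable_funM; last exact: mden.
apply: measurable_funM; first exact: mYB.
apply: measurable_funB; last exact: mint.
by apply: measurable_funM; [exact: measurable_cst|exact: mYB].
Qed.

(** Its mean is bounded for large T, so large values are rare, and a bound on it controls B_T, N_T,
    P_T and the remainder at once. *)
Definition magnitude (T : R) (w : Omega) : R :=
  B T w ^+ 2 + forward_average B b0 T w ^+ 2 + backward_average B b0 T w ^+ 2
  + noise_integral T w / T.

Lemma noise_integral_ge0 T w : 0 <= noise_integral T w.
Proof. by apply: Rintegral_ge0 => s _; exact: sqr_ge0. Qed.

Lemma magnitude_ge0 T w : 0 <= T -> 0 <= magnitude T w.
Proof.
move=> T0; rewrite /magnitude addr_ge0//; first by rewrite !addr_ge0// sqr_ge0.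
by rewrite divr_ge0// noise_integral_ge0.
Qed.

Let variance_le t : 0 <= t -> (\int[P]_w (beta w t ^+ 2)%:E <= (tfbm_varoo H lambda)%:E)%E.
Proof.
move=> t0; rewrite /beta (max_idPl t0).
have sB := wiener_space_sqint (tfbm_wiener_space hW hB t0).
by rewrite (sqint_EFin sB) (tfbm_ip_var hH hl hW hB t0) lee_fin tfbm_var_le.
Qed.

Let joint_beta : measurable_fun [set: R * Omega] (fun z => beta z.2 z.1).
Proof.
apply: (@joint_measurable _ _ _ (fun t w => B (Num.max t 0) w)).
- by move=> t; exact: measurable_funPT.
- exact: cbeta.
- by move=> t w; rewrite (max_idPl (_ : 0 <= Num.max t 0))// le_max lexx orbT.
Qed.

Let sqr_integrable (X : Omega -> R) : sqint P X -> P.-integrable setT (EFin \o (fun w => X w ^+ 2)).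
Proof. by case. Qed.

Let sB T : 0 <= T -> sqint P (B T).
Proof. by move=> T0; exact: (wiener_space_sqint (tfbm_wiener_space hW hB T0)). Qed.
Let sN T : 0 <= T -> sqint P (forward_average B b0 T).
Proof. by move=> T0; exact: (wiener_space_sqint (forward_average_wiener_space hH hl b0 hW hB cB T0)). Qed.
Let sP T : 0 <= T -> sqint P (backward_average B b0 T).
Proof. by move=> T0; exact: (wiener_space_sqint (backward_average_wiener_space hH hl b0 hW hB cB T0)). Qed.

Let noise_integrable T : 0 <= T -> P.-integrable setT (EFin \o noise_integral T).
Proof.
move=> T0.
exact: (@time_integral_integrable _ _ _ P (fun t w => beta w t) T joint_beta cbeta T0 _ variance_le).
Qed.

Lemma magnitude_integrable T : 0 <= T -> P.-integrable setT (EFin \o magnitude T).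
Proof.
move=> T0.
have i1 := integrableD measurableT (sqr_integrable (sB T0)) (sqr_integrable (sN T0)).
have i2 := integrableD measurableT i1 (sqr_integrable (sP T0)).
have i3 := integrableZr measurableT T^-1 (noise_integrable T0).
by have := integrableD measurableT i2 i3; apply: eq_integrable.
Qed.

Lemma magnitude_mean_le T : 0 < T -> \int[P]_w magnitude T w <=
  ip P (B T) (B T) + ip P (forward_average B b0 T) (forward_average B b0 T)
  + ip P (backward_average B b0 T) (backward_average B b0 T) + tfbm_varoo H lambda.
Proof.
move=> T1; have T0 := ltW T1.
have i1 := integrableD measurableT (sqr_integrable (sB T0)) (sqr_integrable (sN T0)).
have i2 := integrableD measurableT i1 (sqr_integrable (sP T0)).
have i3 := integrableZr measurableT T^-1 (noise_integrable T0).
rewrite /magnitude RintegralD//.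
apply: lerD; last first.
  rewrite RintegralZr//; last exact: noise_integrable.
  rewrite ler_pdivrMr//.
  exact: (@time_integral_le _ _ _ P (fun t w => beta w t) T joint_beta cbeta T0 _ variance_le).
rewrite RintegralD//; last exact: sqr_integrable (sP T0).
apply: lerD.
  rewrite (RintegralD measurableT (sqr_integrable (sB T0)) (sqr_integrable (sN T0))).
  by apply: lerD; rewrite le_eqVlt; apply/orP; left; apply/eqP; apply: eq_Rintegral => w _; rewrite expr2.
by rewrite le_eqVlt; apply/orP; left; apply/eqP; apply: eq_Rintegral => w _; rewrite expr2.
Qed.

End model.

(** * Uniform approximation of the estimators on large events *)

Section limits.
Context {R : realType} {d} {Omega : measurableType d} {P : probability Omega R}.
Variables (H lambda a b sigma y0 : R) (W B : R -> {RV P >-> R}) (Y : R -> Omega -> R).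
Hypotheses (hH : 0 < H) (hl : 0 < lambda) (b0 : 0 < b) (s0 : 0 < sigma) (hW : two_sided_wiener W).
Hypothesis hB : forall t : R, 0 <= t -> is_wiener_integral W (tfbm_kernel H lambda t) (B t).
Hypothesis cB : forall w, {within `[0, +oo[, continuous (fun t : R => B t w)}.
Hypothesis hY : is_tf_vasicek a b sigma y0 B Y.
Variable T_ : nat -> R.
Hypotheses (T_ge1 : forall n, 1 <= T_ n) (T_y : T_ n @[n --> \oo] --> +oo).
Variables (f : R -> R) (M : R).
Hypotheses (cf : continuous f) (fM : forall x, `|f x| <= M).

Notation N T := (forward_average B b0 T).
Notation Q T := (backward_average B b0 T).
Notation Z T := (zeta a sigma y0 B b0 T).
Notation mag T := (magnitude B b0 T).
Notation err_a T w := (T * (a_hat y0 (fun t => Y t w) T - a)).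
Notation err_b T w := (expR (b * T) * (b_hat y0 (fun t => Y t w) T - b)).

Let T_gt0 n : 0 < T_ n. Proof. exact: lt_le_trans (T_ge1 n). Qed.
Let T_ge0 n : 0 <= T_ n. Proof. exact: ltW. Qed.

Let norm_le_sqr (x K : R) : x ^+ 2 <= K -> `|x| <= K + 1.
Proof.
move=> xK; apply: (@le_trans _ _ (x ^+ 2 + 1)); last by rewrite lerD2r.
rewrite -(real_normK (num_real x)); move: (`|x|) => u.
have : 0 <= (u - 2^-1) ^+ 2 by exact: sqr_ge0.
by rewrite sqrrB; lra.
Qed.

(** When [mag] is at most K and zeta_T is away from 0, the Gaussian coordinates lie in a fixed
    compact set and the perturbations are of order 1/T, so the radius of [uniform_estimates] is
    respected for all large T. *)
Lemma near_estimates (delta eta K : R) : 0 < delta -> 0 < eta -> 0 < K ->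
  \forall n \near \oo, forall w, mag (T_ n) w <= K -> delta <= `|Z (T_ n) w| ->
  `|f (err_a (T_ n) w) - f (sigma * (2 * Q (T_ n) w - B (T_ n) w))| <= eta /\
  `|f (err_b (T_ n) w) - f (2 * b * sigma * (B (T_ n) w - Q (T_ n) w) / Z (T_ n) w)| <= eta.
Proof.
move=> delta0 eta0 K0.
(* [norm_le_sqr] turns x^2 <= K into |x| <= K + 1; the remaining terms are there for zeta_T. *)
pose K' := K + 1 + `|y0 + a / b| + sigma * (K + 1).
have [rad rad0 hrad] := uniform_estimates a sigma y0 b0 K' cf delta0 eta0.
(* [C2] times T bounds the remainder [r]; [C1] adds the bounds for 1 and for the drift term y0 + a/b
   + a T, all relative to T >= 1. *)
pose C2 := `|a / b| * sigma * (K + 1) + 2^-1 * sigma ^+ 2 * K + sigma ^+ 2 * b * K.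
pose C1 := 1 + (`|y0 + a / b| + `|a|) + C2.
pose c := 4 / b ^+ 2.
have C20 : 0 <= C2.
  rewrite /C2 !addr_ge0// ?mulr_ge0// ?sqr_ge0// ?addr_ge0// ltW//.
have c0 : 0 < c by rewrite divr_gt0// exprn_gt0.
have C11 : 1 <= C1.
  by rewrite /C1 -addrA lerDl; apply: addr_ge0 => //; apply: addr_ge0.
have C10 : 0 <= C1 by exact: le_trans C11.
have near1 : \forall n \near \oo, (c * C1 + 1) / rad < T_ n by move/cvgryPgt : T_y; exact.
apply: filterS near1 => n; rewrite ltr_pdivrMr// => hT w hmag hz.
move: (T_ge1 n) (T_gt0 n) (T_ge0 n) hT hmag hz; move: (T_ n) => T T1 Tp T0 hT hmag hz.
have [r hr hscaled] := vasicek_scaled b0 s0 cB hY w Tp.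
pose q := (expR (b * T))^-1.
have q0 : 0 < q by rewrite invr_gt0 expR_gt0.
have hq : T * q <= c / T by exact: expR_decay.
have small u : 0 <= u -> u <= T * q * C1 -> u < rad.
  move=> u0 uq; apply: le_lt_trans uq _.
  apply: le_lt_trans (ler_wpM2r C10 hq) _.
  rewrite mulrAC ltr_pdivrMr// (mulrC rad); apply: lt_trans hT.
  by rewrite ltrDl.
have qT : q <= T * q by rewrite ler_peMl// ltW.
have Tq0 : 0 <= T * q by rewrite mulr_ge0// ltW.
move: hmag; rewrite /magnitude => hmag.
have V0 : 0 <= noise_integral B T w by exact: noise_integral_ge0.
have VT0 : 0 <= noise_integral B T w / T by rewrite divr_ge0.
have hB2 : B T w ^+ 2 <= K.
  have h1 := sqr_ge0 (N T w); have h2 := sqr_ge0 (Q T w).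
  by move: hmag h1 h2 VT0; move: (_ ^+ 2) (_ ^+ 2) (_ ^+ 2) (_ / T) => x1 x2 x3 x4; lra.
have hN2 : N T w ^+ 2 <= K.
  have h1 := sqr_ge0 (B T w); have h2 := sqr_ge0 (Q T w).
  by move: hmag h1 h2 VT0; move: (_ ^+ 2) (_ ^+ 2) (_ ^+ 2) (_ / T) => x1 x2 x3 x4; lra.
have hQ2 : Q T w ^+ 2 <= K.
  have h1 := sqr_ge0 (B T w); have h2 := sqr_ge0 (N T w).
  by move: hmag h1 h2 VT0; move: (_ ^+ 2) (_ ^+ 2) (_ ^+ 2) (_ / T) => x1 x2 x3 x4; lra.
have hV : noise_integral B T w <= K * T.
  rewrite -ler_pdivrMr//.
  have h1 := sqr_ge0 (B T w); have h2 := sqr_ge0 (N T w); have h3 := sqr_ge0 (Q T w).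
  by move: hmag h1 h2 h3; move: (_ ^+ 2) (_ ^+ 2) (_ ^+ 2) (_ / T) => x1 x2 x3 x4; lra.
have sK : 0 <= sigma * (K + 1) by rewrite mulr_ge0// ?addr_ge0// ltW.
have K1K' : K + 1 <= K' by rewrite /K' -addrA lerDl addr_ge0.
have hz2 : `|Z T w| <= K'.
  rewrite /zeta; apply: le_trans (ler_normD _ _) _.
  rewrite normrM (gtr0_norm s0).
  have h1 : sigma * `|N T w| <= sigma * (K + 1) by rewrite ler_pM2l// norm_le_sqr.
  by rewrite /K'; move: h1 K0; move: (`|y0 + _|) (sigma * `|_|) (sigma * (K + 1)) => x1 x2 x3; lra.
have hr2 : `|r| <= C2 * T.
  apply: le_trans hr _.
  have h1 : `|a / b| * sigma * `|B T w| <= `|a / b| * sigma * (K + 1) * T.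
    apply: (@le_trans _ _ (`|a / b| * sigma * (K + 1))).
      by rewrite ler_wpM2l ?norm_le_sqr// mulr_ge0// ltW.
    by rewrite ler_peMr// mulr_ge0// ?addr_ge0// ?mulr_ge0// ltW.
  have h2 : 2^-1 * sigma ^+ 2 * B T w ^+ 2 <= 2^-1 * sigma ^+ 2 * K * T.
    apply: (@le_trans _ _ (2^-1 * sigma ^+ 2 * K)).
      by rewrite ler_wpM2l// mulr_ge0// sqr_ge0.
    by rewrite ler_peMr// mulr_ge0// ?mulr_ge0// ?sqr_ge0// ltW.
  have h3 : sigma ^+ 2 * b * noise_integral B T w <= sigma ^+ 2 * b * K * T.
    by rewrite -(mulrA (sigma ^+ 2 * b)) ler_wpM2l// mulr_ge0// ?sqr_ge0// ltW.
  rewrite /C2 !mulrDl; apply: lerD; last exact: h3.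
  by apply: lerD; [exact: h1|exact: h2].
have e1 : `|q| < rad.
  rewrite gtr0_norm//; apply: small; first exact: ltW.
  apply: le_trans qT _; exact: ler_peMr.
have e2 : `|q * (y0 + a / b + a * T)| < rad.
  rewrite normrM (gtr0_norm q0); apply: small; first by rewrite mulr_ge0// ltW.
  apply: (@le_trans _ _ (T * q * (`|y0 + a / b| + `|a|))); last first.
    rewrite ler_wpM2l// /C1; move: C20 (normr_ge0 (y0 + a / b)) (normr_ge0 a).
    by move: (`|_|) (`|a|) => x1 x2; lra.
  rewrite (mulrC T q) -mulrA ler_pM2l//.
  apply: le_trans (ler_normD _ _) _.
  rewrite mulrDr; apply: lerD; first by rewrite ler_peMl.
  by rewrite normrM (gtr0_norm Tp) mulrC.
have e3 : `|q * r| < rad.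
  rewrite normrM (gtr0_norm q0); apply: small; first by rewrite mulr_ge0// ltW.
  apply: (@le_trans _ _ (T * q * C2)).
    by rewrite (mulrC T q) -mulrA ler_pM2l// mulrC.
  rewrite ler_wpM2l// /C1; move: C20 (normr_ge0 (y0 + a / b)) (normr_ge0 a).
  by move: (`|_|) (`|a|) => x1 x2; lra.
have e4 : `|T^-1| < rad.
  rewrite gtr0_norm ?invr_gt0// -[T^-1]mul1r ltr_pdivrMr// (mulrC rad); apply: le_lt_trans hT.
  by rewrite lerDr mulr_ge0// ltW.
have [D0 hA hBB] := hrad _ _ _ _ _ _ _ e1 e2 e3 e4
  (le_trans (norm_le_sqr hB2) K1K') (le_trans (norm_le_sqr hQ2) K1K') hz hz2.
by have [-> ->] := hscaled D0.
Qed.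

End limits.

(** * Convergence in distribution *)

Section convergence.
Context {R : realType} {d} {Omega : measurableType d} {P : probability Omega R}.
Variables (H lambda a b sigma y0 : R) (W B : R -> {RV P >-> R}) (Y : R -> Omega -> R).
Hypotheses (hH : 0 < H) (hl : 0 < lambda) (b0 : 0 < b) (s0 : 0 < sigma) (hW : two_sided_wiener W).
Hypothesis hB : forall t : R, 0 <= t -> is_wiener_integral W (tfbm_kernel H lambda t) (B t).
Hypothesis cB : forall w, {within `[0, +oo[, continuous (fun t : R => B t w)}.
Hypothesis hY : is_tf_vasicek a b sigma y0 B Y.
Variable T_ : nat -> R.
Hypotheses (T_ge1 : forall n, 1 <= T_ n) (T_y : T_ n @[n --> \oo] --> +oo).
Variables (f : R -> R) (M : R).
Hypotheses (cf : continuous f) (fM : forall x, `|f x| <= M).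

Notation N T := (forward_average B b0 T).
Notation Q T := (backward_average B b0 T).
Notation Z T := (zeta a sigma y0 B b0 T).
Notation mag T := (magnitude B b0 T).
Notation err_a T w := (T * (a_hat y0 (fun t => Y t w) T - a)).
Notation err_b T w := (expR (b * T) * (b_hat y0 (fun t => Y t w) T - b)).
Notation A2 := (alpha2 H lambda).
Notation B2 := (beta2 H lambda b).
Notation m := (y0 + a / b).
Notation stdn2 := ((@stdn R \x @stdn R)%E).

Let T_gt0 n : 0 < T_ n. Proof. exact: lt_le_trans (T_ge1 n). Qed.
Let T_ge0 n : 0 <= T_ n. Proof. exact: ltW. Qed.
Let M0 : 0 <= M. Proof. exact: le_trans (normr_ge0 _) (fM 0). Qed.
Let mf : measurable_fun setT f. Proof. exact: continuous_measurable_fun. Qed.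

Let mv := measurable_tfbm_var hH hl hW hB cB.
Let v_ge0 := tfbm_var_ge0 hH hl hW hB.
Let B2E : B2 = 2^-1 * exp_mean b0 (tfbm_var H lambda). Proof. exact: (beta2E hH hl b0 mv v_ge0). Qed.
Let B2_gt0 : 0 < B2. Proof. exact: (beta2_gt0 hH hl b0 mv v_ge0). Qed.
Let A2_gt0 : 0 < A2. Proof. exact: alpha2_gt0. Qed.

Let wB n := tfbm_wiener_space hW hB (T_ge0 n).
Let wN n := forward_average_wiener_space hH hl b0 hW hB cB (T_ge0 n).
Let wQ n := backward_average_wiener_space hH hl b0 hW hB cB (T_ge0 n).
Let wX n : wiener_space W (fun w => B (T_ n) w - Q (T_ n) w).
Proof.
have := wiener_spaceD hW (wB n) (wiener_spaceZ hW (-1) (wQ n)).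
by congr wiener_space; apply/funext => w; rewrite mulN1r.
Qed.
Let wS n : wiener_space W (fun w => 2 * Q (T_ n) w - B (T_ n) w).
Proof.
have := wiener_spaceD hW (wiener_spaceZ hW 2 (wQ n)) (wiener_spaceZ hW (-1) (wB n)).
by congr wiener_space; apply/funext => w; rewrite mulN1r.
Qed.

Let Rintegral_cvg (g : nat -> Omega -> R) (h : R * R -> R) (M' : R) :
  measurable_fun [set: R * R] h -> (forall z, `|h z| <= M') ->
  (\int[P]_w (g n w)%:E @[n --> \oo] --> \int[stdn2]_z (h z)%:E)%E ->
  \int[P]_w g n w @[n --> \oo] --> \int[stdn2]_z h z.
Proof.
move=> mh hM'.
have hi := @bounded_integrable _ _ _ [the probability _ _ of stdn2] h M' mh hM'.
have <- : ((\int[stdn2]_z h z)%:E = \int[stdn2]_z (h z)%:E)%E.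
  by rewrite /Rintegral fineK//; exact: (integrable_fin_num measurableT hi).
exact: fine_cvg.
Qed.

Let delta (k : nat) : R := k.+1%:R^-1.
Let delta_gt0 k : 0 < delta k. Proof. by rewrite invr_gt0. Qed.
Let delta_cvg : delta k @[k --> \oo] --> 0. Proof. exact: cvg_harmonic. Qed.

Let chi k n w := cutoff (delta k) (Z (T_ n) w).

Let mcutoff k : measurable_fun [set: R] (cutoff (delta k)).
Proof. by apply: continuous_measurable_fun; exact: cutoff_continuous. Qed.

Let mZ n : measurable_fun setT (Z (T_ n)).
Proof. exact: (measurable_zeta a sigma y0 hH hl b0 hW hB cB (T_ge0 n)). Qed.

Let mchi k n : measurable_fun setT (chi k n).
Proof. exact: (measurableT_comp (mcutoff k) (mZ n)). Qed.

Let cutoff_norm k z : `|cutoff (delta k) z| <= 1.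
Proof. by rewrite ger0_norm ?cutoff_ge0// cutoff_le1. Qed.

(** The limit of the means of [chi k], since zeta_T tends in law to a normal variable with mean [m]
    and variance sigma^2 beta^2. *)
Let e k := \int[@stdn R]_x cutoff (delta k) (m + sigma * (Num.sqrt B2 * x)).

Let maffine : measurable_fun [set: R] (fun x : R => m + sigma * (Num.sqrt B2 * x)).
Proof.
by apply: measurable_funD => //; apply: measurable_funM => //; exact: measurable_funM.
Qed.

(** The limit variable is almost surely nonzero, so its cutoffs tend to 0 pointwise; bounded
    convergence concludes. *)
Let e_cvg : e k @[k --> \oo] --> 0.
Proof.
have -> : 0 = \int[@stdn R]_x (0 : R) by rewrite probability_Rintegral_cst.
apply: (@bounded_Rintegral_cvg _ _ _ (@stdn R) _ _ 1) => //.
- by move=> k; exact: (measurableT_comp (mcutoff k) maffine).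
- have ss : sigma * Num.sqrt B2 != 0 by rewrite mulf_neq0// gt_eqF// sqrtr_gt0.
  apply: filterS (stdn_ae_neq (- m / (sigma * Num.sqrt B2))) => x hx.
  apply: cutoff_cvg0 => //; apply: contra hx => /eqP h.
  apply/eqP; apply: (mulIf ss); rewrite divfK//.
  by move: h; move: (Num.sqrt B2) => u h; lra.
- by move=> x; rewrite normr0.
Qed.

Let lim_N : ip P (N (T_ n)) (N (T_ n)) @[n --> \oo] --> B2.
Proof. by rewrite B2E; exact: (forward_variance_cvg hH hl hW hB cB T_ge0 T_y). Qed.

Let chi_cvg k : \int[P]_w chi k n w @[n --> \oo] --> e k.
Proof.
pose F (z : R * R) := cutoff (delta k) (m + sigma * z.1).
have cF : continuous F.
  move=> z; apply: continuous_cvg; first exact: cutoff_continuous.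
  apply: cvgD; first exact: cvg_cst.
  by apply: cvgM; [exact: cvg_cst|exact: cvg_fst].
have mF : measurable_fun setT F.
  apply: (measurableT_comp (mcutoff k)); apply: measurable_funD => //.
  exact: measurable_funM.
have FM z : `|F z| <= 1 by exact: cutoff_norm.
have jg n : jgauss P (N (T_ n)) (N (T_ n)) by exact: (wiener_space_jgauss hW (wN n) (wN n)).
have := jgauss_cvg jg lim_N lim_N lim_N B2_gt0 mF cF FM.
have mc : measurable_fun [set: R] (fun x : R => cutoff (delta k) (m + sigma * (Num.sqrt B2 * x))).
  exact: (measurableT_comp (mcutoff k) maffine).
have me : measurable_fun [set: R * R] (fun z : R * R => cutoff (delta k) (m + sigma * (Num.sqrt B2 * z.1))).
  exact: (measurableT_comp mc measurable_fst).
have eE : e k = \int[stdn2]_z cutoff (delta k) (m + sigma * (Num.sqrt B2 * z.1)).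
  by rewrite /e /Rintegral (integral_stdn2_fst mc (fun x => cutoff_norm k _)).
rewrite eE; exact: (Rintegral_cvg me (fun z => cutoff_norm k _)).
Qed.

Let G n := mag (T_ n).
Let G_ge0 n w : 0 <= G n w. Proof. exact: magnitude_ge0. Qed.
Let intG n : P.-integrable setT (EFin \o G n).
Proof. exact: (magnitude_integrable hH hl b0 hW hB cB (T_ge0 n)). Qed.

Let bounded_G : exists C : R, \forall n \near \oo, \int[P]_w G n w <= C.
Proof.
have [C hC] := bounded_second_moments hH hl b0 hW hB cB T_ge0 T_y.
exists (C + tfbm_varoo H lambda); apply: filterS hC => n hC.
apply: le_trans (magnitude_mean_le hH hl b0 hW hB cB (T_gt0 n)) _.
by rewrite lerD2r.
Qed.

(** The case |zeta_T| >= delta, where replacing the factor 1 by 1 - c costs at most M c. In the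
    other case, [gap2], the cutoff is 1 and the trivial bound 2 M is available. *)
Let gap (x y' h c eta : R) : `|y'| <= M -> 0 <= c -> `|x - y'| <= eta -> h = y' * (1 - c) ->
  `|x - h| <= eta + 2 * M * c.
Proof.
move=> yM c0 xy ->; have -> : x - y' * (1 - c) = (x - y') + y' * c by ring.
apply: le_trans (ler_normD _ _) _; apply: lerD => //.
rewrite normrM (ger0_norm c0) -mulrA.
have : `|y'| * c <= M * c by rewrite ler_wpM2r.
have : 0 <= M * c by rewrite mulr_ge0.
by move: (M * c) (`|y'| * c) => u1 u2; lra.
Qed.

Let gap2 (x h c eta : R) : `|x| <= M -> `|h| <= M -> 0 < eta -> c = 1 -> `|x - h| <= eta + 2 * M * c.
Proof.
move=> xM hM eta0 ->; apply: le_trans (ler_normB _ _) _.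
by move: xM hM M0 eta0; move: (`|x|) (`|h|) => u1 u2; lra.
Qed.

(** The approximating functional does not involve zeta_T, so [h] is the same for all [k] and the
    limit needs no correction; the cutoff only discards the event that zeta_T is small. *)
Lemma a_hat_cvg : \int[P]_w f (err_a (T_ n) w) @[n --> \oo] -->
  \int[@stdn R]_x f (sigma * (Num.sqrt A2 * x)).
Proof.
have [C hC] := bounded_G.
pose h (k n : nat) w := f (sigma * (2 * Q (T_ n) w - B (T_ n) w)).
have mh k n : measurable_fun setT (h k n).
  apply: (measurableT_comp mf); apply: measurable_funM; first exact: measurable_cst.
  exact: (sqint_measurable (wiener_space_sqint (wS n))).
apply: (@integral_approximation _ _ _ P M C _ (fun n w => f (err_a (T_ n) w)) G h chi
  (fun=> \int[@stdn R]_x f (sigma * (Num.sqrt A2 * x))) e M0) => //.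
- move=> n; apply: (measurableT_comp mf).
  exact: (measurable_a_hat hH hl b0 hW hB cB hY (T_ge0 n)).
- by move=> k n w; exact: fM.
- by move=> k n w; exact: cutoff_ge0.
- by move=> k n w; exact: cutoff_le1.
- move=> k eta K eta0 K0.
  have := near_estimates b0 s0 cB hY T_ge1 T_y cf (delta_gt0 k) eta0 K0.
  apply: filterS => n hn w GK; have [zd|zd] := leP (delta k) `|Z (T_ n) w|.
    have [h1 _] := hn w GK zd; apply: le_trans h1 _.
    by rewrite lerDl; apply: mulr_ge0; [exact: mulr_ge0|exact: cutoff_ge0].
  apply: gap2 => //; first exact: fM.
  by apply: cutoff_eq1 => //; exact: ltW.
- move=> k; rewrite /h.
  pose F (z : R * R) := f (sigma * z.1).
  have cF : continuous F.
    move=> z.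
    have c1 : sigma * z'.1 @[z' --> z] --> sigma * z.1.
      by apply: cvgM; [exact: cvg_cst|exact: cvg_fst].
    apply: (@continuous_comp _ _ _ (fun z' : R * R => sigma * z'.1) f); first exact: c1.
    exact: cf.
  have mF : measurable_fun setT F.
    by apply: (measurableT_comp mf); exact: measurable_funM.
  have FM z : `|F z| <= M by exact: fM.
  have jg n : jgauss P (fun w => 2 * Q (T_ n) w - B (T_ n) w) (fun w => 2 * Q (T_ n) w - B (T_ n) w).
    exact: (wiener_space_jgauss hW (wS n) (wS n)).
  have lim_S : ip P (fun w => 2 * Q (T_ n) w - B (T_ n) w) (fun w => 2 * Q (T_ n) w - B (T_ n) w) @[n --> \oo] --> A2.
    by rewrite alpha2E//; exact: (numerator_variance_cvg hH hl b0 hW hB cB T_ge0 T_y).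
  have := jgauss_cvg jg lim_S lim_S lim_S A2_gt0 mF cF FM.
  have mc : measurable_fun [set: R] (fun x : R => f (sigma * (Num.sqrt A2 * x))).
    by apply: (measurableT_comp mf); apply: measurable_funM => //; exact: measurable_funM.
  have me : measurable_fun [set: R * R] (fun z : R * R => f (sigma * (Num.sqrt A2 * z.1))).
    exact: (measurableT_comp mc measurable_fst).
  have -> : \int[@stdn R]_x f (sigma * (Num.sqrt A2 * x)) =
      \int[stdn2]_z f (sigma * (Num.sqrt A2 * z.1)).
    by rewrite /Rintegral (integral_stdn2_fst mc (fun x => fM _)).
  exact: (Rintegral_cvg me (fun z => fM _)).
- move=> k; rewrite subrr normr0; apply: mulr_ge0 => //.
  by apply: Rintegral_ge0 => x _; exact: cutoff_ge0.
Qed.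

(** The factor 1 - cutoff makes the quotient continuous before the passage to the Gaussian limit;
    removing it afterwards costs at most M e_k. *)
Lemma b_hat_cvg : \int[P]_w f (err_b (T_ n) w) @[n --> \oo] -->
  \int[stdn2]_z f (2 * b * sigma * (Num.sqrt B2 * z.1) / (m + sigma * (Num.sqrt B2 * z.2))).
Proof.
have [C hC] := bounded_G.
pose g (k : nat) (z : R * R) : R := f (z.1 / z.2) * (1 - cutoff (delta k) z.2).
have cg k : continuous (g k) by exact: cutoff_quotient_continuous.
pose lin (z : R * R) : R * R := (2 * b * sigma * z.1, m + sigma * z.2).
have clin : continuous lin.
  move=> z.
  have c1 : 2 * b * sigma * z'.1 @[z' --> z] --> 2 * b * sigma * z.1.
    by apply: cvgM; [exact: cvg_cst|exact: cvg_fst].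
  have c2 : m + sigma * z'.2 @[z' --> z] --> m + sigma * z.2.
    by apply: cvgD; [exact: cvg_cst|apply: cvgM; [exact: cvg_cst|exact: cvg_snd]].
  exact: (cvg_pair c1 c2).
have mlin : measurable_fun setT lin.
  apply: measurable_pairR; first exact: measurable_funM.
  by apply: measurable_funD => //; exact: measurable_funM.
have mdiv : measurable_fun [set: R * R] (fun z : R * R => f (z.1 / z.2)).
  apply: (measurableT_comp mf); apply: measurable_funM => //.
  exact: (measurableT_comp (@measurable_inv R) measurable_snd).
have mcut k : measurable_fun [set: R * R] (fun z : R * R => cutoff (delta k) z.2).
  exact: (measurableT_comp (mcutoff k) measurable_snd).
have mg k : measurable_fun [set: R * R] (g k).
  by apply: measurable_funM => //; apply: measurable_funB.
have gM k z : `|g k z| <= M.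
  rewrite normrM -[leRHS]mulr1; apply: ler_pM => //.
  have := cutoff_ge0 (delta k) z.2; have := cutoff_le1 (delta k) z.2.
  move: (cutoff _ _) => u u1 u2; rewrite ger0_norm ?subr_ge0//; lra.
pose X n w := B (T_ n) w - Q (T_ n) w.
have mX n : measurable_fun setT (X n) := sqint_measurable (wiener_space_sqint (wX n)).
have mN n : measurable_fun setT (N (T_ n)) := sqint_measurable (wiener_space_sqint (wN n)).
pose h (k n : nat) w := g k (lin (X n w, N (T_ n) w)).
pose scal (z : R * R) : R * R := (Num.sqrt B2 * z.1, Num.sqrt B2 * z.2).
have mscal : measurable_fun setT scal by apply: measurable_pairR; exact: measurable_funM.
pose l k := \int[stdn2]_z g k (lin (scal z)).
have mll : measurable_fun setT (fun z => lin (scal z)) by exact: measurableT_comp.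
have mh k n : measurable_fun setT (h k n).
  apply: (measurableT_comp (mg k)); apply: (measurableT_comp mlin).
  exact: measurable_pairR.
apply: (@integral_approximation _ _ _ P M C _ (fun n w => f (err_b (T_ n) w)) G h chi l e M0) => //.
- move=> n; apply: (measurableT_comp mf).
  exact: (measurable_b_hat hH hl b0 hW hB cB hY (T_ge0 n)).
- by move=> k n w; exact: gM.
- by move=> k n w; exact: cutoff_ge0.
- by move=> k n w; exact: cutoff_le1.
- move=> k eta K eta0 K0.
  have := near_estimates b0 s0 cB hY T_ge1 T_y cf (delta_gt0 k) eta0 K0.
  apply: filterS => n hn w GK; have [zd|zd] := leP (delta k) `|Z (T_ n) w|.
    have [_ h2] := hn w GK zd.
    by apply: (gap _ _ h2) => //; exact: cutoff_ge0.
  apply: gap2 => //; first exact: gM.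
  by apply: cutoff_eq1 => //; exact: ltW.
- move=> k.
  have jg n : jgauss P (X n) (N (T_ n)) by exact: (wiener_space_jgauss hW (wX n) (wN n)).
  have lim_X : ip P (X n) (X n) @[n --> \oo] --> B2.
    by rewrite B2E; exact: (remainder_variance_cvg hH hl hW hB cB T_ge0 T_y).
  have lim_XN : ip P (X n) (N (T_ n)) @[n --> \oo] --> 0.
    exact: (remainder_forward_cov_cvg hH hl b0 hW hB cB T_ge0 T_y).
  have cF : continuous (fun z => g k (lin z)).
    by move=> z; apply: continuous_comp; [exact: clin|exact: cg].
  have mF : measurable_fun setT (fun z => g k (lin z)) by exact: measurableT_comp.
  have := jgauss_cvg jg lim_X lim_XN lim_N B2_gt0 mF cF (fun z => gM k _).
  (* Zero covariance makes the coefficient matrix diagonal: the limit pair is independent. *)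
  have nc z : normal_coeff B2 0 B2 z = scal z.
    by rewrite /normal_coeff /scal expr0n/= !mul0r subr0 add0r.
  under eq_integral do rewrite nc.
  apply: Rintegral_cvg; last by move=> z; exact: gM.
  exact: measurableT_comp.
move=> k; rewrite /l.
have i1 : (stdn2).-integrable setT (EFin \o (fun z => g k (lin (scal z)))).
  apply: (@bounded_integrable _ _ _ [the probability _ _ of stdn2] _ M) => //.
  exact: measurableT_comp.
have i2 : (stdn2).-integrable setT (EFin \o (fun z => f ((lin (scal z)).1 / (lin (scal z)).2))).
  apply: (@bounded_integrable _ _ _ [the probability _ _ of stdn2] _ M) => //.
  exact: (measurableT_comp mdiv mll).
have i3 : (stdn2).-integrable setT (EFin \o (fun z => M * cutoff (delta k) (lin (scal z)).2)).
  apply: (@bounded_integrable _ _ _ [the probability _ _ of stdn2] _ (M * 1)).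
    by apply: measurable_funM => //; exact: (measurableT_comp (mcut k) mll).
  by move=> z; rewrite normrM (ger0_norm M0) ler_wpM2l.
rewrite -RintegralB//.
apply: le_trans (le_normr_Rintegral measurableT _) _; first by have := integrableB measurableT i1 i2.
have mc : measurable_fun [set: R] (fun x : R => cutoff (delta k) (m + sigma * (Num.sqrt B2 * x))).
  exact: (measurableT_comp (mcutoff k) maffine).
have -> : M * e k = \int[stdn2]_z (M * cutoff (delta k) (lin (scal z)).2).
  rewrite RintegralZl//; last first.
    apply: (@bounded_integrable _ _ _ [the probability _ _ of stdn2] _ 1) => //.
    exact: (measurableT_comp (mcut k) mll).
  by rewrite /e /Rintegral -(integral_stdn2_snd mc (fun x => cutoff_norm k _)).
apply: le_Rintegral => //.
  by have := integrable_norm (integrableB measurableT i1 i2).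
move=> z _; rewrite /g -[f (_ / (m + _))]/(f ((lin (scal z)).1 / (lin (scal z)).2)).
move: (lin (scal z)) => u.
have -> : f (u.1 / u.2) * (1 - cutoff (delta k) u.2) - f (u.1 / u.2) =
   - (f (u.1 / u.2) * cutoff (delta k) u.2) by ring.
by rewrite normrN normrM (ger0_norm (cutoff_ge0 _ _)) ler_wpM2r// cutoff_ge0.
Qed.

End convergence.

(** Convergence at +oo is tested along sequences, and truncating a divergent sequence from below by
    1 changes finitely many terms. *)
Lemma bounded_integral_cvg_pinfty {R : realType} {d} {Omega : measurableType d}
    (P : probability Omega R) (X : R -> Omega -> R) (M l : R) :
  (forall t, 1 <= t -> measurable_fun setT (X t)) -> (forall t w, `|X t w| <= M) ->
  (forall T_ : nat -> R, (forall n, 1 <= T_ n) -> T_ n @[n --> \oo] --> +oo ->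
    \int[P]_w X (T_ n) w @[n --> \oo] --> l) ->
  (\int[P]_w (X t w)%:E @[t --> +oo%R] --> l%:E)%E.
Proof.
move=> mX XM cX; apply/cvge_pinftyP => u uy.
pose T_ n := Num.max (u n) 1.
have T1 n : 1 <= T_ n by rewrite le_max lexx orbT.
have near_u : \forall n \near \oo, T_ n = u n.
  have : \forall n \near \oo, 1 < u n by move/cvgryPgt : uy; exact.
  by apply: filterS => n u1; rewrite /T_; apply/max_idPl; exact: ltW.
have Ty : T_ n @[n --> \oo] --> +oo.
  by apply: cvg_trans uy; apply: near_eq_cvg; apply: filterS near_u => n ->.
have fin n : (\int[P]_w (X (T_ n) w)%:E \is a fin_num)%E.
  exact: (integrable_fin_num measurableT (bounded_integrable P (mX _ (T1 n)) (XM _))).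
have : (\int[P]_w (X (T_ n) w)%:E @[n --> \oo] --> l%:E)%E.
  by apply: cvg_EFin; [exact: nearW|exact: cX].
by apply: cvg_trans; apply: near_eq_cvg; apply: filterS near_u => n <-.
Qed.

Theorem theorem2p1 (R : realType) (H lambda a b sigma y0 : R)
    (hH : 0 < H) (hlambda : 0 < lambda) (hb : 0 < b) (hsigma : 0 < sigma)
    (d : measure_display) (Omega : measurableType d)
    (P : probability Omega R)
    (B : R -> {RV P >-> R}) (hB : is_tfbm H lambda B)
    (Y : R -> Omega -> R) (hY : is_tf_vasicek a b sigma y0 B Y) :
  cvg_in_distribution P
    (fun T w => T * (a_hat y0 (fun t => Y t w) T - a))
    (normal_law 0 (sigma ^+ 2 * alpha2 H lambda)) /\
  (forall (d' : measure_display) (Omega' : measurableType d')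
     (P' : probability Omega' R) (eta1 eta2 : {RV P' >-> R}),
     has_law P' eta1
       (normal_law 0 (4 * b ^+ 2 * sigma ^+ 2 * beta2 H lambda b)) ->
     has_law P' eta2
       (normal_law (y0 + a / b) (sigma ^+ 2 * beta2 H lambda b)) ->
     independent P' eta1 eta2 ->
     cvg_in_distribution P
       (fun T w => expR (b * T) * (b_hat y0 (fun t => Y t w) T - b))
       (pushforward P' (fun w => eta1 w / eta2 w))).
Proof.
have [[W hW hWB] cB] := hB.
have T0 (T : R) : 1 <= T -> 0 <= T by exact: le_trans.
have near1 : \forall t \near (+oo : set_system R), 1 <= t by exact: nbhs_pinfty_ge.
have A2_gt0 : 0 < alpha2 H lambda by exact: alpha2_gt0.
have B2_gt0 : 0 < beta2 H lambda b.
  apply: (beta2_gt0 hH hlambda hb).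
  - exact: (measurable_tfbm_var hH hlambda hW hWB cB).
  - exact: (tfbm_var_ge0 hH hlambda hW hWB).
have ma T : 1 <= T -> measurable_fun setT (fun w => T * (a_hat y0 (fun t => Y t w) T - a)).
  by move=> T1; exact: (measurable_a_hat hH hlambda hb hW hWB cB hY (T0 _ T1)).
have mb T : 1 <= T -> measurable_fun setT (fun w => expR (b * T) * (b_hat y0 (fun t => Y t w) T - b)).
  by move=> T1; exact: (measurable_b_hat hH hlambda hb hW hWB cB hY (T0 _ T1)).
split.
  split; first by apply: filterS near1 => T; exact: ma.
  move=> f cf [M fM].
  have mf : measurable_fun setT f by exact: continuous_measurable_fun.
  have mf' : measurable_fun setT (fun x : R => f (sigma * (Num.sqrt (alpha2 H lambda) * x))).
    by apply: (measurableT_comp mf); apply: measurable_funM => //; exact: measurable_funM.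
  have -> : (\int[normal_law 0 (sigma ^+ 2 * alpha2 H lambda)]_x (f x)%:E =
      (\int[@stdn R]_x f (sigma * (Num.sqrt (alpha2 H lambda) * x)))%:E)%E.
    rewrite (integral_normal_law 0 _ mf fM); last by rewrite mulr_gt0// exprn_gt0.
    rewrite /Rintegral fineK; last first.
      exact: (integrable_fin_num measurableT (bounded_integrable _ mf' (fun x => fM _))).
    apply: eq_integral => x _; rewrite add0r sqrtrM ?sqr_ge0// sqrtr_sqr gtr0_norm//.
    by rewrite mulrA.
  apply: (@bounded_integral_cvg_pinfty _ _ _ P
    (fun T w => f (T * (a_hat y0 (fun t => Y t w) T - a))) M).
  - by move=> T T1; apply: (measurableT_comp mf); exact: ma.
  - by move=> T w; exact: fM.
  - by move=> T_ T1 Ty; exact: (a_hat_cvg hH hlambda hb hsigma hW hWB cB hY T1 Ty cf fM).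
move=> d' Omega' P' eta1 eta2 law1 law2 ind.
split; first by apply: filterS near1 => T; exact: mb.
move=> f cf [M fM].
have mf : measurable_fun setT f by exact: continuous_measurable_fun.
have v1 : 0 < 4 * b ^+ 2 * sigma ^+ 2 * beta2 H lambda b.
  by rewrite mulr_gt0// mulr_gt0// ?exprn_gt0// mulr_gt0// exprn_gt0.
have v2 : 0 < sigma ^+ 2 * beta2 H lambda b by rewrite mulr_gt0// exprn_gt0.
pose F (z : R * R) : R := f (z.1 / z.2).
have mdiv : measurable_fun [set: R * R] (fun z : R * R => z.1 / z.2).
  apply: measurable_funM => //.
  exact: (measurableT_comp (@measurable_inv R) measurable_snd).
have mF : measurable_fun setT F by exact: (measurableT_comp mf mdiv).
have FM z : `|F z| <= M by exact: fM.
have mquot : measurable_fun setT (fun w => eta1 w / eta2 w).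
  exact: (measurableT_comp mdiv (measurable_pairR (measurable_funPT eta1) (measurable_funPT eta2))).
(* The law of the quotient is expressed through the standard Gaussian law of the plane, in which the
   limit of [b_hat_cvg] is stated. *)
have -> : (\int[pushforward P' (fun w => (eta1 w / eta2 w)%R)]_x (f x)%:E =
    (\int[(@stdn R \x @stdn R)%E]_z f (2 * b * sigma * (Num.sqrt (beta2 H lambda b) * z.1) /
      (y0 + a / b + sigma * (Num.sqrt (beta2 H lambda b) * z.2))))%:E)%E.
  have fi : P'.-integrable setT ((EFin \o f) \o (fun w => eta1 w / eta2 w)).
    apply: (@bounded_integrable _ _ _ P' (fun w => f (eta1 w / eta2 w)) M) => //.
    exact: (measurableT_comp mf mquot).
  have mEf : measurable_fun setT (EFin \o f) by exact/measurable_EFinP.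
  rewrite (@integral_pushforward _ _ _ _ _ _ mquot P' setT (EFin \o f) mEf fi measurableT).
  rewrite preimage_setT.
  transitivity (\int[P']_w (F (eta1 w, eta2 w))%:E)%E; first by [].
  rewrite (integral_independent_normals v1 v2 law1 law2 ind mF FM).
  have e1 : Num.sqrt (4 * b ^+ 2 * sigma ^+ 2 * beta2 H lambda b) =
      2 * b * sigma * Num.sqrt (beta2 H lambda b).
    have -> : 4 * b ^+ 2 * sigma ^+ 2 = (2 * b * sigma) ^+ 2 by ring.
    by rewrite sqrtrM ?sqr_ge0// sqrtr_sqr gtr0_norm// !mulr_gt0.
  have e2 : Num.sqrt (sigma ^+ 2 * beta2 H lambda b) = sigma * Num.sqrt (beta2 H lambda b).
    by rewrite sqrtrM ?sqr_ge0// sqrtr_sqr gtr0_norm.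
  rewrite /Rintegral fineK.
    by apply: eq_integral => z _; rewrite /F/= e1 e2 add0r !mulrA.
  have mlin : measurable_fun setT (fun z : R * R => (2 * b * sigma * (Num.sqrt (beta2 H lambda b) * z.1),
      y0 + a / b + sigma * (Num.sqrt (beta2 H lambda b) * z.2))).
    apply: measurable_pairR.
      by apply: measurable_funM => //; exact: measurable_funM.
    by apply: measurable_funD => //; apply: measurable_funM => //; exact: measurable_funM.
  apply: (integrable_fin_num measurableT).
  apply: (@bounded_integrable _ _ _ [the probability _ _ of (@stdn R \x @stdn R)%E] _ M) => //.
  exact: (measurableT_comp mF mlin).
apply: (@bounded_integral_cvg_pinfty _ _ _ P
  (fun T w => f (expR (b * T) * (b_hat y0 (fun t => Y t w) T - b))) M).
- by move=> T T1; apply: (measurableT_comp mf); exact: mb.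
- by move=> T w; exact: fM.
- by move=> T_ T1 Ty; exact: (b_hat_cvg hH hlambda hb hsigma hW hWB cB hY T1 Ty cf fM).
Qed.
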